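(* Let $p>0$ and consider the stochastic functional differential equation (SFDE) $$\mathrm{d}x(t)=f_0(t,x_t,u(t))\,\mathrm{d}t+g_0(t,x_t,u(t))\,\mathrm{d}w(t),\quad t\in J,$$ described in the context. Let $V(t,x)\in\mathbf{C}^{2,1}(J_\tau\times\mathbf{R}^n,J)$, let $\mu(t)$ be a uniformly stable function, $\alpha_1\in\mathcal{VK}_\infty$, $\alpha_2\in\mathcal{CK}_\infty$, $\varpi\in\mathcal{K}_\infty$, $q\in\mathcal{K}_\infty$, $T\in\Omega_\mu$, and let $\rho\in(0,1)$ be a constant such that $$q(s)\ge \frac{\mathrm{e}^{\varphi_\mu(T)}}{\rho}\,s,\quad\forall s\ge 0.$$ Consider the following conditions, where $t\in J$: (A) $\alpha_1(|x|^p)\le V(t,x)\le\alpha_2(|x|^p)$ for all $x\in\mathbf{R}^n$. (B-ISS) $\mathbf{E}\{\mathcal{L}_V(t,x_t)\}\le\mu(t)\mathbf{E}\{V(t,x(t))\}$ if $\mathbf{E}\{V(t,x(t))\}\ge\max\{\varpi(|u(t)|),\,q^{-1}(\mathbf{E}\{V(t+\theta,x(t+\theta))\})\}$, $\forall\theta\in[-\tau,0]$. (B-iISS) $\mathbf{E}\{\mathcal{L}_V(t,x_t)\}\le\mu(t)\mathbf{E}\{V(t,x(t))\}+\varpi(|u(t)|)$ if $\mathbf{E}\{V(t+\theta,x(t+\theta))\}\le q(\mathbf{E}\{V(t,x(t))\})$, $\forall\theta\in[-\tau,0]$. (B-GUAS) $\mathbf{E}\{\mathcal{L}_V(t,x_t)\}\le\mu(t)\mathbf{E}\{V(t,x(t))\}$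 if $\mathbf{E}\{V(t+\theta,x(t+\theta))\}\le q(\mathbf{E}\{V(t,x(t))\})$, $\forall\theta\in[-\tau,0]$. (D) There exist positive numbers $\beta_0,\beta_1,\beta_2$ such that $\alpha_1(s)=\beta_1s^{\beta_0}$, $\alpha_2(s)=\beta_2s^{\beta_0}$. Then the SFDE 1. is $p$th moment ISS if (A) and (B-ISS) are satisfied; 2. is $p$th moment iISS if (A) and (B-iISS) are satisfied; 3. is $p$th moment GUAS if (A) and (B-GUAS) are satisfied; 4. is $p$th moment GUES if (A), (B-GUAS) and (D) are satisfied.
   Context: Notation. $J=[0,\infty)$, $\tau\ge 0$, $J_\tau=[-\tau,\infty)$; $|\cdot|$ is the Euclidean norm; $\mathbf{C}([-\tau,0],\mathbf{R}^n)$ is the space of continuous functions with norm $\|\phi\|=\sup_{-\tau\le\theta\le0}|\phi(\theta)|$; $\|u\|_{[t_0,t]}=\sup\{|u(s)|:s\in[t_0,t]\}$; $\mathbf{L}_\infty^l$ is the set of $u:J\to\mathbf{R}^l$ with $\sup_{t\in J}|u(t)|<\infty$. $\mathcal{K},\mathcal{K}_\infty,\mathcal{KL}$ are the usual comparison function classes; $\mathcal{VK}_\infty$ (resp. $\mathcal{CK}_\infty$) is the set of convex (resp. concave) $\mathcal{K}_\infty$ functions. $\mathbf{C}^{2,1}(J_\tau\times\mathbf{R}^n,J)$ is the set of nonnegative functions $V(t,x)$ twice continuously differentiable in $x$ and once in $t$. System. $(\Omega,\mathcal{F},\{\mathcal{F}_t\}_{t\ge t_0},\mathbb{P})$ is a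 complete filtered probability space satisfying the usual conditions, with expectation $\mathbf{E}$; $w$ is an $m$-dimensional Brownian motion. In the SFDE, $x_t(\theta)=x(t+\theta)$, $\theta\in[-\tau,0]$; the initial condition is $x_{t_0}=\xi\in\mathbf{C}^{\mathrm b}_{\mathcal{F}_{t_0}}([-\tau,0],\mathbf{R}^n)$, the family of bounded $\mathcal{F}_{t_0}$-measurable $\mathbf{C}([-\tau,0],\mathbf{R}^n)$-valued random variables; the input $u:J\to\mathbf{R}^l$ is locally essentially bounded; $f_0:J\times\mathbf{C}([-\tau,0],\mathbf{R}^n)\times\mathbf{R}^l\to\mathbf{R}^n$ and $g_0:J\times\mathbf{C}([-\tau,0],\mathbf{R}^n)\times\mathbf{R}^l\to\mathbf{R}^{n\times m}$ are measurable, $f_0(t,0,0)\equiv0$, $g_0(t,0,0)\equiv0$ for all $t\in J$, and are sufficiently smooth so that the SFDE only has continuous solutions on $J$. Stability (for any initial condition $\xi$, all $t,t_0\in J$, $t\ge t_0$). $p$th moment ISS (input-to-state stable): there exist $\sigma\in\mathcal{KL}$, $\gamma_1\in\mathcal{K}$ such that for any $u\in\mathbf{L}_\infty^l$, $\mathbf{E}\{|x(t)|^p\}\le\sigma(\mathbf{E}\{\|\xi\|^p\},t-t_0)+\gamma_1(\|u\|_{[t_0,t]})$. $p$th moment iISS (integral ISS): there exist $\sigma\in\mathcal{KL}$, $\gamma_1,\gamma_2\in\mathcal{K}$ such that for any $u$, $\mathbf{E}\{|x(t)|^p\}\le\sigma(\mathbf{E}\{\|\xi\|^p\},t-t_0)+\gamma_1\big(\int_{t_0}^t\gamma_2(|u(s)|)\,\mathrm{d}s\big)$.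 With $u\equiv0$: $p$th moment GUAS (globally uniformly asymptotically stable): there is $\sigma\in\mathcal{KL}$ with $\mathbf{E}\{|x(t)|^p\}\le\sigma(\mathbf{E}\{\|\xi\|^p\},t-t_0)$; $p$th moment GUES (globally uniformly exponentially stable): there are constants $\alpha>0,\beta>0$ with $\mathbf{E}\{|x(t)|^p\}\le\beta\mathrm{e}^{-\alpha(t-t_0)}\mathbf{E}\{\|\xi\|^p\}$. Infinitesimal operator along the SFDE, with $x=x(t)$, $u=u(t)$: $$\mathcal{L}_V(t,x_t)=V_t(t,x)+V_x(t,x)f_0(t,x_t,u)+\tfrac12\mathrm{trace}\big(g_0^{\mathrm T}(t,x_t,u)V_{xx}(t,x)g_0(t,x_t,u)\big).$$ Conditions involving $x(t)$, $x_t$ are required along the solutions of the SFDE (every initial time $t_0\in J$, initial condition $\xi$ and input $u$, with $u\equiv0$ in the case of GUAS and GUES; $t\ge t_0$). A continuous $\mu:J\to\mathbf{R}$ is a uniformly stable function (USF) if there are constants $\varepsilon>0$, $\delta\ge0$ with $\int_{t_0}^t\mu(s)\,\mathrm{d}s\le-\varepsilon(t-t_0)+\delta$ for all $t\ge t_0$ in $J$ (equivalently $\dot y=\mu(t)y$ is globally uniformly asymptotically stable). For a USF $\mu$: $\Omega_\mu=\{T>0:\sup_{t\in J}\int_t^{t+T}\mu(s)\,\mathrm{d}s<0\}$, and for $T\ge0$, $\varphi_\mu(T)=\sup_{t\in J}\max_{\theta\in[0,T]}\int_t^{t+\theta}\mu(s)\,\mathrm{d}s$.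
   Formalization: Condition (A) is required for all t ≥ −τ (with t ∈ J only the claim is false), and each condition (B) includes that E{V(t,x(t))} is finite, E|L_V(t,x_t)| is locally integrable in t along every solution, and L_V(t,x_t) is integrable wherever its bound is asserted. *)

(* Defs.v *)
From HB Require Import structures.
From mathcomp Require Import all_boot all_order all_algebra.
From mathcomp Require Import all_classical all_reals all_analysis.

Set Implicit Arguments.
Unset Strict Implicit.
Unset Printing Implicit Defensive.

Import Order.TTheory GRing.Theory Num.Theory.
Import numFieldNormedType.Exports.

Local Open Scope classical_set_scope.
Local Open Scope ring_scope.

(** Functions defined on an interval of the real line ([J = [0, +oo[] or
    [J_tau = [-tau, +oo[]) are total functions on [R] whose values outside of
    the interval are never used. *)

Section comparison_functions.
Context {R : realType}.
Implicit Types (alpha mu : R -> R) (sigma : R -> R -> R).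

Definition J : set R := [set s | 0 <= s].

Definition classK alpha : Prop :=
  [/\ {within J, continuous alpha},
      alpha 0 = 0 &
      forall s s', 0 <= s -> s < s' -> alpha s < alpha s'].

Definition classKoo alpha : Prop :=
  classK alpha /\ alpha s @[s --> +oo] --> +oo.

Definition classVKoo alpha : Prop :=
  classKoo alpha /\ @convex_function R R^o J alpha.

Definition classCKoo alpha : Prop :=
  classKoo alpha /\ @convex_function R R^o J (\- alpha).

Definition classKL sigma : Prop :=
  (forall t, 0 <= t -> classK (sigma ^~ t)) /\
  (forall s, 0 <= s ->
    (forall t t', 0 <= t -> t <= t' -> sigma s t' <= sigma s t) /\
    sigma s t @[t --> +oo] --> 0).

Definition Kinv alpha : R -> R := 'pinv_(fun=> 0) J alpha.

Definition integral_between mu (s t : R) : R :=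
  \int[lebesgue_measure]_(r in `[s, t]) mu r.

Definition uniformly_stable mu : Prop :=
  {within J, continuous mu} /\
  exists eps delta : R, [/\ 0 < eps, 0 <= delta &
    forall t0 t, 0 <= t0 -> t0 <= t ->
      integral_between mu t0 t <= - eps * (t - t0) + delta].

(** For a uniformly stable [mu], the real suprema below are those of nonempty
    sets that are bounded above. *)
Definition Omega mu : set R :=
  [set T | 0 < T /\ sup [set integral_between mu t (t + T) | t in J] < 0].

Definition phi mu (T : R) : R :=
  sup [set sup [set integral_between mu t (t + theta) | theta in `[0, T]]
      | t in J].

End comparison_functions.

Section vectors_and_histories.
Context {R : realType}.

(** The library norm on column vectors is the maximum norm. *)
Definition enorm n (x : 'cV[R]_n) : R := Num.sqrt (\sum_i x i 0 ^+ 2).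

(** The space C([-tau, 0], R^n). *)
Definition history (tau : R) (n : nat) : Type :=
  {ph : `[- tau, 0]%classic -> 'cV[R]_n | continuous ph}.

Lemma history_cst_subproof (tau : R) n (c : 'cV[R]_n) :
  continuous (fun _ : `[- tau, 0]%classic => c).
Proof. exact: cst_continuous. Qed.

Definition history_cst tau n (c : 'cV[R]_n) : history tau n :=
  exist _ _ (@history_cst_subproof tau n c).

Definition history_norm tau n (ph : history tau n) : R :=
  sup (range (fun theta => enorm (sval ph theta))).

(** [x_t], that is [theta |-> x (t + theta)]. The junk value [0] is only taken
    when [x] is not continuous on [[t - tau, t]]. *)
Definition history_at tau n (x : R -> 'cV[R]_n) (t : R) : history tau n :=
  match pselect (continuous (fun theta : `[- tau, 0]%classic =>
                               x (t + set_val theta))) with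
  | left cx => exist _ _ cx
  | right _ => history_cst tau 0
  end.

(** The sigma-algebra generated by a set of real functions. *)
Definition sigma_gen (X : Type) (S : set (X -> R)) : set (set X) :=
  <<s \bigcup_(c in S) preimage_set_system setT c measurable >>.

(** By separability, the sigma-algebra generated by the evaluations is the Borel
    sigma-algebra of the supremum norm. *)
Definition history_sigma tau n : set (set (history tau n)) :=
  sigma_gen [set c | exists theta i, c = fun ph : history tau n => sval ph theta i 0].

(** The product sigma-algebra on the domain of the coefficients. *)
Definition coef_sigma tau n l :
    set (set (R * history tau n * 'cV[R]_l)) :=
  sigma_gen
    ([set (fun z => z.1.1)] `|`
     [set c | exists theta i,
        c = fun z : R * history tau n * 'cV[R]_l => sval z.1.2 theta i 0] `|`
     [set c | exists j,
        c = fun z : R * history tau n * 'cV[R]_l => z.2 j 0]).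

Definition coef_measurable tau n l (h : R -> history tau n -> 'cV[R]_l -> R) :
    Prop :=
  forall B : set R, measurable B ->
    @coef_sigma tau n l ([set z | 0 <= z.1.1] `&`
                         (fun z => h z.1.1 z.1.2 z.2) @^-1` B).

End vectors_and_histories.

Section stochastic_basis.
Context {R : realType} d {T : measurableType d} (P : probability T R).
Context (F : R -> set (set T)).

Record usual_conditions : Prop := {
  filtration_sigma : forall t, 0 <= t -> sigma_algebra setT (F t) ;
  filtration_sub : forall t, 0 <= t -> F t `<=` measurable ;
  filtration_incr : forall s t, 0 <= s -> s <= t -> F s `<=` F t ;
  filtration_right : forall t, 0 <= t -> \bigcap_(s in `]t, +oo[) F s `<=` F t ;
  filtration_complete : measure_is_complete P ;
  filtration_null : forall N, P.-negligible N -> F 0 N }.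

Definition rv_measurable (G : set (set T)) (X : T -> R) : Prop :=
  forall B : set R, measurable B -> G (X @^-1` B).

Record brownian m (w : R -> T -> 'cV[R]_m) : Prop := {
  brownian_adapted : forall t j, 0 <= t ->
    rv_measurable (F t) (fun om => w t om j 0) ;
  brownian_0 : {ae P, forall om, w 0 om = 0} ;
  brownian_continuous :
    {ae P, forall om, {within J, continuous (fun t => w t om)}} ;
  (* [w t - w s] is independent of [F s], with law [N(0, (t - s) I_m)] *)
  brownian_increment : forall s t (A : set T) (B : 'I_m -> set R),
    0 <= s -> s < t -> F s A -> (forall j, measurable (B j)) ->
    P (A `&` [set om | forall j, B j (w t om j 0 - w s om j 0)]) =
    (P A * \prod_(j < m) normal_prob 0 (Num.sqrt (t - s)) (B j))%E }.

(** The process [\sum_(k < pieces) coef k 1_]node k, node k.+1] ]. *)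
Record simple_process := SimpleProcess {
  pieces : nat ;
  node : nat -> R ;
  coef : nat -> T -> R }.

Definition adapted_simple (t0 t : R) (S : simple_process) : Prop :=
  [/\ node S 0%N = t0, node S (pieces S) = t &
      forall k, (k < pieces S)%N ->
        [/\ node S k <= node S k.+1,
            rv_measurable (F (node S k)) (coef S k) &
            exists c, forall om, `|coef S k om| <= c]].

Definition simple_value (S : simple_process) (r : R) (om : T) : R :=
  \sum_(k < pieces S | node S k < r <= node S k.+1) coef S k om.

Definition simple_integral (b : R -> T -> R) (S : simple_process) (om : T) : R :=
  \sum_(k < pieces S) coef S k om * (b (node S k.+1) om - b (node S k) om).

Definition cvg0_in_probability (X : nat -> T -> \bar R) : Prop :=
  forall eps : R, 0 < eps ->
    P [set om | (eps%:E <= X k om)%E] @[k --> \oo] --> 0%E.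

(** [Z] is the Ito integral of [H] over [[t0, t]] against the scalar Brownian
    motion [b]: the limit in probability of the integrals of bounded adapted
    simple processes [S k] with [\int (S k - H)^2 --> 0] in probability. *)
Definition is_ito_integral (b : R -> T -> R) (t0 t : R) (H : R -> T -> R)
    (Z : T -> R) : Prop :=
  measurable_fun setT Z /\
  exists S : nat -> simple_process,
    [/\ forall k, adapted_simple t0 t (S k),
        cvg0_in_probability (fun k om =>
          \int[lebesgue_measure]_(r in `[t0, t])
             ((simple_value (S k) r om - H r om) ^+ 2)%:E)%E &
        cvg0_in_probability (fun k om =>
          `|simple_integral b (S k) om - Z om|%:E)].

End stochastic_basis.

Section sfde.
Context {R : realType} d {T : measurableType d} (P : probability T R).
Context (F : R -> set (set T)).
Context (tau : R) (n m l : nat) (w : R -> T -> 'cV[R]_m).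
Context (f0 : R -> history tau n -> 'cV[R]_l -> 'cV[R]_n).
Context (g0 : R -> history tau n -> 'cV[R]_l -> 'M[R]_(n, m)).

Definition input : Type := R -> 'cV[R]_l.

Definition admissible_input (u : input) : Prop :=
  (forall j, measurable_fun J (fun t => u t j 0)) /\
  (forall b, 0 <= b -> exists M : R,
     {ae lebesgue_measure, forall t : R, 0 <= t <= b -> enorm (u t) <= M}).

Definition bounded_input (u : input) : Prop :=
  exists M : R, forall t, 0 <= t -> enorm (u t) <= M.

Definition zero_input : input := fun=> 0.

Definition input_sup (u : input) (t0 t : R) : R :=
  sup [set enorm (u s) | s in `[t0, t]].

Definition initial_condition (t0 : R) (xi : T -> history tau n) : Prop :=
  (forall A, @history_sigma R tau n A -> F t0 (xi @^-1` A)) /\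
  (exists c : R, forall om, history_norm (xi om) <= c).

Definition drift_along (u : input) (x : R -> T -> 'cV[R]_n) i t om : R :=
  f0 t (history_at tau (x ^~ om) t) (u t) i 0.

Definition diffusion_along (u : input) (x : R -> T -> 'cV[R]_n) i j t om : R :=
  g0 t (history_at tau (x ^~ om) t) (u t) i j.

Record is_solution (t0 : R) (xi : T -> history tau n) (u : input)
    (x : R -> T -> 'cV[R]_n) : Prop := {
  solution_continuous : forall om,
    {within [set t | t0 - tau <= t], continuous (x ^~ om)} ;
  solution_adapted : forall t i, t0 <= t ->
    rv_measurable (F t) (fun om => x t om i 0) ;
  solution_initial : {ae P, forall om, forall theta : `[- tau, 0]%classic,
    x (t0 + set_val theta) om = sval (xi om) theta} ;
  solution_drift : forall t i, t0 <= t -> {ae P, forall om,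
    lebesgue_measure.-integrable `[t0, t]
      (fun s => (drift_along u x i s om)%:E)} ;
  solution_diffusion : forall t i j, t0 <= t -> {ae P, forall om,
    lebesgue_measure.-integrable `[t0, t]
      (fun s => (diffusion_along u x i j s om ^+ 2)%:E)} ;
  solution_equation : forall t, t0 <= t ->
    exists Z : 'I_n -> 'I_m -> T -> R,
      (forall i j, is_ito_integral P F (fun s om => w s om j 0) t0 t
                     (diffusion_along u x i j) (Z i j)) /\
      {ae P, forall om, forall i,
         x t om i 0 = x t0 om i 0
           + \int[lebesgue_measure]_(s in `[t0, t]) drift_along u x i s om
           + \sum_j Z i j om} }.

(** Non-explosion and continuity are part of [is_solution]; uniqueness of
    solutions is not required. *)
Record sfde_assumptions : Prop := {
  drift_measurable : forall i, coef_measurable (fun t ph v => f0 t ph v i 0) ;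
  diffusion_measurable :
    forall i j, coef_measurable (fun t ph v => g0 t ph v i j) ;
  drift_0 : forall t, 0 <= t -> f0 t (history_cst tau 0) 0 = 0 ;
  diffusion_0 : forall t, 0 <= t -> g0 t (history_cst tau 0) 0 = 0 ;
  sfde_solvable : forall t0 xi u, 0 <= t0 ->
    initial_condition t0 xi -> admissible_input u ->
    exists x, is_solution t0 xi u x }.

Section stability.
Context (p : R).

Definition moment (x : R -> T -> 'cV[R]_n) (t : R) : \bar R :=
  'E_P[fun om => enorm (x t om) `^ p].

(** Finite, since initial conditions are bounded. *)
Definition initial_moment (xi : T -> history tau n) : R :=
  fine ('E_P[fun om => history_norm (xi om) `^ p]).

Definition moment_ISS : Prop :=
  exists (sigma : R -> R -> R) (gamma1 : R -> R),
    [/\ classKL sigma, classK gamma1 &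
    forall u, admissible_input u -> bounded_input u ->
    forall t0 xi x t, 0 <= t0 -> t0 <= t ->
      initial_condition t0 xi -> is_solution t0 xi u x ->
      (moment x t <= (sigma (initial_moment xi) (t - t0)
                      + gamma1 (input_sup u t0 t))%:E)%E].

Definition moment_iISS : Prop :=
  exists (sigma : R -> R -> R) (gamma1 gamma2 : R -> R),
    [/\ classKL sigma, classK gamma1, classK gamma2 &
    forall u, admissible_input u ->
    forall t0 xi x t, 0 <= t0 -> t0 <= t ->
      initial_condition t0 xi -> is_solution t0 xi u x ->
      (moment x t <= (sigma (initial_moment xi) (t - t0)
         + gamma1 (\int[lebesgue_measure]_(s in `[t0, t])
                     gamma2 (enorm (u s))))%:E)%E].

Definition moment_GUAS : Prop :=
  exists sigma : R -> R -> R, classKL sigma /\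
    forall t0 xi x t, 0 <= t0 -> t0 <= t ->
      initial_condition t0 xi -> is_solution t0 xi zero_input x ->
      (moment x t <= (sigma (initial_moment xi) (t - t0))%:E)%E.

Definition moment_GUES : Prop :=
  exists alpha beta : R, [/\ 0 < alpha, 0 < beta &
    forall t0 xi x t, 0 <= t0 -> t0 <= t ->
      initial_condition t0 xi -> is_solution t0 xi zero_input x ->
      (moment x t <=
         (beta * expR (- alpha * (t - t0)) * initial_moment xi)%:E)%E].

End stability.

Section lyapunov.
Context (V : R -> 'cV[R]_n -> R).

(** On [J_tau] the time derivative at the endpoint [- tau] is one-sided. *)
Definition quotient_t (t : R) (x : 'cV[R]_n) (h : R) : R :=
  h^-1 * (V (t + h) x - V t x).

Definition nbhs_t (t : R) : set_system R :=
  within [set h | - tau <= t + h] (0^').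

Definition V_t (t : R) (x : 'cV[R]_n) : R := lim (quotient_t t x @ nbhs_t t).

Definition V_x (t : R) (x : 'cV[R]_n) : 'rV[R]_n :=
  \row_i 'D_(delta_mx i 0) (V t) x.

Definition V_xx (t : R) (x : 'cV[R]_n) : 'M[R]_n :=
  \matrix_(i, j) 'D_(delta_mx j 0) (fun y => V_x t y 0 i) x.

Definition Jtau_continuous (h : R -> 'cV[R]_n -> R) : Prop :=
  {within [set z : R * 'cV[R]_n | - tau <= z.1],
     continuous (fun z => h z.1 z.2)}.

Record classC21 : Prop := {
  C21_ge0 : forall t x, - tau <= t -> 0 <= V t x ;
  C21_cvg_t : forall t x, - tau <= t -> cvg (quotient_t t x @ nbhs_t t) ;
  C21_derivable_x : forall t x i, - tau <= t ->
    derivable (V t) x (delta_mx i 0) ;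
  C21_derivable_xx : forall t x i j, - tau <= t ->
    derivable (fun y => V_x t y 0 i) x (delta_mx j 0) ;
  C21_continuous : Jtau_continuous V ;
  C21_continuous_t : Jtau_continuous V_t ;
  C21_continuous_x : forall i, Jtau_continuous (fun t x => V_x t x 0 i) ;
  C21_continuous_xx : forall i j, Jtau_continuous (fun t x => V_xx t x i j) }.

(** The operator [L_V], where [y] stands for [x(t)] and [v] for [u(t)]. *)
Definition LV (t : R) (y : 'cV[R]_n) (ph : history tau n) (v : 'cV[R]_l) : R :=
  V_t t y + (V_x t y *m f0 t ph v) 0 0
  + 2^-1 * \tr ((g0 t ph v)^T *m V_xx t y *m g0 t ph v).

Definition LV_along (u : input) (x : R -> T -> 'cV[R]_n) (t : R) (om : T) : R :=
  LV t (x t om) (history_at tau (x ^~ om) t) (u t).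

Definition EV (x : R -> T -> 'cV[R]_n) (t : R) : R :=
  fine ('E_P[fun om => V t (x t om)]).

(** Makes the expectations in the conditions below meaningful. The library
    integral is total, so without integrability [EV] could be the junk value [0],
    and pointwise bounds on [E L_V] would say nothing about [t |-> EV x t]. *)
Definition expectations_defined (t0 : R) (u : input)
    (x : R -> T -> 'cV[R]_n) : Prop :=
  (forall t, t0 - tau <= t ->
     P.-integrable setT (fun om => (V t (x t om))%:E)) /\
  (forall t, t0 <= t ->
     (\int[lebesgue_measure]_(s in `[t0, t])
        'E_P[(fun om => `|LV_along u x s om|)%R] < +oo)%E).

(** [E L_V <= c], including the existence of the left-hand side: the library
    expectation of a function with no expectation is [-oo]. *)
Definition ELV_le (u : input) (x : R -> T -> 'cV[R]_n) (t c : R) : Prop :=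
  P.-integrable setT (fun om => (LV_along u x t om)%:E) /\
  ('E_P[LV_along u x t] <= c%:E)%E.

Definition along_solutions (U : set input)
    (C : input -> (R -> T -> 'cV[R]_n) -> R -> Prop) : Prop :=
  forall t0 xi u x, 0 <= t0 -> initial_condition t0 xi -> U u ->
    is_solution t0 xi u x ->
    expectations_defined t0 u x /\ forall t, t0 <= t -> C u x t.

(** The bounds hold on the whole domain [J_tau] of [V], as they must control
    [V(t0 + theta, xi(theta))] when [t0 < tau]. *)
Definition cond_A (p : R) (alpha1 alpha2 : R -> R) : Prop :=
  forall t x, - tau <= t ->
    alpha1 (enorm x `^ p) <= V t x <= alpha2 (enorm x `^ p).

Definition cond_B_ISS (mu varpi q : R -> R) : Prop :=
  along_solutions admissible_input (fun u x t =>
    (forall theta, - tau <= theta <= 0 ->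
       Num.max (varpi (enorm (u t))) (Kinv q (EV x (t + theta))) <= EV x t) ->
    ELV_le u x t (mu t * EV x t)).

Definition cond_B_iISS (mu varpi q : R -> R) : Prop :=
  along_solutions admissible_input (fun u x t =>
    (forall theta, - tau <= theta <= 0 -> EV x (t + theta) <= q (EV x t)) ->
    ELV_le u x t (mu t * EV x t + varpi (enorm (u t)))).

Definition cond_B_GUAS (mu q : R -> R) : Prop :=
  along_solutions [set zero_input] (fun u x t =>
    (forall theta, - tau <= theta <= 0 -> EV x (t + theta) <= q (EV x t)) ->
    ELV_le u x t (mu t * EV x t)).

End lyapunov.
End sfde.

Definition cond_D {R : realType} (alpha1 alpha2 : R -> R) : Prop :=
  exists beta0 beta1 beta2 : R, [/\ 0 < beta0, 0 < beta1, 0 < beta2 &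
    forall s, 0 <= s ->
      alpha1 s = beta1 * s `^ beta0 /\ alpha2 s = beta2 * s `^ beta0].

(* Main.v *)
(** An Ito inequality [E V(t, x(t)) <= E V(s, x(s)) + \int_s^t E L_V] is enough. It
    is proved by hand: the coefficients are approximated by bounded adapted simple
    processes, [V] is expanded along the corresponding Euler scheme, and the scheme
    converges uniformly on the grid by a maximal inequality. Concave truncation of
    [V] and a decreasing weight in the accumulated size of the coefficients take
    the place of stopping times; they only lose mass, hence an inequality.

    The function [v(t) = E V(t, x(t))] is then compared with
    [z(t) Q(t) exp(- eps (t - t0))], where [z(t)] is the supremum over
    [t0 <= s <= t] of [exp(\int_s^t (mu + eps))], which lies between 1 and
    [exp(phi + eps T0)], and [Q] is nondecreasing and carries the initial value and
    the input. Since [z] is bounded, the comparison function loses at most the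
    factor [exp(phi + eps (T0 + tau))] over a delay, and this is below
    [exp(phi) / rho] for small [eps], so that the Razumikhin condition holds
    whenever [v] is near its largest multiple of the comparison function. Convexity
    of [alpha1] and concavity of [alpha2] convert the bound on [v] into moments. *)

Require Import Defs.
From mathcomp Require Import all_boot all_order all_algebra.
From mathcomp Require Import all_classical all_reals all_analysis.
From mathcomp Require Import finmap measurable_realfun ring lra.

Set Implicit Arguments.
Unset Strict Implicit.
Unset Printing Implicit Defensive.

Import Order.TTheory GRing.Theory Num.Theory.
Import numFieldNormedType.Exports.

Local Open Scope classical_set_scope.
Local Open Scope ring_scope.

(** * Gaussian moments and independent products *)

(** The Ito integral is only given for each time separately, as a limit in probability, so no path
    of it is at hand to stop. Comparison on a finite grid is enough, provided that the error does
    not grow with the number of grid points; Lenglart's inequality supplies this. The order of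
    choices then shapes everything: the simple coefficients and their bound [K] come first, a mesh
    [h] with [K ^+ 4 * h] small afterwards, so every constant that survives the limit must be free
    of [K]. Hence it is the accumulated size of the coefficients, not the coefficients themselves,
    that is capped, at a level [M]. An inequality leaves [EV P V x] possibly discontinuous: it may
    drop freely and only its upward increments are controlled. The product rule with the integrating
    factor and the crossing argument are therefore arranged without derivatives of this function and
    without attained level sets. The rate [eps] is paid twice: over one period [T0] it must not
    exceed the decay [kappa] of the integral of [mu], and over [T0 + tau] it uses up half of the
    logarithmic margin [ln rho^-1], the other half being the slack [eta] of the crossing
    argument. *)

Section indep_integral.
Context d (T : measurableType d) d' (U : measurableType d') (R : realType).
Variables (mu : {measure set T -> \bar R}) (nu : {measure set U -> \bar R}).
Local Open Scope ereal_scope.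
Import HBNNSimple.

(** On measurable sets the image under [eta] of the measure with density [ph] is [c] times [nu]; the
    identity passes from indicators to simple functions by linearity and to [f] along
    [nnsfun_approx] by monotone convergence. With [ph] a density it computes Gaussian integrals;
    with [ph] an already treated factor it peels off one independent variable. *)
Lemma integral_mul_comp (ph : T -> R) (eta : T -> U) (c : R) (f : U -> R) :
  measurable_fun setT ph -> (forall x, (0 <= ph x)%R) ->
  measurable_fun setT eta -> (0 <= c)%R ->
  (forall B, measurable B ->
     \int[mu]_(x in eta @^-1` B) (ph x)%:E = c%:E * nu B) ->
  measurable_fun setT f -> (forall y, (0 <= f y)%R) ->
  \int[mu]_x (ph x * f (eta x))%:E = c%:E * \int[nu]_y (f y)%:E.
Proof.
move=> mph ph0 meta c0 H mf f0.
have mfE : measurable_fun setT (EFin \o f) by exact/measurable_EFinP.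
pose g := nnsfun_approx measurableT mfE.
have cvg_g y : EFin \o g^~ y @ \oo --> (f y)%:E.
  by apply: cvg_nnsfun_approx => // z _; rewrite lee_fin.
have nd_g y : {homo (fun n => (g n y)%:E) : m n / (m <= n)%N >-> m <= n}.
  by move=> m n mn; rewrite lee_fin; exact/lefP/nd_nnsfun_approx.
have key n : \int[mu]_x (ph x * g n (eta x))%:E
             = c%:E * \int[nu]_y (g n y)%:E.
  set s := fset_set (range (g n)).
  have s0 (i : 'I_(#|`s|)) : (0 <= s`_i)%R.
    have : s`_i \in s by exact: mem_nth.
    by rewrite in_fset_set// => /set_mem[y _ <-].
  have mpre (i : 'I_(#|`s|)) : measurable (g n @^-1` [set s`_i]).
    exact: measurable_funPTI.
  have mI (i : 'I_(#|`s|)) :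
      measurable_fun setT (fun x => \1_(g n @^-1` [set s`_i]) (eta x) : R).
    by apply: measurableT_comp.
  under eq_integral => x _.
    rewrite (fimfunEord (g n)) -/s mulr_sumr -sumEFin.
    over.
  rewrite ge0_integral_sum//=; last first.
  { by move=> i x _; rewrite lee_fin mulr_ge0// mulr_ge0. }
  { move=> i; apply/measurable_EFinP; apply: measurable_funM => //.
    exact: measurable_funM. }
  transitivity (\sum_(i < #|`s|) c%:E * ((s`_i)%:E * nu (g n @^-1` [set s`_i]))).
    apply: eq_bigr => i _.
    under eq_integral do rewrite mulrCA EFinM.
    rewrite ge0_integralZl//; last first.
    { by rewrite lee_fin. }
    { by move=> x _; rewrite lee_fin mulr_ge0. }
    { by apply/measurable_EFinP; apply: measurable_funM. }
    rewrite muleCA; congr (_ * _); rewrite -H// [RHS]integral_mkcond.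
    apply: eq_integral => x _; rewrite patchE indicE.
    have -> : (eta x \in g n @^-1` [set s`_i]) =
              (x \in eta @^-1` (g n @^-1` [set s`_i])).
      by apply/idP/idP => /set_mem h; apply/mem_set.
    by case: ifP => _; rewrite ?mulr1 ?mulr0.
  rewrite -ge0_sume_distrr; last first.
    by move=> i _; rewrite mule_ge0// lee_fin.
  congr (_ * _); under [RHS]eq_integral => x _.
    rewrite (fimfunEord (g n)) -/s -sumEFin; over.
  rewrite ge0_integral_sum//=; last first.
  { by move=> i x _; rewrite lee_fin mulr_ge0. }
  { by move=> i; apply/measurable_EFinP; apply: measurable_funM. }
  apply: eq_bigr => i _; under [RHS]eq_integral do rewrite EFinM.
  rewrite ge0_integralZl ?integral_indic ?setIT ?lee_fin//.
  by apply/measurable_EFinP.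
have mgeta k : measurable_fun setT (fun x => ph x * g k (eta x))%R.
  by apply: measurable_funM => //; apply: measurableT_comp.
transitivity (limn (fun n => \int[mu]_x (ph x * g n (eta x))%:E)).
{ rewrite -monotone_convergence//.
  - apply: eq_integral => x _; apply/esym/cvg_lim => //.
    under eq_fun do rewrite EFinM.
    rewrite EFinM; apply: cvgeZl => //; exact: cvg_g.
  - by move=> n; exact/measurable_EFinP.
  - by move=> n x _; rewrite lee_fin mulr_ge0.
  - move=> x _ m n mn; rewrite lee_fin ler_wpM2l// -lee_fin; exact: nd_g. }
under eq_fun do rewrite key.
have lg : \int[nu]_y (g n y)%:E @[n --> \oo] --> \int[nu]_y (f y)%:E.
  rewrite (_ : (fun y => (f y)%:E) = fun y => limn (fun n => (g n y)%:E)); last first.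
    by apply/funext => y; apply/esym/cvg_lim => //; exact: cvg_g.
  apply: cvg_monotone_convergence => //.
  { by move=> n; exact/measurable_EFinP. }
  by move=> n x _; rewrite lee_fin.
apply: (cvg_lim (@ereal_hausdorff R)); exact: (cvgeZl _ lg).
Qed.

End indep_integral.

Lemma Rcvg_unique {R : realType} (u : nat -> R) (a b : R) :
  u n @[n --> \oo] --> a -> u n @[n --> \oo] --> b -> a = b.
Proof. by move=> /cvg_lim <-// /cvg_lim <-. Qed.

Section real_dominated_convergence.
Context d (T : measurableType d) (R : realType).
Variables (mu : {measure set T -> \bar R}) (D : set T) (mD : measurable D).

Lemma Rintegral_dominated_ae (f_ : nat -> T -> R) (f g : T -> R) :
  (forall n, measurable_fun D (f_ n)) -> measurable_fun D f ->
  {ae mu, forall x, D x -> f_ n x @[n --> \oo] --> f x} ->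
  mu.-integrable D (EFin \o g) ->
  {ae mu, forall x, forall n, D x -> `|f_ n x| <= g x} ->
  mu.-integrable D (EFin \o f) /\
  \int[mu]_(x in D) f_ n x @[n --> \oo] --> \int[mu]_(x in D) f x.
Proof.
move=> mf_ mf cf ig fg.
have [|||||h1 _ h3] := @dominated_convergence _ _ _ mu D mD
  (fun n x => (f_ n x)%:E) (fun x => (f x)%:E) (EFin \o g).
- by move=> n; exact/measurable_EFinP.
- exact/measurable_EFinP.
- by apply: filterS cf => x h Dx; apply: cvg_EFin; [exact: nearW|exact: h].
- exact: ig.
- by apply: filterS fg => x h n Dx; rewrite /= lee_fin h.
- split; first exact: h1.
  apply: fine_cvg; rewrite fineK//; exact: integrable_fin_num.
Qed.

Lemma Rintegral_dominated (f_ : nat -> T -> R) (f g : T -> R) :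
  (forall n, measurable_fun D (f_ n)) -> measurable_fun D f ->
  {ae mu, forall x, D x -> f_ n x @[n --> \oo] --> f x} ->
  mu.-integrable D (EFin \o g) ->
  (forall n x, D x -> `|f_ n x| <= g x) ->
  mu.-integrable D (EFin \o f) /\
  \int[mu]_(x in D) f_ n x @[n --> \oo] --> \int[mu]_(x in D) f x.
Proof.
by move=> mf_ mf cf ig fg; apply: (Rintegral_dominated_ae mf_ mf cf ig); apply: aeW => x n; exact: fg.
Qed.

Lemma le_integrable_EFin (f g : T -> R) : measurable_fun D f ->
  mu.-integrable D (EFin \o g) -> (forall x, D x -> `|f x| <= g x) ->
  mu.-integrable D (EFin \o f).
Proof.
move=> mf ig fg; apply: (le_integrable mD _ _ ig); first exact/measurable_EFinP.
move=> x Dx /=; rewrite lee_fin (le_trans (fg x Dx))// ler_norm//.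
Qed.

End real_dominated_convergence.

Lemma Rintegral_prob_cst d (T : measurableType d) (R : realType)
  (P : probability T R) (c : R) : \int[P]_x c = c.
Proof. by rewrite /Rintegral integral_cst//= probability_setT mule1. Qed.

Section exp_bounds.
Context {R : realType}.
Implicit Types z w : R.

(** [z / 4 <= expR (z / 4)] raised to the fourth power, whence 256. Powers are dominated by
    exponentials because the Gaussian means of the latter are explicit. *)
Lemma expR_lower4 z : 0 <= z -> z ^+ 4 <= 256 * expR z.
Proof.
move=> z0; have -> : expR z = expR (z / 4) ^+ 4.
  by rewrite -expRM_natl; congr expR; field.
have h : z / 4 <= expR (z / 4) by rewrite (le_trans _ (expR_ge1Dx _))// lerDr.
have : (z / 4) ^+ 4 <= expR (z / 4) ^+ 4.
  by apply: lerXn2r => //; rewrite nnegrE ?divr_ge0// expR_ge0.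
rewrite exprMn exprVn ler_pdivrMr ?exprn_gt0//.
by rewrite mulrC (_ : 4 ^+ 4 = 256 :> R)//; ring.
Qed.

Lemma expR_lower2 z : 0 <= z -> z ^+ 2 <= 4 * expR z.
Proof.
move=> z0; have -> : expR z = expR (z / 2) ^+ 2.
  by rewrite -expRM_natl; congr expR; field.
have h : z / 2 <= expR (z / 2) by rewrite (le_trans _ (expR_ge1Dx _))// lerDr.
have : (z / 2) ^+ 2 <= expR (z / 2) ^+ 2.
  by apply: lerXn2r => //; rewrite nnegrE ?divr_ge0// expR_ge0.
rewrite exprMn exprVn ler_pdivrMr ?exprn_gt0//.
by rewrite mulrC (_ : 2 ^+ 2 = 4 :> R)//; ring.
Qed.

Lemma expR_norm_le z : expR `|z| <= expR z + expR (- z).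
Proof.
case: (ger0P z) => z0.
  by rewrite lerDl expR_ge0.
by rewrite lerDr expR_ge0.
Qed.

(** The upper bound comes from [1 - z <= expR (- z)], that is [expR z <= 1 / (1 - z)], together with
    [1 / (1 - z) - 1 - z = z ^+ 2 / (1 - z)]. *)
Lemma expR_taylor1 z : `|z| <= 2^-1 -> `|expR z - 1 - z| <= 2 * z ^+ 2.
Proof.
rewrite ler_norml => /andP[z1 z2].
have l1 := expR_ge1Dx z; have l2 := expR_ge1Dx (- z).
have z3 : 0 < 1 - z by lra.
have : expR z * (1 - z) <= expR z * expR (- z) by rewrite ler_pM2l ?expR_gt0.
rewrite expRxMexpNx_1.
rewrite -ler_pdivlMr// => l3.
have l4 : (1 - z)^-1 - 1 - z <= 2 * z ^+ 2.
  rewrite -subr_ge0; have -> : 2 * z ^+ 2 - ((1 - z)^-1 - 1 - z) =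
     z ^+ 2 * (1 - 2 * z) / (1 - z) by field; lra.
  apply: divr_ge0; last lra.
  apply: mulr_ge0; [exact: sqr_ge0 | lra].
rewrite ger0_norm; first by rewrite div1r in l3; lra.
lra.
Qed.

Lemma expR_sinh_le z : 0 <= z -> expR z - expR (- z) <= 2 * z * expR z.
Proof.
move=> z0; have -> : expR (- z) = expR z * expR (- (2 * z)).
  by rewrite -expRD; congr expR; ring.
have h := expR_ge1Dx (- (2 * z)); have e0 := expR_gt0 z.
rewrite -[X in X - _]mulr1 -mulrBr mulrC ler_pM2r//; lra.
Qed.

End exp_bounds.

Section gaussian_moments.
Context {R : realType} (s : R).
Hypothesis s0 : 0 < s.
Local Notation mu := (@lebesgue_measure R).
Local Notation N := (normal_prob 0 s).

Lemma ge0_integral_normal_prob (f : R -> R) : measurable_fun setT f ->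
  (forall x, 0 <= f x) ->
  (\int[N]_x (f x)%:E = \int[mu]_x (normal_pdf 0 s x * f x)%:E)%E.
Proof.
move=> mf f0; rewrite (@integral_mul_comp _ _ _ _ _ mu (normal_prob 0 s) _ id 1 f) ?mul1e//.
- exact: measurable_normal_pdf.
- by move=> x; exact: normal_pdf_ge0.
- by move=> B mB; rewrite preimage_id mul1e.
Qed.

(** Completing the square: [expR (l * x)] times the centred density is a constant times the density
    with mean [l * s ^+ 2]. *)
Lemma normal_mgf (l : R) :
  (\int[N]_x (expR (l * x))%:E = (expR (l ^+ 2 * s ^+ 2 / 2))%:E)%E.
Proof.
have sn0 : s != 0 by rewrite gt_eqF.
rewrite ge0_integral_normal_prob; last 2 first.
  { by apply: measurableT_comp => //; exact: measurable_funM. }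
  { by move=> x; exact: expR_ge0. }
transitivity (\int[mu]_x ((expR (l ^+ 2 * s ^+ 2 / 2))%:E *
                          (normal_pdf (l * s ^+ 2) s x)%:E))%E.
  apply: eq_integral => x _; rewrite -EFinM; congr EFin.
  rewrite /normal_pdf (negbTE sn0) /normal_fun.
  rewrite [in RHS]mulrCA -[LHS]mulrA -!expRD; congr (_ * expR _).
  by rewrite subr0 -mulr_natr; field.
rewrite integralZl//; last exact: integrable_normal_pdf.
by rewrite integral_normal_pdf mule1.
Qed.

Lemma normal_mgf_integrable (l : R) : N.-integrable setT (EFin \o (fun x => expR (l * x))).
Proof.
apply/integrableP; split.
  apply/measurable_EFinP; apply: measurableT_comp => //; exact: measurable_funM.
under eq_integral do rewrite /= ger0_norm ?expR_ge0//.
by rewrite normal_mgf ltry.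
Qed.

(** Symmetric difference quotient at 0, with step [1 / n.+1], of [l |-> expR (l * x)]. It tends to
    [x], and the means of [sl n] and of its square are combinations of values of [normal_mgf], so
    the first two moments follow by dominated convergence. *)
Let sl n (x : R) : R := n.+1%:R * (expR (x / (2 * n.+1%:R)) - expR (- (x / (2 * n.+1%:R)))).

Let sl_cvg x : sl n x @[n --> \oo] --> x.
Proof.
apply/cvgrPdist_le => e e0.
near=> n.
have n0 : (0 : R) < n.+1%:R by [].
have xn : `|x| <= n.+1%:R.
  rewrite (@le_trans _ _ n%:R)// ?ler_nat//; near: n; exact: nbhs_infty_ger.
have h : `|x / (2 * n.+1%:R)| <= 2^-1.
  rewrite normrM (ger0_norm (_ : 0 <= (2 * n.+1%:R)^-1)) ?invr_ge0//.
  by rewrite invfM mulrCA ler_piMr// ler_pdivrMr// mul1r.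
have h1 := expR_taylor1 h.
have := @expR_taylor1 _ (- (x / (2 * n.+1%:R))).
rewrite normrN => /(_ h); rewrite sqrrN opprK => h2.
have -> : x - sl n x = - (n.+1%:R * ((expR (x / (2 * n.+1%:R)) - 1 - x / (2 * n.+1%:R))
   - (expR (- (x / (2 * n.+1%:R))) - 1 + x / (2 * n.+1%:R)))).
  have aux (c a b : R) : c != 0 ->
      x - c * (a - b) = - (c * ((a - 1 - x / (2 * c)) - (b - 1 + x / (2 * c)))).
    by move=> c0; field.
  by rewrite /sl; apply: aux; rewrite gt_eqF.
rewrite normrN normrM ger0_norm//.
apply: (@le_trans _ _ (n.+1%:R * (4 * (x / (2 * n.+1%:R)) ^+ 2))).
  rewrite ler_pM2l// (le_trans (ler_normB _ _))//.
  rewrite (le_trans (lerD h1 h2))// le_eqVlt; apply/orP; left; apply/eqP; ring.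
have -> : n.+1%:R * (4 * (x / (2 * n.+1%:R)) ^+ 2) = x ^+ 2 / n.+1%:R.
  have aux (c : R) : c != 0 -> c * (4 * (x / (2 * c)) ^+ 2) = x ^+ 2 / c.
    by move=> c0; field.
  by apply: aux; rewrite gt_eqF.
rewrite ler_pdivrMr// mulrC -ler_pdivrMr//.
rewrite (@le_trans _ _ n%:R)// ?ler_nat//; near: n; exact: nbhs_infty_ger.
Unshelve. all: by end_near. Qed.

Let dom (x : R) := 1 + 4 * (expR (3 * x) + expR (- 3 * x)).

(** For [0 <= y], [expR_sinh_le] gives [sl n y <= y * expR y], and [y ^+ 2 <= 4 * expR y] turns the
    square into [4 * expR (3 * y)]. Negative arguments follow because [sl n] is odd. *)
Let sl_sqr_le n x : sl n x ^+ 2 <= 4 * (expR (3 * x) + expR (- 3 * x)).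
Proof.
have n0 : (0 : R) < n.+1%:R by [].
have key (y : R) : 0 <= y -> sl n y ^+ 2 <= 4 * expR (3 * y).
  move=> y0; have h : 0 <= y / (2 * n.+1%:R) by rewrite divr_ge0.
  have h1 : sl n y <= y * expR y.
    rewrite /sl (le_trans (ler_wpM2l _ (expR_sinh_le h)))//.
    have aux (c e : R) : c != 0 -> c * (2 * (y / (2 * c)) * e) = y * e.
      by move=> c0; field.
    rewrite aux ?gt_eqF//.
    rewrite ler_wpM2l// ler_expR ler_pdivrMr ?mulr_gt0// ler_peMr//.
    by rewrite (@le_trans _ _ n.+1%:R) ?ler1n// ler_peMl// ler1n.
  have h2 : 0 <= sl n y.
    by rewrite /sl mulr_ge0// subr_ge0 ler_expR (le_trans _ h)// oppr_le0.
  apply: (@le_trans _ _ ((y * expR y) ^+ 2)).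
    by apply: lerXn2r => //; rewrite nnegrE// mulr_ge0// expR_ge0.
  rewrite exprMn (le_trans (ler_wpM2r _ (expR_lower2 y0))) ?exprn_ge0 ?expR_ge0//.
  rewrite -mulrA ler_pM2l// -expRM_natl -expRD.
  by rewrite (_ : y + _ = 3 * y)//; ring.
case: (ger0P x) => x0.
  by rewrite (le_trans (key _ x0))// ler_pM2l// lerDl expR_ge0.
have -> : sl n x ^+ 2 = sl n (- x) ^+ 2.
  by rewrite -[in RHS]sqrrN /sl !mulNr !opprK; congr (_ ^+ 2); ring.
have xn0 : 0 <= - x by lra.
rewrite (le_trans (key _ xn0))// ler_pM2l// mulrN mulNr.
by rewrite lerDr expR_ge0.
Qed.

Let msl n : measurable_fun setT (sl n).
Proof.
apply: measurable_funM => //; apply: measurable_funB; apply: measurableT_comp => //.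
  by apply: measurable_funM.
apply: measurableT_comp => //; exact: measurable_funM.
Qed.

Let idom : N.-integrable setT (EFin \o dom).
Proof.
rewrite (_ : EFin \o dom = (EFin \o cst 1) \+ (fun x => 4%:E * ((EFin \o (fun x => expR (3 * x))) \+
  (EFin \o (fun x => expR (- 3 * x)))) x)%E) //.
apply: integrableD => //; first exact: finite_measure_integrable_cst.
apply: integrableZl => //; apply: integrableD => //; exact: normal_mgf_integrable.
Qed.

Let sqr_le_dom n x : `|sl n x ^+ 2| <= dom x.
Proof. by rewrite ger0_norm ?sqr_ge0// (le_trans (sl_sqr_le n x))// lerDr. Qed.

Let norm_le_dom n x : `|sl n x| <= dom x.
Proof.
rewrite (@le_trans _ _ (1 + sl n x ^+ 2))// ?lerD2l ?sl_sqr_le//.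
rewrite -[X in _ + X]real_normK ?num_real//.
have := sqr_ge0 (`|sl n x| - 2^-1); rewrite sqrrB; lra.
Qed.

Lemma normal_moment1 : N.-integrable setT (EFin \o (fun x => x)) /\ \int[N]_x x = 0.
Proof.
have [|||||h1 h2] := @Rintegral_dominated _ _ _ N setT measurableT sl id dom.
- exact: msl.
- by [].
- by apply: aeW => x _; exact: sl_cvg.
- exact: idom.
- by move=> n x _; exact: norm_le_dom.
- split => //; move: h2; rewrite (_ : (fun n => \int[N]_x sl n x) = cst 0); last first.
  apply/funext => n; rewrite /sl RintegralZl//; last first.
    apply: (@integrableB _ _ _ N setT measurableT
      (EFin \o (fun x => expR (x / (2 * n.+1%:R)))) (EFin \o (fun x => expR (- (x / (2 * n.+1%:R)))))).
      by have := normal_mgf_integrable (2 * n.+1%:R)^-1; under eq_fun do rewrite mulrC.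
    have := normal_mgf_integrable (- (2 * n.+1%:R)^-1).
    by under eq_fun do rewrite mulrC mulrN.
  rewrite RintegralB//; last 2 first.
  { by have := normal_mgf_integrable (2 * n.+1%:R)^-1; under eq_fun do rewrite mulrC. }
  { have := normal_mgf_integrable (- (2 * n.+1%:R)^-1).
    by under eq_fun do rewrite mulrC mulrN. }
  rewrite /Rintegral; under eq_integral do rewrite mulrC.
  under [X in _ - fine X]eq_integral do rewrite mulrC -mulNr.
  by rewrite !normal_mgf /= sqrrN subrr mulr0.
  by move=> h; apply: (Rcvg_unique h); exact: cvg_cst.
Qed.

(** The square of [sl n] is [n.+1 ^+ 2] times [expR (x / n.+1) + expR (- x / n.+1) - 2]; its mean is
    [n.+1 ^+ 2 * 2 * (expR z - 1)] with [z = s ^+ 2 / (2 * n.+1 ^+ 2)], which tends to [s ^+ 2]. *)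
Lemma normal_moment2 : N.-integrable setT (EFin \o (fun x => x ^+ 2)) /\
  \int[N]_x (x ^+ 2) = s ^+ 2.
Proof.
have [|||||h1 h2] := @Rintegral_dominated _ _ _ N setT measurableT
  (fun n x => sl n x ^+ 2) (fun x => x ^+ 2) dom.
- by move=> n; apply: measurable_funX; exact: msl.
- exact: measurable_funX.
- by apply: aeW => x _; under eq_fun do rewrite expr2; rewrite expr2;
    apply: cvgM; exact: sl_cvg.
- exact: idom.
- by move=> n x _; exact: sqr_le_dom.
- split => //; apply: (Rcvg_unique h2).
rewrite (_ : (fun n => \int[N]_x (sl n x ^+ 2)) = (fun n => n.+1%:R ^+ 2 *
     (2 * (expR ((n.+1%:R)^-1 ^+ 2 * s ^+ 2 / 2) - 1)))); last first.
  apply/funext => n.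
  have i1 := normal_mgf_integrable (n.+1%:R)^-1.
  have i2 := normal_mgf_integrable (- (n.+1%:R)^-1).
  have i3 : N.-integrable setT (EFin \o (fun x => expR ((n.+1%:R)^-1 * x) + expR (- (n.+1%:R)^-1 * x))).
    by exact: (integrableD measurableT i1 i2).
  have i4 : N.-integrable setT (EFin \o cst 2) by exact: finite_measure_integrable_cst.
  transitivity (\int[N]_x (n.+1%:R ^+ 2 * ((expR ((n.+1%:R)^-1 * x) +
      expR (- (n.+1%:R)^-1 * x)) - 2))).
    apply: eq_Rintegral => x _; rewrite /sl exprMn sqrrB -!expRM_natl -mulr_natr -expRD.
    rewrite addrN expR0; congr (_ * _).
    have aux (c : R) : c != 0 -> 2 * (x / (2 * c)) = c^-1 * x by move=> c0; field.
    rewrite mulrN aux ?mulNr ?gt_eqF//; ring.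
  have icst : \int[N]_(x in setT) (2 : R) = 2.
    exact: (Rintegral_prob_cst (normal_prob 0 s)).
  rewrite RintegralZl//; last exact: (integrableB measurableT i3 i4).
  rewrite RintegralB// RintegralD// icst.
  by rewrite /Rintegral !normal_mgf /= sqrrN; ring.
apply/cvgrPdist_le => e e0.
near=> n.
have n0 : (0 : R) < n.+1%:R by [].
have nn0 : n.+1%:R != 0 :> R by [].
set z := (n.+1%:R)^-1 ^+ 2 * s ^+ 2 / 2.
have z0 : 0 <= z by rewrite divr_ge0// mulr_ge0// sqr_ge0.
have n1 : (1 : R) <= n.+1%:R by rewrite ler1n.
have sn : s ^+ 2 <= n.+1%:R.
  rewrite (@le_trans _ _ n%:R)// ?ler_nat//; near: n; exact: nbhs_infty_ger.
have h : `|z| <= 2^-1.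
  rewrite ger0_norm// /z exprVn mulrC -[leRHS]mulr1 ler_pM2l// mulrC.
  by rewrite ler_pdivrMr ?exprn_gt0// mul1r (le_trans sn)// ler_eXnr.
have h3 := expR_taylor1 h.
have -> : s ^+ 2 - n.+1%:R ^+ 2 * (2 * (expR z - 1)) = - (n.+1%:R ^+ 2 * 2 * (expR z - 1 - z)).
  have aux (c u : R) : c != 0 -> s ^+ 2 - c ^+ 2 * (2 * (u - 1)) =
      - (c ^+ 2 * 2 * (u - 1 - c^-1 ^+ 2 * s ^+ 2 / 2)) by move=> c0; field.
  by apply: aux.
rewrite normrN normrM ger0_norm//.
apply: (@le_trans _ _ (n.+1%:R ^+ 2 * 2 * (2 * z ^+ 2))).
  by rewrite ler_wpM2l// mulr_ge0// sqr_ge0.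
have -> : n.+1%:R ^+ 2 * 2 * (2 * z ^+ 2) = s ^+ 4 / n.+1%:R ^+ 2.
  have aux (c : R) : c != 0 -> c ^+ 2 * 2 * (2 * (c^-1 ^+ 2 * s ^+ 2 / 2) ^+ 2) =
      s ^+ 4 / c ^+ 2 by move=> c0; field.
  by apply: aux.
rewrite ler_pdivrMr ?exprn_gt0// mulrC -ler_pdivrMr//.
apply: (@le_trans _ _ n.+1%:R); last exact: ler_eXnr.
rewrite (@le_trans _ _ n%:R)// ?ler_nat//; near: n; exact: nbhs_infty_ger.
Unshelve. all: by end_near. Qed.

(* A crude bound; the fourth moment of the standard normal law is 3. *)
Definition gauss4 : R := 512 * expR 2^-1.

(** [expR_lower4] at the modulus of [x / s] bounds [x ^+ 4] by [256 * s ^+ 4] times two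
    exponentials, each of mean [expR 2^-1]; this is where the value of [gauss4] comes from. *)
Lemma normal_moment4 : N.-integrable setT (EFin \o (fun x => x ^+ 4)) /\
  \int[N]_x (x ^+ 4) <= gauss4 * s ^+ 4.
Proof.
have sn0 : s != 0 by rewrite gt_eqF.
have i1 := normal_mgf_integrable s^-1.
have i2 := normal_mgf_integrable (- s^-1).
have i3 := integrableD measurableT i1 i2.
pose g x := 256 * s ^+ 4 * (expR (s^-1 * x) + expR (- s^-1 * x)).
have ig : N.-integrable setT (EFin \o g).
  by have := integrableZl measurableT (256 * s ^+ 4) i3.
have le x : x ^+ 4 <= g x.
  rewrite /g; have -> : x ^+ 4 = s ^+ 4 * `|s^-1 * x| ^+ 4.
    by rewrite -normrX ger0_norm ?exprn_even_ge0// exprMn exprVn mulrA divff ?mul1r ?expf_neq0.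
  have := expR_lower4 (normr_ge0 (s^-1 * x)).
  have := expR_norm_le (s^-1 * x).
  rewrite -mulNr => h1 h2.
  rewrite (_ : 256 * _ * _ = s ^+ 4 * (256 * (expR (s^-1 * x) + expR (- (s^-1 * x))))); last by rewrite mulNr; ring.
  rewrite ler_pM2l ?exprn_gt0//.
  apply: (le_trans h2); rewrite -mulNr; exact: (ler_wpM2l (ler0n _ 256) h1).
have i4 : N.-integrable setT (EFin \o (fun x : R => x ^+ 4)).
  apply: (le_integrable_EFin measurableT _ ig); first exact: measurable_funX.
  by move=> x _; rewrite ger0_norm ?exprn_even_ge0.
split => //.
apply: (@le_trans _ _ (\int[N]_x g x)); first exact: le_Rintegral.
rewrite /g RintegralZl// RintegralD// /Rintegral !normal_mgf /= sqrrN.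
rewrite exprVn mulVf ?expf_neq0// mul1r /gauss4 le_eqVlt; apply/orP; left.
by apply/eqP; ring.
Qed.

End gaussian_moments.

Section independence.
Context d (T : measurableType d) (R : realType) (P : probability T R).
Variables (G : set (set T)) (W1 W2 : T -> R).
Variables (N1 N2 : probability (measurableTypeR R) R).
Hypothesis mG : G `<=` measurable.
Hypotheses (mW1 : measurable_fun setT W1) (mW2 : measurable_fun setT W2).
Hypothesis indep : forall A (B1 B2 : set R), G A -> measurable B1 -> measurable B2 ->
  (P (A `&` (W1 @^-1` B1) `&` (W2 @^-1` B2)) = P A * N1 B1 * N2 B2)%E.

Lemma rv_measurable_fun (xi : T -> R) : rv_measurable G xi -> measurable_fun setT xi.
Proof. by move=> h _ B mB; rewrite setTI; apply: mG; exact: h. Qed.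

(** [integral_mul_comp] is used once per factor: [W2] is integrated out with the indicator of an
    event of [G] and [W1] as weight, then [W1] with weight [f2 (W2 x)] on an event of [G], and
    finally [xi] against its own image measure. *)
Let ge0_indep (xi : T -> R) (f1 f2 : R -> R) : rv_measurable G xi ->
  (forall om, 0 <= xi om) ->
  measurable_fun setT f1 -> (forall y, 0 <= f1 y) ->
  measurable_fun setT f2 -> (forall y, 0 <= f2 y) ->
  (\int[N1]_y (f1 y)%:E < +oo)%E -> (\int[N2]_y (f2 y)%:E < +oo)%E ->
  (\int[P]_om (f2 (W2 om) * f1 (W1 om) * xi om)%:E =
    (\int[N1]_y f1 y * \int[N2]_y f2 y)%:E * \int[P]_om (xi om)%:E)%E.
Proof.
move=> mxi xi0 mf1 f10 mf2 f20 fin1 fin2.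
set c1 := \int[N1]_y f1 y; set c2 := \int[N2]_y f2 y.
have c1E : (\int[N1]_y (f1 y)%:E = c1%:E)%E.
  by rewrite /c1 /Rintegral fineK// ge0_fin_numE// integral_ge0// => y _; rewrite lee_fin.
have c2E : (\int[N2]_y (f2 y)%:E = c2%:E)%E.
  by rewrite /c2 /Rintegral fineK// ge0_fin_numE// integral_ge0// => y _; rewrite lee_fin.
have c10 : 0 <= c1 by rewrite /c1 Rintegral_ge0.
have c20 : 0 <= c2 by rewrite /c2 Rintegral_ge0.
have mf1W : measurable_fun setT (fun om => f1 (W1 om)) by exact: measurableT_comp.
have mf2W : measurable_fun setT (fun om => f2 (W2 om)) by exact: measurableT_comp.
have s1 (A : set T) (B : set R) : G A -> measurable B ->
    (\int[P]_(x in A `&` (W1 @^-1` B)) (f2 (W2 x))%:E = c2%:E * (P A * N1 B))%E.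
  move=> GA mB; have mA := mG GA.
  have mWB : measurable (W1 @^-1` B) by rewrite -[X in measurable X]setTI; exact: mW1.
  rewrite integral_mkcond.
  transitivity (\int[P]_x ((\1_(A `&` (W1 @^-1` B)) x) * f2 (W2 x))%:E)%E.
    apply: eq_integral => x _; rewrite patchE indicE.
    by case: ifP => _; rewrite ?mul1r ?mul0r.
  have pAB : (P A * N1 B)%E \is a fin_num.
    by rewrite fin_numM// fin_num_measure.
  rewrite (@integral_mul_comp _ _ _ _ _ P N2 _ W2 (fine (P A * N1 B)) f2)//.
  - by rewrite c2E fineK// muleC.
  - by apply: measurable_indic; exact: measurableI.
  - by rewrite fine_ge0// mule_ge0.
  - move=> C mC; rewrite fineK//.
    have mC' : measurable (W2 @^-1` C) by rewrite -[X in measurable X]setTI; exact: mW2.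
    rewrite integral_indic//; first exact: indep.
    exact: measurableI.
have s2 (A : set T) : G A ->
    (\int[P]_(x in A) (f2 (W2 x) * f1 (W1 x))%:E = (c1 * c2)%:E * P A)%E.
  move=> GA; have mA := mG GA.
  rewrite integral_mkcond.
  transitivity (\int[P]_x ((f2 (W2 x) * \1_A x) * f1 (W1 x))%:E)%E.
    apply: eq_integral => x _; rewrite patchE indicE.
    by case: ifP => _; rewrite ?mulr1 ?mulr0 ?mul0r.
  rewrite (@integral_mul_comp _ _ _ _ _ P N1 _ W1 (c2 * fine (P A)) f1)//.
  - by rewrite c1E -EFinM -[X in _ = (_ * X)%E]fineK ?fin_num_measure// -EFinM; congr EFin; ring.
  - by apply: measurable_funM => //; exact: measurable_indic.
  - by move=> x; rewrite mulr_ge0.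
  - by rewrite mulr_ge0// fine_ge0.
  - move=> B mB; have pA : P A \is a fin_num by exact: fin_num_measure.
    have -> : ((c2 * fine (P A))%:E * N1 B = c2%:E * (P A * N1 B))%E.
      rewrite EFinM (fineK pA); exact: esym (muleA _ _ _).
    rewrite -s1//.
    rewrite setIC integral_mkcondr; apply: eq_integral => x _.
    by rewrite patchE indicE; case: ifP => _; rewrite ?mulr1 ?mulr0.
(* The function composed with [xi] must be nonnegative on the whole line, which the identity is not;
   the absolute value agrees with it on the values of [xi]. *)
transitivity (\int[P]_om ((f2 (W2 om) * f1 (W1 om)) * `|xi om|)%:E)%E.
  by apply: eq_integral => om _; rewrite ger0_norm.
have mxiT := rv_measurable_fun mxi.
rewrite (@integral_mul_comp _ _ _ _ _ P (pushforward P xi) _ xi (c1 * c2) (fun y : R => `|y|))//.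
- congr (_ * _)%E; rewrite ge0_integral_pushforward//=.
  + by apply: eq_integral => om _; rewrite /= ger0_norm.
  + by apply/measurable_EFinP; exact: normr_measurable.
- exact: measurable_funM.
- by move=> x; rewrite mulr_ge0.
- by rewrite mulr_ge0.
- by move=> B mB; rewrite s2//; exact: mxi.
Qed.

Let PR xi f1 f2 :=
  P.-integrable setT (EFin \o (fun om => xi om * f1 (W1 om) * f2 (W2 om))) /\
  \int[P]_om (xi om * f1 (W1 om) * f2 (W2 om)) =
    \int[P]_om xi om * \int[N1]_y f1 y * \int[N2]_y f2 y.

Let PR0 (xi : T -> R) (f1 f2 : R -> R) : rv_measurable G xi ->
  (forall om, 0 <= xi om) -> P.-integrable setT (EFin \o xi) ->
  N1.-integrable setT (EFin \o f1) -> (forall y, 0 <= f1 y) ->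
  N2.-integrable setT (EFin \o f2) -> (forall y, 0 <= f2 y) -> PR xi f1 f2.
Proof.
move=> mxi xi0 ixi if1 f10 if2 f20.
have mf1 : measurable_fun setT f1 by have /measurable_int/measurable_EFinP := if1.
have mf2 : measurable_fun setT f2 by have /measurable_int/measurable_EFinP := if2.
have fin1 : (\int[N1]_y (f1 y)%:E < +oo)%E.
  by rewrite integrable_lty.
have fin2 : (\int[N2]_y (f2 y)%:E < +oo)%E.
  by rewrite integrable_lty.
have key := ge0_indep mxi xi0 mf1 f10 mf2 f20 fin1 fin2.
have e : (\int[P]_om (xi om * f1 (W1 om) * f2 (W2 om))%:E =
    \int[P]_om (f2 (W2 om) * f1 (W1 om) * xi om)%:E)%E.
  by apply: eq_integral => om _; congr EFin; ring.
have fx : (\int[P]_om (xi om)%:E)%E \is a fin_num by exact: integrable_fin_num.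
split.
  apply/integrableP; split.
    apply/measurable_EFinP; apply: measurable_funM; last exact: measurableT_comp.
    by apply: measurable_funM; [exact: rv_measurable_fun|exact: measurableT_comp].
  under eq_integral do rewrite /= ger0_norm ?mulr_ge0//.
  by rewrite e key lte_mul_pinfty ?lee_fin ?mulr_ge0 ?Rintegral_ge0// ltey_eq fx.
rewrite {1}/Rintegral e key fineM//= -/(Rintegral P setT xi); ring.
Qed.

Let PRB2 xi f1 f2 f2' : N2.-integrable setT (EFin \o f2) ->
  N2.-integrable setT (EFin \o f2') ->
  PR xi f1 f2 -> PR xi f1 f2' -> PR xi f1 (fun y => f2 y - f2' y).
Proof.
move=> i1 i2 [a1 a2] [b1 b2].
have e om : xi om * f1 (W1 om) * (f2 (W2 om) - f2' (W2 om)) =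
   xi om * f1 (W1 om) * f2 (W2 om) - xi om * f1 (W1 om) * f2' (W2 om) by ring.
split.
  by under [X in _.-integrable _ X]eq_fun do rewrite /= e;
     exact: (integrableB measurableT a1 b1).
under eq_Rintegral do rewrite e.
by rewrite !RintegralB// a2 b2; ring.
Qed.

Let PRB1 xi f1 f1' f2 : N1.-integrable setT (EFin \o f1) ->
  N1.-integrable setT (EFin \o f1') ->
  PR xi f1 f2 -> PR xi f1' f2 -> PR xi (fun y => f1 y - f1' y) f2.
Proof.
move=> i1 i2 [a1 a2] [b1 b2].
have e om : xi om * (f1 (W1 om) - f1' (W1 om)) * f2 (W2 om) =
   xi om * f1 (W1 om) * f2 (W2 om) - xi om * f1' (W1 om) * f2 (W2 om) by ring.
split.
  by under [X in _.-integrable _ X]eq_fun do rewrite /= e;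
     exact: (integrableB measurableT a1 b1).
under eq_Rintegral do rewrite e.
by rewrite !RintegralB// a2 b2; ring.
Qed.

Let PRB0 xi xi' f1 f2 : P.-integrable setT (EFin \o xi) ->
  P.-integrable setT (EFin \o xi') ->
  PR xi f1 f2 -> PR xi' f1 f2 -> PR (fun om => xi om - xi' om) f1 f2.
Proof.
move=> i1 i2 [a1 a2] [b1 b2].
have e om : (xi om - xi' om) * f1 (W1 om) * f2 (W2 om) =
   xi om * f1 (W1 om) * f2 (W2 om) - xi' om * f1 (W1 om) * f2 (W2 om) by ring.
split.
  by under [X in _.-integrable _ X]eq_fun do rewrite /= e;
     exact: (integrableB measurableT a1 b1).
under eq_Rintegral do rewrite e.
by rewrite !RintegralB// a2 b2; ring.
Qed.

Let pos_part (N : probability (measurableTypeR R) R) (f : R -> R) :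
  N.-integrable setT (EFin \o f) ->
  exists f1 f2 : R -> R, [/\ N.-integrable setT (EFin \o f1),
   N.-integrable setT (EFin \o f2), (forall y, 0 <= f1 y), (forall y, 0 <= f2 y) &
   f = fun y => f1 y - f2 y].
Proof.
move=> iF; exists (f^\+), (f^\-); split.
- exact: integrable_funrpos.
- exact: integrable_funrneg.
- exact: funrpos_ge0.
- exact: funrneg_ge0.
- by apply/funext => y; have := congr1 (fun g => g y) (funrposBneg f) => <-.
Qed.

(** The identity is linear in each of the three factors and [PR0] covers nonnegative ones; positive
    and negative parts of [xi] are still measurable for [G]. *)
Lemma indep_product (xi : T -> R) (f1 f2 : R -> R) :
  rv_measurable G xi -> P.-integrable setT (EFin \o xi) ->
  N1.-integrable setT (EFin \o f1) -> N2.-integrable setT (EFin \o f2) ->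
  P.-integrable setT (EFin \o (fun om => xi om * f1 (W1 om) * f2 (W2 om))) /\
  \int[P]_om (xi om * f1 (W1 om) * f2 (W2 om)) =
    \int[P]_om xi om * \int[N1]_y f1 y * \int[N2]_y f2 y.
Proof.
move=> mxi ixi if1 if2.
have [f11 [f12 [i11 i12 f110 f120 ->]]] := pos_part if1.
have [f21 [f22 [i21 i22 f210 f220 ->]]] := pos_part if2.
have key (xi' : T -> R) : rv_measurable G xi' ->
  (forall om, 0 <= xi' om) -> P.-integrable setT (EFin \o xi') ->
  PR xi' (fun y => f11 y - f12 y) (fun y => f21 y - f22 y).
  move=> m1 m2 m3; apply: PRB2 => //; apply: PRB1 => //; exact: PR0.
have -> : xi = fun om => xi^\+ om - xi^\- om.
  by apply/funext => y; have := congr1 (fun g => g y) (funrposBneg xi) => <-.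
have mcomp (h : R -> R) : measurable_fun setT h -> rv_measurable G (h \o xi).
  move=> mh B mB; have := mxi (h @^-1` B); apply.
  by rewrite -[X in measurable X]setTI; apply: mh.
apply: PRB0; [exact: integrable_funrpos|exact: integrable_funrneg|apply: key|apply: key].
- exact: (mcomp (fun y => Num.max y 0) (measurable_maxr _ _)).
- exact: funrpos_ge0.
- exact: integrable_funrpos.
- exact: (mcomp (fun y => Num.max (- y) 0) (measurable_maxr _ _)).
- exact: funrneg_ge0.
- exact: integrable_funrneg.
Qed.

End independence.

(** * Brownian increments *)

Section rv_measurable_closure.
Context {R : realType} d {T : measurableType d} (G : set (set T)).
Hypothesis sG : sigma_algebra setT G.
Implicit Types X Y : T -> R.

Let TG := g_sigma_algebraType G.

(** Read on the type generated by [G], [rv_measurable] becomes ordinary measurability and inherits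
    its closure properties. *)
Lemma rv_measurableE X :
  rv_measurable G X <-> measurable_fun (setT : set TG) (X : TG -> R).
Proof.
have e : (@measurable _ TG) = G by exact: sigma_algebra_id.
split.
  move=> h _ B mB; rewrite setTI e; exact: h.
move=> h B mB; rewrite -e -[X in measurable X]setTI; exact: h.
Qed.

Lemma rv_measurable_cst (c : R) : rv_measurable G (fun=> c).
Proof. by apply/rv_measurableE; exact: measurable_cst. Qed.

Lemma rv_measurableD X Y : rv_measurable G X -> rv_measurable G Y ->
  rv_measurable G (fun om => X om + Y om).
Proof. by move=> /rv_measurableE mX /rv_measurableE mY; apply/rv_measurableE; exact: measurable_funD. Qed.

Lemma rv_measurableB X Y : rv_measurable G X -> rv_measurable G Y ->
  rv_measurable G (fun om => X om - Y om).
Proof. by move=> /rv_measurableE mX /rv_measurableE mY; apply/rv_measurableE; exact: measurable_funB. Qed.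

Lemma rv_measurableM X Y : rv_measurable G X -> rv_measurable G Y ->
  rv_measurable G (fun om => X om * Y om).
Proof. by move=> /rv_measurableE mX /rv_measurableE mY; apply/rv_measurableE; exact: measurable_funM. Qed.

Lemma rv_measurable_sum (I : Type) (r : seq I) (Q : pred I) (X : I -> T -> R) :
  (forall i, rv_measurable G (X i)) ->
  rv_measurable G (fun om => \sum_(i <- r | Q i) X i om).
Proof.
move=> mX; apply/rv_measurableE.
under eq_fun do rewrite big_mkcond /=.
apply: (@measurable_sum _ TG R setT I r (fun i om => if Q i then X i om else 0)) => i.
by case: (Q i); [exact/rv_measurableE|exact: measurable_cst].
Qed.

Lemma rv_measurable_comp (h : R -> R) X : measurable_fun setT h ->
  rv_measurable G X -> rv_measurable G (fun om => h (X om)).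
Proof.
move=> mh mX B mB; apply: (mX (h @^-1` B)).
by rewrite -[X in measurable X]setTI; exact: mh.
Qed.

Lemma rv_measurable_bool (b : T -> bool) : G [set om | b om] ->
  rv_measurable G (fun om => (b om)%:R : R).
Proof.
move=> Gb; apply/rv_measurableE.
have -> : (fun om => (b om)%:R : R) = \1_([set om | b om] : set TG) :> (TG -> R).
  apply/funext => om; rewrite indicE; congr ((nat_of_bool _)%:R).
  by apply/idP/idP => [h|/set_mem//]; exact: mem_set.
apply: measurable_indic; exact: sub_gen_smallest.
Qed.

Lemma rv_measurable_set_ler X Y : rv_measurable G X -> rv_measurable G Y ->
  G [set om | X om <= Y om].
Proof.
move=> mX mY; have := rv_measurableB mY mX => /(_ `[0, +oo[%classic) h.
rewrite (_ : [set om | _] = (fun om => Y om - X om) @^-1` `[0, +oo[%classic); first exact: h.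
by apply/seteqP; split => om /=; rewrite in_itv/= andbT subr_ge0.
Qed.

Lemma rv_measurable_set_ltr X Y : rv_measurable G X -> rv_measurable G Y ->
  G [set om | X om < Y om].
Proof.
move=> mX mY; have := rv_measurableB mY mX => /(_ `]0, +oo[%classic) h.
rewrite (_ : [set om | _] = (fun om => Y om - X om) @^-1` `]0, +oo[%classic); first exact: h.
by apply/seteqP; split => om /=; rewrite in_itv/= andbT subr_gt0.
Qed.

End rv_measurable_closure.

Lemma rv_measurable_sub {R : realType} d {T : measurableType d} (G H : set (set T)) (X : T -> R) :
  G `<=` H -> rv_measurable G X -> rv_measurable H X.
Proof. by move=> GH mX B mB; apply: GH; exact: mX. Qed.

Section measurable_comparison.
Context {R : realType} d {T : measurableType d} (X Y : T -> R).
Hypotheses (mX : measurable_fun setT X) (mY : measurable_fun setT Y).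

Let rvT (Z : T -> R) : measurable_fun setT Z -> rv_measurable measurable Z.
Proof. by move=> mZ B mB; rewrite -[X in measurable X]setTI; exact: mZ. Qed.

Lemma measurable_set_ler : measurable [set om | X om <= Y om].
Proof.
apply: rv_measurable_set_ler; [exact: sigma_algebra_measurable|exact: rvT|exact: rvT].
Qed.

Lemma measurable_set_ltr : measurable [set om | X om < Y om].
Proof.
apply: rv_measurable_set_ltr; [exact: sigma_algebra_measurable|exact: rvT|exact: rvT].
Qed.

End measurable_comparison.

Section brownian_increments.
Context {R : realType} d {T : measurableType d} (P : probability T R).
Context (F : R -> set (set T)) (hF : usual_conditions P F).
Context (m : nat) (w : R -> T -> 'cV[R]_m) (hw : brownian P F w).

Lemma filtration_rv_measurable t (X : T -> R) : 0 <= t ->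
  rv_measurable (F t) X -> measurable_fun setT X.
Proof. by move=> t0 h; exact: (rv_measurable_fun (filtration_sub hF t0) h). Qed.

Definition incr (s t : R) (i : 'I_m) (om : T) : R := w t om i 0 - w s om i 0.

Lemma incr_rv_measurable (s t u : R) i : 0 <= s -> s <= t -> t <= u ->
  rv_measurable (F u) (incr s t i).
Proof.
move=> s0 st tu; have t0 := le_trans s0 st; have u0 := le_trans t0 tu.
apply: (rv_measurableB (filtration_sigma hF u0)).
  by apply: rv_measurable_sub (brownian_adapted hw i t0); exact: (filtration_incr hF).
apply: rv_measurable_sub (brownian_adapted hw i s0).
by apply: (filtration_incr hF) => //; exact: le_trans tu.
Qed.

Lemma incr_measurable (s t : R) i : 0 <= s -> s <= t ->
  measurable_fun setT (incr s t i).
Proof.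
move=> s0 st; apply: (@filtration_rv_measurable t); first exact: le_trans st.
exact: incr_rv_measurable.
Qed.

Let N s t : probability (measurableTypeR R) R := normal_prob 0 (Num.sqrt (t - s)).

Let incr_indep2 s t i j : 0 <= s -> s < t -> i != j ->
  forall A (B1 B2 : set R), F s A -> measurable B1 -> measurable B2 ->
  (P (A `&` (incr s t i @^-1` B1) `&` (incr s t j @^-1` B2)) =
   P A * N s t B1 * N s t B2)%E.
Proof.
move=> s0 st ij A B1 B2 FA mB1 mB2.
pose B k : set R := if k == i then B1 else if k == j then B2 else setT.
have := @brownian_increment _ _ _ _ _ _ _ hw s t A B s0 st FA.
rewrite (_ : _ `&` [set om | _] =
  A `&` (incr s t i @^-1` B1) `&` (incr s t j @^-1` B2)); last first.
  apply/seteqP; split => om /=.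
    move=> [Aom h]; split; first split => //.
      by have := h i; rewrite /B eqxx.
    by have := h j; rewrite /B eq_sym (negbTE ij) eqxx.
  move=> [[Aom h1] h2]; split => // k; rewrite /B.
  by case: eqP => [->//|_]; case: eqP => [->//|_].
move=> ->; last by move=> k; rewrite /B; case: ifP => // _; case: ifP.
rewrite (bigD1 i)//= (bigD1 j)//=; last by rewrite eq_sym.
rewrite big1 ?mule1; last first.
  move=> k /andP[ki kj]; rewrite /B (negbTE ki) (negbTE kj).
  exact: (probability_setT (N s t)).
by rewrite /B eqxx eq_sym (negbTE ij) eqxx muleA.
Qed.

(** The second variable is the constant 0, with the Dirac mass as its law, so that the two-variable
    product formula also covers a single increment. *)
Let incr_indep1 s t i : 0 <= s -> s < t ->
  forall A (B1 B2 : set R), F s A -> measurable B1 -> measurable B2 ->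
  (P (A `&` (incr s t i @^-1` B1) `&` (cst (0%R : R) @^-1` B2)) =
   P A * N s t B1 * (dirac (0%R : measurableTypeR R)) B2)%E.
Proof.
move=> s0 st A B1 B2 FA mB1 mB2.
pose B k : set R := if k == i then B1 else setT.
have := @brownian_increment _ _ _ _ _ _ _ hw s t A B s0 st FA.
rewrite (_ : _ `&` [set om | _] = A `&` (incr s t i @^-1` B1)); last first.
  apply/seteqP; split => om /=.
    move=> [Aom h]; split => //.
    by have := h i; rewrite /B eqxx.
  move=> [Aom h1]; split => // k; rewrite /B.
  by case: eqP => [->//|_].
rewrite (bigD1 i)//= big1 ?mule1; last first.
  by move=> k ki; rewrite /B (negbTE ki); exact: (probability_setT (N s t)).
rewrite /B eqxx => h.
rewrite diracE; have [B20|B20] := boolP (0 \in B2).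
  rewrite mule1 -h; last by move=> k; case: ifP.
  by congr (P _); rewrite setIidl// => om _ /=; exact: set_mem.
rewrite mule0 (_ : _ `&` _ `&` _ = set0) ?measure0//.
apply/seteqP; split => // om [_ /= h2]; by rewrite mem_set in B20.
Qed.

Let sqrt_gt0 (s t : R) : s < t -> 0 < Num.sqrt (t - s).
Proof. by move=> st; rewrite sqrtr_gt0 subr_gt0. Qed.

Let idirac (c : R) : (dirac (0 : measurableTypeR R)).-integrable setT (EFin \o (fun=> c)).
Proof. exact: finite_measure_integrable_cst. Qed.

Let indep1 s t i (xi f : T -> R) (g : R -> R) : 0 <= s -> s < t ->
  rv_measurable (F s) xi -> P.-integrable setT (EFin \o xi) ->
  (N s t).-integrable setT (EFin \o g) ->
  P.-integrable setT (EFin \o (fun om => xi om * g (incr s t i om))) /\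
  \int[P]_om (xi om * g (incr s t i om)) = \int[P]_om xi om * \int[N s t]_y g y.
Proof.
move=> s0 st mxi ixi ig.
have [] := @indep_product _ _ _ P (F s) (incr s t i) (fun=> 0) (N s t)
  (dirac (0 : measurableTypeR R)) _ _ _ (incr_indep1 i s0 st) xi g (fun=> 1) mxi ixi ig (idirac 1).
- exact: (filtration_sub hF).
- by apply: incr_measurable => //; exact: ltW.
- exact: measurable_cst.
rewrite Rintegral_prob_cst mulr1.
under [X in _.-integrable _ X -> _]eq_fun do rewrite /= mulr1.
by under eq_Rintegral do rewrite mulr1.
Qed.

Lemma incr_moment1 s t i xi : 0 <= s -> s <= t ->
  rv_measurable (F s) xi -> P.-integrable setT (EFin \o xi) ->
  P.-integrable setT (EFin \o (fun om => xi om * incr s t i om)) /\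
  \int[P]_om (xi om * incr s t i om) = 0.
Proof.
move=> s0; rewrite le_eqVlt => /predU1P[<- _ _|st mxi ixi].
  (* The law of increments is prescribed for [s < t] only, but partitions may repeat a point; there
     the increment vanishes. *)
  have e om : xi om * incr s s i om = 0 by rewrite /incr subrr mulr0.
  under [X in _.-integrable _ X]eq_fun do rewrite /= e.
  under eq_Rintegral do rewrite e.
  split; last exact: Rintegral_prob_cst.
  exact: integrable0.
have [i1 m1] := normal_moment1 (sqrt_gt0 st).
have [h1 h2] := indep1 i xi s0 st mxi ixi i1.
by split => //; rewrite h2 m1 mulr0.
Qed.

Lemma incr_moment2 s t i j xi : 0 <= s -> s <= t ->
  rv_measurable (F s) xi -> P.-integrable setT (EFin \o xi) ->
  P.-integrable setT (EFin \o (fun om => xi om * incr s t i om * incr s t j om)) /\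
  \int[P]_om (xi om * incr s t i om * incr s t j om) =
    (i == j)%:R * (t - s) * \int[P]_om xi om.
Proof.
move=> s0; rewrite le_eqVlt => /predU1P[<- _ _|st mxi ixi].
  have e om : xi om * incr s s i om * incr s s j om = 0 by rewrite /incr !subrr !mulr0.
  under [X in _.-integrable _ X]eq_fun do rewrite /= e.
  under eq_Rintegral do rewrite e.
  split; last by rewrite Rintegral_prob_cst subrr mulr0 mul0r.
  exact: integrable0.
have ts0 : 0 <= t - s by rewrite subr_ge0 ltW.
have [ij|ij] := eqVneq i j.
  subst j; have [i2 m2] := normal_moment2 (sqrt_gt0 st).
  have [h1 h2] := indep1 i xi s0 st mxi ixi i2.
  have e om : xi om * incr s t i om * incr s t i om = xi om * incr s t i om ^+ 2 by ring.
  under [X in _.-integrable _ X]eq_fun do rewrite /= e.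
  under eq_Rintegral do rewrite e.
  by split => //; rewrite h2 m2 sqr_sqrtr// mul1r mulrC.
have [i1 m1] := normal_moment1 (sqrt_gt0 st).
have [] := @indep_product _ _ _ P (F s) (incr s t i) (incr s t j) (N s t) (N s t)
  _ _ _ (incr_indep2 s0 st ij) xi id id mxi ixi i1 i1.
- exact: (filtration_sub hF).
- by apply: incr_measurable => //; exact: ltW.
- by apply: incr_measurable => //; exact: ltW.
by move=> h1 h2; split => //; rewrite h2 m1 mulr0 !mul0r.
Qed.

Lemma incr_moment4 s t i : 0 <= s -> s <= t ->
  P.-integrable setT (EFin \o (fun om => incr s t i om ^+ 4)) /\
  \int[P]_om (incr s t i om ^+ 4) <= gauss4 * (t - s) ^+ 2.
Proof.
move=> s0; rewrite le_eqVlt => /predU1P[<-|st].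
  have e om : incr s s i om ^+ 4 = 0 by rewrite /incr subrr expr0n.
  under [X in _.-integrable _ X]eq_fun do rewrite /= e.
  under eq_Rintegral do rewrite e.
  split; last by rewrite Rintegral_prob_cst subrr expr0n mulr0.
  exact: integrable0.
have [i4 m4] := normal_moment4 (sqrt_gt0 st).
have mc : rv_measurable (F s) (fun=> 1 : R) by apply: rv_measurable_cst; exact: (filtration_sigma hF).
have ic : P.-integrable setT (EFin \o (fun=> 1 : R)) by exact: finite_measure_integrable_cst.
have [h1 h2] := indep1 i (fun=> 1) s0 st mc ic i4.
split.
  by move: h1; under [X in _.-integrable _ X -> _]eq_fun do rewrite /= mul1r.
move: h2; under eq_Rintegral do rewrite mul1r.
move=> ->; rewrite Rintegral_prob_cst mul1r (le_trans m4)//.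
rewrite (_ : 4 = 2 * 2)%N// exprM sqr_sqrtr// subr_ge0 ltW//.
Qed.

End brownian_increments.

(** * Maximal inequality for discrete stochastic integrals *)

Section simple_martingale.
Context {R : realType} d {T : measurableType d} (P : probability T R).
Context (F : R -> set (set T)) (hF : usual_conditions P F).
Context (m : nat) (w : R -> T -> 'cV[R]_m) (hw : brownian P F w) (j : 'I_m).
Variable pi : nat -> R.
Hypotheses (pi0 : 0 <= pi 0%N) (pi_le : forall k, pi k <= pi k.+1).

Lemma partition_mono k l : (k <= l)%N -> pi k <= pi l.
Proof.
elim: l => [|l ih]; first by rewrite leqn0 => /eqP ->.
by rewrite leq_eqVlt => /predU1P[->//|]; rewrite ltnS => /ih /le_trans; apply.
Qed.

Lemma partition_ge0 k : 0 <= pi k.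
Proof. by rewrite (le_trans pi0)// partition_mono. Qed.

Definition discrete_martingale (c : nat -> T -> R) k om : R :=
  \sum_(i < k) c i om * incr w (pi i) (pi i.+1) j om.

Definition discrete_qvar (c : nat -> T -> R) k om : R :=
  \sum_(i < k) c i om ^+ 2 * (pi i.+1 - pi i).

Lemma discrete_martingaleS c k om : discrete_martingale c k.+1 om = discrete_martingale c k om + c k om * incr w (pi k) (pi k.+1) j om.
Proof. by rewrite /discrete_martingale big_ord_recr. Qed.

Lemma discrete_qvarS c k om : discrete_qvar c k.+1 om = discrete_qvar c k om + c k om ^+ 2 * (pi k.+1 - pi k).
Proof. by rewrite /discrete_qvar big_ord_recr. Qed.

Lemma discrete_martingaleSE c k :
  discrete_martingale c k.+1 = fun om => discrete_martingale c k om + c k om * incr w (pi k) (pi k.+1) j om.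
Proof. by apply/funext => om; exact: discrete_martingaleS. Qed.

Lemma discrete_qvarSE c k :
  discrete_qvar c k.+1 = fun om => discrete_qvar c k om + c k om ^+ 2 * (pi k.+1 - pi k).
Proof. by apply/funext => om; exact: discrete_qvarS. Qed.

Let Fsub k l : (k <= l)%N -> F (pi k) `<=` F (pi l).
Proof. by move=> kl; apply: (filtration_incr hF); [exact: partition_ge0|exact: partition_mono]. Qed.

Let sF k : sigma_algebra setT (F (pi k)).
Proof. exact/(filtration_sigma hF)/partition_ge0. Qed.

Section coefficients.
Variable c : nat -> T -> R.
Hypothesis mc : forall k, rv_measurable (F (pi k)) (c k).

Lemma discrete_martingale_rv_measurable k : rv_measurable (F (pi k)) (discrete_martingale c k).
Proof.
elim: k => [|k ih].
  rewrite (_ : discrete_martingale c 0 = fun=> 0); last by apply/funext => om; rewrite /discrete_martingale big_ord0.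
  exact: rv_measurable_cst.
rewrite discrete_martingaleSE.
apply: (rv_measurableD (sF _)); first exact: rv_measurable_sub (Fsub (leqnSn k)) ih.
apply: (rv_measurableM (sF _)).
  exact: rv_measurable_sub (Fsub (leqnSn k)) (mc k).
by apply: (incr_rv_measurable hF hw) => //; exact: partition_ge0.
Qed.

(** Index [k.+1] against time [pi k]: the sum only involves [c 0] to [c k]. This predictability
    allows switching off a coefficient before the step that would exceed the allowed variation. *)
Lemma discrete_qvar_rv_measurable k : rv_measurable (F (pi k)) (discrete_qvar c k.+1).
Proof.
elim: k => [|k ih].
  rewrite (_ : discrete_qvar c 1 = fun om => c 0%N om ^+ 2 * (pi 1%N - pi 0%N)); last first.
    by rewrite discrete_qvarSE; apply/funext => om; rewrite /discrete_qvar big_ord0 add0r.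
  apply: (rv_measurableM (sF _)); last exact: rv_measurable_cst.
  by apply: (rv_measurable_comp (h := fun y => y ^+ 2)) => //; exact: measurable_funX.
rewrite discrete_qvarSE.
apply: (rv_measurableD (sF _)); first exact: rv_measurable_sub (Fsub (leqnSn k)) ih.
apply: (rv_measurableM (sF _)); last exact: rv_measurable_cst.
by apply: (rv_measurable_comp (h := fun y => y ^+ 2)) => //; exact: measurable_funX.
Qed.

Hypothesis bc : forall k, exists K, forall om, `|c k om| <= K.

Let measF k (X : T -> R) : rv_measurable (F (pi k)) X -> measurable_fun setT X.
Proof. by move=> h; apply: (filtration_rv_measurable hF _ h); exact: partition_ge0. Qed.

Let int_bounded (X : T -> R) K : measurable_fun setT X -> (forall om, `|X om| <= K) ->
  P.-integrable setT (EFin \o X).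
Proof.
move=> mX h; apply: (le_integrable_EFin measurableT mX (g := fun=> K)) => //.
exact: finite_measure_integrable_cst.
Qed.

Let int_mulb k (X : T -> R) : P.-integrable setT (EFin \o X) ->
  P.-integrable setT (EFin \o (fun om => X om * c k om)).
Proof.
move=> iX; have [K hK] := bc k.
have mX : measurable_fun setT X by exact/measurable_EFinP/(measurable_int _ iX).
have ia : P.-integrable setT (EFin \o (fun om => K * `|X om|)).
  by have := integrableZl measurableT K (integrable_norm iX).
apply: (le_integrable_EFin measurableT _ ia).
  by apply: measurable_funM => //; exact: (measF (mc k)).
by move=> om _; rewrite normrM mulrC ler_wpM2r.
Qed.

Let int_c2 k : P.-integrable setT (EFin \o (fun om => c k om * c k om)).
Proof.
have [K hK] := bc k.
apply: int_mulb; apply: (int_bounded _ hK); exact: (measF (mc k)).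
Qed.

(** Discrete Ito isometry. In the square of the next value, the cross term has mean zero by
    [incr_moment1] with the factor [discrete_martingale c k * c k], known at [pi k], and the squared
    increment contributes its variance by [incr_moment2]. *)
Lemma discrete_martingale_moments k :
  [/\ P.-integrable setT (EFin \o discrete_martingale c k),
      P.-integrable setT (EFin \o (fun om => discrete_martingale c k om ^+ 2)),
      P.-integrable setT (EFin \o discrete_qvar c k) &
      \int[P]_om (discrete_martingale c k om ^+ 2) = \int[P]_om discrete_qvar c k om].
Proof.
elim: k => [|k [i1 i2 i3 e]].
  have e1 om : discrete_martingale c 0 om = 0 by rewrite /discrete_martingale big_ord0.
  have e2 om : discrete_qvar c 0 om = 0 by rewrite /discrete_qvar big_ord0.
  have -> : discrete_martingale c 0 = fun=> 0 by apply/funext.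
  have -> : discrete_qvar c 0 = fun=> 0 by apply/funext.
  have -> : (fun om : T => (0 : R) ^+ 2) = fun=> 0 by apply/funext => om; rewrite expr0n.
  split => //; try exact: integrable0.
have p0 := partition_ge0 k.
have mM := discrete_martingale_rv_measurable k.
have mMc : rv_measurable (F (pi k)) (fun om => discrete_martingale c k om * c k om).
  exact: (rv_measurableM (sF _)).
have mcc : rv_measurable (F (pi k)) (fun om => c k om * c k om).
  exact: (rv_measurableM (sF _)).
have ic : P.-integrable setT (EFin \o c k).
  have [K hK] := bc k; apply: (int_bounded _ hK); exact: (measF (mc k)).
have [a1 a2] := incr_moment1 hF hw j p0 (pi_le k) (mc k) ic.
have [b1 b2] := incr_moment1 hF hw j p0 (pi_le k) mMc (int_mulb k i1).
have [d1 d2] := incr_moment2 hF hw j j p0 (pi_le k) mcc (int_c2 k).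
have e1 : discrete_martingale c k.+1 = fun om => discrete_martingale c k om + c k om * incr w (pi k) (pi k.+1) j om.
  by apply/funext => om; rewrite discrete_martingaleS.
have e3 : discrete_qvar c k.+1 = fun om => discrete_qvar c k om + (c k om * c k om) * (pi k.+1 - pi k).
  by apply/funext => om; rewrite discrete_qvarS expr2.
have e2 : (fun om => discrete_martingale c k.+1 om ^+ 2) = fun om => (discrete_martingale c k om ^+ 2 +
   2 * (discrete_martingale c k om * c k om * incr w (pi k) (pi k.+1) j om)) +
   c k om * c k om * incr w (pi k) (pi k.+1) j om * incr w (pi k) (pi k.+1) j om.
  by apply/funext => om; rewrite discrete_martingaleS; ring.
have j1 := integrableZl measurableT 2 b1.
have j2 := integrableD measurableT i2 j1.
have j3 := integrableZr measurableT (pi k.+1 - pi k) (int_c2 k).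
split.
- rewrite e1; exact: (integrableD measurableT i1 a1).
- rewrite e2; exact: (integrableD measurableT j2 d1).
- rewrite e3; exact: (integrableD measurableT i3 j3).
- rewrite e2 e3 !RintegralD//.
  rewrite e RintegralZl// b2 mulr0 addr0 d2 eqxx mul1r RintegralZr//.
  by rewrite mulrC.
Qed.

End coefficients.

Section maximal.
Variables (c : nat -> T -> R) (N : nat) (eps del : R).
Hypothesis mc : forall k, rv_measurable (F (pi k)) (c k).
Hypothesis bc : forall k, exists K, forall om, `|c k om| <= K.
Hypotheses (eps0 : 0 < eps) (del0 : 0 <= del).

(* The coefficients are switched off, predictably, once the martingale reaches
   [eps] or the next step would push its quadratic variation beyond [del]. *)
Let sel k om := (discrete_qvar c k.+1 om <= del) && [forall i : 'I_k.+1, `|discrete_martingale c i om| < eps].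

Let ct k om : R := c k om * (sel k om)%:R.

Let msel k : F (pi k) [set om | sel k om].
Proof.
have mk i : (i <= k)%N -> rv_measurable (F (pi k)) (fun om => `|discrete_martingale c i om|).
  move=> ik; apply: (rv_measurable_comp (h := fun y => `|y|)); first exact: normr_measurable.
  exact: rv_measurable_sub (Fsub ik) (discrete_martingale_rv_measurable mc i).
have h0 := rv_measurable_cst (sF k).
have hset (A : set T) : F (pi k) A <-> measurable (A : set (g_sigma_algebraType (F (pi k)))).
  by rewrite [X in _ <-> X _](sigma_algebra_id (sF k)).
rewrite (_ : [set om | _] = [set om | discrete_qvar c k.+1 om <= del] `&`
  \bigcap_(i in `I_k.+1) [set om | `|discrete_martingale c i om| < eps]).
  apply/hset; apply: measurableI.
    by apply/hset; apply: (rv_measurable_set_ler (sF k)) => //; exact: discrete_qvar_rv_measurable.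
  apply: bigcap_measurableType => i /= ik; apply/hset.
  apply: (rv_measurable_set_ltr (sF k)) => //; exact: mk.
apply/seteqP; split => om /=; rewrite /sel.
  by move=> /andP[h1 /forallP h2]; split => // i /= ik; exact: (h2 (Ordinal ik)).
by move=> [-> h2] /=; apply/forallP => i; apply: h2 => /=.
Qed.

Let mct k : rv_measurable (F (pi k)) (ct k).
Proof.
apply: (rv_measurableM (sF k)) => //.
exact: (rv_measurable_bool (sF k) (msel k)).
Qed.

Let bct k : exists K, forall om, `|ct k om| <= K.
Proof.
have [K hK] := bc k; exists K => om; rewrite normrM (le_trans _ (hK om))//.
by rewrite ler_piMr// normr_nat lern1 leq_b1.
Qed.

(** Switching off only decreases the variation. If the full variation after the step is at most
    [del], so is the switched one; otherwise [sel] is false and the step adds nothing. *)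
Let qvar_ct_le k om : discrete_qvar ct k om <= del /\ discrete_qvar ct k om <= discrete_qvar c k om.
Proof.
elim: k => [|k [ih1 ih2]]; first by rewrite /discrete_qvar !big_ord0.
have d0 : 0 <= pi k.+1 - pi k by rewrite subr_ge0.
rewrite !discrete_qvarS; have h : ct k om ^+ 2 * (pi k.+1 - pi k) <= c k om ^+ 2 * (pi k.+1 - pi k).
  rewrite ler_wpM2r// /ct; case: (sel k om); rewrite ?mulr1// mulr0 expr0n/=; exact: sqr_ge0.
split; last exact: lerD.
have [s|ns] := boolP (discrete_qvar c k.+1 om <= del).
  by apply: le_trans s; rewrite discrete_qvarS; exact: lerD.
by rewrite /ct /sel (negbTE ns) /= mulr0 expr0n/= mul0r addr0.
Qed.

Let qvar_mono k l om : (k <= l)%N -> discrete_qvar c k om <= discrete_qvar c l om.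
Proof.
elim: l => [|l ih]; first by rewrite leqn0 => /eqP ->.
rewrite leq_eqVlt => /predU1P[->//|]; rewrite ltnS => /ih h.
by rewrite discrete_qvarS (le_trans h)// lerDl mulr_ge0 ?sqr_ge0// subr_ge0.
Qed.

(** Take the first index at which [eps] is reached. Before it [sel] holds, since the variation stays
    below [del] by monotonicity, so both martingales agree up to that index; from it on [sel] fails
    and the switched martingale keeps its value up to [N]. *)
Let stopped om : discrete_qvar c N om <= del -> (exists2 k, (k <= N)%N & eps <= `|discrete_martingale c k om|) ->
  eps <= `|discrete_martingale ct N om|.
Proof.
move=> q [k0 k0N hk0].
have exk : exists k, (k <= N)%N && (eps <= `|discrete_martingale c k om|) by exists k0; rewrite k0N.
have [k /andP[kN hk] kmin] := ex_minnP exk.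
have lt i : (i < k)%N -> `|discrete_martingale c i om| < eps.
  move=> ik; rewrite ltNge; apply/negP => h.
  have := kmin i; rewrite h (leq_trans (ltnW ik) kN)/= => /(_ isT).
  by rewrite leqNgt ik.
have e1 i : (i <= k)%N -> discrete_martingale ct i om = discrete_martingale c i om.
  elim: i => [|i ih]; first by rewrite /discrete_martingale !big_ord0.
  move=> ik; rewrite !discrete_martingaleS ih ?(ltnW ik)//; congr (_ + _ * _).
  rewrite /ct; suff -> : sel i om by rewrite mulr1.
  apply/andP; split; first by apply: le_trans q; apply: qvar_mono; exact: leq_trans kN.
  by apply/forallP => i'; apply: lt; exact: leq_trans ik.
have e2 i : (k <= i)%N -> discrete_martingale ct i om = discrete_martingale c k om.
  elim: i => [|i ih]; first by rewrite leqn0 => /eqP ->; rewrite /discrete_martingale !big_ord0.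
  rewrite leq_eqVlt => /predU1P[<-|]; first exact: e1.
  rewrite ltnS => ki; rewrite discrete_martingaleS ih// /ct.
  suff -> : sel i om = false by rewrite mulr0 mul0r addr0.
  apply/negP => /andP[_ /forallP h].
  have ki' : (k < i.+1)%N by [].
  by have := h (Ordinal ki') => /=; rewrite ltNge hk.
by rewrite e2.
Qed.

(** Lenglart's inequality: off the event of large variation, reaching [eps] at some index forces the
    switched martingale to be at least [eps] at the end, and Chebyshev's inequality with the
    isometry bounds this by [del / eps ^+ 2]. The bound does not depend on the number of steps. *)
Lemma discrete_martingale_maximal :
  (P [set om | exists2 k, (k <= N)%N & (eps <= `|discrete_martingale c k om|)%R] <=
   (del / eps ^+ 2)%:E + P [set om | (del < discrete_qvar c N om)%R])%E.
Proof.
have mM k : measurable_fun setT (discrete_martingale c k).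
  exact: (filtration_rv_measurable hF (partition_ge0 k) (discrete_martingale_rv_measurable mc k)).
have mMt : measurable_fun setT (discrete_martingale ct N).
  exact: (filtration_rv_measurable hF (partition_ge0 N) (discrete_martingale_rv_measurable mct N)).
have mq : measurable [set om | del < discrete_qvar c N om].
  have mqN : measurable_fun setT (discrete_qvar c N).
    case: (N) => [|k].
      rewrite (_ : discrete_qvar c 0 = fun=> 0); first exact: measurable_cst.
      by apply/funext => om; rewrite /discrete_qvar big_ord0.
    exact: (filtration_rv_measurable hF (partition_ge0 k) (discrete_qvar_rv_measurable mc k)).
  exact: (measurable_set_ltr (measurable_cst _) mqN).
have mA : measurable [set om | exists2 k, (k <= N)%N & eps <= `|discrete_martingale c k om|].
  rewrite (_ : [set om | _] = \bigcup_(k in `I_N.+1) [set om | eps <= `|discrete_martingale c k om|]).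
    apply: bigcup_measurable => k _; apply: (measurable_set_ler (measurable_cst _)).
    by apply: measurableT_comp => //; exact: normr_measurable.
  apply/seteqP; split => om /=.
    by move=> [k kN h]; exists k.
  by move=> [k /= kN h]; exists k.
have mB : measurable [set om | eps <= `|discrete_martingale ct N om|].
  apply: (measurable_set_ler (measurable_cst _)).
  by apply: measurableT_comp => //; exact: normr_measurable.
apply: (@le_trans _ _ (P ([set om | eps <= `|discrete_martingale ct N om|] `|` [set om | del < discrete_qvar c N om]))).
  have mU := measurableU _ _ mB mq.
  apply: le_measure; [exact/mem_set|exact/mem_set|].
  move=> om /= h; have [q|q] := leP (discrete_qvar c N om) del; last by right.
  by left; exact: stopped.
apply: (le_trans (measureU2 _ mB mq)); apply: leeD => //.
have [i1 i2 i3 e] := discrete_martingale_moments mct bct N.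
have le1 : eps ^+ 2 * fine (P [set om | eps <= `|discrete_martingale ct N om|]) <= del.
  rewrite -[X in _ * X](_ : \int[P]_om (\1_[set om | eps <= `|discrete_martingale ct N om|] om) = _); last first.
    by rewrite /Rintegral integral_indic// setIT.
  have ii : P.-integrable setT (EFin \o \1_[set om | eps <= `|discrete_martingale ct N om|]).
    by apply: integrable_indic => //; rewrite -ge0_fin_numE// fin_num_measure.
  rewrite -RintegralZl//.
  apply: (@le_trans _ _ (\int[P]_om (discrete_martingale ct N om ^+ 2))).
    apply: le_Rintegral => //.
      exact: (integrableZl measurableT _ ii).
    move=> om _; rewrite indicE; case: (boolP (om \in _)) => [/set_mem /= h|_].
      rewrite mulr1 -[leRHS]real_normK ?num_real//.
      by apply: lerXn2r => //; rewrite nnegrE// ltW.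
    by rewrite mulr0 sqr_ge0.
  rewrite e -[leRHS](Rintegral_prob_cst P).
  apply: le_Rintegral => //.
    exact: finite_measure_integrable_cst.
  by move=> om _; have [] := qvar_ct_le N om.
rewrite -[leLHS]fineK ?fin_num_measure// lee_fin ler_pdivlMr ?exprn_gt0//.
by rewrite mulrC.
Qed.

End maximal.
End simple_martingale.

(** * Interval integrals and simple processes *)

Section interval_integrals.
Context {R : realType}.
Local Notation leb := (@lebesgue_measure R).
Implicit Types (f g : R -> R) (a b c : R).

Definition itv_integrable a b f := leb.-integrable `[a, b] (EFin \o f).

Lemma itv_integrableS a b a' b' f : a <= a' -> b' <= b ->
  itv_integrable a b f -> itv_integrable a' b' f.
Proof.
move=> aa bb; apply: integrableS => // x /=; rewrite !in_itv/= => /andP[h1 h2].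
by rewrite (le_trans aa h1) (le_trans h2 bb).
Qed.

Lemma itv_setUc a b c : a <= b -> b <= c ->
  `[a, c]%classic = `[a, b]%classic `|` `]b, c]%classic :> set R.
Proof.
move=> ab bc; apply/seteqP; split => x /=; rewrite !in_itv/=.
  by move=> /andP[h1 h2]; have [h|h] := leP x b; [left|right]; rewrite ?h1 ?h ?h2.
move=> [/andP[h1 h2]|/andP[h1 h2]]; apply/andP; split => //.
  exact: le_trans bc.
exact: (le_trans ab (ltW h1)).
Qed.

Lemma itv_integrable_cat a b c f : a <= b -> b <= c ->
  itv_integrable a b f -> itv_integrable b c f -> itv_integrable a c f.
Proof.
move=> ab bc i1 i2; rewrite /itv_integrable (itv_setUc ab bc).
have i3 : leb.-integrable `]b, c] (EFin \o f).
  by apply: integrableS i2 => // x /=; rewrite !in_itv/= => /andP[/ltW -> ->].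
have /measurable_int m1 := i1; have /measurable_int m3 := i3.
apply/integrableP; split; first exact/measurable_funU.
rewrite ge0_integral_setU//=.
- by rewrite lte_add_pinfty//; [case/integrableP : i1|case/integrableP : i3].
- apply/measurable_EFinP; apply: measurableT_comp; first exact: normr_measurable.
  by apply/measurable_EFinP; apply/measurable_funU.
- by apply/disj_setPLR => x /=; rewrite !in_itv/= => /andP[_ h1] /andP[h2 _]; rewrite ltNge h1 in h2.
Qed.

Lemma itv_integral_cat a b c f : a <= b -> b <= c -> itv_integrable a c f ->
  \int[leb]_(r in `[a, c]) f r =
  \int[leb]_(r in `[a, b]) f r + \int[leb]_(r in `[b, c]) f r.
Proof.
move=> ab bc i; rewrite -[X in _ = _ + X]Rintegral_itv_obnd_cbnd; last first.
  by apply: integrableS i => // x /=; rewrite !in_itv/= => /andP[/ltW h1 ->]; rewrite (le_trans ab h1).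
have := @Rintegral_itvB R f (BLeft a) (BRight c) b i.
by rewrite !bnd_simp => /(_ ab bc) <-; rewrite addrC subrK.
Qed.

Lemma itv_integral_cst a b (k : R) : a <= b ->
  \int[leb]_(r in `[a, b]) k = k * (b - a).
Proof.
move=> ab; rewrite Rintegral_cst//= lebesgue_measure_itv/= lte_fin.
case: ltP => // ba; congr (_ * _).
by rewrite (@le_anti _ _ a b) ?ab ?ba// subrr.
Qed.

Lemma itv_integrable_cst a b (k : R) : itv_integrable a b (fun=> k).
Proof.
apply: measurable_bounded_integrable => //.
  by rewrite /= lebesgue_measure_itv/= lte_fin; case: ifP; rewrite ?ltry// -EFinB ltry.
by exists `|k|; split; [exact: num_real|move=> x kx y _ /=; exact: ltW].
Qed.

Lemma itv_integral_ge0 a b f : (forall x, a <= x <= b -> 0 <= f x) ->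
  0 <= \int[leb]_(r in `[a, b]) f r.
Proof. by move=> h; apply: Rintegral_ge0 => x /=; rewrite in_itv/=; exact: h. Qed.

Lemma itv_integral_point a f : \int[leb]_(r in `[a, a]) f r = 0.
Proof. by rewrite set_itv1 Rintegral_set1. Qed.

Lemma itv_integrable_point a f : itv_integrable a a f.
Proof.
rewrite /itv_integrable set_itv1; apply: null_set_integrable => //.
- exact: measurable_fun_set1.
- exact: lebesgue_measure_set1.
Qed.

Lemma itv_le_integral a b f g : itv_integrable a b f -> itv_integrable a b g ->
  (forall x, a <= x <= b -> f x <= g x) ->
  \int[leb]_(r in `[a, b]) f r <= \int[leb]_(r in `[a, b]) g r.
Proof. by move=> h1 h2 h; apply: le_Rintegral => // x /=; rewrite in_itv/=; exact: h. Qed.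

Lemma itv_integral_mono a b c f : a <= b -> b <= c -> itv_integrable a c f ->
  (forall x, a <= x <= c -> 0 <= f x) ->
  \int[leb]_(r in `[a, b]) f r <= \int[leb]_(r in `[a, c]) f r.
Proof.
move=> ab bc i f0; rewrite (itv_integral_cat ab bc i) lerDl itv_integral_ge0// => x /andP[h1 h2].
by apply: f0; rewrite h2 (le_trans ab h1).
Qed.

Section step.
Variable pi : nat -> R.
Hypothesis pi_le : forall k, pi k <= pi k.+1.

Lemma itv_integrable_oc a b f (k : R) : (forall x, a < x <= b -> f x = k) -> itv_integrable a b f.
Proof.
move=> h; have [ba|ab] := ltP b a.
  by rewrite /itv_integrable set_itv_ge -?ltNge// ; exact: integrable_set0.
rewrite /itv_integrable; have e : `[a, b]%classic = [set a] `|` `]a, b]%classic :> set R.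
  by rewrite (itv_setUc (lexx a) ab) set_itv1.
apply/integrableP; split.
  rewrite e; apply/measurable_funU => //; split; first exact: measurable_fun_set1.
  apply: (eq_measurable_fun (fun=> k%:E)); last exact: measurable_cst.
  by move=> x /set_mem /=; rewrite in_itv/= => xab; rewrite h.
have mf : measurable_fun `[a, b]%classic (EFin \o f).
  rewrite e; apply/measurable_funU => //; split; first exact: measurable_fun_set1.
  apply: (eq_measurable_fun (fun=> k%:E)); last exact: measurable_cst.
  by move=> x /set_mem /=; rewrite in_itv/= => xab; rewrite h.
apply: (@le_lt_trans _ _ (\int[leb]_(x in `[a, b]) (`|f a| + `|k|)%:E)%E); last first.
  have /integrableP[_] := itv_integrable_cst a b (`|f a| + `|k|).
  by under eq_integral do rewrite /= ger0_norm ?addr_ge0//.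
apply: ge0_le_integral => //.
- exact: measurableT_comp.
- move=> x /=; rewrite in_itv/= => /andP[]; rewrite le_eqVlt => /predU1P[<- _|ax xb].
    by rewrite lee_fin lerDl.
  by rewrite h ?ax// lee_fin lerDr.
Qed.

(** Cells are open on the left, so the value is read at the right end; the left end is a null set,
    and a repeated point contributes nothing because its cell has length 0. *)
Lemma step_integral f L :
  (forall k r, (k < L)%N -> pi k < r <= pi k.+1 -> f r = f (pi k.+1)) ->
  itv_integrable (pi 0%N) (pi L) f /\
  \int[leb]_(r in `[pi 0%N, pi L]) f r = \sum_(k < L) f (pi k.+1) * (pi k.+1 - pi k).
Proof.
have mono k : pi 0%N <= pi k by elim: k => // k /le_trans; apply.
elim: L => [_|L ih h].
  by split; [exact: itv_integrable_point|rewrite itv_integral_point big_ord0].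
have [|i1 e1] := ih; first by move=> k r kL; apply: h; exact: ltnW.
have i2 : itv_integrable (pi L) (pi L.+1) f.
  by apply: (@itv_integrable_oc _ _ _ (f (pi L.+1))) => x; exact: h.
have i3 := itv_integrable_cat (mono L) (pi_le L) i1 i2.
split => //; rewrite (itv_integral_cat (mono L) (pi_le L) i3) big_ord_recr/= e1.
congr (_ + _); rewrite -itv_integral_cst//.
rewrite -[LHS]Rintegral_itv_obnd_cbnd; last first.
  by apply: integrableS i2 => // x /=; rewrite !in_itv/= => /andP[/ltW -> ->].
rewrite -[RHS]Rintegral_itv_obnd_cbnd; last first.
  apply: integrableS (itv_integrable_cst (pi L) (pi L.+1) (f (pi L.+1))) => // x /=.
  by rewrite !in_itv/= => /andP[/ltW -> ->].
by apply: eq_Rintegral => x /set_mem /=; rewrite in_itv/=; exact: h.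
Qed.

End step.
End interval_integrals.

Section common_partition.
Context {R : realType}.

(** The given points are sorted together with a uniform grid of step at most [h]. The default value
    [t] of [nth] makes the sequence constant after its last entry, hence nondecreasing with small
    steps on all of [nat]. *)
Lemma exists_partition (t0 t h : R) (s : seq R) : t0 <= t -> 0 < h ->
  (forall x, x \in s -> t0 <= x <= t) ->
  exists (pi : nat -> R) (L : nat),
    [/\ pi 0%N = t0, pi L = t, (forall k, pi k <= pi k.+1) &
        (forall x, x \in s -> exists2 l, (l <= L)%N & x = pi l)] /\
    (forall k, pi k.+1 - pi k <= h).
Proof.
move=> t0t h0 st.
have [N Nh] : exists N : nat, (t - t0) / h <= N.+1%:R.
  exists (Num.bound ((t - t0) / h)).
  have /archi_boundP/ltW/le_trans := divr_ge0 (etrans (subr_ge0 t0 t) t0t) (ltW h0).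
  by apply; rewrite ler_nat.
pose grid i : R := t0 + (t - t0) * (i%:R / N.+1%:R).
have N0 : (0 : R) < N.+1%:R by [].
have tt0 : 0 <= t - t0 by rewrite subr_ge0.
have grid0 : grid 0%N = t0 by rewrite /grid mul0r mulr0 addr0.
have gridN : grid N.+1 = t by rewrite /grid divff ?mulr1 ?gt_eqF// addrC subrK.
have gridS i : grid i.+1 = grid i + (t - t0) / N.+1%:R.
  by rewrite /grid -natr1; field; rewrite gt_eqF.
have grid_le i : (i <= N.+1)%N -> t0 <= grid i <= t.
  move=> iN; rewrite lerDl mulr_ge0 ?divr_ge0//=.
  rewrite -lerBrDl ler_piMr// ler_pdivrMr// mul1r ler_nat//.
pose l0 := t0 :: t :: s ++ [seq grid i | i <- iota 0 N.+2].
pose l := sort <=%R l0.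
have lmem x : (x \in l) = (x \in l0) by rewrite mem_sort.
have lin x : x \in l -> t0 <= x <= t.
  rewrite lmem !inE => /or3P[/eqP->|/eqP->|]; rewrite ?lexx ?t0t//.
  rewrite mem_cat => /orP[/st//|/mapP[i]].
  by rewrite mem_iota add0n ltnS => /andP[_ iN] ->; exact: grid_le.
have srt : sorted <=%R l by apply: sort_sorted => x y; exact: le_total.
pose pi k := nth t l k.
have sz : (0 < size l)%N by rewrite size_sort.
have pin k : t0 <= pi k <= t.
  rewrite /pi; have [kl|kl] := ltnP k (size l); first exact/lin/mem_nth.
  by rewrite nth_default// t0t lexx.
have mono i k : (i <= k)%N -> pi i <= pi k.
  move=> ik; rewrite /pi; have [kl|kl] := ltnP k (size l).
    apply: (sorted_leq_nth le_trans le_refl) => //; rewrite inE//.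
    exact: leq_ltn_trans kl.
  by rewrite [leRHS]nth_default//; have /andP[] := pin i.
have ex x : x \in l0 -> exists2 k, (k < size l)%N & x = pi k.
  by rewrite -lmem => /(nthP t)[k kl <-]; exists k.
exists pi, (size l).-1; split; last first.
  move=> k; have [tk|tk] := leP t (pi k).
    have /andP[_ h1] := pin k.+1.
    by rewrite (le_trans _ (ltW h0))// subr_le0 (le_trans h1).
  (* The first grid point above [pi k] is an entry of the list, so [pi k.+1] does not pass it, while
     the preceding grid point is at most [pi k]. *)
  have exi : exists i, pi k < grid i by exists N.+1; rewrite gridN.
  have [i hi imin] := ex_minnP exi.
  have iN : (i <= N.+1)%N by apply: imin; rewrite gridN.
  case: i hi imin iN => [|i] hi imin iN.
    by have /andP[] := pin k; rewrite leNgt -grid0 hi.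
  have hgi : grid i <= pi k.
    by rewrite leNgt; apply/negP => /imin; rewrite ltnn.
  have [k' k'l e] : exists2 k', (k' < size l)%N & grid i.+1 = pi k'.
    apply: ex; rewrite !inE mem_cat; apply/or3P; apply: Or33; apply/orP; right.
    by apply/mapP; exists i.+1 => //; rewrite mem_iota.
  have kk' : (k < k')%N by rewrite ltnNge; apply/negP => /mono; rewrite -e leNgt hi.
  have h1 := mono _ _ kk'; rewrite -e gridS in h1.
  have h2 : (t - t0) / N.+1%:R <= h by rewrite ler_pdivrMr// mulrC -ler_pdivrMr.
  by rewrite lerBlDl (le_trans h1)// lerD.
split.
- apply/eqP; rewrite eq_le; have /andP[-> _] := pin 0%N; rewrite andbT.
  have [k _ ->] : exists2 k, (k < size l)%N & t0 = pi k by apply: ex; rewrite !inE eqxx.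
  exact: mono.
- apply/eqP; rewrite eq_le; have /andP[_ ->] := pin (size l).-1; rewrite /=.
  have [k kl ->] : exists2 k, (k < size l)%N & t = pi k by apply: ex; rewrite !inE eqxx orbT.
  by apply: mono; rewrite -ltnS prednK.
- by move=> k; exact: mono.
- move=> x xs; have [k kl ->] : exists2 k, (k < size l)%N & x = pi k.
    by apply: ex; rewrite !inE mem_cat xs !orbT.
  by exists k => //; rewrite -ltnS prednK.
Qed.

End common_partition.

Section simple_processes.
Context {R : realType} d {T : measurableType d}.
Context (F : R -> set (set T)).
Context (Fs : forall t, 0 <= t -> sigma_algebra setT (F t)).
Context (Fi : forall s t, 0 <= s -> s <= t -> F s `<=` F t).
Implicit Types S : @simple_process R d T.

Lemma node_mono t0 t S k l : adapted_simple F t0 t S -> (k <= l <= pieces S)%N ->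
  node S k <= node S l.
Proof.
move=> [_ _ h]; elim: l => [|l ih].
  by rewrite leqn0 => /andP[/eqP ->].
move=> /andP[]; rewrite leq_eqVlt => /predU1P[->//|]; rewrite ltnS => kl lS.
have [h1 _ _] := h l lS.
by rewrite (le_trans _ h1)// ih// kl ltnW.
Qed.

Lemma node_itv t0 t S k : adapted_simple F t0 t S -> (k <= pieces S)%N ->
  t0 <= node S k <= t.
Proof.
move=> a kS; have [n0 nt _] := a; rewrite -n0 -nt.
by rewrite !(node_mono a)//= leqnn kS.
Qed.

Definition refines (pi : nat -> R) S : Prop :=
  forall k, (k <= pieces S)%N -> exists l, node S k = pi l.

(** Elementary integral over the part of the time interval before [r]: the nodes are cut at [r], so
    that one simple process yields a value at every time. *)
Definition simple_int_at (b : R -> T -> R) S (r : R) om : R :=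
  \sum_(k < pieces S) coef S k om *
    (b (Num.min r (node S k.+1)) om - b (Num.min r (node S k)) om).

Lemma simple_int_at_end (b : R -> T -> R) t0 t S om : adapted_simple F t0 t S ->
  simple_int_at b S t om = simple_integral b S om.
Proof.
move=> a; apply: eq_bigr => k _; rewrite !min_r//.
  by have /andP[] := node_itv a (ltnW (ltn_ord k)).
by have /andP[] := node_itv a (ltn_ord k).
Qed.

Lemma simple_bounded t0 t S : adapted_simple F t0 t S ->
  exists K, forall r om, `|simple_value S r om| <= K.
Proof.
move=> [_ _ h].
have h' (k : 'I_(pieces S)) : {c : R | forall om, `|coef S k om| <= c}.
  by apply/cid; have [_ _] := h k (ltn_ord k).
exists (\sum_(k < pieces S) `|sval (h' k)|) => r om.
rewrite /simple_value (le_trans (ler_norm_sum _ _ _))//.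
rewrite [leRHS](bigID (fun k : 'I__ => node S k < r <= node S k.+1))/=.
rewrite (le_trans (ler_sum _ _ (G := fun k => `|sval (h' k)|)))//; last first.
  by rewrite lerDl sumr_ge0.
move=> k _; apply: (le_trans (svalP (h' k) om)); exact: ler_norm.
Qed.

Section refine.
Variables (pi : nat -> R) (t0 t : R) (S : @simple_process R d T).
Hypotheses (pi0 : 0 <= pi 0%N) (pi_le : forall k, pi k <= pi k.+1).
Hypothesis (aS : adapted_simple F t0 t S) (rS : refines pi S).

Let lt_idx k l : pi k < pi l -> (k < l)%N.
Proof. by move=> h; rewrite ltnNge; apply/negP => /(partition_mono pi_le); rewrite leNgt h. Qed.

(** A coefficient active on the cell ending at [pi k.+1] starts at a node strictly before it. That
    node is a partition point, hence at most [pi k], where the coefficient is already known. *)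
Lemma simple_value_rv_measurable k :
  rv_measurable (F (pi k)) (fun om => simple_value S (pi k.+1) om).
Proof.
have p0 := partition_ge0 pi0 pi_le k.
rewrite /simple_value.
under [X in rv_measurable _ X]eq_fun do rewrite big_mkcond /=.
apply: (rv_measurable_sum (Fs p0)) => i.
case: (boolP (node S i < pi k.+1 <= node S i.+1)) => [/andP[h _]|_]; last first.
  exact: (rv_measurable_cst (Fs p0)).
have [_ _ hh] := aS; have [_ mc _] := hh i (ltn_ord i).
have [l el] := rS (ltnW (ltn_ord i)).
rewrite el in h; have := lt_idx h; rewrite ltnS => lk.
apply: rv_measurable_sub mc; rewrite el; apply: Fi; first exact: partition_ge0.
exact: partition_mono.
Qed.

Lemma simple_value_step k r om : pi k < r <= pi k.+1 ->
  simple_value S r om = simple_value S (pi k.+1) om.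
Proof.
move=> /andP[kr rk]; apply: eq_bigl => i.
have [l el] := rS (ltnW (ltn_ord i)); have [l' el'] := rS (ltn_ord i).
rewrite el el'; congr andb.
  apply/idP/idP => [h|h]; first exact: lt_le_trans rk.
  have := lt_idx h; rewrite ltnS => /(partition_mono pi_le) h'.
  exact: le_lt_trans kr.
apply/idP/idP => [h|h]; last exact: le_trans rk h.
by have /lt_idx := lt_le_trans kr h => /(partition_mono pi_le).
Qed.

Lemma simple_int_refine (b : R -> T -> R) l om : pi 0%N = t0 ->
  \sum_(k < l) simple_value S (pi k.+1) om * (b (pi k.+1) om - b (pi k) om) =
  simple_int_at b S (pi l) om.
Proof.
move=> pi00.
under eq_bigr do rewrite /simple_value big_mkcond/= mulr_suml.
rewrite exchange_big/=; apply: eq_bigr => i _.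
have [a ea] := rS (ltnW (ltn_ord i)); have [e ee] := rS (ltn_ord i).
have nle : pi a <= pi e by rewrite -ea -ee; have [_ _ /(_ i (ltn_ord i))[]] := aS.
have t0a : pi 0%N <= pi a by rewrite pi00 -ea; have /andP[] := node_itv aS (ltnW (ltn_ord i)).
rewrite ea ee.
(* The path with time clamped to one interval of [S]: its increments over the partition vanish
   outside of that interval and telescope to the cut increment. *)
pose f x := b (Num.min (Num.max x (pi a)) (pi e)) om.
transitivity (\sum_(k < l) coef S i om * (f (pi k.+1) - f (pi k))).
  apply: eq_bigr => k _; have pk := pi_le k; rewrite /f.
  have [h1|h1] := leP (pi k.+1) (pi a).
    by rewrite /= (max_r (le_trans pk h1)) subrr mul0r mulr0.
  have ak : pi a <= pi k by apply: (partition_mono pi_le); rewrite -ltnS; exact: lt_idx.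
  rewrite (max_l ak) /=.
  have [h2|h2] := leP (pi k.+1) (pi e); first by rewrite (min_l (le_trans pk h2)).
  have ek : pi e <= pi k by apply: (partition_mono pi_le); rewrite -ltnS; exact: lt_idx.
  by rewrite (min_r ek) subrr mul0r mulr0.
rewrite -mulr_sumr; congr (_ * _).
have -> : \sum_(k < l) (f (pi k.+1) - f (pi k)) = f (pi l) - f (pi 0%N).
  by rewrite -(big_mkord xpredT (fun k => f (pi k.+1) - f (pi k))) telescope_sumr.
rewrite /f (max_r t0a) (min_l nle).
have [h|h] := leP (pi a) (pi l).
  by [].
by rewrite (min_l nle) (min_l (le_trans (ltW h) nle)) !subrr.
Qed.

End refine.
End simple_processes.

Lemma measurable_exists_list d (T : measurableType d) (I : eqType) (s : seq I)
    (Q : I -> set T) : (forall r, r \in s -> measurable (Q r)) ->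
  measurable [set om | exists2 r, r \in s & Q r om].
Proof.
elim: s => [_|x s ih mQ].
  rewrite (_ : [set om | _] = set0)//.
  by apply/seteqP; split => // om /= [].
have -> : [set om | exists2 r, r \in x :: s & Q r om] =
    Q x `|` [set om | exists2 r, r \in s & Q r om].
  apply/seteqP; split => om /=.
    by move=> [r]; rewrite inE => /predU1P[->|rs] q; [left|right; exists r].
  by move=> [q|[r rs q]]; [exists x => //; rewrite mem_head|exists r => //; rewrite inE rs orbT].
apply: measurableU; first by apply: mQ; rewrite mem_head.
by apply: ih => r rs; apply: mQ; rewrite inE rs orbT.
Qed.

Lemma probability_list_le d (T : measurableType d) (R : realType) (P : probability T R)
    (I : eqType) (s : seq I) (Q : I -> set T) (e : R) :
  (forall r, r \in s -> measurable (Q r)) ->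
  (forall r, r \in s -> (P (Q r) <= e%:E)%E) ->
  (P [set om | exists2 r, r \in s & Q r om] <= ((size s)%:R * e)%:E)%E.
Proof.
elim: s => [|x s ih] mQ hQ.
  rewrite (_ : [set om | _] = set0); first by rewrite measure0 mul0r.
  by apply/seteqP; split => // om /= [].
have mQ' r : r \in s -> measurable (Q r) by move=> rs; apply: mQ; rewrite inE rs orbT.
have h1 : (P [set om | exists2 r, r \in s & Q r om] <= ((size s)%:R * e)%:E)%E.
  by apply: ih => // r rs; apply: hQ; rewrite inE rs orbT.
have mx := mQ x (mem_head x s); have hx := hQ x (mem_head x s).
have m1 := measurable_exists_list mQ'.
have -> : [set om | exists2 r, r \in x :: s & Q r om] =
    Q x `|` [set om | exists2 r, r \in s & Q r om].
  apply/seteqP; split => om /=.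
    by move=> [r]; rewrite inE => /predU1P[->|rs] q; [left|right; exists r].
  by move=> [q|[r rs q]]; [exists x => //; rewrite mem_head|exists r => //; rewrite inE rs orbT].
apply: (le_trans (measureU2 _ mx m1)).
by rewrite /= -natr1 mulrDl mul1r addrC EFinD leeD.
Qed.

(** * Elementary integrals against the Ito integral, uniformly on a grid *)

Section ito_uniform.
Context {R : realType} d {T : measurableType d} (P : probability T R).
Context (F : R -> set (set T)) (hF : usual_conditions P F).
Context (m : nat) (w : R -> T -> 'cV[R]_m) (hw : brownian P F w) (j : 'I_m).
Local Notation leb := (@lebesgue_measure R).
Local Notation b := (fun s om => w s om j 0).
Implicit Types S : @simple_process R d T.

Let Fs t : 0 <= t -> sigma_algebra setT (F t). Proof. exact: (filtration_sigma hF). Qed.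
Let Fi s t : 0 <= s -> s <= t -> F s `<=` F t. Proof. exact: (filtration_incr hF). Qed.

Lemma simple_int_at_measurable t0 t S r : 0 <= t0 -> 0 <= r -> adapted_simple F t0 t S ->
  measurable_fun setT (simple_int_at b S r).
Proof.
move=> t00 r0 a; apply: measurable_sum => k.
have [_ _ /(_ k (ltn_ord k))[_ mc _]] := a.
have n0 i : (i <= pieces S)%N -> 0 <= node S i.
  by move=> iS; have /andP[/(le_trans t00)] := node_itv a iS.
have mb x : 0 <= x -> measurable_fun setT (b x).
  by move=> x0; exact: (filtration_rv_measurable hF x0 (brownian_adapted hw j x0)).
apply: measurable_funM.
  exact: (filtration_rv_measurable hF (n0 k (ltnW (ltn_ord k))) mc).
by apply: measurable_funB; apply: mb; rewrite le_min r0 n0// ltnW.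
Qed.

Definition sqdist S S' t0 r om : R :=
  \int[leb]_(x in `[t0, r]) ((simple_value S x om - simple_value S' x om) ^+ 2).

(** On a partition containing the nodes of both processes, the points of [s] and the horizon [rm],
    the difference of the two elementary integrals is a discrete martingale whose variation at [rm]
    is [sqdist]; [discrete_martingale_maximal] then applies. The length of [s] does not enter the
    bound. *)
Lemma simple_maximal t0 t t' S S' rm (s : seq R) (eps del : R) : 0 <= t0 ->
  t0 <= rm -> adapted_simple F t0 t S -> adapted_simple F t0 t' S' ->
  (forall r, r \in s -> t0 <= r <= rm) -> 0 < eps -> 0 <= del ->
  [/\ (forall om, itv_integrable t0 rm (fun x => (simple_value S x om - simple_value S' x om) ^+ 2)),
   measurable_fun setT (sqdist S S' t0 rm) &
  (P [set om | exists2 r, r \in s & (eps <= `|simple_int_at b S r om - simple_int_at b S' r om|)%R]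
   <= (del / eps ^+ 2)%:E + P [set om | (del < sqdist S S' t0 rm om)%R])%E].
Proof.
move=> t00 t0rm aS aS' srm eps0 del0.
pose tm := Num.max rm (Num.max t t').
have t0tm : t0 <= tm by rewrite le_max t0rm.
pose nodes := rm :: s ++ [seq node S k | k <- iota 0 (pieces S).+1]
                ++ [seq node S' k | k <- iota 0 (pieces S').+1].
have rmtm : rm <= tm by rewrite le_max lexx.
have hn x : x \in nodes -> t0 <= x <= tm.
  rewrite inE !mem_cat => /predU1P[->|]; first by rewrite t0rm rmtm.
  move=> /or3P[/srm/andP[-> h]|/mapP[k]|/mapP[k]].
  - by rewrite (le_trans h rmtm).
  - rewrite mem_iota add0n ltnS => /andP[_ kS] ->.
    by have /andP[-> h] := node_itv aS kS; rewrite !le_max h orbT.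
  - rewrite mem_iota add0n ltnS => /andP[_ kS] ->.
    by have /andP[-> h] := node_itv aS' kS; rewrite !le_max h !orbT.
have [pi [L [[pi0 piL pi_le hpi] _]]] := exists_partition t0tm ltr01 hn.
have rS : refines pi S.
  move=> k kS; have [|l _ ->] := hpi (node S k); last by exists l.
  by rewrite inE !mem_cat; apply/or4P; apply: Or43; apply/mapP; exists k => //; rewrite mem_iota.
have rS' : refines pi S'.
  move=> k kS; have [|l _ ->] := hpi (node S' k); last by exists l.
  by rewrite inE !mem_cat; apply/or4P; apply: Or44; apply/mapP; exists k => //; rewrite mem_iota.
have [Lm LmL eLm] := hpi rm (mem_head _ _).
have pi00 : 0 <= pi 0%N by rewrite pi0.
pose c k om := simple_value S (pi k.+1) om - simple_value S' (pi k.+1) om.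
have mc k : rv_measurable (F (pi k)) (c k).
  have p0 := partition_ge0 pi00 pi_le k.
  by apply: (rv_measurableB (Fs p0));
    [exact: (simple_value_rv_measurable Fs Fi pi00 pi_le aS rS)
    |exact: (simple_value_rv_measurable Fs Fi pi00 pi_le aS' rS')].
have bc k : exists K, forall om, `|c k om| <= K.
  have [K hK] := simple_bounded aS; have [K' hK'] := simple_bounded aS'.
  by exists (K + K') => om; rewrite (le_trans (ler_normB _ _))// lerD.
have eI om k r : pi k < r <= pi k.+1 ->
    (simple_value S r om - simple_value S' r om) ^+ 2 = c k om ^+ 2.
  move=> h; rewrite /c (simple_value_step pi_le rS om h).
  by rewrite (simple_value_step pi_le rS' om h).
have st om : itv_integrable (pi 0%N) (pi Lm) (fun x => (simple_value S x om - simple_value S' x om) ^+ 2) /\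
    \int[leb]_(x in `[pi 0%N, pi Lm]) ((simple_value S x om - simple_value S' x om) ^+ 2) = discrete_qvar pi c Lm om.
  have [|h1 h2] := @step_integral R pi pi_le (fun x => (simple_value S x om - simple_value S' x om) ^+ 2) Lm.
    by move=> k r kL h; rewrite (eI om k r h).
  by split.
have eq : sqdist S S' t0 rm = discrete_qvar pi c Lm.
  by apply/funext => om; rewrite /sqdist -pi0 eLm; have [_ ->] := st om.
have mq : measurable_fun setT (discrete_qvar pi c Lm).
  case: (Lm) => [|k].
    rewrite (_ : discrete_qvar pi c 0 = fun=> 0); first exact: measurable_cst.
    by apply/funext => om; rewrite /discrete_qvar big_ord0.
  exact: (filtration_rv_measurable hF (partition_ge0 pi00 pi_le k) (discrete_qvar_rv_measurable hF pi00 pi_le mc k)).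
split; first by move=> om; have [h _] := st om; rewrite -pi0 eLm.
  by rewrite eq.
have := discrete_martingale_maximal hF hw j pi00 pi_le Lm mc bc eps0 del0.
rewrite eq; apply: le_trans; apply: le_measure.
- apply/mem_set; apply: measurable_exists_list => r rs.
  have r0 : 0 <= r by have /andP[/(le_trans t00)] := srm r rs.
  apply: (measurable_set_ler (measurable_cst _)).
  apply: measurableT_comp; first exact: normr_measurable.
  apply: measurable_funB; [exact: simple_int_at_measurable aS|exact: simple_int_at_measurable aS'].
- apply/mem_set.
  rewrite (_ : [set om | _] = [set om | exists2 k, k \in iota 0 Lm.+1 & eps <= `|discrete_martingale w j pi c k om|]).
    apply: measurable_exists_list => k _; apply: (measurable_set_ler (measurable_cst _)).
    apply: measurableT_comp; first exact: normr_measurable.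
    exact: (filtration_rv_measurable hF (partition_ge0 pi00 pi_le k) (discrete_martingale_rv_measurable hF hw j pi00 pi_le mc k)).
  apply/seteqP; split => om [k kL h]; exists k => //; last by move: kL; rewrite mem_iota.
  by rewrite mem_iota.
- move=> om /= [r rs h].
  have [|l lL el] := hpi r; first by rewrite inE !mem_cat rs orbT.
  have rrm : r <= rm by have /andP[] := srm r rs.
  have key k : discrete_martingale w j pi c k om = simple_int_at b S (pi k) om - simple_int_at b S' (pi k) om.
    rewrite -(simple_int_refine pi_le aS rS b k om pi0).
    rewrite -(simple_int_refine pi_le aS' rS' b k om pi0) -sumrB.
    by apply: eq_bigr => i _; rewrite /c mulrBl.
  have [lLm|Lml] := leqP l Lm.
    by exists l => //; rewrite key -el.
  have e : r = pi Lm.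
    apply/eqP; rewrite eq_le -eLm rrm el/= eLm; exact: (partition_mono pi_le (ltnW Lml)).
  by exists Lm => //; rewrite key -e.
Qed.

Variables (t0 t : R) (H : R -> T -> R) (Z : R -> T -> R).
Hypotheses (t00 : 0 <= t0) (t0t : t0 <= t).
Hypothesis Zint : forall r, t0 <= r <= t -> is_ito_integral P F b t0 r H (Z r).
Hypothesis mdist : forall S t' r, t0 <= r <= t -> adapted_simple F t0 t' S ->
  measurable_fun setT (fun om => (\int[leb]_(x in `[t0, r]) ((simple_value S x om - H x om) ^+ 2)%:E)%E).
Hypothesis mH : forall om, measurable_fun `[t0, t] (H ^~ om).

Definition edist S r om : \bar R :=
  (\int[leb]_(x in `[t0, r]) ((simple_value S x om - H x om) ^+ 2)%:E)%E.

Lemma simple_value_measurable_time S om : measurable_fun setT (fun x => simple_value S x om).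
Proof.
rewrite /simple_value; under eq_fun do rewrite big_mkcond/=.
apply: measurable_sum => k.
rewrite (_ : (fun x => _) = fun x => coef S k om * (\1_(`]node S k, node S k.+1]%classic) x)).
  by apply: measurable_funM => //; exact: measurable_indic.
apply/funext => x; rewrite indicE; case: ifPn => h.
  by rewrite mem_set ?mulr1//= in_itv/= h.
by rewrite memNset ?mulr0//= in_itv/=; exact/negP.
Qed.

Lemma edist_measurable S r om : t0 <= r <= t ->
  measurable_fun `[t0, r] (fun x => ((simple_value S x om - H x om) ^+ 2)%:E).
Proof.
move=> /andP[t0r rt]; apply/measurable_EFinP; apply: measurable_funX.
apply: measurable_funB.
  by apply: measurable_funTS; exact: simple_value_measurable_time.
apply: measurable_funS (mH om) => // x /=; rewrite !in_itv/= => /andP[-> h].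
exact: le_trans rt.
Qed.

Lemma edist_mono S r om : t0 <= r <= t -> (edist S r om <= edist S t om)%E.
Proof.
move=> /andP[t0r rt]; apply: ge0_subset_integral => //.
- by apply: edist_measurable; rewrite t0t lexx.
- by move=> x _; rewrite lee_fin sqr_ge0.
- by move=> x /=; rewrite !in_itv/= => /andP[-> h]; exact: le_trans rt.
Qed.

Lemma sqdist_le S S' t1 t1' r om : t0 <= r <= t ->
  adapted_simple F t0 t1 S -> adapted_simple F t0 t1' S' ->
  ((sqdist S S' t0 r om)%:E <= 2%:E * edist S r om + 2%:E * edist S' r om)%E.
Proof.
move=> rt aS aS'; have /andP[t0r _] := rt.
have [|h _ _] := @simple_maximal t0 t1 t1' S S' r [::] 1 0 t00 t0r aS aS' _ ltr01 (lexx 0).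
  by [].
rewrite /sqdist /Rintegral fineK; last by apply: integrable_fin_num => //; exact: h.
rewrite -!ge0_integralZl//; first last.
- by move=> x _; rewrite lee_fin sqr_ge0.
- exact: edist_measurable.
- by move=> x _; rewrite lee_fin sqr_ge0.
- exact: edist_measurable.
rewrite -ge0_integralD//; first last.
- by apply: measurable_funeM; exact: edist_measurable.
- by move=> x _; rewrite lee_fin mulr_ge0// sqr_ge0.
- by apply: measurable_funeM; exact: edist_measurable.
- by move=> x _; rewrite lee_fin mulr_ge0// sqr_ge0.
apply: ge0_le_integral => //.
- by move=> x _; rewrite lee_fin sqr_ge0.
- apply/measurable_EFinP; apply: measurable_funX; apply: measurable_funB;
    apply: measurable_funTS; exact: simple_value_measurable_time.
- by apply: emeasurable_funD; apply: measurable_funeM; exact: edist_measurable.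
- move=> x _; rewrite -!EFinM -EFinD lee_fin.
  set a := simple_value S x om; set a' := simple_value S' x om; set h0 := H x om.
  rewrite -subr_ge0; have -> : 2 * (a - h0) ^+ 2 + 2 * (a' - h0) ^+ 2 - (a - a') ^+ 2 =
    (a + a' - 2 * h0) ^+ 2 by ring.
  exact: sqr_ge0.
Qed.

Lemma measurable_edist_set S t1 r (del : R) : t0 <= r <= t -> adapted_simple F t0 t1 S ->
  measurable [set om | (del%:E <= edist S r om)%E].
Proof.
move=> rt aS; rewrite -[X in measurable X]setTI.
exact: emeasurable_fun_c_infty (mdist rt aS) _.
Qed.

(** [sqdist] is at most twice the sum of the two distances to [H], so exceeding [4 * del] forces one
    of these distances to be at least [del]. *)
Lemma simple_pair_close S S' t1 t1' rm (s : seq R) (eps del : R) :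
  t0 <= rm <= t -> adapted_simple F t0 t1 S -> adapted_simple F t0 t1' S' ->
  (forall r, r \in s -> t0 <= r <= rm) -> 0 < eps -> 0 < del ->
  (P [set om | exists2 r, r \in s & (eps <= `|simple_int_at b S r om - simple_int_at b S' r om|)%R]
   <= (4 * del / eps ^+ 2)%:E + (P [set om | del%:E <= edist S rm om]
       + P [set om | del%:E <= edist S' rm om]))%E.
Proof.
move=> rmt aS aS' srm eps0 del0; have /andP[t0rm _] := rmt.
have d40 : 0 <= 4 * del by rewrite mulr_ge0// ltW.
have [_ ms h] := simple_maximal t00 t0rm aS aS' srm eps0 d40.
apply: (le_trans h); apply: leeD => //.
have m1 := measurable_edist_set del rmt aS; have m2 := measurable_edist_set del rmt aS'.
apply: (le_trans _ (measureU2 _ m1 m2)); apply: le_measure.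
- by apply/mem_set; apply: (measurable_set_ltr (measurable_cst _)).
- by apply/mem_set; exact: measurableU.
- move=> om /= hlt.
  have [h1|h1] := leP del%:E (edist S rm om); first by left.
  have [h2|h2] := leP del%:E (edist S' rm om); first by right.
  have := sqdist_le om rmt aS aS'; rewrite leNgt => /negP; case.
  apply: (@lt_le_trans _ _ (4 * del)%:E); last by rewrite lee_fin ltW.
  have e1 : edist S rm om \is a fin_num.
    by rewrite ge0_fin_numE ?(lt_trans h1) ?ltry// integral_ge0// => x _; rewrite lee_fin sqr_ge0.
  have e2 : edist S' rm om \is a fin_num.
    by rewrite ge0_fin_numE ?(lt_trans h2) ?ltry// integral_ge0// => x _; rewrite lee_fin sqr_ge0.
  move: h1 h2; rewrite -(fineK e1) -(fineK e2) -!EFinM -EFinD !lte_fin; lra.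
Qed.

Lemma cvg0_probP (X : nat -> T -> \bar R) (e eta : R) : cvg0_in_probability P X ->
  0 < e -> 0 < eta -> \forall k \near \oo, (P [set om | (e%:E <= X k om)%E] <= eta%:E)%E.
Proof.
move=> h e0 eta0; have := h e e0.
move=> /fine_cvgP[hf /cvgr_lt/(_ _ eta0) h1]; near=> k.
have fk : P [set om | (e%:E <= X k om)%E] \is a fin_num by near: k.
by rewrite -(fineK fk) lee_fin; apply/ltW; near: k.
Unshelve. all: by end_near. Qed.

(** Each [Z r] has its own approximating sequence, so uniformity in [r] passes through one late term
    [S'] of the sequence for the final time. From [S] to [S'] the maximal inequality is uniform over
    the grid; from [S'] to [Z r] the comparison is pointwise, and its error is divided by the number
    of points. Since [S'] is chosen after the grid, [del] depends on [eps] and [eta] alone, which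
    allows a process to be fixed before the grid. *)
Lemma ito_grid_close (eps eta : R) : 0 < eps -> 0 < eta -> exists2 del : R, 0 < del &
  forall t1 S (s : seq R), adapted_simple F t0 t1 S ->
  (forall r, r \in s -> t0 <= r <= t) ->
  (P [set om | del%:E <= edist S t om] <= eta%:E)%E ->
  measurable [set om | exists2 r, r \in s & (eps <= `|simple_int_at b S r om - Z r om|)%R] /\
  (P [set om | exists2 r, r \in s & (eps <= `|simple_int_at b S r om - Z r om|)%R] <= (7 * eta)%:E)%E.
Proof.
move=> eps0 eta0.
have tt : t0 <= t <= t by rewrite t0t lexx.
(* Solves [4 * del / (eps / 2) ^+ 2 = eta], the first term of [simple_pair_close]; with the two
   distance terms this gives [3 * eta]. *)
pose del := eta * (eps / 2) ^+ 2 / 4.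
have del0 : 0 < del by rewrite divr_gt0// mulr_gt0// exprn_gt0// divr_gt0.
exists del => // t1 S s aS st hS.
(* Error allowed per grid point. Each point costs [4 * en]: one term of the maximal inequality, two
   distances to [H], and the convergence to [Z r]. Altogether at most [4 * eta], whence 7. *)
pose en := eta / (size s).+1%:R; have en0 : 0 < en by rewrite divr_gt0.
pose del' := en * (eps / 4) ^+ 2 / 4.
have del'0 : 0 < del' by rewrite divr_gt0// mulr_gt0// exprn_gt0// divr_gt0.
have mZ r : t0 <= r <= t -> measurable_fun setT (Z r) by move=> /Zint[].
have mI t1' S' r : t0 <= r <= t -> adapted_simple F t0 t1' S' -> measurable_fun setT (simple_int_at b S' r).
  by move=> /andP[/(le_trans t00) r0 _]; exact: simple_int_at_measurable.
have msub (X Y : T -> R) e : measurable_fun setT X -> measurable_fun setT Y ->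
    measurable [set om | e <= `|X om - Y om|].
  move=> mX mY; apply: (measurable_set_ler (measurable_cst _)).
  by apply: measurableT_comp; [exact: normr_measurable|exact: measurable_funB].
have mset : measurable [set om | exists2 r, r \in s & (eps <= `|simple_int_at b S r om - Z r om|)%R].
  apply: measurable_exists_list => r rs; apply: msub; [exact: mI (st r rs) aS|exact: mZ (st r rs)].
split => //.
have [_ [Sk [aSk cSk _]]] := Zint tt.
have [k k1 k2] : exists2 k, (P [set om | del%:E <= edist (Sk k) t om] <= eta%:E)%E
    & (P [set om | del'%:E <= edist (Sk k) t om] <= en%:E)%E.
  have h1 := cvg0_probP cSk del0 eta0; have h2 := cvg0_probP cSk del'0 en0.
  by near \oo => k; exists k; near: k.
pose S' := Sk k; have aS' : adapted_simple F t0 t S' by exact: aSk.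
have step1 : (P [set om | exists2 r, r \in s & (eps / 2 <= `|simple_int_at b S r om - simple_int_at b S' r om|)%R]
    <= (3 * eta)%:E)%E.
  have := simple_pair_close tt aS aS' st (divr_gt0 eps0 (ltr0n _ 2)) del0.
  move/le_trans; apply.
  rewrite (_ : 4 * del / (eps / 2) ^+ 2 = eta); last by rewrite /del; field; rewrite gt_eqF.
  rewrite (_ : 3 * eta = eta + (eta + eta)); last by ring.
  by rewrite !EFinD !leeD.
have step2 r : r \in s -> (P [set om | (eps / 2 <= `|simple_int_at b S' r om - Z r om|)%R] <= (4 * en)%:E)%E.
  move=> rs; have rt := st r rs; have /andP[t0r _] := rt.
  have [_ [Sr [aSr cSr iSr]]] := Zint rt.
  have eps40 : 0 < eps / 4 by rewrite divr_gt0.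
  have [i i1 i2] : exists2 i, (P [set om | del'%:E <= edist (Sr i) r om] <= en%:E)%E
    & (P [set om | ((eps / 4)%:E <= (`|simple_integral b (Sr i) om - Z r om|)%:E)%E] <= en%:E)%E.
    have h1 := cvg0_probP cSr del'0 en0; have h2 := cvg0_probP iSr eps40 en0.
    by near \oo => k'; exists k'; near: k'.
  have sr x : x \in [:: r] -> t0 <= x <= r by rewrite inE => /eqP ->; rewrite t0r lexx.
  have := simple_pair_close rt aS' (aSr i) sr eps40 del'0.
  rewrite (_ : 4 * del' / (eps / 4) ^+ 2 = en); last by rewrite /del'; field; rewrite gt_eqF.
  rewrite (_ : [set om | exists2 r0, r0 \in [:: r] & _] =
    [set om | eps / 4 <= `|simple_int_at b S' r om - simple_int_at b (Sr i) r om|]); last first.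
    apply/seteqP; split => om /=; first by move=> [x]; rewrite inE => /eqP ->.
    by move=> h; exists r => //; rewrite inE.
  move=> h3.
  have k3 : (P [set om | del'%:E <= edist S' r om] <= en%:E)%E.
    apply: le_trans k2; apply: le_measure.
    - by apply/mem_set; exact: measurable_edist_set aS'.
    - by apply/mem_set; exact: measurable_edist_set (aSk k).
    - by move=> om /= /le_trans; apply; exact: edist_mono.
  have m1 : measurable [set om | eps / 4 <= `|simple_int_at b S' r om - simple_int_at b (Sr i) r om|].
    by apply: msub; apply: mI => //; eassumption.
  have m2 : measurable [set om | eps / 4 <= `|simple_int_at b (Sr i) r om - Z r om|].
    by apply: msub; [exact: mI (aSr i)|exact: mZ].
  apply: (@le_trans _ _ (P ([set om | eps / 4 <= `|simple_int_at b S' r om - simple_int_at b (Sr i) r om|] `|`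
      [set om | eps / 4 <= `|simple_int_at b (Sr i) r om - Z r om|]))).
    apply: le_measure.
    - by apply/mem_set; apply: msub; [exact: mI aS'|exact: mZ].
    - by apply/mem_set; exact: measurableU.
    - move=> om /= h; have [h1|h1] := leP (eps / 4) `|simple_int_at b S' r om - simple_int_at b (Sr i) r om|.
        by left.
      right; have := ler_distD (simple_int_at b (Sr i) r om) (simple_int_at b S' r om) (Z r om).
      lra.
  apply: (le_trans (measureU2 _ m1 m2)).
  rewrite (_ : 4 * en = (en + (en + en)) + en); last by ring.
  rewrite !EFinD; apply: leeD.
    by apply: (le_trans h3); rewrite !leeD.
  apply: le_trans i2; apply: le_measure.
  - by apply/mem_set.
  - apply/mem_set; rewrite (_ : [set om | _] = [set om | eps / 4 <= `|simple_int_at b (Sr i) r om - Z r om|])//.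
    by apply/seteqP; split => om /=; rewrite lee_fin (simple_int_at_end _ _ (aSr i)).
  - by move=> om /=; rewrite lee_fin (simple_int_at_end _ _ (aSr i)).
have m3 r : r \in s -> measurable [set om | (eps / 2 <= `|simple_int_at b S' r om - Z r om|)%R].
  by move=> rs; apply: msub; [exact: mI (st r rs) aS'|exact: mZ (st r rs)].
have step3 := probability_list_le m3 step2.
have m4 := measurable_exists_list m3.
have m5 : measurable [set om | exists2 r, r \in s & (eps / 2 <= `|simple_int_at b S r om - simple_int_at b S' r om|)%R].
  by apply: measurable_exists_list => r rs; apply: msub; [exact: mI (st r rs) aS|exact: mI (st r rs) aS'].
apply: (@le_trans _ _ (P ([set om | exists2 r, r \in s & (eps / 2 <= `|simple_int_at b S r om - simple_int_at b S' r om|)%R]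
   `|` [set om | exists2 r, r \in s & (eps / 2 <= `|simple_int_at b S' r om - Z r om|)%R]))).
  apply: le_measure; [exact/mem_set|by apply/mem_set; exact: measurableU|].
  move=> om /= [r rs h].
  have [h1|h1] := leP (eps / 2) `|simple_int_at b S r om - simple_int_at b S' r om|.
    by left; exists r.
  right; exists r => //; have := ler_distD (simple_int_at b S' r om) (simple_int_at b S r om) (Z r om).
  lra.
apply: (le_trans (measureU2 _ m5 m4)).
rewrite (_ : 7 * eta = 3 * eta + 4 * eta); last by ring.
rewrite EFinD; apply: leeD => //; apply: (le_trans step3).
rewrite lee_fin mulrCA ler_pM2l// /en mulrA ler_pdivrMr// mulrC.
by rewrite ler_pM2l// ler_nat.
Unshelve. all: by end_near. Qed.

End ito_uniform.

(** * Taylor expansion of the Lyapunov function *)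

Section column_norm.
Context {R : realType} {n : nat}.
Implicit Types x y : 'cV[R]_n.

Lemma ler_coord_norm x i : `|x i 0| <= `|x|.
Proof.
rewrite [leRHS]/Num.norm /= mx_normrE.
have /mapP[j Hj e] : `|x i 0| \in [seq `|x z.1 z.2| | z : 'I_n * 'I_1].
  by apply/mapP; exists (i, 0) => //=; rewrite mem_enum.
by apply/bigmax_geP; right => /=; exists j; rewrite ?e.
Qed.

Lemma norm_le_coord x (r : R) : 0 <= r -> (forall i, `|x i 0| <= r) -> `|x| <= r.
Proof.
move=> r0 h; rewrite [leLHS]/Num.norm /= mx_normrE.
apply/bigmax_leP; split => //= -[i j] _ /=; rewrite ord1; exact: h.
Qed.

Lemma norm_le_sum x : `|x| <= \sum_i `|x i 0|.
Proof.
apply: norm_le_coord; first by rewrite sumr_ge0.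
by move=> i; rewrite (bigD1 i)//= lerDl sumr_ge0.
Qed.

Lemma compact_box (r : R) : compact [set x : 'cV[R]_n | `|x| <= r].
Proof.
pose A := [set v : 'rV[R]_n | forall i, `[- r, r]%classic (v ord0 i)].
have cA : compact A.
  by apply: (@rV_compact _ _ (fun=> `[- r, r]%classic)) => _; exact: segment_compact.
have [r0|r0] := ltP r 0.
  rewrite (_ : [set x | _] = set0); first exact: compact0.
  by apply/seteqP; split => // x /= h; have := le_lt_trans h r0; rewrite ltNge normr_ge0.
rewrite (_ : [set x | _] = (fun v : 'rV[R]_n => v^T) @` A).
  apply: continuous_compact => //; apply: continuous_subspaceT => v.
  move=> B /nbhs_ballP[e e0 eB]; apply/nbhs_ballP; exists e => // u [_ vu].
  by apply: eB; split => // i j; rewrite !mxE; exact: vu.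
apply/seteqP; split => x /=.
  move=> h; exists x^T; last by rewrite trmxK.
  move=> i /=; rewrite mxE in_itv/= -ler_norml.
  exact: le_trans (ler_coord_norm x i) h.
move=> [v Av <-]; apply: norm_le_coord => // i; rewrite mxE.
by have := Av i; rewrite /= in_itv/= -ler_norml.
Qed.

Variable tau : R.
Hypothesis tau0 : 0 <= tau.

(** Compactness is used in its near-covering form for the property that [g] oscillates by less than
    [eps] around [z]. Thus only the first point must lie in the compact box; the second one may
    leave it, as an increment of the scheme does. *)
Lemma Jtau_uniform (g : R -> 'cV[R]_n -> R) (Tm Rd eps : R) : Jtau_continuous tau g -> 0 < eps ->
  exists2 del : R, 0 < del & forall r r' x x', 0 <= r <= Tm -> 0 <= r' -> `|x| <= Rd ->
    `|r - r'| < del -> `|x - x'| < del -> `|g r x - g r' x'| < eps.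
Proof.
move=> cg eps0.
pose A := [set z : R * 'cV[R]_n | - tau <= z.1].
pose K : set (R * 'cV[R]_n) := `[0, Tm]%classic `*` [set x | `|x| <= Rd].
have cK : compact K by apply: compact_setX; [exact: segment_compact|exact: compact_box].
pose Q (del : R) (z : R * 'cV[R]_n) := A z -> forall z', A z' ->
  `|z.1 - z'.1| < del -> `|z.2 - z'.2| < del -> `|g z.1 z.2 - g z'.1 z'.2| < eps.
have : \forall del \near 0^'+, forall z, K z -> Q del z.
  move/compact_near_coveringP : cK; apply => z Kz.
  have Az : A z by case: Kz => /=; rewrite in_itv/= => /andP[h _] _; rewrite /A/= (le_trans _ h)// oppr_le0.
  have /subspace_continuousP/(_ z Az)/cvgrPdist_lt/(_ (eps / 2)) := cg.
  move=> /(_ (divr_gt0 eps0 (ltr0n _ 2))).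
  rewrite near_withinE => /nbhs_ballP[rho /= rho0 hrho].
  have rho20 : 0 < rho / 2 by rewrite divr_gt0.
  exists (ball z (rho / 2), [set del | del < rho / 2]).
    split; first exact: nbhsx_ballx.
    by apply: nbhs_right_lt.
  move=> [z1 del] /= [[b1 b2] dl] Az1 z' Az' d1 d2.
  have h1 : `|g z.1 z.2 - g z1.1 z1.2| < eps / 2.
    apply: hrho => //; apply: (@le_ball _ _ _ (rho / 2)); last by split.
    lra.
  have h2 : `|g z.1 z.2 - g z'.1 z'.2| < eps / 2.
    apply: hrho => //; split => /=.
      apply: (@ball_split _ _ z1.1); first exact: b1.
      by rewrite -ball_normE /ball_ /=; exact: lt_trans dl.
    apply: (@ball_split _ _ z1.2); first exact: b2.
    by rewrite -ball_normE /ball_ /=; exact: lt_trans dl.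
  rewrite (_ : g z1.1 z1.2 - g z'.1 z'.2 = (g z.1 z.2 - g z'.1 z'.2) - (g z.1 z.2 - g z1.1 z1.2)); last by ring.
  rewrite (le_lt_trans (ler_normB _ _))//; lra.
move=> h; near (0 : R)^'+ => del.
have del0 : 0 < del by near: del; exact: nbhs_right_gt.
have hK : forall z, K z -> Q del z by near: del.
exists del => // r r' x x' rT r'0 xR d1 d2.
apply: (hK (r, x) _ _ (r', x')) => //=.
- by rewrite /A/=; have /andP[h1 _] := rT; rewrite (le_trans _ h1)// oppr_le0.
- by rewrite /A/= (le_trans _ r'0)// oppr_le0.
Unshelve. all: by end_near. Qed.

Lemma Jtau_bounded (g : R -> 'cV[R]_n -> R) (Tm Rd : R) : Jtau_continuous tau g ->
  exists2 C : R, 0 <= C & forall r x, 0 <= r <= Tm -> `|x| <= Rd -> `|g r x| <= C.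
Proof.
move=> cg.
pose K : set (R * 'cV[R]_n) := `[0, Tm]%classic `*` [set x | `|x| <= Rd].
have cK : compact K by apply: compact_setX; [exact: segment_compact|exact: compact_box].
have cK' : compact ((fun z => g z.1 z.2) @` K).
  apply: continuous_compact => //; apply: continuous_subspaceW cg => z [/= + _].
  by rewrite in_itv/= => /andP[h _]; rewrite (le_trans _ h)// oppr_le0.
have [M [Mreal hM]] := compact_bounded cK'.
exists (`|M| + 1); first by rewrite addr_ge0.
move=> r x rT xR; apply: (hM (`|M| + 1)); first by rewrite (le_lt_trans (ler_norm _))// ltrDl.
by exists (r, x) => //; split => //=; rewrite in_itv/= rT.
Qed.

End column_norm.

Section first_order.
Context {R : realType}.

Lemma mvt_slope (f df : R -> R) (c eps k : R) :
  (forall s : R, is_derive s 1 f (df s)) ->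
  (forall s, `|s| <= `|k| -> `|df s - c| <= eps) ->
  `|f k - f 0 - c * k| <= eps * `|k|.
Proof.
move=> fd hd.
have cf a b : {within `[a, b], continuous f}.
  apply: continuous_subspaceT => s; apply: differentiable_continuous.
  by apply/derivable1_diffP; have [] := fd s.
have [k0|k0] := leP 0 k.
  have [s /andP[s0 sk] ->] := MVT_segment k0 (fun s _ => fd s) (cf 0 k).
  rewrite subr0 -mulrBl normrM ler_wpM2r// hd//.
  by rewrite !ger0_norm.
have [s /andP[s0 sk] e] := MVT_segment (ltW k0) (fun s _ => fd s) (cf k 0).
rewrite (_ : f k - f 0 - c * k = - ((df s - c) * (0 - k))); last by rewrite mulrBl -e; ring.
rewrite normrN sub0r normrM normrN ler_wpM2r// hd//.
by rewrite !ler0_norm ?lerN2// ltW.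
Qed.

Context {n : nat}.
Implicit Types (G : 'cV[R]_n -> R) (x h : 'cV[R]_n).
Local Notation e_ i := (delta_mx i 0 : 'cV[R]_n).

Lemma derivable_line G (x v : 'cV[R]_n) : (forall y, derivable G y v) ->
  forall s : R, is_derive s 1 (fun s => G (x + s *: v)) ('D_v G (x + s *: v)).
Proof.
move=> dG s.
have e : (fun k : R => k^-1 *: (((fun s => G (x + s *: v)) \o shift s) (k *: 1) - G (x + s *: v))) =
         (fun k : R => k^-1 *: ((G \o shift (x + s *: v)) (k *: v) - G (x + s *: v))).
  apply/funext => k /=; congr (_ *: (G _ - _)).
  by rewrite [k *: (1 : R)]mulr1 scalerDl addrCA addrA addrC addrA addrAC.
by split; rewrite /derivable /derive e //; exact: dG.
Qed.

(** The step is made one coordinate at a time, with the mean value theorem for each. In the maximum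
    norm all intermediate points stay within [norm h] of [x], so the hypothesis on the partial
    derivatives applies to them. *)
Lemma first_order G x h (eps : R) :
  (forall y i, derivable G y (e_ i)) ->
  (forall z, `|z - x| <= `|h| -> forall i, `|'D_(e_ i) G z - 'D_(e_ i) G x| <= eps) ->
  `|G (x + h) - G x - \sum_i 'D_(e_ i) G x * h i 0| <= eps * \sum_i `|h i 0|.
Proof.
move=> dG hG.
pose hk (k : nat) : 'cV[R]_n := \col_i (if (i < k)%N then h i 0 else 0).
have hk0 : hk 0%N = 0 by apply/matrixP => i j; rewrite !mxE.
have hkn : hk n = h by apply/matrixP => i j; rewrite !mxE ltn_ord ord1.
have hkS (k : 'I_n) : hk k.+1 = hk k + h k 0 *: e_ k.
  apply/matrixP => i j; rewrite !mxE ord1 eqxx andbT ltnS leq_eqVlt val_eqE.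
  by have [->|ik] := eqVneq i k; rewrite ?ltnn ?add0r ?mulr1//= mulr0 addr0.
have tel : G (x + h) - G x = \sum_(k < n) (G (x + hk k.+1) - G (x + hk k)).
  rewrite -(big_mkord xpredT (fun k => G (x + hk k.+1) - G (x + hk k))) telescope_sumr//.
  by rewrite hk0 hkn addr0.
rewrite tel -sumrB (le_trans (ler_norm_sum _ _ _))// mulr_sumr; apply: ler_sum => k _.
rewrite hkS addrA.
have := @mvt_slope (fun s => G ((x + hk k) + s *: e_ k)) (fun s => 'D_(e_ k) G ((x + hk k) + s *: e_ k))
  ('D_(e_ k) G x) eps (h k 0) (derivable_line _ (fun y => dG y k)).
rewrite scale0r addr0; apply => s sk; apply: hG.
rewrite addrAC (addrC x) addrK; apply: norm_le_coord => // i; rewrite !mxE eqxx andbT.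
have [ik|ik] := ltnP i k.
  have /negbTE -> : i != k by rewrite -val_eqE neq_ltn ik.
  by rewrite mulr0 addr0 ler_coord_norm.
case: (eqVneq i k) => _; last by rewrite mulr0 addr0 normr0.
by rewrite mulr1 add0r (le_trans sk)// ler_coord_norm.
Qed.

End first_order.

Section truncation.
Context {R : realType}.
Variable N : R.
Hypothesis N0 : 0 < N.

(* [hcap] is concave, C^1 and constant from [N] on, with derivative [hcap_d]:
   the first-order bound [hcap_concave] needs no stopping time, and is trivial
   outside of a sublevel set of [V], which is bounded by coercivity. *)
Definition hcap_d (v : R) : R := Num.max 0 (1 - v / N).
Definition hcap (v : R) : R := N / 2 * (1 - hcap_d v ^+ 2).

Lemma hcap_d_ge0 v : 0 <= hcap_d v. Proof. by rewrite le_max lexx. Qed.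

Lemma hcap_d_le1 v : 0 <= v -> hcap_d v <= 1.
Proof.
move=> v0; rewrite ge_max ler01/=.
have : 0 <= v / N by rewrite divr_ge0// ltW.
lra.
Qed.

Lemma hcap_d_eq0 v : N <= v -> hcap_d v = 0.
Proof.
move=> Nv; rewrite /hcap_d max_l//.
have : 1 <= v / N by rewrite ler_pdivlMr// mul1r.
lra.
Qed.

Lemma hcap_le v : hcap v <= N / 2.
Proof.
have : 0 <= N / 2 * hcap_d v ^+ 2 by rewrite mulr_ge0 ?sqr_ge0// divr_ge0// ltW.
rewrite /hcap; lra.
Qed.

Lemma hcap_ge0 v : 0 <= v -> 0 <= hcap v.
Proof.
move=> v0; rewrite /hcap; apply: mulr_ge0; first by rewrite divr_ge0// ltW.
by rewrite subr_ge0 expr_le1// ?hcap_d_ge0// hcap_d_le1.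
Qed.

Lemma hcap_concave v v' : hcap v' - hcap v <= hcap_d v * (v' - v).
Proof.
have e : v' - v = N * ((1 - v / N) - (1 - v' / N)) by field; rewrite gt_eqF.
rewrite e /hcap; set u := 1 - v / N; set u' := 1 - v' / N.
have -> : N / 2 * (1 - hcap_d v' ^+ 2) - N / 2 * (1 - hcap_d v ^+ 2) =
  N * ((hcap_d v ^+ 2 - hcap_d v' ^+ 2) / 2) by field.
rewrite [leRHS]mulrCA ler_pM2l// ler_pdivrMr//.
rewrite /hcap_d -/u -/u'.
have h : 0 <= (Num.max 0 u - Num.max 0 u') ^+ 2 by exact: sqr_ge0.
case: (leP 0 u) h => u0; case: (leP 0 u') => u'0; nra.
Qed.

Lemma hcap_le_id v : hcap v <= v.
Proof.
have := hcap_concave 0 v; rewrite subr0 /hcap_d mul0r subr0.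
have -> : Num.max 0 1 = 1 :> R by rewrite max_r.
by rewrite mul1r {2}/hcap /hcap_d mul0r subr0 max_r// expr1n subrr mulr0 subr0.
Qed.

Lemma hcap_d_lip v v' : `|hcap_d v - hcap_d v'| <= `|v - v'| / N.
Proof.
have e : `|v - v'| / N = `|(1 - v / N) - (1 - v' / N)|.
  rewrite (_ : 1 - v / N - (1 - v' / N) = - ((v - v') / N)); last by ring.
  by rewrite normrN normrM; congr (_ * _); rewrite ger0_norm// invr_ge0 ltW.
rewrite e /hcap_d; set u := 1 - v / N; set u' := 1 - v' / N.
rewrite ler_norml; have := ler_norm (u - u'); have := lerNnormlW (lexx `|u - u'|).
case: (leP 0 u) => u0; case: (leP 0 u') => u'0; lra.
Qed.

End truncation.

Lemma fin_min_pos {R : realType} (I : finType) (Q : I -> R -> Prop) :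
  (forall i d d', d' <= d -> Q i d -> Q i d') ->
  (forall i, exists2 d : R, 0 < d & Q i d) -> exists2 d : R, 0 < d & forall i, Q i d.
Proof.
move=> mono h; pose dd i := sval (cid2 (h i)).
have dP i : 0 < dd i /\ Q i (dd i) by rewrite /dd; case: cid2.
exists (\big[Order.min/1]_i dd i).
  by apply: lt_bigmin => // i _; have [] := dP i.
move=> i; apply: (mono i (dd i)); last by have [] := dP i.
exact: bigmin_le.
Qed.

Section line_derivatives.
Context {R : realType}.

Lemma is_derive_eps (f : R -> R) (s l : R) :
  (forall eps : R, 0 < eps -> exists2 d : R, 0 < d & forall k : R, k != 0 -> `|k| < d ->
     `|k^-1 * (f (k + s) - f s) - l| <= eps) -> is_derive s 1 f l.
Proof.
move=> h.
have c : (fun k : R => k^-1 *: ((f \o shift s) (k *: 1) - f s)) @ 0^' --> l.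
  apply/cvgrPdist_le => e e0; have [d d0 hd] := h e e0.
  exists d => //= k; rewrite /ball_ /= sub0r normrN => kd k0.
  by rewrite distrC [k *: (1 : R)]mulr1; exact: hd.
split; first by rewrite /derivable; apply/cvg_ex; exists l.
by rewrite /derive; apply/cvg_lim.
Qed.

Lemma is_derive_quadratic (a b s : R) :
  is_derive s 1 (fun s => s * a + s ^+ 2 * b) (a + 2 * s * b).
Proof.
apply: is_derive_eps => eps eps0; exists (eps / (`|b| + 1)).
  by rewrite divr_gt0// ltr_wpDl.
move=> k k0 kd.
have -> : k^-1 * ((k + s) * a + (k + s) ^+ 2 * b - (s * a + s ^+ 2 * b)) - (a + 2 * s * b) = k * b.
  by field.
rewrite normrM; move: kd; rewrite ltr_pdivlMr ?ltr_wpDl// => /ltW; apply: le_trans.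
by rewrite ler_wpM2l// lerDl.
Qed.

(** Chain rule from continuous partial derivatives: [first_order] is applied to the step [k *: h]
    with accuracy [eps / S], where [S] bounds the sum of the coordinates of [h]. *)
Lemma line_derive n (G : 'cV[R]_n -> R) :
  (forall y i, derivable G y (delta_mx i 0)) ->
  (forall i z (e : R), 0 < e -> exists2 d : R, 0 < d & forall z', `|z - z'| < d ->
    `|'D_(delta_mx i 0) G z - 'D_(delta_mx i 0) G z'| < e) ->
  forall (x h : 'cV[R]_n) (s : R), is_derive s 1 (fun s => G (x + s *: h))
    (\sum_i 'D_(delta_mx i 0) G (x + s *: h) * h i 0).
Proof.
move=> dG cG x h s; apply: is_derive_eps => eps eps0.
pose S := \sum_i `|h i 0| + 1; have S0 : 0 < S by rewrite ltr_wpDl// sumr_ge0.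
pose z := x + s *: h.
have eS : 0 < eps / S by rewrite divr_gt0.
have [d d0 hd] : exists2 d : R, 0 < d & forall i z', `|z - z'| < d ->
    `|'D_(delta_mx i 0) G z - 'D_(delta_mx i 0) G z'| < eps / S.
  apply: fin_min_pos => [i d d' d'd hh z' zz'|i]; last exact: cG.
  by apply: hh; exact: lt_le_trans d'd.
exists (d / (`|h| + 1)); first by rewrite divr_gt0// ltr_wpDl.
move=> k k0; rewrite ltr_pdivlMr ?ltr_wpDl// => kd.
have kh : `|k *: h| < d.
  by rewrite normrZ (le_lt_trans _ kd)// ler_wpM2l// lerDl.
have := @first_order R n G z (k *: h) (eps / S) dG.
have hh w : `|w - z| <= `|k *: h| -> forall i,
    `|'D_(delta_mx i 0) G w - 'D_(delta_mx i 0) G z| <= eps / S.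
  by move=> wz i; rewrite distrC ltW// hd// distrC (le_lt_trans wz).
move=> /(_ hh).
have -> : z + k *: h = x + (k + s) *: h by rewrite /z scalerDl -addrA [s *: h + _]addrC.
set D := (X in `|X| <= _) => hD.
have -> : k^-1 * (G (x + (k + s) *: h) - G (x + s *: h)) - \sum_i 'D_(delta_mx i 0) G (x + s *: h) * h i 0 =
    k^-1 * D.
  rewrite /D [RHS]mulrBr; congr (_ - _); rewrite mulr_sumr; apply: eq_bigr => i _.
  by rewrite -/z [(k *: h) i 0]mxE; field.
rewrite normrM normfV ler_pdivrMl ?normr_gt0//; apply: (le_trans hD).
rewrite mulrAC ler_pdivrMr// -mulrA [leRHS]mulrCA; rewrite ler_pM2l//.
under eq_bigr do rewrite mxE normrM.
by rewrite -mulr_sumr ler_wpM2l// /S lerDl.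
Qed.

End line_derivatives.

Section lyapunov_taylor.
Context {R : realType} {n : nat} (tau : R) (V : R -> 'cV[R]_n -> R).
Hypotheses (tau0 : 0 <= tau) (hV : classC21 tau V).
Implicit Types x y : 'cV[R]_n.
Local Notation Vt := (V_t tau V).
Local Notation Vx i t x := (V_x V t x 0 i).
Local Notation Vxx i j t x := (V_xx V t x i j).

(** For [0 < r] the constraint [- tau <= r + k] holds near [k = 0], so [nbhs_t] is the usual
    punctured neighbourhood. The mean value theorem needs the derivative inside the interval only,
    which covers a one-sided left end. *)
Lemma V_is_derive_t (r : R) x : 0 < r -> is_derive r 1 (fun s => V s x) (Vt r x).
Proof.
move=> r0.
have rt : - tau <= r by rewrite (le_trans _ (ltW r0))// oppr_le0.
have e : (fun k : R => k^-1 *: (((fun s => V s x) \o shift r) (k *: 1) - V r x)) = quotient_t V r x.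
  by apply/funext => k /=; rewrite /quotient_t [k *: (1 : R)]mulr1 (addrC r).
have nb : nbhs_t tau r = 0^' :> set_system R.
  apply/seteqP; split => B.
    rewrite /nbhs_t /within /= => h.
    have : \forall k \near 0^', - tau <= r + k.
      apply: nbhs_dnbhs; exists r => //= k; rewrite /ball_ /= sub0r normrN ltr_norml => /andP[h1 _].
      rewrite (@le_trans _ _ 0)// ?oppr_le0//; lra.
    by move: h; apply: filterS2 => k h1 h2; exact: h1.
  by rewrite /nbhs_t /within /=; apply: filterS.
have c : cvg (quotient_t V r x @ nbhs_t tau r) by exact: C21_cvg_t.
by split; rewrite /derivable /derive e /V_t -nb.
Qed.

Lemma V_continuous_itv (a b : R) x : 0 <= a -> {within `[a, b], continuous (fun s => V s x)}.
Proof.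
move=> a0; have /subspace_continuousP h := C21_continuous hV.
apply/subspace_continuousP => r /=; rewrite in_itv/= => /andP[ar rb].
have rt : - tau <= r by rewrite (le_trans _ (le_trans a0 ar))// oppr_le0.
have := h (r, x) rt => /cvgrPdist_lt hc; apply/cvgrPdist_lt => e e0.
have := hc e e0; rewrite !near_withinE => /nbhs_ballP[rho /= rho0 hr].
apply/nbhs_ballP; exists rho => //= s rs; rewrite in_itv/= => /andP[as_ _].
apply: (hr (s, x)).
  by split => //=; exact: ballxx.
by rewrite /= (le_trans _ (le_trans a0 as_))// oppr_le0.
Qed.

(** Time is moved first, at the fixed point [x + y], by the mean value theorem; then space at the
    fixed time [r], to second order. The constants are uniform for [x] in the box and for every
    small enough [y]. *)
Lemma V_taylor (Tm Rd eps : R) : 0 < eps -> exists2 del : R, 0 < del &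
  forall r r' x y, 0 <= r -> r <= r' -> r' <= Tm -> r' - r < del -> `|x| <= Rd -> `|y| < del ->
  `|V r' (x + y) - V r x - (Vt r x * (r' - r) + \sum_i Vx i r x * y i 0 +
     2^-1 * \sum_i \sum_j Vxx i j r x * y j 0 * y i 0)| <=
  eps * ((r' - r) + (\sum_i `|y i 0|) ^+ 2).
Proof.
move=> eps0.
have [d1 d10 h1] := Jtau_uniform tau0 Tm Rd (C21_continuous_t hV) eps0.
have [d2 d20 h2] : exists2 d : R, 0 < d & forall (ij : 'I_n * 'I_n) r x x', 0 <= r <= Tm -> `|x| <= Rd ->
    `|x - x'| < d -> `|Vxx ij.1 ij.2 r x - Vxx ij.1 ij.2 r x'| < eps.
  apply: fin_min_pos => [ij d d' d'd h r x x' rT xR xx'|ij].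
    by apply: h => //; exact: lt_le_trans d'd.
  have [d d0 hd] := @Jtau_uniform R n tau tau0 (fun t x => Vxx ij.1 ij.2 t x) Tm Rd eps
    (@C21_continuous_xx _ _ _ _ hV ij.1 ij.2) eps0.
  exists d => // r x x' rT xR xx'; apply: hd => //; last by rewrite subrr normr0.
  by have /andP[] := rT.
exists (Num.min d1 d2); first by rewrite lt_min d10 d20.
move=> r r' x y r0 rr' r'T; rewrite !lt_min => /andP[rd1 rd2] xR /andP[yd1 yd2].
have r'0 : 0 <= r' by exact: le_trans rr'.
have rT : 0 <= r <= Tm by rewrite r0 (le_trans rr').
have rtau : - tau <= r by rewrite (le_trans _ r0)// oppr_le0.
have timep : `|V r' (x + y) - V r (x + y) - Vt r x * (r' - r)| <= eps * (r' - r).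
  have hd s : s \in `]r, r'[ -> is_derive s 1 (fun s => V s (x + y)) (Vt s (x + y)).
    by rewrite in_itv/= => /andP[rs _]; apply: V_is_derive_t; exact: le_lt_trans rs.
  have [c + ->] := MVT_segment rr' hd (@V_continuous_itv r r' (x + y) r0).
  rewrite in_itv/= => /andP[rc cr'].
  rewrite -mulrBl normrM (ger0_norm (_ : 0 <= r' - r)) ?subr_ge0// ler_wpM2r ?subr_ge0//.
  rewrite distrC ltW// h1//.
  - exact: le_trans rc.
  - by rewrite distrC ger0_norm ?subr_ge0// (le_lt_trans _ rd1)// lerD2r.
  - by rewrite opprD addrA subrr sub0r normrN.
pose S := \sum_i `|y i 0|.
have S0 : 0 <= S by rewrite sumr_ge0.
pose Q := \sum_i \sum_j Vxx i j r x * y j 0 * y i 0.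
pose L := \sum_i Vx i r x * y i 0.
have dV z i : derivable (V r) z (delta_mx i 0) by apply: (@C21_derivable_x _ _ _ _ hV).
have VxE i z : 'D_(delta_mx i 0) (V r) z = Vx i r z by rewrite mxE.
have VxxE i j z : 'D_(delta_mx j 0) (fun z => Vx i r z) z = Vxx i j r z by rewrite [RHS]mxE.
have cVx i z (e : R) : 0 < e -> exists2 d : R, 0 < d & forall z', `|z - z'| < d ->
    `|'D_(delta_mx i 0) (V r) z - 'D_(delta_mx i 0) (V r) z'| < e.
  move=> e0; have [d d0 hd] := @Jtau_uniform R n tau tau0 (fun t x => Vx i t x) Tm `|z| e
    (@C21_continuous_x _ _ _ _ hV i) e0.
  exists d => // z' zz'; rewrite !VxE; apply: hd => //; by rewrite subrr normr0.
have spacep : `|V r (x + y) - V r x - (L + 2^-1 * Q)| <= eps * S ^+ 2.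
  (* [V] along the segment minus its quadratic Taylor polynomial. Its derivative is a sum of
     first-order remainders of the components of [V_x], small by [first_order], so the increment
     over [[0, 1]] is small too. *)
  pose psi (s : R) := V r (x + s *: y) - (s * L + s ^+ 2 * (2^-1 * Q)).
  pose dpsi (s : R) := \sum_i 'D_(delta_mx i 0) (V r) (x + s *: y) * y i 0 - (L + 2 * s * (2^-1 * Q)).
  have dpsiP (s : R) : is_derive s 1 psi (dpsi s).
    have l1 := line_derive dV cVx x y s.
    have l2 := is_derive_quadratic L (2^-1 * Q) s.
    exact: is_deriveB.
  have := @mvt_slope R psi dpsi 0 (eps * S ^+ 2) 1 dpsiP.
  rewrite mul0r subr0 normr1 mulr1.
  rewrite (_ : psi 1 - psi 0 = V r (x + y) - V r x - (L + 2^-1 * Q)); last first.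
    by rewrite /psi scale1r scale0r addr0 expr1n expr0n/= !mul1r !mul0r addr0 subr0; ring.
  apply => s s1; rewrite subr0.
  have -> : dpsi s = \sum_i (Vx i r (x + s *: y) - Vx i r x -
       \sum_j Vxx i j r x * (s *: y) j 0) * y i 0.
    under [RHS]eq_bigr do rewrite !mulrBl.
    rewrite !sumrB /dpsi /L; under eq_bigr do rewrite VxE.
    have -> : \sum_i (\sum_j Vxx i j r x * (s *: y) j 0) * y i 0 = s * Q.
      rewrite /Q mulr_sumr; apply: eq_bigr => i _; rewrite mulr_suml mulr_sumr.
      by apply: eq_bigr => j _; rewrite [(s *: y) j 0]mxE; ring.
    by rewrite -addrA -opprD; congr (_ - (_ + _)); field.
  rewrite (le_trans (ler_norm_sum _ _ _))//.
  rewrite (_ : eps * S ^+ 2 = \sum_i (eps * S) * `|y i 0|); last by rewrite -mulr_sumr -/S; ring.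
  apply: ler_sum => i _; rewrite normrM ler_wpM2r//.
  rewrite (_ : \sum_j Vxx i j r x * (s *: y) j 0 =
    \sum_j 'D_(delta_mx j 0) (fun z => Vx i r z) x * (s *: y) j 0); last first.
    by apply: eq_bigr => j _; rewrite VxxE.
  have := @first_order R n (fun z => Vx i r z) x (s *: y) eps (fun z j => @C21_derivable_xx _ _ _ _ hV r z i j rtau).
  have sy : `|s *: y| <= `|y| by rewrite normrZ ler_piMl// -(normr1 R).
  move=> h; apply: (le_trans (h _)).
    move=> z zx j; rewrite !VxxE distrC ltW// (h2 (i, j))//.
    by rewrite distrC (le_lt_trans zx)// (le_lt_trans sy).
  rewrite ler_pM2l// /S; apply: ler_sum => j _; rewrite [(s *: y) j 0]mxE normrM ler_piMl//.
rewrite (_ : V r' (x + y) - V r x - _ =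
  (V r' (x + y) - V r (x + y) - Vt r x * (r' - r)) + (V r (x + y) - V r x - (L + 2^-1 * Q))); last first.
  by rewrite /L /Q; ring.
by apply: (le_trans (ler_normD _ _)); rewrite [leRHS]mulrDr; exact: lerD.
Qed.

Lemma Jtau_bounded_fin (I : finType) (g : I -> R -> 'cV[R]_n -> R) (Tm Rd : R) :
  (forall i, Jtau_continuous tau (g i)) ->
  exists2 C : R, 0 <= C & forall i r x, 0 <= r <= Tm -> `|x| <= Rd -> `|g i r x| <= C.
Proof.
move=> cg; pose c i := sval (cid2 (Jtau_bounded tau0 Tm Rd (cg i))).
have cP i : 0 <= c i /\ forall r x, 0 <= r <= Tm -> `|x| <= Rd -> `|g i r x| <= c i.
  by rewrite /c; case: cid2.
exists (\sum_i c i); first by apply: sumr_ge0 => i _; have [] := cP i.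
move=> i r x rT xR; have [_ /(_ r x rT xR)] := cP i; move/le_trans; apply.
by rewrite (bigD1 i)//= lerDl; apply: sumr_ge0 => j _; have [] := cP j.
Qed.

(** Valid for all [x] and [y], in three regimes. Where [V r x] is at least [N], [hcap] is already
    maximal. In the bounded sublevel set with small [y], concavity reduces the claim to [V_taylor].
    For large [y] all terms grow at most quadratically and are absorbed by the fourth power, whose
    Gaussian mean is of second order in the time step. *)
Lemma hcap_step (N Tm eps Rd : R) : 0 < N -> 0 < eps ->
  (forall r x, 0 <= r <= Tm -> V r x < N -> `|x| <= Rd) ->
  exists C del : R, [/\ 0 <= C, 0 < del &
  forall r r' x y, 0 <= r -> r <= r' -> r' <= Tm -> r' - r < del ->
  hcap N (V r' (x + y)) - hcap N (V r x) <=
  hcap_d N (V r x) * (Vt r x * (r' - r) + \sum_i Vx i r x * y i 0 +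
     2^-1 * \sum_i \sum_j Vxx i j r x * y j 0 * y i 0) +
  eps * ((r' - r) + (\sum_i `|y i 0|) ^+ 2) + C * (\sum_i `|y i 0|) ^+ 4].
Proof.
move=> N0 eps0 coer.
have [d1 d10 hd1] := V_taylor Tm Rd eps0.
pose d := Num.min d1 1.
have d0 : 0 < d by rewrite lt_min d10 ltr01.
have dle1 : d <= 1 by rewrite ge_min lexx orbT.
have dled1 : d <= d1 by rewrite ge_min lexx.
have [Ct Ct0 hCt] := Jtau_bounded tau0 Tm Rd (@C21_continuous_t _ _ _ _ hV).
have [Cx Cx0 hCx] := Jtau_bounded_fin Tm Rd (@C21_continuous_x _ _ _ _ hV).
have [Cxx Cxx0 hCxx] := @Jtau_bounded_fin _ (fun (ij : 'I_n * 'I_n) t x => Vxx ij.1 ij.2 t x) Tm Rd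
   (fun ij => @C21_continuous_xx _ _ _ _ hV ij.1 ij.2).
pose C := N / 2 + Ct + Cx + Cxx.
have N20 : 0 <= N / 2 by rewrite divr_ge0// ltW.
have C0 : 0 <= C by rewrite /C; do ! apply: addr_ge0.
exists (C / d ^+ 4), d; split => //; first by rewrite divr_ge0// exprn_ge0// ltW.
move=> r r' x y r0 rr' r'T rd.
have r'0 : 0 <= r' by exact: le_trans rr'.
have rT : 0 <= r <= Tm by rewrite r0 (le_trans rr').
have rtau : - tau <= r by rewrite (le_trans _ r0)// oppr_le0.
have r'tau : - tau <= r' by rewrite (le_trans _ r'0)// oppr_le0.
set S := \sum_i `|y i 0|.
have S0 : 0 <= S by rewrite sumr_ge0.
have e0 : 0 <= eps * (r' - r + S ^+ 2).
  by rewrite mulr_ge0 ?(ltW eps0)// addr_ge0 ?subr_ge0// sqr_ge0.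
have e4 : 0 <= C / d ^+ 4 * S ^+ 4.
  by rewrite mulr_ge0 ?divr_ge0 ?exprn_ge0// ltW.
have V0 : 0 <= V r x by exact: (C21_ge0 hV).
have V'0 : 0 <= V r' (x + y) by exact: (C21_ge0 hV).
set Tl := (X in hcap_d N (V r x) * X).
have [NV|VN] := leP N (V r x).
  rewrite [hcap N (V r x)]/hcap hcap_d_eq0// mul0r expr0n/= subr0 mulr1 add0r.
  by have := hcap_le N0 (V r' (x + y)); lra.
have xR : `|x| <= Rd by exact: coer VN.
have h0 := hcap_d_ge0 N (V r x).
have h1 := hcap_d_le1 N0 V0.
have [yd|dy] := ltP `|y| d.
  have := hd1 r r' x y r0 rr' r'T (lt_le_trans rd dled1) xR (lt_le_trans yd dled1).
  rewrite -/Tl -/S ler_norml => /andP[_ h].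
  have := hcap_concave N0 (V r x) (V r' (x + y)); move/le_trans; apply.
  have hh : hcap_d N (V r x) * (V r' (x + y) - V r x - Tl) <= eps * (r' - r + S ^+ 2).
    by apply: (le_trans (ler_wpM2l h0 h)); rewrite ler_piMl.
  move: hh; rewrite mulrBr; lra.
have dS : d <= S by apply: (le_trans dy); exact: norm_le_sum.
have Tlb : `|Tl| <= Ct + Cx * S + Cxx * S ^+ 2.
  rewrite /Tl; apply: (le_trans (ler_normD _ _)); apply: lerD.
    apply: (le_trans (ler_normD _ _)); apply: lerD.
      rewrite normrM (ger0_norm (_ : 0 <= r' - r)) ?subr_ge0//.
      rewrite -[leRHS]mulr1; apply: ler_pM => //; [by rewrite subr_ge0|exact: hCt|].
      by rewrite (le_trans (ltW rd)).
    rewrite (le_trans (ler_norm_sum _ _ _))// /S mulr_sumr; apply: ler_sum => i _.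
    by rewrite normrM ler_wpM2r//; exact: hCx.
  rewrite normrM (ger0_norm (_ : 0 <= 2^-1 :> R)) ?invr_ge0//.
  have q : `|\sum_i \sum_j Vxx i j r x * y j 0 * y i 0| <= Cxx * S ^+ 2.
    rewrite (le_trans (ler_norm_sum _ _ _))// expr2 {1}/S mulr_suml mulr_sumr; apply: ler_sum => i _.
    rewrite (le_trans (ler_norm_sum _ _ _))// /S !mulr_sumr; apply: ler_sum => j _.
    rewrite !normrM mulrAC -mulrA; apply: ler_wpM2r; first exact: mulr_ge0.
    exact: (hCxx (i, j)).
  by apply: (le_trans _ q); rewrite ler_piMl// invf_le1// ler1n.
(* [S] in units of the threshold [d]. Since [d <= 1], each of 1, [S] and [S ^+ 2] is at most
   [s ^+ 4]. *)
have [s s1 Ss] : exists2 s : R, 1 <= s & S = d * s.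
  by exists (S / d); [rewrite ler_pdivlMr// mul1r|rewrite mulrCA divff ?mulr1// gt_eqF].
have bnd : N / 2 + (Ct + Cx * S + Cxx * S ^+ 2) <= C / d ^+ 4 * S ^+ 4.
  have -> : C / d ^+ 4 * S ^+ 4 = C * s ^+ 4 by rewrite Ss exprMn; field; rewrite gt_eqF.
  have Sles : S <= s by rewrite Ss ler_piMl// (le_trans _ s1).
  have s41 : 1 <= s ^+ 4 by rewrite exprn_ege1.
  have s4s : s <= s ^+ 4 by rewrite exprS ler_peMr ?(le_trans _ s1)// exprn_ege1.
  have s4s2 : S ^+ 2 <= s ^+ 4.
    apply: (@le_trans _ _ (s ^+ 2)); first by rewrite ler_sqr ?nnegrE// (le_trans _ s1).
    by rewrite ler_weXn2l.
  rewrite /C !mulrDl !addrA; do ! apply: lerD.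
  - by rewrite ler_peMr.
  - by rewrite ler_peMr.
  - by rewrite ler_wpM2l// (le_trans Sles).
  - by rewrite ler_wpM2l.
have l1 := hcap_le N0 (V r' (x + y)).
have l2 := hcap_ge0 N0 V0.
have l3 : - (hcap_d N (V r x) * Tl) <= Ct + Cx * S + Cxx * S ^+ 2.
  apply: le_trans Tlb; apply: (le_trans (ler_norm _)); rewrite normrN normrM.
  by rewrite ler_piMl// ger0_norm.
lra.
Qed.

End lyapunov_taylor.

(** * Joint measurability along solutions *)

Section joint_measurability.
Context {R : realType} d1 (T1 : measurableType d1).
Local Notation leb := (@lebesgue_measure R).

Lemma floor_cell (n : nat) (k : int) (s : R) :
  (Num.floor (n.+1%:R * s) == k) = (s \in `[k%:~R / n.+1%:R, (k + 1)%:~R / n.+1%:R[).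
Proof.
rewrite in_itv/= ler_pdivrMr// ltr_pdivlMr// mulrC.
by apply/eqP/idP => [<-|h]; [exact: floor_itv|exact: floor_def].
Qed.

Lemma floor_approx_cvg (s : R) :
  ((Num.floor (n.+1%:R * s))%:~R / n.+1%:R : R) @[n --> \oo] --> s.
Proof.
apply/cvgrPdist_le => e e0; near=> n.
have := floor_cell n (Num.floor (n.+1%:R * s)) s; rewrite eqxx => /esym.
set k := Num.floor _; rewrite in_itv/= intrD mulrDl => /andP[h1 h2].
rewrite ger0_norm ?subr_ge0//.
have : n.+1%:R^-1 <= e by near: n; apply: filterS (near_infty_natSinv_lt (PosNum e0)) => n' /ltW.
by move=> h3; rewrite lerBlDr (le_trans (ltW h2))// addrC lerD2r mulr1z div1r.
Unshelve. all: by end_near. Qed.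

(** The second argument is rounded down to a grid of step [1 / n.+1]; the rounded functions have
    preimages that are countable unions of rectangles and converge by continuity. *)
Lemma measurable_caratheodory (f : T1 -> R -> R) :
  (forall om, continuous (f om)) -> (forall s, measurable_fun setT (f ^~ s)) ->
  measurable_fun setT (fun z : T1 * R => f z.1 z.2).
Proof.
move=> cf mf.
pose fn (n : nat) (z : T1 * R) := f z.1 ((Num.floor (n.+1%:R * z.2))%:~R / n.+1%:R).
apply: (@measurable_fun_cvg _ _ _ _ fn) => [n _ B mB|z _]; last first.
  by apply: continuous_cvg; [exact: cf|exact: floor_approx_cvg].
rewrite setTI (_ : _ @^-1` _ = \bigcup_(k : int)
  ((f ^~ (k%:~R / n.+1%:R) @^-1` B) `*` `[k%:~R / n.+1%:R, (k + 1)%:~R / n.+1%:R[%classic)).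
  apply: countable_bigcupT_measurable; first exact: countableP.
  move=> k; apply: measurableX => //.
  by rewrite -[X in measurable X]setTI; exact: mf.
apply/seteqP; split => [[om s] /= h|[om s] /= [k _ [/= h1 h2]]].
  by exists (Num.floor (n.+1%:R * s)) => //; split => //=; rewrite -floor_cell eqxx.
by move: h2; rewrite -floor_cell => /eqP; rewrite /fn/= => ->.
Qed.

Lemma measurable_comp_caratheodory (f : T1 -> R -> R) (y : T1 -> R) :
  (forall om, continuous (f om)) -> (forall s, measurable_fun setT (f ^~ s)) ->
  measurable_fun setT y -> measurable_fun setT (fun om => f om (y om)).
Proof.
move=> cf mf my.
have mp : measurable_fun setT (fun om : T1 => (om, y om)) by exact: measurable_fun_pair.
exact: (measurableT_comp (measurable_caratheodory cf mf) mp).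
Qed.

(** The coordinates of a fixed vector are replaced by those of [X] one at a time. Each replacement
    composes a function continuous in one real variable with a measurable one, so
    [measurable_comp_caratheodory] suffices and column vectors need no sigma-algebra. *)
Lemma measurable_continuous_vec n (G : 'cV[R]_n -> R) (X : T1 -> 'cV[R]_n) :
  continuous G -> (forall i, measurable_fun setT (fun om => X om i 0)) ->
  measurable_fun setT (fun om => G (X om)).
Proof.
move=> cG mX.
pose Y k (c : 'cV[R]_n) om : 'cV[R]_n := \col_i (if (i < k)%N then X om i 0 else c i 0).
suff h k : forall c, measurable_fun setT (fun om => G (Y k c om)).
  rewrite (_ : (fun om => G (X om)) = fun om => G (Y n 0 om)); first exact: h.
  by apply/funext => om; congr G; apply/matrixP => i j; rewrite mxE ltn_ord ord1.
elim: k => [|k ih] c.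
  rewrite (_ : (fun om => _) = fun=> G c); first exact: measurable_cst.
  by apply/funext => om; congr G; apply/matrixP => i j; rewrite mxE ord1.
have [kn|nk] := ltnP k n; last first.
  rewrite (_ : (fun om => _) = fun om => G (Y k c om)); first exact: ih.
  apply/funext => om; congr G; apply/matrixP => i j; rewrite !mxE.
  by rewrite !(leq_trans (ltn_ord i))// (leq_trans nk).
pose io := Ordinal kn.
pose Z (s : R) : 'cV[R]_n := c + (s - c io 0) *: delta_mx io 0.
have ZE s i : Z s i 0 = if i == io then s else c i 0.
  by rewrite /Z !mxE eqxx andbT; case: eqP => [->|_]; rewrite ?mulr1 ?mulr0 ?addr0// addrC subrK.
rewrite (_ : (fun om => _) = fun om => G (Y k (Z (X om io 0)) om)).
  apply: (@measurable_comp_caratheodory (fun om s => G (Y k (Z s) om)) (fun om => X om io 0)) => //.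
    move=> om s; apply: continuous_comp; last exact: cG.
    pose Y0 := Y k (Z 0) om.
    rewrite (_ : (fun s => _) = fun s => Y0 + s *: delta_mx io 0).
      apply: continuousD; first exact: cst_continuous.
      by apply: continuousZr_tmp.
    have YZ r i : Y k (Z r) om i 0 = if (i < k)%N then X om i 0 else if i == io then r else c i 0.
      by rewrite /Y mxE ZE.
    apply/funext => r; apply/matrixP => i j; rewrite ord1 YZ [RHS]mxE /Y0 YZ [X in _ + X]mxE [delta_mx _ _ _ _]mxE !eqxx andbT.
    case: ifP => ik; case: eqP => [e|_]; rewrite ?mulr0 ?mulr1 ?addr0 ?add0r//.
    by move: ik; rewrite e ltnn.
apply/funext => om; congr G; apply/matrixP => i j; rewrite ord1 [LHS]mxE [RHS]mxE ZE ltnS leq_eqVlt.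
case: ltnP => ik; first by rewrite orbT.
rewrite orbF; case: (i =P io) => [->|ne]; first by rewrite eqxx.
case: eqP => // ek; exfalso; apply: ne; exact: val_inj.
Qed.

Lemma measurable_Rintegral_param (a b : R) (f : T1 -> R -> R) :
  measurable_fun (setT `*` `[a, b]) (fun z : T1 * R => f z.1 z.2) ->
  measurable_fun setT (fun om => \int[leb]_(r in `[a, b]) f om r).
Proof.
move=> mf.
have mD : measurable ([set: T1] `*` `[a, b]%classic) by exact: measurableX.
pose g (z : T1 * R) : \bar R := ((fun z => (f z.1 z.2)%:E) \_ ([set: T1] `*` `[a, b]%classic)) z.
have mg : measurable_fun setT g.
  by apply/(measurable_restrictT _ mD); exact/measurable_EFinP.
apply: measurableT_comp => //.
rewrite (_ : (fun om => _) = fun om => (\int[leb]_r (g^\+ (om, r)) - \int[leb]_r (g^\- (om, r)))%E).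
  apply: emeasurable_funB.
  - have h := @measurable_fun_fubini_tonelli_F _ _ _ _ _ leb (g^\+)%E (measurable_funepos mg) (fun z => funepos_ge0 g z).
    exact: h.
  - have h := @measurable_fun_fubini_tonelli_F _ _ _ _ _ leb (g^\-)%E (measurable_funeneg mg) (fun z => funeneg_ge0 g z).
    exact: h.
apply/funext => om; rewrite integral_mkcond integralE.
have e r : ((fun r => (f om r)%:E) \_ `[a, b]) r = g (om, r).
  rewrite /g !patchE; congr (if _ then _ else _).
  by apply/idP/idP => /set_mem h; apply/mem_set; [split|case: h].
by congr (_ - _)%E; apply: eq_integral => r _; rewrite ?funeposE ?funenegE e.
Qed.

Lemma measurable_integral_param (a b : R) (f : T1 -> R -> R) :
  measurable_fun (setT `*` `[a, b]) (fun z : T1 * R => f z.1 z.2) ->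
  (forall om r, 0 <= f om r) ->
  measurable_fun setT (fun om => \int[leb]_(r in `[a, b]) (f om r)%:E)%E.
Proof.
move=> mf f0.
have mD : measurable ([set: T1] `*` `[a, b]%classic) by exact: measurableX.
pose g (z : T1 * R) : \bar R := ((fun z => (f z.1 z.2)%:E) \_ ([set: T1] `*` `[a, b]%classic)) z.
have mg : measurable_fun setT g.
  by apply/(measurable_restrictT _ mD); exact/measurable_EFinP.
rewrite (_ : (fun om => _) = fun om => (\int[leb]_r (g (om, r)))%E).
  apply: (@measurable_fun_fubini_tonelli_F _ _ _ _ _ leb g) => // z.
  by rewrite /g patchE; case: ifP => //; rewrite lee_fin.
apply/funext => om; rewrite integral_mkcond.
apply: eq_integral => r _; rewrite /g !patchE; congr (if _ then _ else _).
by apply/idP/idP => /set_mem h; apply/mem_set; [split|case: h].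
Qed.

Lemma measurable_section (a b : R) (f : T1 -> R -> R) om :
  measurable_fun (setT `*` `[a, b]) (fun z : T1 * R => f z.1 z.2) ->
  measurable_fun `[a, b] (f om).
Proof.
move=> mf; have mD : measurable ([set: T1] `*` `[a, b]%classic) by exact: measurableX.
apply: (@measurable_comp _ _ _ _ _ _ _ (fun z : T1 * R => f z.1 z.2) _ (fun r => (om, r)) mD) => //.
- by move=> _ [r /= rab <-].
- by apply: measurable_funTS; exact: measurable_pair1.
Qed.

End joint_measurability.

(** Off a measurable null set the limit is pointwise; on it every subset is measurable because the
    measure is complete. *)
Lemma measurable_ae_cvg {R : realType} d (T : measurableType d) (P : {measure set T -> \bar R})
    (f_ : nat -> T -> R) (f : T -> R) :
  measure_is_complete P -> (forall n, measurable_fun setT (f_ n)) ->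
  {ae P, forall x, f_ n x @[n --> \oo] --> f x} -> measurable_fun setT f.
Proof.
move=> cP mf [N [mN PN hN]].
pose g_ n x := f_ n x * \1_(~` N) x; pose g x := f x * \1_(~` N) x.
have mg : measurable_fun setT g.
  apply: (@measurable_fun_cvg _ _ _ setT g_) => [n|x _].
    by apply: measurable_funM => //; apply: measurable_indic; exact: measurableC.
  rewrite /g_ /g indicE; case: (pselect (N x)) => Nx.
    rewrite memNset//= mulr0; under eq_fun do rewrite mulr0; exact: cvg_cst.
  rewrite mem_set//= mulr1; under eq_fun do rewrite mulr1.
  by apply: contrapT => h; apply: Nx; exact: hN.
move=> _ B mB; rewrite setTI.
rewrite (_ : f @^-1` B = ((g @^-1` B) `\` N) `|` (f @^-1` B `&` N)).
  apply: measurableU.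
    by apply: measurableD => //; rewrite -[X in measurable X]setTI; exact: mg.
  by apply: cP; exists N; split => // x [].
apply/seteqP; split => x /=.
  move=> Bx; case: (pselect (N x)) => Nx; [by right|left; split => //].
  by rewrite /g indicE mem_set//= mulr1.
by rewrite /g indicE => -[[+ Nx]|[]//]; rewrite mem_set//= mulr1.
Qed.

Lemma continuous_clamp {R : realType} (W : topologicalType) (a : R) (f : R -> W) :
  {within [set t | a <= t], continuous f} -> continuous (fun r => f (Num.max a r)).
Proof.
move=> /subspace_continuousP cf r.
have ar : a <= Num.max a r by rewrite le_max lexx.
have cm : continuous (fun r : R => Num.max a r).
  by move=> z; apply: continuous_max; [exact: cst_continuous|exact: cvg_id].
apply: cvg_comp (cf (Num.max a r) ar) => B nB.
have h : \forall z \near r, a <= Num.max a z -> B (Num.max a z) := cm r _ nB.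
by apply: filterS h => z; apply; rewrite le_max lexx.
Qed.

Section solution_measurability.
Context {R : realType} d {T : measurableType d} (P : probability T R).
Context (F : R -> set (set T)) (hF : usual_conditions P F).
Context (tau : R) (n m l : nat) (w : R -> T -> 'cV[R]_m).
Context (f0 : R -> history tau n -> 'cV[R]_l -> 'cV[R]_n).
Context (g0 : R -> history tau n -> 'cV[R]_l -> 'M[R]_(n, m)).
Hypothesis tau0 : 0 <= tau.
Variables (t0 : R) (xi : T -> history tau n) (u : @input R l) (x : R -> T -> 'cV[R]_n).
Hypotheses (t00 : 0 <= t0) (hxi : initial_condition F t0 xi) (hu : admissible_input u).
Hypothesis hx : is_solution P F w f0 g0 t0 xi u x.
Local Notation a0 := (t0 - tau).
Local Notation TG g := (g_sigma_algebraType (F g)).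

Lemma rv_measurable_ae g (X Y : T -> R) : 0 <= g -> {ae P, forall om, X om = Y om} ->
  rv_measurable (F g) Y -> rv_measurable (F g) X.
Proof.
move=> g0' XY mY B mB.
have sF := filtration_sigma hF g0'.
have FT A (FA : F g A) : measurable (A : set (TG g)) by exact: sub_gen_smallest.
have FN N : P.-negligible N -> measurable (N : set (TG g)).
  by move=> nN; apply: FT; apply: (filtration_incr hF (lexx 0) g0'); exact: (filtration_null hF).
pose N := [set om | X om <> Y om].
have nN : P.-negligible N by exact: XY.
rewrite -(sigma_algebra_id sF).
rewrite (_ : X @^-1` B = ((Y @^-1` B) `\` N) `|` (X @^-1` B `&` N)); last first.
  apply/seteqP; split => om /=.
    by move=> XB; case: (pselect (X om = Y om)) => e; [left; rewrite -e; split => // /(_ e)|right].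
  by move=> [[YB /contrapT ->]//|[]].
have h : measurable (((Y @^-1` B) `\` N) `|` (X @^-1` B `&` N) : set (TG g)).
  apply: measurableU; first by apply: measurableD; [apply: FT; exact: mY|exact: FN].
  by apply: FN; apply: negligibleS nN => om [].
exact: h.
Qed.

(** Before [t0] the value is, up to a null set, an evaluation of [xi], hence known at [t0]; null
    events belong to every sigma-algebra of the filtration. *)
Lemma solution_rv_measurable s g i : a0 <= s -> s <= g -> t0 <= g ->
  rv_measurable (F g) (fun om => x s om i 0).
Proof.
move=> as_ sg t0g; have g00 : 0 <= g by exact: le_trans t0g.
have [t0s|st0] := leP t0 s.
  apply: rv_measurable_sub (solution_adapted hx i t0s).
  by apply: (filtration_incr hF) => //; exact: le_trans t0s.
have th : s - t0 \in `[- tau, 0]%classic.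
  by apply/mem_set; rewrite /= in_itv/= subr_le0 (ltW st0) andbT; move: as_; lra.
pose theta : `[- tau, 0]%classic := SigSub th.
apply: (@rv_measurable_ae g _ (fun om => sval (xi om) theta i 0)) => //.
  apply: filterS (solution_initial hx) => om /(_ theta) <-.
  by rewrite /theta/= set_valE/= addrC subrK.
move=> B mB; apply: (filtration_incr hF t00 t0g).
suff h : @history_sigma R tau n [set ph : history tau n | B (sval ph theta i 0)] by exact: (hxi.1 _ h).
apply: sub_gen_smallest; exists (fun ph : history tau n => sval ph theta i 0); first by exists theta, i.
by exists B => //; rewrite setTI.
Qed.

Lemma path_continuous om : continuous (fun r => x (Num.max a0 r) om).
Proof. exact: (continuous_clamp (@solution_continuous _ _ _ _ _ _ _ _ _ _ _ _ _ _ _ _ hx om)). Qed.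

(** Paths are continuous from [t0 - tau] on, which excludes the default branch of [history_at] for
    [t0 <= r]. *)
Lemma history_at_val om r (theta : `[- tau, 0]%classic) : t0 <= r ->
  sval (history_at tau (x ^~ om) r) theta = x (r + set_val theta) om.
Proof.
move=> t0r; rewrite /history_at; case: pselect => [cx //|]; case.
rewrite (_ : (fun theta : `[- tau, 0]%classic => x (r + set_val theta) om) =
   (fun s => x (Num.max a0 s) om) \o (fun theta : `[- tau, 0]%classic => r + set_val theta)).
  move=> th; apply: continuous_comp; last exact: path_continuous.
  apply: (@continuous_comp _ _ _ (set_val : `[- tau, 0]%classic -> R) (fun v : R => r + v)).
    exact: initial_continuous.
  by apply: cvgD; [exact: cvg_cst|exact: cvg_id].
apply/funext => th /=; rewrite max_r//.
by have := set_valP th; rewrite /= in_itv/= => /andP[h _]; rewrite lerD// opprK.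
Qed.

(** Progressive measurability. Clamping the time to [[t0 - tau, g]] makes the process continuous on
    the whole line while every evaluation remains known at [g]. *)
Lemma solution_joint_measurable g (theta : R) i : t0 <= g -> - tau <= theta <= 0 ->
  measurable_fun (setT `*` `[t0, g]) (fun z : TG g * R => x (z.2 + theta) z.1 i 0).
Proof.
move=> t0g /andP[th1 th2]; have g00 : 0 <= g by exact: le_trans t0g.
have ag : a0 <= g by rewrite (le_trans _ t0g)// gerBl.
pose f om r := x (Num.max a0 (Num.min (r + theta) g)) om i 0.
have mf : measurable_fun setT (fun z : TG g * R => f z.1 z.2).
  apply: (@measurable_caratheodory R _ (TG g) f).
    move=> om r; rewrite /f.
    apply: (@continuous_comp _ _ _ (fun r : R => Num.min (r + theta) g) (fun r => x (Num.max a0 r) om i 0)).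
      apply: continuous_min; last exact: cst_continuous.
      by apply: cvgD; [exact: cvg_id|exact: cvg_cst].
    apply: (@continuous_comp _ _ _ (fun r => x (Num.max a0 r) om) (fun v : 'cV[R]_n => v i 0)).
      exact: path_continuous.
    exact: coord_continuous.
  move=> s; apply/(rv_measurableE (filtration_sigma hF g00)).
  apply: solution_rv_measurable => //; first by rewrite le_max lexx.
  by rewrite ge_max ag ge_min lexx orbT.
apply: eq_measurable_fun (measurable_funTS mf) => -[om r] /set_mem[_ /=].
rewrite in_itv/= => /andP[t0r rg]; rewrite /f/= min_l ?max_r//.
  by rewrite lerD.
by rewrite -[leRHS]addr0 lerD.
Qed.

(** The sets with measurable preimage under [Phi] form a sigma-algebra, so it suffices to treat the
    three kinds of generators of [coef_sigma]: time, evaluations of the history, coordinates of the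
    input. *)
Lemma along_joint_measurable (h : R -> history tau n -> 'cV[R]_l -> R) g : t0 <= g ->
  coef_measurable h -> measurable_fun (setT `*` `[t0, g])
    (fun z : TG g * R => h z.2 (history_at tau (x ^~ z.1) z.2) (u z.2)).
Proof.
move=> t0g hm _ B mB.
pose D : set (TG g * R) := setT `*` `[t0, g]%classic.
have mD : measurable D by exact: measurableX.
pose Phi (z : TG g * R) := (z.2, history_at tau (x ^~ z.1) z.2, u z.2).
have key A : @coef_sigma R tau n l A -> measurable (D `&` Phi @^-1` A).
  apply: (@smallest_sub _ _ _ [set A | measurable (D `&` Phi @^-1` A)]).
    split => /=.
    - by rewrite preimage_set0 setI0.
    - move=> A1 hA; rewrite setTD.
      rewrite (_ : D `&` _ = D `\` (D `&` Phi @^-1` A1)); first exact: measurableD.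
      by apply/seteqP; split => z /= [Dz hz]; split => // hA1; apply: hz => //; case: hA1.
    - move=> A1 hA; rewrite preimage_bigcup setI_bigcupr; exact: bigcup_measurable.
  move=> A1 [c hc] [C mC <-] /=; rewrite setTI.
  suff mc : measurable_fun D (c \o Phi) by exact: mc.
  case: hc => [[->|[theta [i ->]]]|[j ->]].
  - by apply: measurable_funTS; exact: measurable_snd.
  - have th : - tau <= set_val theta <= 0 by have := set_valP theta; rewrite /= in_itv/=.
    apply: eq_measurable_fun (solution_joint_measurable i t0g th) => -[om r] /set_mem[_ /=].
    by rewrite in_itv/= => /andP[t0r _]; rewrite history_at_val.
  - apply: (@measurable_comp _ _ _ _ _ _ J (fun t => u t j 0) D snd).
    + rewrite (_ : J = `[0, +oo[%classic); first exact: measurable_itv.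
      by apply/seteqP; split => r; rewrite /J /= in_itv/= andbT.
    + by move=> _ [[om r] [_ /=] + <-] /=; rewrite in_itv/= => /andP[t0r _]; exact: le_trans t0r.
    + exact: hu.1.
    + by apply: measurable_funTS; exact: measurable_snd.
rewrite (_ : D `&` _ = D `&` Phi @^-1` ([set z | 0 <= z.1.1] `&`
    (fun z => h z.1.1 z.1.2 z.2) @^-1` B)); first by apply: key; exact: hm.
apply/seteqP; split => -[om r] /= [] [_ +] hh; rewrite /= in_itv/= => /andP[h1 h2].
  split; first by split => //=; rewrite in_itv/= h1.
  by split => //=; exact: le_trans h1.
by case: hh => _ hh; split => //; split => //=; rewrite in_itv/= h1.
Qed.

End solution_measurability.

(** * Approximation of the drift by simple processes *)

Lemma ae_cvg_probP {R : realType} d (T : measurableType d) (P : probability T R)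
    (X : nat -> T -> R) : (forall n, measurable_fun setT (X n)) ->
  {ae P, forall om, X n om @[n --> \oo] --> 0} ->
  forall eps eta : R, 0 < eps -> 0 < eta ->
  exists N, forall n, (N <= n)%N -> (P [set om | (eps <= X n om)%R] <= eta%:E)%E.
Proof.
move=> mX cX eps eta eps0 eta0.
pose A n := [set om | (eps <= X n om)%R].
have mA n : measurable (A n) by exact: measurable_set_ler.
have ic : P.-integrable setT (EFin \o (fun=> 1 : R)).
  exact: finite_measure_integrable_cst.
have [|||||_ hc] := @Rintegral_dominated _ T R P setT measurableT (fun n => \1_(A n)) (fun=> 0) (fun=> 1).
- by move=> n; exact: measurable_indic.
- by [].
- apply: filterS cX => om h _; apply/cvgrPdist_le => e e0.
  move/cvgrPdist_lt : h => /(_ eps eps0); apply: filterS => n.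
  rewrite !sub0r !normrN => h; rewrite indicE memNset ?normr0 ?ltW//.
  by rewrite /A/= => h'; move: h; rewrite ltNge (le_trans h')// ler_norm.
- exact: ic.
- by move=> n om _; rewrite indicE ger0_norm// lern1 leq_b1.
move: hc; rewrite Rintegral_cst// mul0r => /cvgrPdist_le /(_ eta eta0)[N _ hN].
exists N => n Nn; have := hN n Nn; rewrite sub0r normrN => h.
have e : P (A n) = (\int[P]_(x in setT) (\1_(A n) x : R))%:E.
  rewrite /Rintegral integral_indic// setIT fineK// fin_num_measure//.
by rewrite e lee_fin; exact: le_trans (ler_norm _) h.
Qed.

Lemma simple_value_joint {R : realType} d (T : measurableType d) (S : @simple_process R d T) :
  (forall k, (k < pieces S)%N -> measurable_fun setT (coef S k)) ->
  measurable_fun setT (fun z : T * R => simple_value S z.2 z.1).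
Proof.
move=> mS; rewrite /simple_value; under eq_fun do rewrite big_mkcond/=.
apply: measurable_sum => k.
rewrite (_ : (fun z => _) = fun z : T * R =>
    coef S k z.1 * (\1_(`]node S k, node S k.+1]%classic) z.2)).
  apply: measurable_funM.
    by apply: measurableT_comp; [exact: mS|exact: measurable_fst].
  by apply: measurableT_comp; [exact: measurable_indic|exact: measurable_snd].
apply/funext => z; rewrite indicE; case: ifPn => h.
  by rewrite mem_set ?mulr1//= in_itv/= h.
by rewrite memNset ?mulr0//= in_itv/=; exact/negP.
Qed.

Lemma measurable_joint_sub {R : realType} d {T : measurableType d} (G : set (set T)) (D : set R)
    (f : T -> R -> R) : sigma_algebra setT G -> G `<=` measurable -> measurable D ->
  measurable_fun (setT `*` D) (fun z : g_sigma_algebraType G * R => f z.1 z.2) ->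
  measurable_fun (setT `*` D) (fun z : T * R => f z.1 z.2).
Proof.
move=> sG GT mD mf.
pose G1 := g_sigma_algebraType G.
have mid : measurable_fun setT (fun z : T * R => (z.1 : G1, z.2)).
  apply: measurable_fun_pair; last exact: measurable_snd.
  have e : (@measurable _ G1) = G by exact: sigma_algebra_id.
  by move=> _ B; rewrite e => GB; apply: measurable_fst => //; exact: GT.
have mD' : measurable ([set: G1] `*` D) by exact: measurableX.
apply: (@measurable_comp _ _ _ _ _ _ ([set: G1] `*` D) (fun z : G1 * R => f z.1 z.2) _
  (fun z : T * R => (z.1 : G1, z.2))) => //.
  by move=> _ [[om r] [_ /= Dr] <-].
exact: measurable_funTS.
Qed.

Section drift_approximation.
Context {R : realType} d {T : measurableType d} (P : probability T R).
Context (F : R -> set (set T)) (hF : usual_conditions P F).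
Local Notation leb := (@lebesgue_measure R).
Local Notation TG g := (g_sigma_algebraType (F g)).
Variables (t0 t : R) (b : R -> T -> R).
Hypotheses (t00 : 0 <= t0) (t0t : t0 < t).
Hypothesis jb : forall g, t0 <= g -> measurable_fun (setT `*` `[t0, g]) (fun z : TG g * R => b z.2 z.1).
Hypothesis ib : {ae P, forall om, itv_integrable t0 t (b ^~ om)}.

Definition clip (K v : R) : R := Num.max (- K) (Num.min v K).

Lemma clip_norm K v : 0 <= K -> `|clip K v| <= K.
Proof.
move=> K0; rewrite ler_norml /clip le_max lexx/= ge_max ge_min lexx orbT andbT.
by rewrite (le_trans _ K0)// oppr_le0.
Qed.

Lemma clip_norm_id K v : 0 <= K -> `|clip K v| <= `|v|.
Proof.
move=> K0; have [vK|Kv] := leP `|v| K; last exact: (le_trans (clip_norm v K0) (ltW Kv)).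
by move: vK; rewrite ler_norml => /andP[h1 h2]; rewrite /clip min_l// max_r.
Qed.

Lemma clip_id K v : `|v| <= K -> clip K v = v.
Proof. by rewrite ler_norml => /andP[h1 h2]; rewrite /clip min_l// max_r. Qed.

Lemma clip_measurable K : measurable_fun setT (clip K).
Proof. by apply: measurable_maxr => //; exact: measurable_minr. Qed.

(** Extended by zero outside of [[t0, t]], so that the average over the cell before [t0] is
    defined. *)
Definition fclip K r om : R := if t0 <= r <= t then clip K (b r om) else 0.

Lemma fclip_norm K r om : 0 <= K -> `|fclip K r om| <= K.
Proof. by move=> K0; rewrite /fclip; case: ifP => _; rewrite ?clip_norm// normr0. Qed.

Lemma fclip_joint K a g : t0 <= g <= t ->
  measurable_fun (setT `*` `[a, g]) (fun z : TG g * R => fclip K z.2 z.1).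
Proof.
move=> /andP[t0g gt]; pose D : set (TG g * R) := setT `*` `[t0, g]%classic.
have mD : measurable D by exact: measurableX.
have m1 : measurable_fun D (fun z : TG g * R => clip K (b z.2 z.1)).
  by apply: measurableT_comp; [exact: clip_measurable|exact: jb].
have m2 := (measurable_restrictT _ mD).1 m1.
apply: eq_measurable_fun (measurable_funTS m2) => -[om r] /set_mem[_ /=].
rewrite in_itv/= => /andP[ar rg]; rewrite patchE /fclip/=.
have [h|h] := leP t0 r.
  by rewrite mem_set ?(le_trans rg gt)//; split => //=; rewrite in_itv/= h.
by rewrite memNset// /D /= in_itv/= leNgt h => -[].
Qed.

Lemma fclip_joint_T K a : measurable_fun (setT `*` `[a, t]) (fun z : T * R => fclip K z.2 z.1).
Proof.
have t0' : 0 <= t by rewrite (le_trans t00)// ltW.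
apply: (@measurable_joint_sub _ _ _ (F t) _ (fun om r => fclip K r om)) => //.
- exact: (filtration_sigma hF t0').
- exact: (filtration_sub hF t0').
- by apply: fclip_joint; rewrite lexx ltW.
Qed.

Lemma b_joint_T : measurable_fun (setT `*` `[t0, t]) (fun z : T * R => b z.2 z.1).
Proof.
have t0' : 0 <= t by rewrite (le_trans t00)// ltW.
apply: (@measurable_joint_sub _ _ _ (F t) _ (fun om r => b r om)) => //.
- exact: (filtration_sigma hF t0').
- exact: (filtration_sub hF t0').
- by apply: jb; rewrite ltW.
Qed.

Lemma fclip_section K om : measurable_fun setT (fun r => fclip K r om).
Proof.
have h := @measurable_section R _ T t0 t (fun om r => clip K (b r om)) om.
have m1 : measurable_fun `[t0, t] (fun r => clip K (b r om)).
  by apply: h; apply: measurableT_comp; [exact: clip_measurable|exact: b_joint_T].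
have m2 := (measurable_restrictT _ (measurable_itv `[t0, t])).1 m1.
apply: eq_measurable_fun m2 => r _; rewrite patchE /fclip.
rewrite (_ : (r \in `[t0, t]%classic) = (t0 <= r <= t)); first by case: ifP.
by apply/idP/idP => [/set_mem|h']; [|apply/mem_set]; rewrite /= in_itv.
Qed.

Section grid.
Variables (K : R) (N : nat).
Hypothesis K0 : 0 <= K.
Let h := (t - t0) / N.+1%:R.
Let h0 : 0 < h. Proof. by rewrite divr_gt0// subr_gt0. Qed.

(* The average over the cell preceding a node is known at that node, so that
   the resulting simple process is adapted. *)
Definition cell (k : int) : set R := `[t0 + (k - 1)%:~R * h, t0 + k%:~R * h]%classic.
Definition avg k om : R := h^-1 * \int[leb]_(r in cell k) fclip K r om.
Definition avg_process : @simple_process R d T :=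
  SimpleProcess N.+1 (fun k => t0 + k%:R * h) (fun k om => avg (k%:Z) om).

Let tE : t = t0 + N.+1%:R * h.
Proof. by rewrite /h mulrCA divff ?mulr1 ?pnatr_eq0// addrC subrK. Qed.

Lemma cell_length k : (t0 + k%:~R * h) - (t0 + (k - 1)%:~R * h) = h.
Proof. by rewrite intrB/=; ring. Qed.

Lemma avg_norm k om : `|avg k om| <= K.
Proof.
have le : t0 + (k - 1)%:~R * h <= t0 + k%:~R * h.
  by rewrite -subr_ge0 cell_length ltW.
have ii : itv_integrable (t0 + (k - 1)%:~R * h) (t0 + k%:~R * h) (fun r => fclip K r om).
  apply: (@le_integrable_EFin _ _ _ leb _ (measurable_itv _) _ (fun=> K)) => //.
  - by apply: measurable_funTS; exact: fclip_section.
  - exact: itv_integrable_cst.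
  - by move=> r _; exact: fclip_norm.
have ii' : itv_integrable (t0 + (k - 1)%:~R * h) (t0 + k%:~R * h) (fun r => `|fclip K r om|).
  exact: (integrable_abse ii).
rewrite /avg normrM ger0_norm ?invr_ge0 ?(ltW h0)// ler_pdivrMl// mulrC.
apply: le_trans (le_normr_Rintegral _ ii) _ => //.
rewrite -[X in _ <= K * X](cell_length k) -itv_integral_cst//.
by apply: itv_le_integral => //; [exact: itv_integrable_cst|move=> r _; exact: fclip_norm].
Qed.

Lemma avg_process_adapted : adapted_simple F t0 t avg_process.
Proof.
split => /=; [by rewrite mul0r addr0|by rewrite tE|move=> k kN; split].
- by rewrite lerD2l ler_pM2r// ler_nat.
- have nk : t0 <= t0 + k%:R * h <= t.
    rewrite lerDl mulr_ge0 ?(ltW h0)//= [X in _ <= X]tE lerD2l ler_pM2r// ler_nat; exact: ltnW.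
  have nk0 : 0 <= t0 + k%:R * h by case/andP: nk => /(le_trans t00).
  apply/(rv_measurableE (filtration_sigma hF nk0)).
  apply: measurable_funM => //.
  apply: (@measurable_Rintegral_param R _ (TG _) _ _ (fun om r => fclip K r om)).
  exact: fclip_joint.
- by exists K => om; exact: avg_norm.
Qed.

(** Index of the left node of the half-open cell containing [r]. The value taken there is the
    average over [cell (idx r)], the cell that ends at this node and so lies to the left of [r]. *)
Definition idx (r : R) : int := Num.ceil ((r - t0) / h) - 1.

Lemma avg_process_value r om : t0 < r <= t ->
  simple_value avg_process r om = avg (idx r) om.
Proof.
move=> /andP[t0r rt].
have c1 : 0 < Num.ceil ((r - t0) / h).
  by rewrite ceil_gt_int /= divr_gt0// subr_gt0.
have c2 : Num.ceil ((r - t0) / h) <= N.+1%:Z.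
  by rewrite ceil_le_int ler_pdivrMr// lerBlDl -tE.
have [k ck] : exists k : nat, Num.ceil ((r - t0) / h) = k.+1%:Z.
  by move: c1; case: (Num.ceil _) => [[//|k] _|//]; exists k.
have kN : (k < N.+1)%N by move: c2; rewrite ck lez_nat.
rewrite /simple_value (eq_bigl (fun i : 'I_N.+1 => i == Ordinal kN)); last first.
  move=> i /=; rewrite -ltrBrDl -lerBlDl -ltr_pdivlMr// -ler_pdivrMr//.
  apply/idP/eqP => [hi|->/=].
    apply: val_inj => /=; have : Num.ceil ((r - t0) / h) = i.+1%:Z.
      by apply: ceil_def; rewrite -addn1 PoszD addrK -!pmulrn addn1.
    by rewrite ck => -[].
  have := ceil_itv ((r - t0) / h); rewrite ck -addn1 PoszD addrK -PoszD addn1.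
  by rewrite -!pmulrn.
by rewrite big_pred1_eq /= /idx ck -addn1 PoszD addrK.
Qed.

Lemma cell_measure k : leb (cell k) = h%:E.
Proof.
rewrite lebesgue_measure_itv/= lte_fin ifT; first by rewrite -EFinD cell_length.
by rewrite -subr_gt0 cell_length.
Qed.

Lemma idx_itv r : t0 + (idx r)%:~R * h < r <= t0 + (idx r)%:~R * h + h.
Proof.
have := ceil_itv ((r - t0) / h); rewrite /idx intrB ltr_pdivlMr// ler_pdivrMr//.
move: (Num.ceil _)%:~R => c; rewrite mulrBl mul1r => /andP[h1 h2]; apply/andP; split; lra.
Qed.

Lemma cell_ball r y : cell (idx r) y -> `|r - y| < 3 * h.
Proof.
rewrite /cell/= in_itv/=; have := idx_itv r.
rewrite (intrB _ (idx r) 1) mulrBl (_ : (1 : int)%:~R = 1 :> R)// mul1r.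
move: ((idx r)%:~R : R) => c /andP[h1 h2] /andP[h3 h4].
by have hp := h0; clearbody h; rewrite ltr_norml; apply/andP; split; lra.
Qed.

End grid.

Lemma fclip_integrable K om : 0 <= K -> leb.-integrable setT (EFin \o (fun r => fclip K r om)).
Proof.
move=> K0.
have ii : itv_integrable t0 t (fun r => fclip K r om).
  apply: (@le_integrable_EFin _ _ _ leb _ (measurable_itv _) _ (fun=> K)) => //.
  - by apply: measurable_funTS; exact: fclip_section.
  - exact: itv_integrable_cst.
  - by move=> r _; exact: fclip_norm.
have mI : measurable (`[t0, t]%classic : set (measurableTypeR R)) by exact: measurable_itv.
move/(integrable_mkcond _ mI) : ii.
congr (_.-integrable _ _); apply/funext => r; rewrite patchE.
case: ifPn => // /negP h; rewrite /= /fclip; case: ifP => // h'.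
by exfalso; apply: h; apply/mem_set; rewrite /= in_itv/=.
Qed.

Let leb_ae_neq (c : R) : {ae leb, forall r, r != c}.
Proof.
exists [set c]; split; [exact: measurable_set1|exact: lebesgue_measure_set1|].
by move=> r /negP; rewrite negbK => /eqP.
Qed.

(** Lebesgue differentiation along nicely shrinking sets, which need not contain the point: the
    averaged cell lies in the ball of radius [3 * h] around [r]. *)
Lemma avg_cvg K om : 0 <= K ->
  {ae leb, forall r, avg K N (idx N r) om @[N --> \oo] --> fclip K r om}.
Proof.
move=> K0.
have hN0 N : 0 < (t - t0) / N.+1%:R by rewrite divr_gt0// subr_gt0.
have hN3 N : 0 < 3 * ((t - t0) / N.+1%:R) by rewrite mulr_gt0.
have shrink r : nicely_shrinking r (fun N => cell N (idx N r)).
  split; first by move=> N; exact: measurable_itv.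
  (* 6 is the ratio of the length of a ball of radius [3 * h] to that of a cell. *)
  exists (6, fun N => PosNum (hN3 N)); split; first by rewrite /= ltr0n.
  - apply/cvgrPdist_lt => e e0.
    have e' : 0 < e / (3 * (t - t0)) by rewrite divr_gt0// mulr_gt0// subr_gt0.
    apply: filterS (near_infty_natSinv_lt (PosNum e')) => N /=.
    rewrite ltr_pdivlMr ?mulr_gt0 ?subr_gt0// => h.
    rewrite sub0r normrN gtr0_norm// (le_lt_trans _ h)//.
    by rewrite mulrC -mulrA [(t - t0) * _]mulrC mulrA -mulrA.
  - by move=> N y /= hy; rewrite /ball/=; exact: cell_ball hy.
  - move=> N; rewrite cell_measure// lebesgue_measure_ball; last exact: ltW.
    rewrite -EFinM lee_fin/= ; move: ((t - t0) / N.+1%:R) => c; rewrite le_eqVlt; apply/orP; left; apply/eqP; ring.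
have li : locally_integrable setT (fun r => fclip K r om).
  by apply: open_integrable_locally; [exact: openT|exact: fclip_integrable].
apply: (@filterS _ _ (ae_filter_ringOfSetsType leb) _ _ _ (lebesgue_differentiation li)) => r hr.
have := nice_lebesgue_differentiation shrink li hr.
move=> /fine_cvg; apply: cvg_trans; apply: near_eq_cvg; near=> N => /=.
rewrite cell_measure// /avg.
have ii : leb.-integrable (cell N (idx N r)) (EFin \o (fun r => fclip K r om)).
  by apply: integrableS (fclip_integrable om K0) => //; exact: measurable_itv.
rewrite inver gt_eqF// fineM//=.
by apply: integrable_fin_num => //; exact: measurable_itv.
Unshelve. all: by end_near. Qed.

Definition l1dist (f g : R -> R) : R := \int[leb]_(r in `[t0, t]) `|f r - g r|.

Lemma avg_process_cvg K om : 0 <= K ->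
  l1dist ((simple_value (avg_process K N))^~ om) (fun r => fclip K r om) @[N --> \oo] --> 0.
Proof.
move=> K0.
have [|||||_] := @Rintegral_dominated _ _ R leb `[t0, t]%classic (measurable_itv _)
   (fun N r => `|simple_value (avg_process K N) r om - fclip K r om|) (fun=> 0) (fun=> K + K).
- move=> N; apply: measurable_funTS; apply: measurableT_comp => //.
  by apply: measurable_funB; [exact: simple_value_measurable_time|exact: fclip_section].
- by [].
- apply: (@filterS2 _ _ (ae_filter_ringOfSetsType leb) _ _ _ _ (avg_cvg om K0) (leb_ae_neq t0)) => r hr rt0.
  rewrite /= in_itv/= le_eqVlt eq_sym (negbTE rt0)/= => rt.
  under eq_fun do rewrite avg_process_value//.
  rewrite -(@normr0 _ R) -(subrr (fclip K r om)); apply: cvg_norm.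
  by apply: cvgB => //; exact: cvg_cst.
- exact: itv_integrable_cst.
- move=> N r _; rewrite normr_id (le_trans (ler_normB _ _))// lerD ?fclip_norm//.
  rewrite /simple_value/=; have [rt|rt] := boolP (t0 < r <= t).
    by have := avg_process_value K N om rt; rewrite /simple_value/= => ->; exact: avg_norm.
  rewrite big_pred0 ?normr0// => i; apply/negbTE; apply: contra rt.
  have a := avg_process_adapted N K0.
  have [/andP[n1 _] /andP[_ n2]] := (node_itv a (ltnW (ltn_ord i)), node_itv a (ltn_ord i)).
  by move=> /andP[h1 h2]; rewrite (le_lt_trans n1 h1)/= (le_trans h2 n2).
by rewrite Rintegral_cst// mul0r.
Qed.

Lemma clip_cvg om : itv_integrable t0 t (b ^~ om) ->
  l1dist (fun r => fclip k%:R r om) (b ^~ om) @[k --> \oo] --> 0.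
Proof.
move=> io.
have mb : measurable_fun `[t0, t] (b ^~ om) by apply/measurable_EFinP; exact: measurable_int io.
have [|||||_] := @Rintegral_dominated _ _ R leb `[t0, t]%classic (measurable_itv _)
   (fun k r => `|fclip k%:R r om - b r om|) (fun=> 0) (fun r => 2 * `|b r om|).
- move=> k; apply: measurableT_comp => //; apply: measurable_funB => //.
  by apply: measurable_funTS; exact: fclip_section.
- by [].
- apply/aeW => r; rewrite /= in_itv/= => rt; apply: cvg_near_cst.
  near=> k; rewrite /fclip rt clip_id ?subrr ?normr0//.
  near: k; exact: nbhs_infty_ger.
- rewrite (_ : EFin \o _ = fun r => (2%:E * (`|b r om|)%:E)%E)//.
  by apply: integrableZl => //; exact: (integrable_abse io).
- move=> k r; rewrite /= in_itv/= => rt; rewrite normr_id (le_trans (ler_normB _ _))// mulr_natl mulr2n lerD2r.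
  by rewrite /fclip rt clip_norm_id.
by rewrite Rintegral_cst// mul0r.
Unshelve. all: by end_near. Qed.

(** Truncation at a level [k], then averaging on a grid; both converge pathwise in mean by
    domination, hence in probability. Only the drift needs this construction: approximations of the
    diffusion are part of the definition of the Ito integral. *)
Lemma drift_approximation (eps eta : R) : 0 < eps -> 0 < eta ->
  exists2 S, adapted_simple F t0 t S &
    measurable [set om | eps <= l1dist ((simple_value S)^~ om) (b ^~ om)] /\
    (P [set om | (eps <= l1dist ((simple_value S)^~ om) (b ^~ om))%R] <= eta%:E)%E.
Proof.
move=> eps0 eta0.
have e2 : 0 < eps / 2 by rewrite divr_gt0.
have n2 : 0 < eta / 2 by rewrite divr_gt0.
have mdist K (f : T -> R -> R) : measurable_fun (setT `*` `[t0, t]) (fun z : T * R => f z.1 z.2) ->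
    measurable_fun (setT `*` `[t0, t]) (fun z : T * R => K z.1 z.2) ->
    measurable_fun setT (fun om => l1dist (K om) (f om)).
  move=> mf mK; apply: (@measurable_Rintegral_param R _ T _ _ (fun om r => `|K om r - f om r|)).
  by apply: measurableT_comp => //; exact: measurable_funB.
have mb := b_joint_T.
have [k hk] : exists k, (P [set om | (eps / 2 <= l1dist (fun r => fclip k%:R r om) (b ^~ om))%R] <= (eta / 2)%:E)%E.
  have h := @ae_cvg_probP _ _ _ P (fun k om => l1dist (fun r => fclip k%:R r om) (b ^~ om)) _ _ _ _ e2 n2.
  have [||k hk] := h.
  - move=> k; apply: (@mdist (fun om r => fclip k%:R r om) (fun om r => b r om)) => //.
    exact: fclip_joint_T.
  - by apply: filterS ib => om; exact: clip_cvg.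
  - by exists k; exact: hk.
have k0 : 0 <= k%:R :> R by exact: ler0n.
have mS N : measurable_fun (setT `*` `[t0, t]) (fun z : T * R => simple_value (avg_process k%:R N) z.2 z.1).
  apply: measurable_funTS; apply: simple_value_joint => j jN.
  have a := avg_process_adapted N k0.
  have /andP[n1 _] := node_itv a (ltnW jN).
  have [_ _ /(_ j jN)[_ r _]] := a.
  exact: (filtration_rv_measurable hF (le_trans t00 n1) r).
have [N hN] : exists N, (P [set om | (eps / 2 <= l1dist ((simple_value (avg_process k%:R N))^~ om)
    (fun r => fclip k%:R r om))%R] <= (eta / 2)%:E)%E.
  have h := @ae_cvg_probP _ _ _ P (fun N om => l1dist ((simple_value (avg_process k%:R N))^~ om)
    (fun r => fclip k%:R r om)) _ _ _ _ e2 n2.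
  have [||N hN] := h.
  - move=> N; apply: (@mdist (fun om r => simple_value (avg_process k%:R N) r om) (fun om r => fclip k%:R r om)) => //.
    exact: fclip_joint_T.
  - by apply: aeW => om; exact: avg_process_cvg.
  - by exists N; exact: hN.
set S := avg_process k%:R N.
have mSb : measurable_fun setT (fun om => l1dist ((simple_value S)^~ om) (b ^~ om)).
  exact: (mdist (fun om r => simple_value S r om) (fun om r => b r om) mb (mS N)).
have mA : measurable [set om | eps <= l1dist ((simple_value S)^~ om) (b ^~ om)].
  exact: measurable_set_ler.
exists S; [exact: avg_process_adapted|split => //].
have [Z [mZ PZ hZ]] := ib.
set B := [set om | eps / 2 <= l1dist (fun r => fclip k%:R r om) (b ^~ om)] in hk.
set C := [set om | _] in hN.
have mB : measurable B.
  apply: measurable_set_ler => //; apply: (@mdist (fun om r => fclip k%:R r om) (fun om r => b r om)) => //.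
  exact: fclip_joint_T.
have mC : measurable C.
  apply: measurable_set_ler => //.
  apply: (mdist (fun om r => simple_value S r om) (fun om r => fclip k%:R r om) _ (mS N)).
  exact: fclip_joint_T.
have sub : [set om | eps <= l1dist ((simple_value S)^~ om) (b ^~ om)] `<=` (B `|` C) `|` Z.
  move=> om /= h; case: (pselect (Z om)) => [|nZ]; [by right|left].
  have io : itv_integrable t0 t (b ^~ om) by apply: contrapT => ni; apply: nZ; exact: hZ.
  apply: contrapT => /not_orP[]; rewrite /B /C /= => /negP; rewrite -ltNge => h1 /negP; rewrite -ltNge => h2.
  have iS : itv_integrable t0 t ((simple_value S)^~ om).
    have [c hc] := simple_bounded (avg_process_adapted N k0).
    apply: (@le_integrable_EFin _ _ _ leb _ (measurable_itv _) _ (fun=> c)) => //.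
    - by apply: measurable_funTS; exact: simple_value_measurable_time.
    - exact: itv_integrable_cst.
  have ic : itv_integrable t0 t (fun r => fclip k%:R r om).
    by apply: integrableS (fclip_integrable om k0) => //; exact: measurable_itv.
  have tri (f g : R -> R) : itv_integrable t0 t f -> itv_integrable t0 t g ->
      itv_integrable t0 t (fun r => `|f r - g r|).
    move=> i1 i2; have i3 : leb.-integrable `[t0, t] ((EFin \o f) \- (EFin \o g))%E by exact: integrableB.
    exact: (integrable_abse i3).
  have : l1dist ((simple_value S)^~ om) (b ^~ om) <=
    l1dist ((simple_value S)^~ om) (fun r => fclip k%:R r om) + l1dist (fun r => fclip k%:R r om) (b ^~ om).
    rewrite /l1dist -RintegralD//; [|exact: tri|exact: tri].
    apply: itv_le_integral; [exact: tri| |by move=> r _; exact: ler_distD].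
    by apply: (@integrableD _ _ _ leb _ _ (EFin \o _) (EFin \o _)) => //; exact: tri.
  by move: h1 h2 h; rewrite /S; lra.
apply: (@le_trans _ _ (P ((B `|` C) `|` Z))).
  by apply: le_measure => //; apply/mem_set => //; do ! apply: measurableU.
apply: (le_trans (measureU2 _ _ _)) => //; first exact: measurableU.
apply: (@le_trans _ _ (P (B `|` C) + 0)%E).
  by apply: leeD => //; have /eqP := PZ; rewrite eq_le => /andP[].
rewrite adde0; apply: (le_trans (measureU2 _ _ _)) => //.
by rewrite [X in (_ <= X)%E](_ : _ = (eta / 2)%:E + (eta / 2)%:E)%E ?leeD// -EFinD; congr EFin; field.
Qed.

End drift_approximation.

(** * The Euler scheme *)

Section mean.
Context {R : realType} d {T : measurableType d} (P : probability T R).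
Implicit Types X Y : T -> R.

(** Existence and value together: the integral is total, so an equation alone would carry no
    integrability. *)
Definition mean X e := P.-integrable setT (EFin \o X) /\ \int[P]_om X om = e.

Lemma meanD X Y e f : mean X e -> mean Y f -> mean (fun om => X om + Y om) (e + f).
Proof.
move=> [iX <-] [iY <-]; split; first exact: (integrableD measurableT iX iY).
by rewrite RintegralD.
Qed.

Lemma meanZ k X e : mean X e -> mean (fun om => k * X om) (k * e).
Proof.
move=> [iX <-]; split; first exact: (integrableZl measurableT k iX).
by rewrite RintegralZl.
Qed.

Lemma mean_cst k : mean (fun=> k) k.
Proof. by split; [exact: finite_measure_integrable_cst|exact: Rintegral_prob_cst]. Qed.

Lemma mean_sum (I : Type) (r : seq I) (Q : pred I) (X : I -> T -> R) (e : I -> R) :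
  (forall i, mean (X i) (e i)) ->
  mean (fun om => \sum_(i <- r | Q i) X i om) (\sum_(i <- r | Q i) e i).
Proof.
move=> h; elim: r => [|i r ih].
  by rewrite big_nil; under [X in mean X _]eq_fun do rewrite big_nil; exact: mean_cst.
rewrite big_cons; under [X in mean X _]eq_fun do rewrite big_cons.
by case: (Q i) => //; exact: meanD.
Qed.

Lemma mean_ext X Y e f : mean X e -> (forall om, X om = Y om) -> e = f -> mean Y f.
Proof. by move=> h /funext <- <-. Qed.

Lemma mean_le X Y e f : mean X e -> mean Y f -> (forall om, X om <= Y om) -> e <= f.
Proof. by move=> [iX <-] [iY <-] h; exact: le_Rintegral. Qed.

Lemma mean_bounded X K : measurable_fun setT X -> (forall om, `|X om| <= K) ->
  mean X (\int[P]_om X om).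
Proof.
move=> mX h; split => //; apply: (le_integrable_EFin measurableT mX (g := fun=> K)) => //.
exact: finite_measure_integrable_cst.
Qed.

Lemma mean_bound_le X K : measurable_fun setT X -> (forall om, `|X om| <= K) ->
  \int[P]_om X om <= K.
Proof.
move=> mX h; apply: (mean_le (mean_bounded mX h) (mean_cst K)) => om.
exact: le_trans (ler_norm _) (h om).
Qed.

End mean.

Lemma sqr_sum_le {R : realType} (I : finType) (a : I -> R) :
  (\sum_i a i) ^+ 2 <= #|I|%:R * \sum_i a i ^+ 2.
Proof.
have h : 0 <= \sum_i \sum_j (a i - a j) ^+ 2 by apply: sumr_ge0 => i _; apply: sumr_ge0 => j _; exact: sqr_ge0.
have e : \sum_i \sum_j (a i - a j) ^+ 2 = 2 * (#|I|%:R * \sum_i a i ^+ 2) - 2 * (\sum_i a i) ^+ 2.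
  transitivity (\sum_i \sum_j (a i ^+ 2 + a j ^+ 2 - 2 * (a i * a j))).
    by apply: eq_bigr => i _; apply: eq_bigr => j _; ring.
  transitivity (\sum_i (#|I|%:R * a i ^+ 2 + \sum_j a j ^+ 2 - 2 * (a i * \sum_j a j))).
    apply: eq_bigr => i _; rewrite sumrB big_split/= sumr_const mulr_natl.
    by rewrite mulr_sumr mulr_sumr.
  rewrite sumrB big_split/= -mulr_sumr sumr_const -mulr_natl -mulr_sumr -mulr_suml expr2; ring.
move: h; rewrite e; lra.
Qed.

Lemma pow4_sum_le {R : realType} (I : finType) (a : I -> R) :
  (\sum_i a i) ^+ 4 <= #|I|%:R ^+ 3 * \sum_i a i ^+ 4.
Proof.
have h1 := sqr_sum_le a; have h2 := sqr_sum_le (fun i => a i ^+ 2).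
have e : (\sum_i a i) ^+ 4 = ((\sum_i a i) ^+ 2) ^+ 2 by rewrite -exprM.
rewrite e; apply: (@le_trans _ _ ((#|I|%:R * \sum_i a i ^+ 2) ^+ 2)).
  by apply: lerXn2r => //; rewrite nnegrE ?sqr_ge0// mulr_ge0// sumr_ge0// => i _; exact: sqr_ge0.
rewrite exprMn (exprSr _ 2) -mulrA ler_wpM2l ?sqr_ge0//; apply: (le_trans h2).
by under eq_bigr do rewrite -exprM.
Qed.

Section euler_step.
Context {R : realType} d {T : measurableType d} (P : probability T R).
Context (F : R -> set (set T)) (hF : usual_conditions P F).
Context (n m : nat) (w : R -> T -> 'cV[R]_m) (hw : brownian P F w).
Variables (s s' K : R) (B : 'I_n -> T -> R) (C : 'I_n -> 'I_m -> T -> R).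
Hypotheses (s0 : 0 <= s) (ss : s <= s').
Hypotheses (mB : forall i, rv_measurable (F s) (B i)) (mC : forall i j, rv_measurable (F s) (C i j)).
Hypotheses (bB : forall i om, `|B i om| <= K) (bC : forall i j om, `|C i j om| <= K).
Local Notation De := (s' - s).
Local Notation dw j := (incr w s s' j).

Definition euler_incr om : 'cV[R]_n := \col_i (B i om * De + \sum_j C i j om * dw j om).

Let sF : sigma_algebra setT (F s). Proof. exact: (filtration_sigma hF). Qed.
Let mF (X : T -> R) : rv_measurable (F s) X -> measurable_fun setT X.
Proof. exact: (filtration_rv_measurable hF). Qed.

Section weight.
Variables (a : T -> R) (Ka : R).
Hypotheses (ma : rv_measurable (F s) a) (ba : forall om, `|a om| <= Ka).

Let bM (X Y : T -> R) KX KY : (forall om, `|X om| <= KX) -> (forall om, `|Y om| <= KY) ->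
  forall om, `|X om * Y om| <= KX * KY.
Proof. by move=> hX hY om; rewrite normrM ler_pM. Qed.

Lemma mean_euler1 i :
  mean P (fun om => a om * euler_incr om i 0) (De * \int[P]_om (a om * B i om)).
Proof.
have m1 : mean P (fun om => a om * B i om) (\int[P]_om (a om * B i om)).
  by apply: (mean_bounded P (mF (rv_measurableM sF ma (mB i)))); exact: bM.
have m2 j : mean P (fun om => a om * C i j om * dw j om) 0.
  have h := mean_bounded P (mF (rv_measurableM sF ma (mC i j))) (bM ba (bC i j)).
  exact: (incr_moment1 hF hw j s0 ss (rv_measurableM sF ma (mC i j)) h.1).
apply: (mean_ext (meanD (meanZ De m1) (mean_sum (index_enum _) xpredT m2))).
  move=> om; rewrite mxE mulrDr mulr_sumr; congr (_ + _); first by ring.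
  by apply: eq_bigr => j _; rewrite mulrA.
by rewrite big1// addr0.
Qed.

(** Drift times drift gives the term in [De ^+ 2]; mixed terms have mean zero; among the products of
    increments only equal indices survive and contribute [De]. *)
Lemma mean_euler2 i l : mean P (fun om => a om * (euler_incr om i 0 * euler_incr om l 0))
  (De ^+ 2 * \int[P]_om (a om * (B i om * B l om)) +
   De * \int[P]_om (a om * \sum_j C i j om * C l j om)).
Proof.
have mBB : rv_measurable (F s) (fun om => a om * (B i om * B l om)).
  by do ! apply: (rv_measurableM sF).
have m1 : mean P (fun om => a om * (B i om * B l om)) (\int[P]_om (a om * (B i om * B l om))).
  by apply: (mean_bounded P (mF mBB)); apply: bM => //; exact: bM.
have mx (X Y : T -> R) j : rv_measurable (F s) X -> rv_measurable (F s) Y ->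
    (forall om, `|X om| <= K) -> (forall om, `|Y om| <= K) ->
    mean P (fun om => a om * (X om * Y om) * dw j om) 0.
  move=> mX mY bX bY.
  have mXY : rv_measurable (F s) (fun om => a om * (X om * Y om)) by do ! apply: (rv_measurableM sF).
  have h := mean_bounded P (mF mXY) (bM ba (bM bX bY)).
  exact: (incr_moment1 hF hw j s0 ss mXY h.1).
have mxx j j' : mean P (fun om => a om * (C i j om * C l j' om) * dw j om * dw j' om)
   ((j == j')%:R * De * \int[P]_om (a om * (C i j om * C l j' om))).
  have mXY : rv_measurable (F s) (fun om => a om * (C i j om * C l j' om)) by do ! apply: (rv_measurableM sF).
  have h := mean_bounded P (mF mXY) (bM ba (bM (bC i j) (bC l j'))).
  exact: (incr_moment2 hF hw j j' s0 ss mXY h.1).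
have mccE : \int[P]_om (a om * \sum_j C i j om * C l j om) = \sum_j \int[P]_om (a om * (C i j om * C l j om)).
  have : mean P (fun om => \sum_j a om * (C i j om * C l j om)) (\sum_j \int[P]_om (a om * (C i j om * C l j om))).
    apply: mean_sum => j.
    have mXY : rv_measurable (F s) (fun om => a om * (C i j om * C l j om)) by do ! apply: (rv_measurableM sF).
    exact: (mean_bounded P (mF mXY) (bM ba (bM (bC i j) (bC l j)))).
  by under [X in mean _ X _]eq_fun do rewrite -mulr_sumr; case.
apply: (mean_ext (meanD (meanD (meanZ (De ^+ 2) m1)
  (meanZ De (meanD (mean_sum (index_enum _) xpredT (fun j => mx _ _ j (mB i) (mC l j) (bB i) (bC l j)))
                   (mean_sum (index_enum _) xpredT (fun j => mx _ _ j (mC i j) (mB l) (bC i j) (bB l))))))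
  (mean_sum (index_enum _) xpredT (fun j => mean_sum (index_enum _) xpredT (fun j' => mxx j j'))))).
  move=> om; rewrite !mxE.
  set b := B i om; set b' := B l om; set S := \sum_j C i j om * _; set S' := \sum_j C l j om * _.
  have -> : \sum_j a om * (b * C l j om) * dw j om = a om * b * S'.
    by rewrite mulr_sumr; apply: eq_bigr => j _; ring.
  have -> : \sum_j a om * (C i j om * b') * dw j om = a om * b' * S.
    by rewrite mulr_sumr; apply: eq_bigr => j _; ring.
  have -> : \sum_j \sum_j' a om * (C i j om * C l j' om) * dw j om * dw j' om = a om * (S * S').
    rewrite /S mulr_suml mulr_sumr; apply: eq_bigr => j _; rewrite !mulr_sumr.
    by apply: eq_bigr => j' _; ring.
  by ring.
rewrite !big1_eq addr0 mulr0 addr0 mccE; congr (_ + _); rewrite mulr_sumr; apply: eq_bigr => j _.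
rewrite (bigD1 j)//= eqxx mul1r big1 ?addr0// => j' jj'.
by rewrite eq_sym (negbTE jj') !mul0r.
Qed.

End weight.

Lemma mean_euler4 : 0 <= De <= 1 -> exists2 e : R,
  mean P (fun om => K ^+ 4 * (n%:R ^+ 4 * 8 * (De ^+ 4 + m%:R ^+ 3 * \sum_j dw j om ^+ 4))) e &
  e <= K ^+ 4 * (n%:R ^+ 4 * 8 * (1 + m%:R ^+ 4 * gauss4)) * De ^+ 2.
Proof.
move=> /andP[D0 D1].
have m4 j : mean P (fun om => dw j om ^+ 4) (\int[P]_om (dw j om ^+ 4)).
  by have [h1 h2] := incr_moment4 hF hw j s0 ss; split.
eexists.
  exact: (meanZ _ (meanZ _ (meanD (mean_cst P _) (meanZ _ (mean_sum (index_enum _) xpredT m4))))).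
rewrite -[leRHS]mulrA ler_wpM2l ?exprn_even_ge0//.
rewrite -[leRHS]mulrA ler_wpM2l ?mulr_ge0 ?exprn_ge0//.
rewrite mulrDl mul1r lerD//.
  by rewrite ler_wiXn2l.
have g4 j : \int[P]_om (dw j om ^+ 4) <= gauss4 * De ^+ 2.
  by have [_ h] := incr_moment4 hF hw j s0 ss.
move: gauss4 g4 => g g4.
rewrite (_ : m%:R ^+ 4 * g * De ^+ 2 = m%:R ^+ 3 * (m%:R * (g * De ^+ 2))); last by ring.
rewrite ler_wpM2l ?exprn_ge0//.
apply: (@le_trans _ _ (\sum_(j < m) g * De ^+ 2)); first by apply: ler_sum => j _; exact: g4.
by rewrite sumr_const card_ord mulr_natl.
Qed.

(** [n ^+ 4] comes from summing over coordinates, 8 from the fourth power of a sum of two terms,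
    [m ^+ 3] from that of a sum of [m] terms. *)
Lemma euler_pow4 om : 0 <= K ->
  (\sum_i `|euler_incr om i 0|) ^+ 4 <=
  K ^+ 4 * (n%:R ^+ 4 * 8 * (De ^+ 4 + m%:R ^+ 3 * \sum_j dw j om ^+ 4)).
Proof.
move=> K0; have D0 : 0 <= De by rewrite subr_ge0.
pose W := \sum_j `|dw j om|.
have W0 : 0 <= W by rewrite sumr_ge0.
have h1 : \sum_i `|euler_incr om i 0| <= n%:R * (K * (De + W)).
  rewrite -[n in n%:R]card_ord mulr_natl -sumr_const; apply: ler_sum => i _.
  rewrite mxE (le_trans (ler_normD _ _))// [leRHS]mulrDr; apply: lerD.
    by rewrite normrM (ger0_norm D0) ler_wpM2r.
  rewrite (le_trans (ler_norm_sum _ _ _))// /W mulr_sumr; apply: ler_sum => j _.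
  by rewrite normrM ler_wpM2r.
apply: (@le_trans _ _ ((n%:R * (K * (De + W))) ^+ 4)).
  by apply: lerXn2r; rewrite ?nnegrE ?sumr_ge0// mulr_ge0// mulr_ge0// addr_ge0.
rewrite !exprMn mulrCA ler_wpM2l ?exprn_ge0// -mulrA ler_wpM2l ?exprn_ge0//.
have h2 : (De + W) ^+ 4 <= 8 * (De ^+ 4 + W ^+ 4).
  have q : (De + W) ^+ 2 <= 2 * (De ^+ 2 + W ^+ 2).
    by have := sqr_ge0 (De - W); rewrite -subr_ge0 => h; rewrite -subr_ge0 (_ : _ - _ = (De - W) ^+ 2 - 0)//; ring.
  have q2 : (De ^+ 2 + W ^+ 2) ^+ 2 <= 2 * (De ^+ 4 + W ^+ 4).
    have := sqr_ge0 (De ^+ 2 - W ^+ 2); rewrite -subr_ge0 => h.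
    by rewrite -subr_ge0 (_ : _ - _ = (De ^+ 2 - W ^+ 2) ^+ 2 - 0)//; ring.
  rewrite (_ : (De + W) ^+ 4 = ((De + W) ^+ 2) ^+ 2); last by rewrite -exprM.
  apply: (@le_trans _ _ ((2 * (De ^+ 2 + W ^+ 2)) ^+ 2)).
    by apply: lerXn2r => //; rewrite nnegrE ?sqr_ge0// mulr_ge0// addr_ge0// sqr_ge0.
  rewrite exprMn; have -> : 8 * (De ^+ 4 + W ^+ 4) = 2 ^+ 2 * (2 * (De ^+ 4 + W ^+ 4)) :> R by ring.
  by rewrite ler_pM2l.
apply: (le_trans h2); rewrite ler_pM2l// lerD2l /W.
have := pow4_sum_le (fun j => `|dw j om|); rewrite card_ord; move/le_trans; apply.
rewrite ler_wpM2l ?exprn_ge0//; apply: ler_sum => j _.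
by rewrite -normrX ger0_norm// exprn_even_ge0.
Qed.

End euler_step.

Lemma ler_sum_ord {R : realType} n (a : 'I_n -> R) (c : R) :
  (forall i, a i <= c) -> \sum_i a i <= n%:R * c.
Proof.
move=> h; rewrite -[n in n%:R]card_ord mulr_natl -sumr_const.
by apply: ler_sum => i _; exact: h.
Qed.

Lemma gauss4_ge0 {R : realType} : 0 <= gauss4 :> R.
Proof. exact: (mulr_ge0 (ler0n R 512) (expR_ge0 _)). Qed.

Lemma hcap_d_measurable {R : realType} (N : R) : measurable_fun setT (hcap_d N).
Proof.
apply: measurable_maxr => //; apply: measurable_funB => //.
exact: measurable_funM.
Qed.

Lemma hcap_measurable {R : realType} (N : R) : measurable_fun setT (hcap N).
Proof.
apply: measurable_funM => //; apply: measurable_funB => //.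
by apply: measurable_funX; exact: hcap_d_measurable.
Qed.

Lemma hcap_d_anti {R : realType} (N v v' : R) : 0 < N -> v <= v' -> hcap_d N v' <= hcap_d N v.
Proof.
move=> N0 vv; rewrite /hcap_d; have h : 1 - v' / N <= 1 - v / N.
  by rewrite lerD2l lerN2 ler_pM2r ?invr_gt0.
by rewrite ge_max le_max lexx/= le_max h orbT.
Qed.

Lemma Jtau_slice_continuous {R : realType} n (tau : R) (g : R -> 'cV[R]_n -> R) r :
  Jtau_continuous tau g -> - tau <= r -> continuous (g r).
Proof.
move=> /subspace_continuousP cg tr x.
apply: (@cvg_comp _ _ _ (fun y => (r, y)) (fun z : R * 'cV[R]_n => g z.1 z.2)) (cg (r, x) tr) => B nB.
have /nbhs_ballP[rho /= rho0 hr] : nbhs (r, x) [set z | - tau <= z.1 -> B z] := nB.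
suff h : nbhs x (fun y => B (r, y)) by exact: h.
apply/nbhs_ballP; exists rho => //= y xy.
by apply: (hr (r, y)) => //; split => //=; exact: ballxx.
Qed.

Section euler_scheme.
Context {R : realType} d {T : measurableType d} (P : probability T R).
Context (F : R -> set (set T)) (hF : usual_conditions P F).
Context (n m : nat) (w : R -> T -> 'cV[R]_m) (hw : brownian P F w).
Context (tau : R) (V : R -> 'cV[R]_n -> R).
Hypotheses (tau0 : 0 <= tau) (hV : classC21 tau V).
Local Notation Vt := (V_t tau V).
Local Notation Vx i t x := (V_x V t x 0 i).
Local Notation Vxx i j t x := (V_xx V t x i j).
Variables (pi : nat -> R) (K : R) (X0 : T -> 'cV[R]_n).
Variables (B : nat -> 'I_n -> T -> R) (C : nat -> 'I_n -> 'I_m -> T -> R).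
Hypotheses (pi0 : 0 <= pi 0%N) (pi_le : forall k, pi k <= pi k.+1).
Hypothesis mX0 : forall i, rv_measurable (F (pi 0%N)) (fun om => X0 om i 0).
Hypotheses (mB : forall k i, rv_measurable (F (pi k)) (B k i))
  (mC : forall k i j, rv_measurable (F (pi k)) (C k i j)).
Hypotheses (bB : forall k i om, `|B k i om| <= K) (bC : forall k i j om, `|C k i j om| <= K).
Hypothesis K0 : 0 <= K.
Local Notation De k := (pi k.+1 - pi k).
Local Notation y k := (euler_incr w (pi k) (pi k.+1) (B k) (C k)).

Fixpoint euler_state k om : 'cV[R]_n :=
  if k is k'.+1 then euler_state k' om + y k' om else X0 om.

(** Discrete counterpart of the integral of the drift plus the squared diffusion, the quantity that
    is finite along almost every solution path. *)
Definition control_incr k om : R := (\sum_i `|B k i om| + \sum_i \sum_j C k i j om ^+ 2) * De k.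
Definition control k om : R := \sum_(l < k) control_incr l om.

Lemma controlS k om : control k.+1 om = control k om + control_incr k om.
Proof. by rewrite /control big_ord_recr. Qed.

Lemma control_incr_ge0 k om : 0 <= control_incr k om.
Proof.
rewrite mulr_ge0 ?subr_ge0// addr_ge0 ?sumr_ge0// => i _.
by apply: sumr_ge0 => j _; exact: sqr_ge0.
Qed.

Lemma control_ge0 k om : 0 <= control k om.
Proof. by apply: sumr_ge0 => l _; exact: control_incr_ge0. Qed.

Lemma control_incr_le k om : control_incr k om <= (n%:R * K + n%:R * m%:R * K ^+ 2) * De k.
Proof.
rewrite ler_wpM2r ?subr_ge0// lerD//.
  by apply: ler_sum_ord => i.
rewrite -mulrA; apply: ler_sum_ord => i.
apply: ler_sum_ord => j.
by rewrite -[leLHS]ger0_norm ?sqr_ge0// normrX; apply: lerXn2r.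
Qed.

Let p0 k : 0 <= pi k. Proof. exact: partition_ge0. Qed.
Let sF k : sigma_algebra setT (F (pi k)). Proof. exact: (filtration_sigma hF). Qed.
Let mF k (X : T -> R) : rv_measurable (F (pi k)) X -> measurable_fun setT X.
Proof. exact: (filtration_rv_measurable hF). Qed.
Let Fsub k l : (k <= l)%N -> F (pi k) `<=` F (pi l).
Proof. by move=> kl; apply: (filtration_incr hF) => //; exact: partition_mono. Qed.

Lemma euler_state_rv_measurable k i : rv_measurable (F (pi k)) (fun om => euler_state k om i 0).
Proof.
elim: k i => [//|k ih] i /=.
under [X in rv_measurable _ X]eq_fun do rewrite !mxE.
apply: (rv_measurableD (sF _)); first exact: rv_measurable_sub (Fsub (leqnSn k)) (ih i).
apply: (rv_measurableD (sF _)).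
  apply: (rv_measurableM (sF _)); last exact: rv_measurable_cst.
  exact: rv_measurable_sub (Fsub (leqnSn k)) (mB k i).
apply: (rv_measurable_sum (sF _)) => j; apply: (rv_measurableM (sF _)).
  exact: rv_measurable_sub (Fsub (leqnSn k)) (mC k i j).
exact: (incr_rv_measurable hF hw).
Qed.

Lemma euler_comp_rv_measurable (G : R -> 'cV[R]_n -> R) k : Jtau_continuous tau G ->
  rv_measurable (F (pi k)) (fun om => G (pi k) (euler_state k om)).
Proof.
move=> cG; apply/(rv_measurableE (sF k)).
apply: (@measurable_continuous_vec R _ (g_sigma_algebraType (F (pi k))) n (G (pi k))).
  by apply: Jtau_slice_continuous cG _; rewrite (le_trans _ (p0 k))// oppr_le0.
by move=> i; apply/(rv_measurableE (sF k)); exact: euler_state_rv_measurable.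
Qed.

Lemma control_incr_rv_measurable k : rv_measurable (F (pi k)) (control_incr k).
Proof.
apply: (rv_measurableM (sF _)); last exact: rv_measurable_cst.
apply: (rv_measurableD (sF _)); apply: (rv_measurable_sum (sF _)) => i.
  by apply: (rv_measurable_comp (h := fun x => `|x|)) (mB k i); exact: normr_measurable.
apply: (rv_measurable_sum (sF _)) => j.
by apply: (rv_measurable_comp (h := fun x => x ^+ 2)) (mC k i j); exact: measurable_funX.
Qed.

Lemma control_rv_measurable k : rv_measurable (F (pi k)) (control k).
Proof.
elim: k => [|k ih].
  rewrite (_ : control 0 = fun=> 0); first exact: rv_measurable_cst.
  by apply/funext => om; rewrite /control big_ord0.
rewrite (_ : control k.+1 = fun om => control k om + control_incr k om); last first.
  by apply/funext => om; exact: controlS.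
apply: (rv_measurableD (sF _)); apply: rv_measurable_sub (Fsub (leqnSn k)) _ => //.
exact: control_incr_rv_measurable.
Qed.

Section truncated.
Variables (N M Tm Rd eps Cs C1 del : R).
Hypotheses (N0 : 0 < N) (M0 : 0 < M) (eps0 : 0 < eps) (Cs0 : 0 <= Cs) (C10 : 0 <= C1).
Hypothesis coer : forall r x, 0 <= r <= Tm -> V r x < N -> `|x| <= Rd.
Hypothesis bVt : forall r x, 0 <= r <= Tm -> `|x| <= Rd -> `|Vt r x| <= C1.
Hypothesis bVx : forall i r x, 0 <= r <= Tm -> `|x| <= Rd -> `|Vx i r x| <= C1.
Hypothesis bVxx : forall i j r x, 0 <= r <= Tm -> `|x| <= Rd -> `|Vxx i j r x| <= C1.
Hypothesis step : forall r r' (x h : 'cV[R]_n), 0 <= r -> r <= r' -> r' <= Tm -> r' - r < del ->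
  hcap N (V r' (x + h)) - hcap N (V r x) <=
  hcap_d N (V r x) * (Vt r x * (r' - r) + \sum_i Vx i r x * h i 0 +
     2^-1 * \sum_i \sum_j Vxx i j r x * h j 0 * h i 0) +
  eps * ((r' - r) + (\sum_i `|h i 0|) ^+ 2) + Cs * (\sum_i `|h i 0|) ^+ 4.

(* The factor [weight] replaces stopping when the accumulated size of the
   coefficients exceeds [M]: it decreases in time, so that it only decreases the
   increments of the nonnegative process [capped]. *)
Definition weight k om : R := hcap_d M (control k om).
Definition capped k om : R := hcap N (V (pi k) (euler_state k om)).
Definition weight' k om : R := weight k om * hcap_d N (V (pi k) (euler_state k om)).
Definition generator k om : R :=
  Vt (pi k) (euler_state k om) + \sum_i Vx i (pi k) (euler_state k om) * B k i om
  + 2^-1 * \sum_i \sum_j Vxx i j (pi k) (euler_state k om) * \sum_l C k j l om * C k i l om.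

Lemma weight_ge0 k om : 0 <= weight k om. Proof. exact: hcap_d_ge0. Qed.
Lemma weight_le1 k om : weight k om <= 1.
Proof. by apply: hcap_d_le1 => //; exact: control_ge0. Qed.
Lemma weight_anti k om : weight k.+1 om <= weight k om.
Proof. by apply: hcap_d_anti => //; rewrite controlS lerDl control_incr_ge0. Qed.

Let V0 k om : 0 <= V (pi k) (euler_state k om).
Proof. by apply: (C21_ge0 hV); rewrite (le_trans _ (p0 k))// oppr_le0. Qed.

Lemma capped_ge0 k om : 0 <= capped k om. Proof. exact: hcap_ge0. Qed.

Lemma weight_rv_measurable k : rv_measurable (F (pi k)) (weight k).
Proof.
by apply: (rv_measurable_comp (h := hcap_d M)) (control_rv_measurable k); exact: hcap_d_measurable.
Qed.

Lemma capped_rv_measurable k : rv_measurable (F (pi k)) (capped k).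
Proof.
apply: (rv_measurable_comp (h := hcap N)); first exact: hcap_measurable.
exact: (euler_comp_rv_measurable _ (C21_continuous hV)).
Qed.

Lemma weight'_rv_measurable k : rv_measurable (F (pi k)) (weight' k).
Proof.
apply: (rv_measurableM (sF _)); first exact: weight_rv_measurable.
apply: (rv_measurable_comp (h := hcap_d N)); first exact: hcap_d_measurable.
exact: (euler_comp_rv_measurable _ (C21_continuous hV)).
Qed.

(** [hcap_d N] vanishes outside of the sublevel set of [V], which lies in the box where the
    derivatives are bounded. *)
Lemma weight'_bound k (G : R -> 'cV[R]_n -> R) om : pi k <= Tm ->
  (forall r x, 0 <= r <= Tm -> `|x| <= Rd -> `|G r x| <= C1) ->
  `|weight' k om * G (pi k) (euler_state k om)| <= C1.
Proof.
move=> kT bG; have kT' : 0 <= pi k <= Tm by rewrite p0.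
have [NV|VN] := leP N (V (pi k) (euler_state k om)).
  by rewrite /weight' hcap_d_eq0// mulr0 mul0r normr0.
rewrite normrM; apply: (@le_trans _ _ (1 * C1)); last by rewrite mul1r.
apply: ler_pM => //; last by apply: bG => //; exact: coer VN.
rewrite ger0_norm ?mulr_ge0 ?weight_ge0 ?hcap_d_ge0//.
by rewrite mulr_ile1 ?weight_ge0 ?hcap_d_ge0 ?weight_le1// hcap_d_le1.
Qed.

Lemma weight'_comp_rv_measurable k (G : R -> 'cV[R]_n -> R) : Jtau_continuous tau G ->
  rv_measurable (F (pi k)) (fun om => weight' k om * G (pi k) (euler_state k om)).
Proof.
move=> cG; apply: (rv_measurableM (sF _)); first exact: weight'_rv_measurable.
exact: euler_comp_rv_measurable.
Qed.

Lemma mean_weighted_capped k :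
  mean P (fun om => weight k om * capped k om) (\int[P]_om (weight k om * capped k om)).
Proof.
apply: (@mean_bounded _ _ _ P _ (N / 2)).
  by apply: measurable_funM; apply: (mF (k := k)); [exact: weight_rv_measurable|exact: capped_rv_measurable].
move=> om; rewrite ger0_norm; last by apply: mulr_ge0; [exact: weight_ge0|exact: capped_ge0].
apply: (@le_trans _ _ (capped k om)); last exact: hcap_le.
by rewrite ler_piMl ?capped_ge0// weight_le1.
Qed.

(** The terms depending on [K] carry [De ^+ 2] and disappear when [K ^+ 4 * h] is small. The last
    term is not small step by step, but the weighted control increments sum to about [M] at most,
    and [eps] multiplies this bound. *)
Definition step_error k : R :=
  (2^-1 * (n%:R * (n%:R * (C1 * K ^+ 2))) + eps * (n%:R * (n%:R * K ^+ 2)) +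
   Cs * (K ^+ 4 * (n%:R ^+ 4 * 8 * (1 + m%:R ^+ 4 * gauss4)))) * De k ^+ 2 + eps * De k
  + eps * n%:R * \int[P]_om (weight k om * control_incr k om).

(** Mean of the inequality [step] multiplied by [weight k], which is known at [pi k]. Passing to
    [weight k.+1] on the left is free because [capped] is nonnegative and the weight decreases. *)
Lemma euler_one_step k : pi k.+1 <= Tm -> De k < del -> De k <= 1 ->
  P.-integrable setT (EFin \o (fun om => weight' k om * generator k om)) /\
  \int[P]_om (weight k.+1 om * capped k.+1 om) <=
  \int[P]_om (weight k om * capped k om) + De k * \int[P]_om (weight' k om * generator k om)
  + step_error k.
Proof.
move=> kT kd k1.
have D0 : 0 <= De k by rewrite subr_ge0.
have kT0 : pi k <= Tm by exact: le_trans kT.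
have [e4 m4 he4] := mean_euler4 hF n hw K (p0 k) (pi_le k) (introT andP (conj D0 k1)).
pose aT om := weight' k om * Vt (pi k) (euler_state k om).
pose aX i om := weight' k om * Vx i (pi k) (euler_state k om).
pose aXX i j om := weight' k om * Vxx i j (pi k) (euler_state k om).
have maT : rv_measurable (F (pi k)) aT.
  exact: (weight'_comp_rv_measurable _ (@C21_continuous_t _ _ _ _ hV)).
have maX i : rv_measurable (F (pi k)) (aX i).
  exact: (weight'_comp_rv_measurable _ (@C21_continuous_x _ _ _ _ hV i)).
have maXX i j : rv_measurable (F (pi k)) (aXX i j).
  exact: (weight'_comp_rv_measurable _ (@C21_continuous_xx _ _ _ _ hV i j)).
have baT om : `|aT om| <= C1 by exact: (weight'_bound om kT0 bVt).
have baX i om : `|aX i om| <= C1 by exact: (weight'_bound om kT0 (bVx i)).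
have baXX i j om : `|aXX i j om| <= C1 by exact: (weight'_bound om kT0 (bVxx i j)).
have bw om : `|weight k om| <= 1 by rewrite ger0_norm ?weight_ge0 ?weight_le1.
have mw := weight_rv_measurable k.
have mT := mean_bounded P (mF maT) baT.
have mW := mean_bounded P (mF mw) bw.
have m1 i := mean_euler1 hF hw (p0 k) (pi_le k) (mB k) (mC k) (bB k) (bC k) (maX i) (baX i) i.
have m2 i j := mean_euler2 hF hw (p0 k) (pi_le k) (mB k) (mC k) (bB k) (bC k) (maXX i j) (baXX i j) j i.
have m3 i := mean_euler2 hF hw (p0 k) (pi_le k) (mB k) (mC k) (bB k) (bC k) mw bw i i.
(* Mean of the pointwise majorant: value at [k], the Taylor terms, the [eps] terms in time and in
   the squared increment, and the fourth-power term. *)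
have mY := meanD (meanD (meanD (meanD (mean_weighted_capped k)
  (meanD (meanD (meanZ (De k) mT) (mean_sum (index_enum _) xpredT m1))
    (meanZ 2^-1 (mean_sum (index_enum _) xpredT (fun i => mean_sum (index_enum _) xpredT (m2 i))))))
  (meanZ eps (meanZ (De k) mW)))
  (meanZ eps (meanZ n%:R (mean_sum (index_enum _) xpredT m3)))) (meanZ Cs m4).
have mXB i : mean P (fun om => aX i om * B k i om) (\int[P]_om (aX i om * B k i om)).
  apply: (@mean_bounded _ _ _ P _ (C1 * K)).
    exact: (mF (rv_measurableM (sF _) (maX i) (mB k i))).
  by move=> om; rewrite normrM ler_pM.
have bCC i j om : `|\sum_l C k j l om * C k i l om| <= m%:R * (K * K).
  by apply: (le_trans (ler_norm_sum _ _ _)); apply: ler_sum_ord => l; rewrite normrM ler_pM.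
have mCC i j : rv_measurable (F (pi k)) (fun om => \sum_l C k j l om * C k i l om).
  by apply: (rv_measurable_sum (sF _)) => l; exact: (rv_measurableM (sF k) (mC k j l) (mC k i l)).
have mXC i j : mean P (fun om => aXX i j om * \sum_l C k j l om * C k i l om)
    (\int[P]_om (aXX i j om * \sum_l C k j l om * C k i l om)).
  apply: (@mean_bounded _ _ _ P _ (C1 * (m%:R * (K * K)))).
    exact: (mF (rv_measurableM (sF _) (maXX i j) (mCC i j))).
  by move=> om; rewrite normrM ler_pM.
pose S1 := \sum_i \int[P]_om (aX i om * B k i om).
pose S2 := \sum_i \sum_j \int[P]_om (aXX i j om * \sum_l C k j l om * C k i l om).
have mG : mean P (fun om => weight' k om * generator k om) (\int[P]_om aT om + S1 + 2^-1 * S2).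
  apply: (mean_ext (meanD (meanD mT (mean_sum (index_enum _) xpredT mXB))
    (meanZ 2^-1 (mean_sum (index_enum _) xpredT (fun i => mean_sum (index_enum _) xpredT (mXC i)))))) => // om.
  rewrite /generator !mulrDr; congr (_ + _ + _).
    by rewrite mulr_sumr; apply: eq_bigr => i _; rewrite mulrA.
  rewrite mulrCA; congr (_ * _); rewrite mulr_sumr; apply: eq_bigr => i _; rewrite mulr_sumr.
  by apply: eq_bigr => j _; rewrite mulrA.
split; first exact: mG.1.
have hle := mean_le (mean_weighted_capped k.+1) mY; apply: (le_trans (hle _)) => {hle} [om|].
  have st := step (euler_state k om) (y k om) (p0 k) (pi_le k) kT kd.
  set S := \sum_i `|y k om i 0|; rewrite -/S in st.
  have S0 : 0 <= S by rewrite sumr_ge0.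
  have S2le : S ^+ 2 <= n%:R * \sum_i (y k om i 0 * y k om i 0).
    have := sqr_sum_le (fun i => `|y k om i 0|); rewrite card_ord; move/le_trans; apply.
    by rewrite ler_wpM2l//; apply: ler_sum => i _; rewrite -normrX ger0_norm ?sqr_ge0// expr2.
  have S4le := euler_pow4 w (pi_le k) (bB k) (bC k) om K0; rewrite -/S in S4le.
  have w0 := weight_ge0 k om; have w1 := weight_le1 k om.
  have l1 : weight k.+1 om * capped k.+1 om <= weight k om * capped k.+1 om.
    by rewrite ler_wpM2r ?capped_ge0// weight_anti.
  apply: (le_trans l1).
  have st' := ler_wpM2l w0 st.
  rewrite -[hcap N (V (pi k.+1) _)]/(capped k.+1 om) -[hcap N (V (pi k) _)]/(capped k om) in st'.
  have l2 : weight k om * (eps * (De k + S ^+ 2)) <=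
      eps * (De k * weight k om) + eps * (n%:R * \sum_i weight k om * (y k om i 0 * y k om i 0)).
    rewrite -mulrDr mulrCA ler_pM2l// [leLHS]mulrDr mulrC lerD2l// -mulr_sumr [leRHS]mulrCA.
    exact: ler_wpM2l.
  have l3 : weight k om * (Cs * S ^+ 4) <= Cs * S ^+ 4.
    by apply: ler_piMl => //; rewrite mulr_ge0// exprn_ge0.
  have l4 := ler_wpM2l Cs0 S4le.
  have l5 : weight k om * (hcap_d N (V (pi k) (euler_state k om)) *
      (Vt (pi k) (euler_state k om) * De k + \sum_i Vx i (pi k) (euler_state k om) * y k om i 0 +
       2^-1 * \sum_i \sum_j Vxx i j (pi k) (euler_state k om) * y k om j 0 * y k om i 0)) =
      De k * aT om + \sum_i aX i om * y k om i 0 +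
      2^-1 * \sum_i \sum_j aXX i j om * (y k om j 0 * y k om i 0).
    rewrite mulrA -/(weight' k om) !mulrDr; congr (_ + _ + _).
    - by rewrite /aT; ring.
    - by rewrite mulr_sumr; apply: eq_bigr => i _; rewrite mulrA.
    - rewrite mulrCA; congr (_ * _); rewrite mulr_sumr; apply: eq_bigr => i _; rewrite mulr_sumr.
      by apply: eq_bigr => j _; rewrite !mulrA.
  have l6 (a b c z : R) : z * (a + b + c) = z * a + z * b + z * c by ring.
  rewrite l6 l5 in st'.
  move: st' l2 l3 l4; lra.
have q1 : \sum_i \sum_j \int[P]_om (aXX i j om * (B k j om * B k i om)) <= n%:R * (n%:R * (C1 * K ^+ 2)).
  apply: ler_sum_ord => i.
  apply: ler_sum_ord => j.
  apply: mean_bound_le; first exact: (mF (rv_measurableM (sF _) (maXX i j) (rv_measurableM (sF _) (mB k j) (mB k i)))).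
  move=> om; rewrite normrM (normrM (B k j om)) expr2; apply: (ler_pM (normr_ge0 _) _ (baXX i j om)); first exact: mulr_ge0.
  by apply: ler_pM.
have q2 : \int[P]_om weight k om <= 1 by exact: (mean_bound_le P (mF mw) bw).
have q3 : \sum_i \int[P]_om (weight k om * (B k i om * B k i om)) <= n%:R * K ^+ 2.
  apply: ler_sum_ord => i.
  apply: mean_bound_le; first exact: (mF (rv_measurableM (sF _) mw (rv_measurableM (sF _) (mB k i) (mB k i)))).
  move=> om; rewrite normrM -[leRHS]mul1r; apply: (ler_pM (normr_ge0 _) (normr_ge0 _) (bw om)).
  by rewrite normrM expr2 ler_pM.
have mwc : mean P (fun om => weight k om * control_incr k om) (\int[P]_om (weight k om * control_incr k om)).
  apply: (@mean_bounded _ _ _ P _ ((n%:R * K + n%:R * m%:R * K ^+ 2) * De k)).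
    exact: (mF (rv_measurableM (sF _) mw (control_incr_rv_measurable k))).
  move=> om; rewrite normrM -[leRHS]mul1r; apply: (ler_pM (normr_ge0 _) (normr_ge0 _) (bw om)).
  by rewrite ger0_norm ?control_incr_ge0// control_incr_le.
have mwC i : mean P (fun om => weight k om * \sum_j C k i j om * C k i j om)
    (\int[P]_om (weight k om * \sum_j C k i j om * C k i j om)).
  apply: (@mean_bounded _ _ _ P _ (1 * (m%:R * (K * K)))).
    exact: (mF (rv_measurableM (sF _) mw (mCC i i))).
  by move=> om; rewrite normrM ler_pM.
have q4 : De k * \sum_i \int[P]_om (weight k om * \sum_j C k i j om * C k i j om) <=
    \int[P]_om (weight k om * control_incr k om).
  apply: (mean_le (meanZ (De k) (mean_sum (index_enum _) xpredT mwC)) mwc) => om.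
  rewrite -mulr_sumr mulrCA ler_wpM2l ?weight_ge0// mulrC /control_incr ler_wpM2r//.
  rewrite (_ : \sum_i \sum_j C k i j om * C k i j om = \sum_i \sum_j C k i j om ^+ 2).
    by rewrite lerDr sumr_ge0.
  by apply: eq_bigr => i _; apply: eq_bigr => j _; rewrite expr2.
have e1 : \sum_i De k * \int[P]_om (aX i om * B k i om) = De k * S1 by rewrite mulr_sumr.
have e2 : \sum_i \sum_j (De k ^+ 2 * \int[P]_om (aXX i j om * (B k j om * B k i om)) +
    De k * \int[P]_om (aXX i j om * \sum_l C k j l om * C k i l om)) =
    De k ^+ 2 * (\sum_i \sum_j \int[P]_om (aXX i j om * (B k j om * B k i om))) + De k * S2.
  under eq_bigr do rewrite big_split/= -!mulr_sumr.
  by rewrite big_split/= -!mulr_sumr.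
have e3 : \sum_i (De k ^+ 2 * \int[P]_om (weight k om * (B k i om * B k i om)) +
    De k * \int[P]_om (weight k om * \sum_j C k i j om * C k i j om)) =
    De k ^+ 2 * (\sum_i \int[P]_om (weight k om * (B k i om * B k i om))) +
    De k * \sum_i \int[P]_om (weight k om * \sum_j C k i j om * C k i j om).
  by rewrite big_split/= -!mulr_sumr.
rewrite e1 e2 e3 mG.2 /step_error.
have r1 := ler_wpM2l (exprn_ge0 2 D0) q1.
have r2 : eps * (De k * \int[P]_om weight k om) <= eps * De k.
  by rewrite ler_pM2l// ler_piMr.
have r3 : eps * n%:R * (De k ^+ 2 * \sum_i \int[P]_om (weight k om * (B k i om * B k i om))) <=
    eps * n%:R * (De k ^+ 2 * (n%:R * K ^+ 2)).
  by rewrite ler_wpM2l ?mulr_ge0 ?(ltW eps0)// ler_wpM2l ?exprn_ge0.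
have r4 : eps * n%:R * (De k * \sum_i \int[P]_om (weight k om * \sum_j C k i j om * C k i j om)) <=
    eps * n%:R * \int[P]_om (weight k om * control_incr k om).
  by rewrite ler_wpM2l ?mulr_ge0 ?(ltW eps0).
have r5 := ler_wpM2l Cs0 he4.
move: r1 r2 r3 r4 r5; lra.
Qed.

(** The weight vanishes once the control has reached [M], so the sum overshoots [M] by at most one
    increment. The induction also carries the bound by the control itself. *)
Lemma weighted_control_le l om c : 0 <= c -> (forall k, control_incr k om <= c) ->
  \sum_(k < l) weight k om * control_incr k om <= M + c.
Proof.
move=> c0 hc; suff [] : \sum_(k < l) weight k om * control_incr k om <= M + c /\
  \sum_(k < l) weight k om * control_incr k om <= control l om by [].
elim: l => [|l [ih1 ih2]].
  by rewrite big_ord0 control_ge0; split => //; rewrite addr_ge0// ltW.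
rewrite big_ord_recr/= controlS.
have le1 : weight l om * control_incr l om <= control_incr l om.
  by rewrite ler_piMl ?control_incr_ge0 ?weight_le1.
split; last exact: lerD.
have [Ml|lM] := leP M (control l om).
  by rewrite [weight l om]/weight hcap_d_eq0// mul0r addr0.
by apply: lerD; [exact: le_trans (ltW lM)|exact: le_trans le1 (hc l)].
Qed.

Definition error_coef : R := 2^-1 * (n%:R * (n%:R * (C1 * K ^+ 2))) + eps * (n%:R * (n%:R * K ^+ 2)) +
   Cs * (K ^+ 4 * (n%:R ^+ 4 * 8 * (1 + m%:R ^+ 4 * gauss4))).

Lemma error_coef_ge0 : 0 <= error_coef.
Proof.
have g0 : 0 <= gauss4 :> R by exact: gauss4_ge0.
have K20 : 0 <= K ^+ 2 by exact: sqr_ge0.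
have K40 : 0 <= K ^+ 4 by rewrite exprn_ge0.
rewrite /error_coef; apply: addr_ge0; first apply: addr_ge0.
- by do ! apply: mulr_ge0 => //.
- by rewrite mulr_ge0 ?(ltW eps0)//; do ! apply: mulr_ge0 => //.
- apply: mulr_ge0 => //; apply: mulr_ge0 => //; apply: mulr_ge0.
    by rewrite mulr_ge0// exprn_ge0.
  by rewrite addr_ge0// mulr_ge0// exprn_ge0.
Qed.

Lemma mean_weighted_control k :
  mean P (fun om => weight k om * control_incr k om) (\int[P]_om (weight k om * control_incr k om)).
Proof.
apply: (@mean_bounded _ _ _ P _ ((n%:R * K + n%:R * m%:R * K ^+ 2) * De k)).
  exact: (mF (rv_measurableM (sF _) (weight_rv_measurable k) (control_incr_rv_measurable k))).
move=> om; rewrite ger0_norm; last by apply: mulr_ge0; [exact: weight_ge0|exact: control_incr_ge0].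
apply: le_trans (control_incr_le k om).
by rewrite ler_piMl ?control_incr_ge0 ?weight_le1.
Qed.

Lemma euler_sum (h : R) j0 l : (forall k, De k <= h) -> h < del -> h <= 1 -> (j0 <= l)%N ->
  pi l <= Tm ->
  P.-integrable setT (EFin \o (fun om => \sum_(k < l | (j0 <= k)%N) weight' k om * generator k om * De k)) /\
  \int[P]_om (weight l om * capped l om) <= \int[P]_om (weight j0 om * capped j0 om) +
  \int[P]_om (\sum_(k < l | (j0 <= k)%N) weight' k om * generator k om * De k) +
  (error_coef * h * Tm + eps * Tm + eps * n%:R * (M + (n%:R * K + n%:R * m%:R * K ^+ 2) * h)).
Proof.
move=> kh hdel h1 j0l lT.
have h0 : 0 <= h by apply: le_trans (kh 0%N); rewrite subr_ge0.
have one k : (k < l)%N -> P.-integrable setT (EFin \o (fun om => weight' k om * generator k om)) /\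
  \int[P]_om (weight k.+1 om * capped k.+1 om) <=
  \int[P]_om (weight k om * capped k om) + De k * \int[P]_om (weight' k om * generator k om)
  + step_error k.
  move=> kl; apply: euler_one_step.
  - by rewrite (le_trans _ lT)//; exact: partition_mono.
  - exact: le_lt_trans hdel.
  - exact: le_trans h1.
have se0 k : 0 <= step_error k.
  rewrite /step_error -/error_coef addr_ge0//.
    by rewrite addr_ge0// mulr_ge0 ?error_coef_ge0 ?sqr_ge0 ?(ltW eps0)// subr_ge0.
  rewrite mulr_ge0 ?mulr_ge0 ?(ltW eps0)//; apply: Rintegral_ge0 => om _.
  by apply: mulr_ge0; [exact: weight_ge0|exact: control_incr_ge0].
have mS : mean P (fun om => \sum_(k < l | (j0 <= k)%N) weight' k om * generator k om * De k)
    (\sum_(k < l | (j0 <= k)%N) De k * \int[P]_om (weight' k om * generator k om)).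
  apply: mean_sum => k.
  have hk : mean P (fun om => weight' k om * generator k om) (\int[P]_om (weight' k om * generator k om)).
    by split => //; have [] := one k (ltn_ord k).
  by apply: (mean_ext (meanZ (De k) hk)) => // om; rewrite mulrC.
split; first exact: mS.1.
rewrite mS.2.
(* The errors are summed from index 0 instead of [j0]; they are nonnegative, so this only enlarges
   the bound. *)
have tele k : (j0 <= k <= l)%N -> \int[P]_om (weight k om * capped k om) <=
    \int[P]_om (weight j0 om * capped j0 om) +
    \sum_(i < k | (j0 <= i)%N) De i * \int[P]_om (weight' i om * generator i om) +
    \sum_(i < k) step_error i.
  elim: k => [|k ih].
    by rewrite leqn0 => /andP[/eqP -> _]; rewrite !big_ord0 !addr0.
  rewrite leq_eqVlt => /andP[/predU1P[<- _|j0k kl]].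
    rewrite [X in _ + X + _]big_pred0; last by move=> i; rewrite leqNgt ltn_ord.
    by rewrite addr0 lerDl sumr_ge0.
  rewrite ltnS in j0k.
  have ih' := ih (introT andP (conj j0k (ltnW kl))).
  have [_ h2] := one k kl.
  have bigS (f : nat -> R) : \sum_(i < k.+1 | (j0 <= i)%N) f i = \sum_(i < k | (j0 <= i)%N) f i + f k.
    by rewrite big_mkcond big_ord_recr/= j0k -big_mkcond.
  rewrite (bigS (fun i => De i * \int[P]_om (weight' i om * generator i om))).
  by rewrite [\sum_(i < k.+1) step_error i]big_ord_recr/=; move: h2 ih'; lra.
have := tele l (introT andP (conj j0l (leqnn l))).
move/le_trans; apply; rewrite lerD2l.
have sumDe : \sum_(k < l) De k <= Tm.
  apply: le_trans lT; rewrite (_ : \sum_(k < l) De k = pi l - pi 0%N).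
    by rewrite lerBlDr lerDl.
  by rewrite -(big_mkord xpredT (fun k => De k)) telescope_sumr.
have De0 k : 0 <= De k by rewrite subr_ge0.
rewrite /step_error -/error_coef !big_split/=; apply: lerD; first apply: lerD.
- apply: (@le_trans _ _ (\sum_(k < l) error_coef * h * De k)).
    apply: ler_sum => k _; rewrite -mulrA ler_wpM2l ?error_coef_ge0// expr2 ler_wpM2r//.
  by rewrite -mulr_sumr ler_wpM2l// mulr_ge0// error_coef_ge0.
- by rewrite -mulr_sumr ler_pM2l.
- rewrite -mulr_sumr; apply: ler_wpM2l; first by rewrite mulr_ge0// ltW.
  have c0 : 0 <= (n%:R * K + n%:R * m%:R * K ^+ 2) * h.
    by rewrite mulr_ge0// addr_ge0 ?mulr_ge0 ?sqr_ge0.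
  apply: (mean_le (mean_sum (index_enum _) xpredT (fun k : 'I_l => mean_weighted_control k)) (mean_cst P _)) => om.
  apply: weighted_control_le => // k.
  apply: (le_trans (control_incr_le k om)); apply: ler_wpM2l => //.
  by rewrite addr_ge0 ?mulr_ge0 ?sqr_ge0.
Qed.

End truncated.
End euler_scheme.

Section scheme_inequality.
Context {R : realType} d {T : measurableType d} (P : probability T R).
Context (F : R -> set (set T)) (hF : usual_conditions P F).
Context (n m : nat) (w : R -> T -> 'cV[R]_m) (hw : brownian P F w).
Context (tau : R) (V : R -> 'cV[R]_n -> R).
Hypotheses (tau0 : 0 <= tau) (hV : classC21 tau V).
Variables (N M Tm Rd : R).
Hypotheses (N0 : 0 < N) (M0 : 0 < M) (Tm0 : 0 <= Tm).
Hypothesis coer : forall r x, 0 <= r <= Tm -> V r x < N -> `|x| <= Rd.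

Lemma derivative_bound : exists2 C1 : R, 0 <= C1 & [/\
  forall r x, 0 <= r <= Tm -> `|x| <= Rd -> `|V_t tau V r x| <= C1,
  forall i r x, 0 <= r <= Tm -> `|x| <= Rd -> `|V_x V r x 0 i| <= C1 &
  forall i j r x, 0 <= r <= Tm -> `|x| <= Rd -> `|V_xx V r x i j| <= C1].
Proof.
have [Ct Ct0 hCt] := Jtau_bounded tau0 Tm Rd (@C21_continuous_t _ _ _ _ hV).
have [Cx Cx0 hCx] := Jtau_bounded_fin tau0 Tm Rd (@C21_continuous_x _ _ _ _ hV).
have [Cxx Cxx0 hCxx] := @Jtau_bounded_fin _ _ tau tau0 _ (fun (ij : 'I_n * 'I_n) t x => V_xx V t x ij.1 ij.2) Tm Rd
   (fun ij => @C21_continuous_xx _ _ _ _ hV ij.1 ij.2).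
exists (Ct + Cx + Cxx); first by rewrite !addr_ge0.
split.
- by move=> r x h1 h2; apply: (le_trans (hCt _ _ h1 h2)); rewrite -addrA lerDl addr_ge0.
- by move=> i r x h1 h2; apply: (le_trans (hCx i _ _ h1 h2)); rewrite -addrA addrCA lerDl addr_ge0.
- by move=> i j r x h1 h2; apply: (le_trans (hCxx (i, j) _ _ h1 h2)); rewrite lerDr addr_ge0.
Qed.

(** The order of quantifiers is the point: [eta] depends on [e] and the truncation levels only,
    while the partition, the coefficients and their bound [K] come afterwards, subject to
    [K ^+ 4 * h <= eta]. *)
Lemma scheme_inequality (e : R) : 0 < e -> exists2 eta : R, 0 < eta &
  forall (pi : nat -> R) (K h : R) (X0 : T -> 'cV[R]_n) (B : nat -> 'I_n -> T -> R)
    (C : nat -> 'I_n -> 'I_m -> T -> R) j0 l,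
  0 <= pi 0%N -> (forall k, pi k <= pi k.+1) -> (forall k, pi k.+1 - pi k <= h) ->
  (forall i, rv_measurable (F (pi 0%N)) (fun om => X0 om i 0)) ->
  (forall k i, rv_measurable (F (pi k)) (B k i)) ->
  (forall k i j, rv_measurable (F (pi k)) (C k i j)) ->
  (forall k i om, `|B k i om| <= K) -> (forall k i j om, `|C k i j om| <= K) ->
  1 <= K -> K ^+ 4 * h <= eta -> (j0 <= l)%N -> pi l <= Tm ->
  P.-integrable setT (EFin \o (fun om => \sum_(k < l | (j0 <= k)%N)
      weight' w V pi X0 B C N M k om * generator w tau V pi X0 B C k om * (pi k.+1 - pi k))) /\
  \int[P]_om (weight pi B C M l om * capped w V pi X0 B C N l om) <=
  \int[P]_om (weight pi B C M j0 om * capped w V pi X0 B C N j0 om) +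
  \int[P]_om (\sum_(k < l | (j0 <= k)%N)
      weight' w V pi X0 B C N M k om * generator w tau V pi X0 B C k om * (pi k.+1 - pi k)) + e.
Proof.
move=> e0.
have [C1 C10 [bVt bVx bVxx]] := derivative_bound.
(* Bounds the total factor of [eps] once [K * h] and [K ^+ 2 * h] are at most 1; it is free of [K].
   Half of [e] is spent here. *)
pose D := Tm + n%:R * (M + (n%:R + n%:R * m%:R)) + 1.
have D0 : 0 < D.
  by rewrite /D ltr_wpDl// addr_ge0// mulr_ge0// addr_ge0 ?(ltW M0)// addr_ge0// mulr_ge0.
pose eps := e / 2 / D.
have eps0 : 0 < eps by rewrite !divr_gt0.
have epsD : e / 2 = eps * D by rewrite /eps divfK// gt_eqF.
clearbody eps.
have [Cs [del [Cs0 del0 step]]] := hcap_step tau0 hV N0 eps0 coer.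
(* [error_coef] with the powers of [K] taken out; they are at most [K ^+ 4] as [1 <= K]. The other
   half of [e] is spent here. *)
pose Q := 2^-1 * (n%:R * (n%:R * C1)) + eps * (n%:R * n%:R) +
  Cs * (n%:R ^+ 4 * 8 * (1 + m%:R ^+ 4 * gauss4)).
have g0 : 0 <= gauss4 :> R by exact: gauss4_ge0.
have Q0 : 0 <= Q.
  rewrite /Q addr_ge0//.
    apply: addr_ge0; last by rewrite mulr_ge0 ?(ltW eps0)// mulr_ge0.
    by rewrite mulr_ge0 ?invr_ge0// mulr_ge0// mulr_ge0.
  rewrite mulr_ge0// mulr_ge0 ?mulr_ge0 ?exprn_ge0// addr_ge0// mulr_ge0// exprn_ge0//.
have QT0 : 0 < Q * Tm + 1 by rewrite ltr_wpDl// mulr_ge0.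
pose eta := Num.min (Num.min 1 (del / 2)) (e / 2 / (Q * Tm + 1)).
have eta0 : 0 < eta by rewrite !lt_min ltr01 !divr_gt0.
exists eta => // pi K h X0 B C j0 l pi0 pi_le hh mX0 mB mC bB bC K1 Kh j0l lT.
have K0 : 0 <= K by exact: le_trans K1.
have h0 : 0 <= h by apply: le_trans (hh 0%N); rewrite subr_ge0.
have K41 : 1 <= K ^+ 4 by rewrite exprn_ege1.
have hK : h <= K ^+ 4 * h by rewrite ler_peMl.
have heta : h <= eta by exact: le_trans Kh.
have hdel : h < del.
  apply: (le_lt_trans heta); rewrite !gt_min; apply/orP; left; apply/orP; right.
  by rewrite ltr_pdivrMr// ltr_pMr// ltr1n.
have h1 : h <= 1 by apply: (le_trans heta); rewrite !ge_min lexx.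
have Kh1 : K ^+ 4 * h <= 1 by apply: (le_trans Kh); rewrite !ge_min lexx.
have [i1 i2] := euler_sum hF hw tau0 hV pi0 pi_le mX0 mB mC bB bC K0 N0 M0 eps0 Cs0 C10 coer bVt bVx bVxx step
  hh hdel h1 j0l lT.
split => //; apply: (le_trans i2); rewrite lerD2l.
have K2 : K ^+ 2 <= K ^+ 4 by rewrite ler_weXn2l.
have K4 : K <= K ^+ 4 by rewrite -[X in X <= _]expr1 ler_weXn2l.
have t1 : error_coef n m K eps Cs C1 * h * Tm <= e / 2.
  have : error_coef n m K eps Cs C1 <= Q * K ^+ 4.
    rewrite /error_coef /Q !mulrDl; apply: lerD; first apply: lerD.
    - by rewrite -!mulrA; do ! (apply: ler_wpM2l => //; rewrite ?invr_ge0//).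
    - by rewrite -!mulrA; apply: (ler_wpM2l (ltW eps0)); do 2 apply: ler_wpM2l => //.
    - by rewrite [leLHS]mulrCA [leLHS]mulrC.
  move=> /(ler_wpM2r h0) q1.
  have q2 : error_coef n m K eps Cs C1 * h <= Q * eta.
    by apply: (le_trans q1); rewrite -mulrA ler_wpM2l.
  apply: (le_trans (ler_wpM2r Tm0 q2)).
  have q3 : Q * eta * Tm <= Q * Tm * (e / 2 / (Q * Tm + 1)).
    by rewrite mulrAC ler_wpM2l ?mulr_ge0// ge_min lexx orbT.
  apply: (le_trans q3); rewrite mulrA ler_pdivrMr// mulrC ler_pM2l ?divr_gt0//.
  by rewrite lerDl.
have t2 : eps * Tm + eps * n%:R * (M + (n%:R * K + n%:R * m%:R * K ^+ 2) * h) <= e / 2.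
  rewrite epsD -mulrA -mulrDr ler_pM2l// /D.
  have q1 : (n%:R * K + n%:R * m%:R * K ^+ 2) * h <= n%:R + n%:R * m%:R.
    have k1 : K * h <= 1 by apply: le_trans Kh1; rewrite ler_wpM2r.
    have k2 : K ^+ 2 * h <= 1 by apply: le_trans Kh1; rewrite ler_wpM2r.
    rewrite mulrDl; apply: lerD; first by rewrite -mulrA ler_piMr.
    by rewrite -[leLHS]mulrA ler_piMr// mulr_ge0.
  have q2 : n%:R * (M + (n%:R * K + n%:R * m%:R * K ^+ 2) * h) <= n%:R * (M + (n%:R + n%:R * m%:R)).
    by rewrite ler_wpM2l// lerD2l.
  by move: q2; lra.
by rewrite -addrA (_ : e = e / 2 + e / 2) ?lerD//; field.
Qed.

End scheme_inequality.

(** * Passage to the limit in the Euler scheme *)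

Lemma norm_mul_le {R : realDomainType} (v v' : R) : `|v * v'| <= v ^+ 2 + v' ^+ 2.
Proof. by rewrite ler_norml; apply/andP; split; nra. Qed.

Lemma sqrB_le {R : realDomainType} (v v' : R) : (v - v') ^+ 2 <= 2 * (v ^+ 2 + v' ^+ 2).
Proof. by rewrite -subr_ge0 (_ : _ - _ = (v + v') ^+ 2) ?sqr_ge0//; ring. Qed.

Section interval_limits.
Context {R : realType} (t0 t : R).
Local Notation leb := (@lebesgue_measure R).
Implicit Types (f g a : R -> R).

Lemma itv_integrable_measurable f : itv_integrable t0 t f -> measurable_fun `[t0, t] f.
Proof. by move=> h; apply/measurable_EFinP; exact: measurable_int h. Qed.

Lemma itv_integrable_le f g : measurable_fun `[t0, t] f -> itv_integrable t0 t g ->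
  (forall r, t0 <= r <= t -> `|f r| <= g r) -> itv_integrable t0 t f.
Proof.
move=> mf ig h; by apply: (@le_integrable_EFin _ _ _ leb _ (measurable_itv _) _ g) => // r /=; rewrite in_itv/=; exact: h.
Qed.

Lemma itv_integrableD f g : itv_integrable t0 t f -> itv_integrable t0 t g ->
  itv_integrable t0 t (fun r => f r + g r).
Proof. by move=> i j; exact: (@integrableD _ _ _ leb _ (measurable_itv _) (EFin \o f) (EFin \o g)). Qed.

Lemma itv_integrableB f g : itv_integrable t0 t f -> itv_integrable t0 t g ->
  itv_integrable t0 t (fun r => f r - g r).
Proof. by move=> i j; exact: (@integrableB _ _ _ leb _ (measurable_itv _) (EFin \o f) (EFin \o g)). Qed.

Lemma itv_integrableZ (c : R) f : itv_integrable t0 t f -> itv_integrable t0 t (fun r => c * f r).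
Proof. by move=> i; exact: (@integrableZl _ _ _ leb _ (measurable_itv _) c (EFin \o f)). Qed.

Lemma itv_integrable_norm f : itv_integrable t0 t f -> itv_integrable t0 t (fun r => `|f r|).
Proof. by move=> i; exact: (integrable_abse i). Qed.

Lemma itv_integrable_sum (I : Type) (s : seq I) (Q : pred I) (f : I -> R -> R) :
  (forall i, itv_integrable t0 t (f i)) -> itv_integrable t0 t (fun r => \sum_(i <- s | Q i) f i r).
Proof.
move=> h; elim: s => [|i s ih].
  by under eq_fun do rewrite big_nil; exact: itv_integrable_cst.
by under eq_fun do rewrite big_cons; case: (Q i) => //; exact: itv_integrableD.
Qed.

Lemma itv_integralD f g : itv_integrable t0 t f -> itv_integrable t0 t g ->
  \int[leb]_(r in `[t0, t]) (f r + g r) =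
  \int[leb]_(r in `[t0, t]) f r + \int[leb]_(r in `[t0, t]) g r.
Proof. by move=> i j; rewrite RintegralD. Qed.

Lemma itv_integralB f g : itv_integrable t0 t f -> itv_integrable t0 t g ->
  \int[leb]_(r in `[t0, t]) (f r - g r) =
  \int[leb]_(r in `[t0, t]) f r - \int[leb]_(r in `[t0, t]) g r.
Proof. by move=> i j; rewrite RintegralB. Qed.

Lemma itv_integralZ c f : itv_integrable t0 t f ->
  \int[leb]_(r in `[t0, t]) (c * f r) = c * \int[leb]_(r in `[t0, t]) f r.
Proof. by move=> i; rewrite RintegralZl. Qed.

Lemma itv_integral_sum (I : Type) (s : seq I) (Q : pred I) (f : I -> R -> R) :
  (forall i, itv_integrable t0 t (f i)) -> t0 <= t ->
  \int[leb]_(r in `[t0, t]) (\sum_(i <- s | Q i) f i r) =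
  \sum_(i <- s | Q i) \int[leb]_(r in `[t0, t]) f i r.
Proof.
move=> h t0t; elim: s => [|i s ih].
  by under eq_Rintegral do rewrite big_nil; rewrite big_nil itv_integral_cst// mul0r.
under eq_Rintegral do rewrite big_cons; rewrite big_cons; case: (Q i) => //.
by rewrite itv_integralD ?ih//; exact: itv_integrable_sum.
Qed.

Lemma itv_norm_integral_le f : itv_integrable t0 t f ->
  `|\int[leb]_(r in `[t0, t]) f r| <= \int[leb]_(r in `[t0, t]) `|f r|.
Proof. by move=> i; apply: le_normr_Rintegral. Qed.

Lemma leb_ae_neq (c : R) : {ae leb, forall r, r != c}.
Proof.
exists [set c]; split; [exact: measurable_set1|exact: lebesgue_measure_set1|].
by move=> r /negP; rewrite negbK => /eqP.
Qed.

(** [a_ k * f_ k] is split as [a_ k * (f_ k - f) + a_ k * f]: the first part is bounded by [C] times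
    the distance in mean, the second converges by domination. *)
Lemma l1_mul_cvg (a_ f_ : nat -> R -> R) a f (C : R) :
  (forall k, measurable_fun `[t0, t] (a_ k)) -> (forall k r, `|a_ k r| <= C) ->
  (forall r, t0 <= r <= t -> a_ k r @[k --> \oo] --> a r) ->
  (forall k, itv_integrable t0 t (f_ k)) -> itv_integrable t0 t f ->
  \int[leb]_(r in `[t0, t]) `|f_ k r - f r| @[k --> \oo] --> 0 ->
  itv_integrable t0 t (fun r => a r * f r) /\
  \int[leb]_(r in `[t0, t]) (a_ k r * f_ k r) @[k --> \oo] -->
  \int[leb]_(r in `[t0, t]) (a r * f r).
Proof.
move=> ma ba ca if_ iff cf.
have mf := itv_integrable_measurable iff.
have ma' : measurable_fun `[t0, t] a.
  by apply: measurable_fun_cvg => [k|r /=]; [exact: ma|rewrite in_itv/=; exact: ca].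
have [|||||i1 c1] := @Rintegral_dominated _ _ R leb `[t0, t]%classic (measurable_itv _)
   (fun k r => a_ k r * f r) (fun r => a r * f r) (fun r => C * `|f r|).
- by move=> k; apply: measurable_funM => //; exact: ma.
- by apply: measurable_funM.
- by apply/aeW => r /=; rewrite in_itv/= => rt; apply: cvgM; [exact: ca|exact: cvg_cst].
- by apply: itv_integrableZ; exact: itv_integrable_norm.
- by move=> k r _; rewrite normrM ler_wpM2r.
split=> //.
have iaf k : itv_integrable t0 t (fun r => a_ k r * f r).
  apply: (@itv_integrable_le _ (fun r => C * `|f r|)).
  - exact: measurable_funM.
  - by apply: itv_integrableZ; exact: itv_integrable_norm.
  - by move=> r _; rewrite normrM ler_wpM2r.
have id k : itv_integrable t0 t (fun r => a_ k r * (f_ k r - f r)).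
  have i2 := itv_integrableB (if_ k) iff.
  apply: (@itv_integrable_le _ (fun r => C * `|f_ k r - f r|)).
  - by apply: measurable_funM => //; exact: itv_integrable_measurable i2.
  - by apply: itv_integrableZ; exact: itv_integrable_norm.
  - by move=> r _; rewrite normrM ler_wpM2r.
have c2 : \int[leb]_(r in `[t0, t]) (a_ k r * (f_ k r - f r)) @[k --> \oo] --> 0.
  have cC : C * \int[leb]_(r in `[t0, t]) `|f_ k r - f r| @[k --> \oo] --> 0.
    by rewrite -[X in _ --> X](mulr0 C); apply: cvgM => //; exact: cvg_cst.
  apply/cvgr0Pnorm_le => e e0; move/cvgr0Pnorm_le : cC => /(_ e e0); apply: filterS => k.
  apply: le_trans; apply: (le_trans _ (ler_norm _)).
  apply: (le_trans (itv_norm_integral_le (id k))).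
  have i2 := itv_integrable_norm (itv_integrableB (if_ k) iff).
  rewrite -itv_integralZ//; apply: itv_le_integral.
  - exact: itv_integrable_norm.
  - exact: itv_integrableZ.
  - by move=> r _; rewrite normrM ler_wpM2r.
rewrite (_ : (fun k => _) = fun k => \int[leb]_(r in `[t0, t]) (a_ k r * (f_ k r - f r)) +
    \int[leb]_(r in `[t0, t]) (a_ k r * f r)).
  by rewrite -[X in _ --> X]add0r; exact: cvgD.
apply/funext => k; rewrite -itv_integralD//; apply: eq_Rintegral => r _.
by rewrite -mulrDr subrK.
Qed.

Lemma itv_integral_cvg_end f (r_ : nat -> R) r : itv_integrable t0 t f ->
  (forall k, t0 <= r_ k <= t) -> t0 <= r <= t -> r_ k @[k --> \oo] --> r ->
  \int[leb]_(y in `[t0, r_ k]) f y @[k --> \oo] --> \int[leb]_(y in `[t0, r]) f y.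
Proof.
move=> iff rt_ rt cr.
have e z : t0 <= z <= t -> \int[leb]_(y in `[t0, z]) f y =
    \int[leb]_(y in `[t0, t]) (\1_(`[t0, z]%classic) y * f y).
  move=> /andP[t0z zt].
  have sub : `[t0, z]%classic `<=` (`[t0, t]%classic : set R).
    by move=> y /=; rewrite !in_itv/= => /andP[-> h]; exact: le_trans zt.
  rewrite /Rintegral; congr fine.
  transitivity (\int[leb]_(x in `[t0, t] `&` `[t0, z]) (f x)%:E)%E; first by rewrite (setIidr sub).
  rewrite integral_mkcondr; apply: eq_integral => y _; rewrite patchE indicE.
  by case: ifP => _; rewrite ?mul1r ?mul0r.
rewrite e//; under eq_fun do rewrite e//.
have mf := itv_integrable_measurable iff.
have [|||||//] := @Rintegral_dominated _ _ R leb `[t0, t]%classic (measurable_itv _)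
   (fun k y => \1_(`[t0, r_ k]%classic) y * f y) (fun y => \1_(`[t0, r]%classic) y * f y) (fun y => `|f y|).
- by move=> k; apply: measurable_funM => //; exact: measurable_indic.
- by apply: measurable_funM => //; exact: measurable_indic.
- apply: (@filterS _ _ (ae_filter_ringOfSetsType leb) _ _ _ (leb_ae_neq r)) => y yr /=.
  rewrite in_itv/= => /andP[t0y yt]; apply: cvgM; last exact: cvg_cst.
  apply: cvg_near_cst.
  have [ry|ry] := ltP r y.
    have : \forall k \near \oo, r_ k < y by exact: (cvgr_lt r).
    apply: filterS => k rky; rewrite !indicE !memNset//= in_itv/= => /andP[_].
      by rewrite leNgt ry.
    by rewrite leNgt rky.
  have {}ry : y < r by rewrite lt_neqAle yr.
  have : \forall k \near \oo, y < r_ k by exact: (cvgr_gt r).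
  apply: filterS => k rky; rewrite !indicE !mem_set//= in_itv/= t0y ltW//.
- exact: itv_integrable_norm.
- move=> k y _; rewrite normrM ler_piMl// indicE ger0_norm// lern1 leq_b1 //.
Qed.

Section square_integrable.
Variables (h h' : R -> R).
Hypotheses (mh : measurable_fun `[t0, t] h) (mh' : measurable_fun `[t0, t] h').
Hypotheses (ih : itv_integrable t0 t (fun r => h r ^+ 2)) (ih' : itv_integrable t0 t (fun r => h' r ^+ 2)).

Lemma mul_integrable : itv_integrable t0 t (fun r => h r * h' r).
Proof.
apply: (@itv_integrable_le _ (fun r => h r ^+ 2 + h' r ^+ 2)).
- exact: measurable_funM.
- exact: itv_integrableD.
- by move=> r _; exact: norm_mul_le.
Qed.

Lemma sqrB_integrable : itv_integrable t0 t (fun r => (h r - h' r) ^+ 2).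
Proof.
apply: (@itv_integrable_le _ (fun r => 2 * (h r ^+ 2 + h' r ^+ 2))).
- by apply: measurable_funX; exact: measurable_funB.
- by apply: itv_integrableZ; exact: itv_integrableD.
- by move=> r _; rewrite ger0_norm ?sqr_ge0//; exact: sqrB_le.
Qed.

End square_integrable.

(** Young's inequality with a parameter [z] takes the place of the Cauchy-Schwarz inequality: the
    distance is at most [z * (Q + Q') + (z^-1 + 1) * (p k + p' k)], with [z] chosen before [k]. *)
Lemma l2_mul_cvg (c_ c'_ : nat -> R -> R) (h h' : R -> R) :
  (forall k, measurable_fun `[t0, t] (c_ k)) -> (forall k, measurable_fun `[t0, t] (c'_ k)) ->
  (forall k, itv_integrable t0 t (fun r => c_ k r ^+ 2)) ->
  (forall k, itv_integrable t0 t (fun r => c'_ k r ^+ 2)) ->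
  measurable_fun `[t0, t] h -> measurable_fun `[t0, t] h' ->
  itv_integrable t0 t (fun r => h r ^+ 2) -> itv_integrable t0 t (fun r => h' r ^+ 2) ->
  \int[leb]_(r in `[t0, t]) ((c_ k r - h r) ^+ 2) @[k --> \oo] --> 0 ->
  \int[leb]_(r in `[t0, t]) ((c'_ k r - h' r) ^+ 2) @[k --> \oo] --> 0 ->
  \int[leb]_(r in `[t0, t]) `|c_ k r * c'_ k r - h r * h' r| @[k --> \oo] --> 0.
Proof.
move=> mc mc' ic ic' mh mh' ih ih' l2 l2'.
set Q := \int[leb]_(r in `[t0, t]) (h r ^+ 2); set Q' := \int[leb]_(r in `[t0, t]) (h' r ^+ 2).
have Q0 : 0 <= Q by apply: itv_integral_ge0 => r _; exact: sqr_ge0.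
have Q'0 : 0 <= Q' by apply: itv_integral_ge0 => r _; exact: sqr_ge0.
pose p k := \int[leb]_(r in `[t0, t]) ((c_ k r - h r) ^+ 2).
pose p' k := \int[leb]_(r in `[t0, t]) ((c'_ k r - h' r) ^+ 2).
have key k (z : R) : 0 < z -> \int[leb]_(r in `[t0, t]) `|c_ k r * c'_ k r - h r * h' r| <=
    z * (Q + Q') + (z^-1 + 1) * (p k + p' k).
  move=> z0.
  have i1 := sqrB_integrable (mc k) mh (ic k) ih.
  have i2 := sqrB_integrable (mc' k) mh' (ic' k) ih'.
  have i3 := itv_integrableZ z (itv_integrableD ih ih').
  have i4 := itv_integrableZ (z^-1 + 1) (itv_integrableD i1 i2).
  have -> : z * (Q + Q') + (z^-1 + 1) * (p k + p' k) =
     \int[leb]_(r in `[t0, t]) (z * (h r ^+ 2 + h' r ^+ 2) +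
       (z^-1 + 1) * ((c_ k r - h r) ^+ 2 + (c'_ k r - h' r) ^+ 2)).
    by rewrite itv_integralD// !itv_integralZ ?itv_integralD//; exact: itv_integrableD.
  apply: itv_le_integral.
  - apply: itv_integrable_norm; apply: itv_integrableB.
      exact: mul_integrable (mc k) (mc' k) (ic k) (ic' k).
    exact: mul_integrable mh mh' ih ih'.
  - exact: itv_integrableD.
  - move=> r _; set a := c_ k r; set a' := c'_ k r; set b := h r; set b' := h' r.
    have cross (v v' : R) : `|v * v'| <= z * v' ^+ 2 + z^-1 * v ^+ 2.
      have zi : 0 < z^-1 by rewrite invr_gt0.
      have e1 : z * v' ^+ 2 + z^-1 * v ^+ 2 - 2 * (v * v') = z^-1 * (v - z * v') ^+ 2.
        by field; rewrite gt_eqF.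
      have e2 : z * v' ^+ 2 + z^-1 * v ^+ 2 + 2 * (v * v') = z^-1 * (v + z * v') ^+ 2.
        by field; rewrite gt_eqF.
      have s1 : 0 <= z^-1 * (v - z * v') ^+ 2 by rewrite mulr_ge0 ?sqr_ge0// ltW.
      have s2 : 0 <= z^-1 * (v + z * v') ^+ 2 by rewrite mulr_ge0 ?sqr_ge0// ltW.
      rewrite -e1 in s1; rewrite -e2 in s2.
      have s3 : 0 <= z * v' ^+ 2 by rewrite mulr_ge0 ?sqr_ge0// ltW.
      have s4 : 0 <= z^-1 * v ^+ 2 by rewrite mulr_ge0 ?sqr_ge0// ltW.
      by rewrite ler_norml; apply/andP; split; lra.
    have q1 := cross (a - b) b'; have q2 := cross (a' - b') b.
    have q3 := norm_mul_le (a - b) (a' - b').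
    have -> : a * a' - b * b' = (a - b) * (a' - b') + (a - b) * b' + (a' - b') * b by ring.
    apply: (le_trans (ler_normD _ _)); apply: (le_trans (lerD (ler_normD _ _) (lexx _))).
    have -> : (z^-1 + 1) * ((a - b) ^+ 2 + (a' - b') ^+ 2) =
      ((a - b) ^+ 2 + (a' - b') ^+ 2) + (z^-1 * (a - b) ^+ 2 + z^-1 * (a' - b') ^+ 2) by ring.
    by apply: le_trans (lerD (lerD q3 q1) q2) _; rewrite le_eqVlt; apply/orP; left; apply/eqP; ring.
have cp : p k + p' k @[k --> \oo] --> 0 by rewrite -[X in _ --> X]addr0; exact: cvgD.
apply/cvgr0Pnorm_le => e e0.
pose z := e / 2 / (Q + Q' + 1).
have QQ : 0 < Q + Q' + 1 by rewrite ltr_wpDl// addr_ge0.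
have z0 : 0 < z by rewrite !divr_gt0.
have z1 : 0 < z^-1 + 1 by rewrite ltr_wpDl// invr_ge0 ltW.
have ez : 0 < e / 2 / (z^-1 + 1) by rewrite !divr_gt0.
move/cvgr0Pnorm_le : cp => /(_ _ ez); apply: filterS => k hk.
rewrite ger0_norm; last by apply: itv_integral_ge0 => r _; exact: normr_ge0.
apply: (le_trans (key k z z0)).
have h1 : z * (Q + Q') <= e / 2.
  rewrite /z mulrAC ler_pdivrMr// ler_wpM2l ?divr_ge0 ?(ltW e0)//.
  by rewrite lerDl.
have h2 : (z^-1 + 1) * (p k + p' k) <= e / 2.
  by rewrite mulrC -ler_pdivlMr//; exact: le_trans (ler_norm _) hk.
by apply: (le_trans (lerD h1 h2)); rewrite -splitr.
Qed.

End interval_limits.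

Lemma cvg_rsum {R : realType} {U : Type} (F : set_system U) {FF : Filter F} (I : Type) (r : seq I)
    (f : I -> U -> R) (l : I -> R) :
  (forall i, f i k @[k --> F] --> l i) ->
  \sum_(i <- r) f i k @[k --> F] --> \sum_(i <- r) l i.
Proof.
move=> h; elim: r => [|i r ih].
  by rewrite big_nil; under eq_fun do rewrite big_nil; exact: cvg_cst.
by rewrite big_cons; under eq_fun do rewrite big_cons; exact: cvgD.
Qed.

Section step_functions.
Context {R : realType} (pi : nat -> R) (L : nat).
Hypothesis pi_le : forall k, pi k <= pi k.+1.
Local Notation leb := (@lebesgue_measure R).
Implicit Types c v : nat -> R.

Definition stepf c (r : R) : R := \sum_(l < L | pi l < r <= pi l.+1) c l.

Lemma stepf_measurable c : measurable_fun setT (stepf c).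
Proof.
exact: (@simple_value_measurable_time R _ R (SimpleProcess L pi (fun l _ => c l)) 0).
Qed.

Lemma stepf_val c l r : (l < L)%N -> pi l < r <= pi l.+1 -> stepf c r = c l.
Proof.
move=> lL /andP[h1 h2]; rewrite /stepf (eq_bigl (fun i : 'I_L => i == Ordinal lL)) ?big_pred1_eq// => i.
apply/idP/eqP => [/andP[h3 h4]|->/=]; last by rewrite h1 h2.
apply: val_inj => /=; apply/eqP; rewrite eqn_leq; apply/andP; split; rewrite leqNgt; apply/negP => h.
  by have := partition_mono pi_le h; rewrite leNgt (lt_le_trans h3 h2).
by have := partition_mono pi_le h; rewrite leNgt (lt_le_trans h1 h4).
Qed.

Lemma stepf_before c r : r <= pi 0%N -> stepf c r = 0.
Proof.
move=> r0; rewrite /stepf big_pred0// => i; apply/negbTE/nandP; left.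
by rewrite -leNgt (le_trans r0)// partition_mono.
Qed.

Lemma cell_of r : pi 0%N < r <= pi L -> exists2 l, (l < L)%N & pi l < r <= pi l.+1.
Proof.
elim: L => [|k ih] /andP[h1 h2]; first by move: h1; rewrite ltNge h2.
have [h|h] := leP r (pi k); last by exists k => //; rewrite h.
by have [|l lk hl] := ih; [rewrite h1|exists l => //; exact: ltnW].
Qed.

Lemma stepf_bound c C r : 0 <= C -> (forall l, (l < L)%N -> `|c l| <= C) -> `|stepf c r| <= C.
Proof.
move=> C0 hc; have [r0|r0] := leP r (pi 0%N); first by rewrite stepf_before// normr0.
have [rL|Lr] := leP r (pi L).
  by have [|l lL hl] := @cell_of r; [rewrite r0|rewrite (stepf_val c lL hl); exact: hc].
rewrite /stepf big_pred0 ?normr0// => i; apply/negbTE/nandP; right.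
by rewrite -ltNge (le_lt_trans _ Lr)// partition_mono.
Qed.

Lemma stepf_sum c v f : (forall l r, (l < L)%N -> pi l < r <= pi l.+1 -> f r = v l) ->
  itv_integrable (pi 0%N) (pi L) (fun r => stepf c r * f r) /\
  \int[leb]_(r in `[pi 0%N, pi L]) (stepf c r * f r) = \sum_(l < L) c l * v l * (pi l.+1 - pi l).
Proof.
move=> hf; have [|i1 ->] := @step_integral R pi pi_le (fun r => stepf c r * f r) L.
  move=> l r lL /andP[h1 h2].
  have h3 : pi l < pi l.+1 <= pi l.+1 by rewrite (lt_le_trans h1 h2) lexx.
  have h4 : pi l < r <= pi l.+1 by rewrite h1 h2.
  by rewrite !(stepf_val _ lL)// !(hf l).
split => //; apply: eq_bigr => l _.
have := pi_le l; rewrite le_eqVlt => /predU1P[->|h]; first by rewrite subrr !mulr0.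
have h3 : pi l < pi l.+1 <= pi l.+1 by rewrite h lexx.
by rewrite (stepf_val _ (ltn_ord l))// (hf l).
Qed.

End step_functions.

(** * Convergence of the scheme along one path *)

Section pathwise_limit.
Context {R : realType} (n m : nat) (tau : R) (V : R -> 'cV[R]_n -> R).
Hypotheses (tau0 : 0 <= tau) (hV : classC21 tau V).
Local Notation leb := (@lebesgue_measure R).
Local Notation Vt := (V_t tau V).
Local Notation Vx i t x := (V_x V t x 0 i).
Local Notation Vxx i j t x := (V_xx V t x i j).
Variables (N M Rd t0 s t : R).
Hypotheses (N0 : 0 < N) (M0 : 0 < M) (t00 : 0 <= t0) (t0s : t0 <= s) (st : s <= t).
Hypothesis coer : forall r x, 0 <= r <= t -> V r x < N -> `|x| <= Rd.
Variables (x : R -> 'cV[R]_n) (b : 'I_n -> R -> R) (sg : 'I_n -> 'I_m -> R -> R).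
Hypothesis cx : forall (r_ : nat -> R) r, (forall k, t0 <= r_ k <= t) -> t0 <= r <= t ->
  r_ k @[k --> \oo] --> r -> forall i, x (r_ k) i 0 @[k --> \oo] --> x r i 0.
Hypothesis ib : forall i, itv_integrable t0 t (b i).
Hypothesis msg : forall i j, measurable_fun `[t0, t] (sg i j).
Hypothesis isg : forall i j, itv_integrable t0 t (fun r => sg i j r ^+ 2).
Variables (e_ : nat -> R) (pi_ : nat -> nat -> R) (L_ j_ : nat -> nat) (X_ : nat -> nat -> 'cV[R]_n).
Variables (B_ : nat -> 'I_n -> nat -> R) (C_ : nat -> 'I_n -> 'I_m -> nat -> R).
Variables (fB_ : nat -> 'I_n -> R -> R) (fC_ : nat -> 'I_n -> 'I_m -> R -> R).
Hypothesis e_cvg : e_ k @[k --> \oo] --> 0.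
Hypothesis pi_le : forall k l, pi_ k l <= pi_ k l.+1.
Hypothesis pi_0 : forall k, pi_ k 0%N = t0.
Hypothesis pi_L : forall k, pi_ k (L_ k) = t.
Hypothesis pi_j : forall k, pi_ k (j_ k) = s.
Hypothesis jL : forall k, (j_ k <= L_ k)%N.
Hypothesis mesh : forall k l, pi_ k l.+1 - pi_ k l <= e_ k.
Hypothesis fB_val : forall k i l r, (l < L_ k)%N -> pi_ k l < r <= pi_ k l.+1 -> fB_ k i r = B_ k i l.
Hypothesis fC_val : forall k i j l r, (l < L_ k)%N -> pi_ k l < r <= pi_ k l.+1 -> fC_ k i j r = C_ k i j l.
Hypothesis hX : forall k l i, (l <= L_ k)%N -> `|X_ k l i 0 - x (pi_ k l) i 0| <= e_ k.
Hypothesis fB_int : forall k i, itv_integrable t0 t (fB_ k i).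
Hypothesis fC_meas : forall k i j, measurable_fun `[t0, t] (fC_ k i j).
Hypothesis fC_int : forall k i j, itv_integrable t0 t (fun r => fC_ k i j r ^+ 2).
Hypothesis hB : forall k i, \int[leb]_(r in `[t0, t]) `|fB_ k i r - b i r| <= e_ k.
Hypothesis hC : forall k i j, \int[leb]_(r in `[t0, t]) ((fC_ k i j r - sg i j r) ^+ 2) <= e_ k.
Local Notation De k l := (pi_ k l.+1 - pi_ k l).

Lemma ge0_le_cvg0 (u v : nat -> R) : (forall k, 0 <= u k <= v k) -> v k @[k --> \oo] --> 0 ->
  u k @[k --> \oo] --> 0.
Proof.
move=> h cv; apply: (@squeeze_cvgr _ _ _ _ (fun=> 0) v) => //; last exact: cvg_cst.
by apply: nearW => k; exact: h.
Qed.

Lemma l1_cvg i : \int[leb]_(r in `[t0, t]) `|fB_ k i r - b i r| @[k --> \oo] --> 0.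
Proof. by apply: ge0_le_cvg0 e_cvg => k; rewrite hB andbT itv_integral_ge0. Qed.

Lemma l2_cvg i j i' j' :
  \int[leb]_(r in `[t0, t]) `|fC_ k i j r * fC_ k i' j' r - sg i j r * sg i' j' r| @[k --> \oo] --> 0.
Proof.
apply: l2_mul_cvg => //.
  by apply: ge0_le_cvg0 e_cvg => k; rewrite hC andbT itv_integral_ge0// => r _; exact: sqr_ge0.
by apply: ge0_le_cvg0 e_cvg => k; rewrite hC andbT itv_integral_ge0// => r _; exact: sqr_ge0.
Qed.

Definition control_at k l : R := \sum_(l' < l) (\sum_i `|B_ k i l'| + \sum_i \sum_j C_ k i j l' ^+ 2) * De k l'.
Definition control_density r : R := \sum_i `|b i r| + \sum_i \sum_j sg i j r ^+ 2.
Definition control_limit r : R := \int[leb]_(y in `[t0, r]) control_density y.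

Lemma control_density_integrable : itv_integrable t0 t control_density.
Proof.
apply: itv_integrableD; apply: itv_integrable_sum => i; first exact: itv_integrable_norm.
by apply: itv_integrable_sum => j; exact: isg.
Qed.

Let pi_itv k l : (l <= L_ k)%N -> t0 <= pi_ k l <= t.
Proof. by move=> lL; rewrite -{1}(pi_0 k) -(pi_L k) !(partition_mono (pi_le k)). Qed.

(** The discrete control is the integral of a step density up to a node. It differs from the limit
    control at the same node by at most [u k], uniformly over nodes, and the limit is continuous in
    its end point. *)
Lemma control_at_cvg (l_ : nat -> nat) r : (forall k, (l_ k <= L_ k)%N) -> t0 <= r <= t ->
  pi_ k (l_ k) @[k --> \oo] --> r -> control_at k (l_ k) @[k --> \oo] --> control_limit r.
Proof.
move=> lL rt cr.
pose g k y : R := \sum_i `|fB_ k i y| + \sum_i \sum_j fC_ k i j y ^+ 2.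
have ig k : itv_integrable t0 t (g k).
  apply: itv_integrableD; apply: itv_integrable_sum => i; first exact: itv_integrable_norm.
  by apply: itv_integrable_sum => j; exact: fC_int.
have control_atE k l : (l <= L_ k)%N -> control_at k l = \int[leb]_(y in `[t0, pi_ k l]) g k y.
  move=> lk; have [|_] := @step_integral R (pi_ k) (pi_le k) (g k) l.
    move=> a y al /andP[h1 h2]; have aL := leq_trans al lk.
    have h3 : pi_ k a < pi_ k a.+1 <= pi_ k a.+1 by rewrite (lt_le_trans h1 h2) lexx.
    have h4 : pi_ k a < y <= pi_ k a.+1 by rewrite h1 h2.
    rewrite /g; congr (_ + _); apply: eq_bigr => i _; first by rewrite !(fB_val i aL).
    by apply: eq_bigr => j _; rewrite !(fC_val i j aL).
  rewrite pi_0 => ->; apply: eq_bigr => a _; have aL := leq_trans (ltn_ord a) lk.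
  have := pi_le k a; rewrite le_eqVlt => /predU1P[->|h]; first by rewrite subrr !mulr0.
  have h3 : pi_ k a < pi_ k a.+1 <= pi_ k a.+1 by rewrite h lexx.
  rewrite /g; congr ((_ + _) * _); apply: eq_bigr => i _; first by rewrite !(fB_val i aL).
  by apply: eq_bigr => j _; rewrite !(fC_val i j aL).
pose u k := \sum_i \int[leb]_(y in `[t0, t]) `|fB_ k i y - b i y| +
  \sum_i \sum_j \int[leb]_(y in `[t0, t]) `|fC_ k i j y * fC_ k i j y - sg i j y * sg i j y|.
have cu : u k @[k --> \oo] --> 0.
  rewrite (_ : 0 = \sum_(i < n) 0 + \sum_(i < n) \sum_(j < m) 0 :> R); last first.
    by rewrite !big1 ?addr0// => i _; rewrite big1.
  apply: cvgD; first by apply: cvg_rsum => i; exact: l1_cvg.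
  by apply: cvg_rsum => i; apply: cvg_rsum => j; exact: l2_cvg.
have idiff k : itv_integrable t0 t (fun y => g k y - control_density y).
  by apply: itv_integrableB => //; exact: control_density_integrable.
have i1 k i : itv_integrable t0 t (fun y => `|fB_ k i y - b i y|).
  by apply: itv_integrable_norm; exact: itv_integrableB.
have i2 k i j : itv_integrable t0 t (fun y => `|fC_ k i j y * fC_ k i j y - sg i j y * sg i j y|).
  apply: itv_integrable_norm; apply: itv_integrableB; exact: mul_integrable.
have t0t : t0 <= t by exact: le_trans st.
have bound k l : (l <= L_ k)%N -> `|control_at k l - control_limit (pi_ k l)| <= u k.
  move=> lk; have /andP[h1 h2] := pi_itv lk.
  have sub f : itv_integrable t0 t f -> itv_integrable t0 (pi_ k l) f by exact: itv_integrableS.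
  rewrite control_atE// /control_limit -itv_integralB; [|exact: sub|exact/sub/control_density_integrable].
  apply: (le_trans (itv_norm_integral_le (sub _ (idiff k)))).
  apply: (@le_trans _ _ (\int[leb]_(y in `[t0, t]) `|g k y - control_density y|)).
    by apply: itv_integral_mono => //; exact: itv_integrable_norm.
  have i3 : itv_integrable t0 t (fun y => \sum_i `|fB_ k i y - b i y| +
      \sum_i \sum_j `|fC_ k i j y * fC_ k i j y - sg i j y * sg i j y|).
    apply: itv_integrableD; apply: itv_integrable_sum => i //.
    exact: itv_integrable_sum.
  have -> : u k = \int[leb]_(y in `[t0, t]) (\sum_i `|fB_ k i y - b i y| +
      \sum_i \sum_j `|fC_ k i j y * fC_ k i j y - sg i j y * sg i j y|).
    rewrite itv_integralD; [|exact: itv_integrable_sum|by apply: itv_integrable_sum => i; exact: itv_integrable_sum].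
    rewrite !itv_integral_sum// => [|i]; last exact: itv_integrable_sum.
    by congr (_ + _); apply: eq_bigr => i _; rewrite itv_integral_sum.
  apply: itv_le_integral => //; first exact: itv_integrable_norm.
  move=> y _; rewrite /g /control_density opprD addrACA -!sumrB.
  apply: (le_trans (ler_normD _ _)); apply: lerD.
    apply: (le_trans (ler_norm_sum _ _ _)); apply: ler_sum => i _; exact: ler_dist_dist.
  apply: (le_trans (ler_norm_sum _ _ _)); apply: ler_sum => i _; rewrite -sumrB.
  by apply: (le_trans (ler_norm_sum _ _ _)); apply: ler_sum => j _; rewrite !expr2.
have c1 : control_limit (pi_ k (l_ k)) @[k --> \oo] --> control_limit r.
  apply: (@itv_integral_cvg_end R t0 t control_density) => //; first exact: control_density_integrable.
  by move=> k; exact: pi_itv.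
have c2 : control_at k (l_ k) - control_limit (pi_ k (l_ k)) @[k --> \oo] --> 0.
  apply/cvgr0Pnorm_le => e e0; move/cvgr0Pnorm_le : cu => /(_ e e0); apply: filterS => k.
  by apply: le_trans; apply: le_trans (ler_norm _); exact: bound.
rewrite (_ : (fun k => _) = fun k => (control_at k (l_ k) - control_limit (pi_ k (l_ k))) + control_limit (pi_ k (l_ k))).
  by rewrite -[X in _ --> X]add0r; exact: cvgD.
by apply/funext => k; rewrite subrK.
Qed.

Lemma state_cvg (l_ : nat -> nat) r : (forall k, (l_ k <= L_ k)%N) -> t0 <= r <= t ->
  pi_ k (l_ k) @[k --> \oo] --> r ->
  forall i, X_ k (l_ k) i 0 @[k --> \oo] --> x r i 0.
Proof.
move=> lL rt cr i.
have c1 := @cx (fun k => pi_ k (l_ k)) r (fun k => pi_itv (lL k)) rt cr i.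
have c2 : X_ k (l_ k) i 0 - x (pi_ k (l_ k)) i 0 @[k --> \oo] --> 0.
  apply/cvgr0Pnorm_le => e e0; move/cvgr0Pnorm_le : e_cvg => /(_ e e0); apply: filterS => k.
  by apply: le_trans; apply: le_trans (ler_norm _); exact: hX.
rewrite (_ : (fun k => _) = fun k => (X_ k (l_ k) i 0 - x (pi_ k (l_ k)) i 0) + x (pi_ k (l_ k)) i 0).
  by rewrite -[X in _ --> X]add0r; exact: cvgD.
by apply/funext => k; rewrite subrK.
Qed.

Lemma comp_cvg (G : R -> 'cV[R]_n -> R) (l_ : nat -> nat) r : Jtau_continuous tau G ->
  (forall k, (l_ k <= L_ k)%N) -> t0 <= r <= t ->
  pi_ k (l_ k) @[k --> \oo] --> r ->
  G (pi_ k (l_ k)) (X_ k (l_ k)) @[k --> \oo] --> G r (x r).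
Proof.
move=> cG lL rt cr; apply/cvgrPdist_lt => e e0.
have r0 : 0 <= r <= t by case/andP: rt => h ->; rewrite (le_trans t00 h).
have [d d0 hd] := Jtau_uniform tau0 t `|x r| cG e0.
have cX := state_cvg lL rt cr.
have : \forall k \near \oo, forall i, i \in index_enum 'I_n -> `|x r i 0 - X_ k (l_ k) i 0| < d / 2.
  elim: (index_enum _) => [|i q ih]; first by apply: nearW.
  have h : \forall k \near \oo, `|x r i 0 - X_ k (l_ k) i 0| < d / 2.
    by move/cvgrPdist_lt : (cX i); apply; rewrite divr_gt0.
  apply: filterS2 ih h => k h1 h2 i'; rewrite inE => /predU1P[->//|]; exact: h1.
have : \forall k \near \oo, `|r - pi_ k (l_ k)| < d by move/cvgrPdist_lt : cr; apply.
apply: filterS2 => k h1 h2; apply: hd => //.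
  by have /andP[h _] := pi_itv (lL k); exact: le_trans h.
apply: (@le_lt_trans _ _ (d / 2)); last by rewrite ltr_pdivrMr// ltr_pMr// ltr1n.
apply: norm_le_coord; first by rewrite divr_ge0// ltW.
by move=> i; rewrite !mxE ltW// h2// mem_index_enum.
Qed.

Lemma hcap_d_continuous (z : R) : 0 < z -> continuous (hcap_d z).
Proof.
move=> z0 y; apply/cvgrPdist_lt => e e0; near=> y'.
apply: (le_lt_trans (hcap_d_lip z0 _ _)); rewrite ltr_pdivrMr//.
near: y'; apply: cvgr_dist_lt; rewrite ?mulr_gt0//; exact: cvg_id.
Unshelve. all: by end_near. Qed.

Definition lweight k l : R := hcap_d M (control_at k l) * hcap_d N (V (pi_ k l) (X_ k l)).
Definition lgen k l : R := Vt (pi_ k l) (X_ k l) + \sum_i Vx i (pi_ k l) (X_ k l) * B_ k i l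
  + 2^-1 * \sum_i \sum_j Vxx i j (pi_ k l) (X_ k l) * \sum_p C_ k j p l * C_ k i p l.
Definition gen_limit r : R := Vt r (x r) + \sum_i Vx i r (x r) * b i r
  + 2^-1 * \sum_i \sum_j Vxx i j r (x r) * \sum_p sg j p r * sg i p r.

Lemma control_at_ge0 k l : 0 <= control_at k l.
Proof.
apply: sumr_ge0 => l' _; rewrite mulr_ge0 ?subr_ge0// addr_ge0 ?sumr_ge0// => i _.
by apply: sumr_ge0 => j _; exact: sqr_ge0.
Qed.

Lemma lweight_bound (G : R -> 'cV[R]_n -> R) C1 k l : (l <= L_ k)%N ->
  (forall r x, 0 <= r <= t -> `|x| <= Rd -> `|G r x| <= C1) -> 0 <= C1 ->
  `|lweight k l * G (pi_ k l) (X_ k l)| <= C1.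
Proof.
move=> lL bG C10; have /andP[p1 p2] := pi_itv lL.
have pT : 0 <= pi_ k l <= t by rewrite (le_trans t00 p1).
have [NV|VN] := leP N (V (pi_ k l) (X_ k l)).
  by rewrite /lweight (hcap_d_eq0 N0 NV) mulr0 mul0r normr0.
rewrite normrM; apply: (@le_trans _ _ (1 * C1)); last by rewrite mul1r.
apply: ler_pM => //; last by apply: bG => //; exact: coer VN.
have V0 : 0 <= V (pi_ k l) (X_ k l).
  by apply: (C21_ge0 hV); rewrite (le_trans _ (le_trans t00 p1))// oppr_le0.
rewrite ger0_norm ?mulr_ge0 ?hcap_d_ge0//.
by rewrite mulr_ile1 ?hcap_d_ge0 ?hcap_d_le1 ?control_at_ge0.
Qed.

(** The indicator reflects that the sums start at the index of the node [s]. *)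
Definition weight_limit r : R := \1_(`]s, t]%classic) r * (hcap_d M (control_limit r) * hcap_d N (V r (x r))).

Definition astep (G : R -> 'cV[R]_n -> R) k : R -> R :=
  stepf (pi_ k) (L_ k) (fun l => if (j_ k <= l)%N then lweight k l * G (pi_ k l) (X_ k l) else 0).

(** For [r <= s] the cell of [r] precedes the index [j_ k] and the step function is 0. For [s < r]
    the left end of the cell of [r] tends to [r] as the mesh vanishes, and state, control and [V]
    are continuous along it. *)
Lemma astep_cvg G r : Jtau_continuous tau G -> t0 <= r <= t ->
  astep G k r @[k --> \oo] --> weight_limit r * G r (x r).
Proof.
move=> cG rt; have /andP[t0r rt'] := rt.
have [rs|sr] := leP r s.
  rewrite /weight_limit indicE memNset/= ?mul0r; last by rewrite in_itv/= ltNge rs.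
  rewrite (_ : (fun k => _) = fun=> 0); first exact: cvg_cst.
  apply/funext => k; have [r0|r0] := leP r t0; first by rewrite /astep stepf_before ?pi_0.
  have [|l lL hl] := @cell_of _ (pi_ k) (L_ k) r; first by rewrite pi_0 pi_L r0.
  rewrite /astep (stepf_val (pi_le k) _ lL hl) leqNgt ifF//; apply/negbTE; rewrite negbK ltnNge.
  apply/negP => /(partition_mono (pi_le k)); rewrite pi_j leNgt.
  by case/andP: hl => h _; rewrite (lt_le_trans h rs).
have r0 : t0 < r by exact: le_lt_trans sr.
have ex k : exists l, (l < L_ k)%N /\ pi_ k l < r <= pi_ k l.+1.
  have [|l lL hl] := @cell_of _ (pi_ k) (L_ k) r; first by rewrite pi_0 pi_L r0.
  by exists l.
pose l_ k := sval (cid (ex k)).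
have lP k : (l_ k < L_ k)%N /\ pi_ k (l_ k) < r <= pi_ k (l_ k).+1 by rewrite /l_; case: cid.
have lL k : (l_ k <= L_ k)%N by apply: ltnW; have [] := lP k.
have cr : pi_ k (l_ k) @[k --> \oo] --> r.
  apply: (@squeeze_cvgr _ _ _ _ (fun k => r - e_ k) (fun=> r)).
  - apply: nearW => k; have [_ /andP[h1 h2]] := lP k; rewrite (ltW h1) andbT.
    by have := mesh k (l_ k); move: h2; lra.
  - by rewrite -[X in _ --> X]subr0; apply: cvgB => //; exact: cvg_cst.
  - exact: cvg_cst.
rewrite (_ : (fun k => _) = fun k => hcap_d M (control_at k (l_ k)) *
    hcap_d N (V (pi_ k (l_ k)) (X_ k (l_ k))) * G (pi_ k (l_ k)) (X_ k (l_ k))); last first.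
  apply/funext => k; have [h1 h2] := lP k.
  rewrite /astep (stepf_val (pi_le k) _ h1 h2) ifT// leqNgt; apply/negP => h.
  have := partition_mono (pi_le k) h; rewrite pi_j leNgt.
  by case/andP: h2 => _ h3; rewrite (lt_le_trans sr h3).
rewrite /weight_limit indicE mem_set/= ?in_itv/= ?sr// mul1r.
apply: cvgM; last exact: comp_cvg.
apply: cvgM.
  by apply: continuous_cvg; [exact: hcap_d_continuous|exact: control_at_cvg].
by apply: continuous_cvg; [exact: hcap_d_continuous|exact: comp_cvg (C21_continuous hV) _ _ _].
Qed.

Lemma boundary_cvg (l_ : nat -> nat) r : (forall k, (l_ k <= L_ k)%N) -> t0 <= r <= t ->
  pi_ k (l_ k) @[k --> \oo] --> r ->
  hcap_d M (control_at k (l_ k)) * hcap N (V (pi_ k (l_ k)) (X_ k (l_ k))) @[k --> \oo] -->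
  hcap_d M (control_limit r) * hcap N (V r (x r)).
Proof.
move=> lL rt cr; apply: cvgM.
  by apply: continuous_cvg; [exact: hcap_d_continuous|exact: control_at_cvg].
have cV : V (pi_ k (l_ k)) (X_ k (l_ k)) @[k --> \oo] --> V r (x r).
  exact: comp_cvg (C21_continuous hV) _ _ _.
apply: cvgM; first exact: cvg_cst.
apply: cvgB; first exact: cvg_cst.
have c : hcap_d N (V (pi_ k (l_ k)) (X_ k (l_ k))) @[k --> \oo] --> hcap_d N (V r (x r)).
  by apply: continuous_cvg; [exact: hcap_d_continuous|].
by rewrite expr2; under eq_fun do rewrite expr2; exact: cvgM.
Qed.

(** The sum is the integral of a step function. Each term of the generator is a bounded factor
    converging pointwise, namely weight times derivative of [V], and a coefficient converging in
    mean: 1 for the time derivative, the drift, or a product of two diffusion coefficients. *)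
Lemma sum_cvg :
  itv_integrable t0 t (fun r => weight_limit r * gen_limit r) /\
  \sum_(l < L_ k | (j_ k <= l)%N) lweight k l * lgen k l * De k l @[k --> \oo] -->
  \int[leb]_(r in `[t0, t]) (weight_limit r * gen_limit r).
Proof.
have t0t : t0 <= t by exact: le_trans st.
have [C1 C10 [bVt bVx bVxx]] := @derivative_bound R n tau V tau0 hV t Rd.
have main G f (v : nat -> nat -> R) (f_ : nat -> R -> R) : Jtau_continuous tau G ->
    (forall r x, 0 <= r <= t -> `|x| <= Rd -> `|G r x| <= C1) ->
    (forall k l r, (l < L_ k)%N -> pi_ k l < r <= pi_ k l.+1 -> f_ k r = v k l) ->
    (forall k, itv_integrable t0 t (f_ k)) -> itv_integrable t0 t f ->
    \int[leb]_(r in `[t0, t]) `|f_ k r - f r| @[k --> \oo] --> 0 ->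
    itv_integrable t0 t (fun r => weight_limit r * G r (x r) * f r) /\
    \sum_(l < L_ k | (j_ k <= l)%N) lweight k l * G (pi_ k l) (X_ k l) * v k l * De k l @[k --> \oo] -->
    \int[leb]_(r in `[t0, t]) (weight_limit r * G r (x r) * f r).
  move=> cG bG hf if_ iff cf.
  have [||||||h1 h2] := @l1_mul_cvg R t0 t (astep G) f_ (fun r => weight_limit r * G r (x r)) f C1 => //.
  - by move=> k; apply: measurable_funTS; exact: stepf_measurable.
  - move=> k r; apply: stepf_bound => // l lL; case: ifP => _; rewrite ?normr0//.
    by apply: lweight_bound => //; exact: ltnW.
  - by move=> r rt; exact: astep_cvg.
  split => //; apply: cvg_trans h2; apply: near_eq_cvg; apply: nearW => k.
  have [_] := @stepf_sum R (pi_ k) (L_ k) (pi_le k) (fun l => if (j_ k <= l)%N then lweight k l * G (pi_ k l) (X_ k l) else 0) (v k) (f_ k) (hf k).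
  rewrite pi_0 pi_L => ->; rewrite [RHS]big_mkcond; apply: eq_bigr => l _.
  by case: ifP => _; rewrite ?mul0r.
have [|i1 c1] := main Vt (fun=> 1) (fun _ _ => 1) (fun _ _ => 1) (@C21_continuous_t _ _ _ _ hV) bVt
    (fun _ _ _ _ _ => erefl) (fun k => itv_integrable_cst t0 t 1) (itv_integrable_cst t0 t 1) _.
  under eq_fun do under eq_Rintegral do rewrite subrr normr0.
  by under eq_fun do rewrite itv_integral_cst// mul0r; exact: cvg_cst.
have h2 i := main (fun r x => Vx i r x) (b i) (fun k l => B_ k i l) (fun k => fB_ k i) (@C21_continuous_x _ _ _ _ hV i) (bVx i)
  (fun k l r => @fB_val k i l r) (fun k => fB_int k i) (ib i) (l1_cvg i).
have i3 k i j p : itv_integrable t0 t (fun r => fC_ k j p r * fC_ k i p r) by exact: mul_integrable.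
have i4 i j p : itv_integrable t0 t (fun r => sg j p r * sg i p r) by exact: mul_integrable.
have v3 i j p k l r (lL : (l < L_ k)%N) (hl : pi_ k l < r <= pi_ k l.+1) :
    fC_ k j p r * fC_ k i p r = C_ k j p l * C_ k i p l by rewrite !(fC_val _ _ lL hl).
have h3 i j p := main (fun r x => Vxx i j r x) (fun r => sg j p r * sg i p r) (fun k l => C_ k j p l * C_ k i p l)
  (fun k r => fC_ k j p r * fC_ k i p r) (@C21_continuous_xx _ _ _ _ hV i j) (bVxx i j)
  (v3 i j p) (fun k => i3 k i j p) (i4 i j p) (l2_cvg j p i p).
have expand (W a1 De' : R) (a2 b2 : 'I_n -> R) (a3 : 'I_n -> 'I_n -> R) (b3 : 'I_n -> 'I_n -> 'I_m -> R) :
    W * (a1 + \sum_i a2 i * b2 i + 2^-1 * \sum_i \sum_j a3 i j * \sum_p b3 i j p) * De' =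
    W * a1 * 1 * De' + \sum_i W * a2 i * b2 i * De' +
    2^-1 * \sum_i \sum_j \sum_p W * a3 i j * b3 i j p * De'.
  have -> : \sum_i W * a2 i * b2 i * De' = W * (\sum_i a2 i * b2 i) * De'.
    by rewrite mulr_sumr mulr_suml; apply: eq_bigr => i _; ring.
  have -> : \sum_i \sum_j \sum_p W * a3 i j * b3 i j p * De' =
      W * (\sum_i \sum_j a3 i j * \sum_p b3 i j p) * De'.
    rewrite mulr_sumr mulr_suml; apply: eq_bigr => i _; rewrite mulr_sumr mulr_suml; apply: eq_bigr => j _.
    by rewrite mulr_sumr mulr_sumr mulr_suml; apply: eq_bigr => p _; ring.
  by ring.
have limE r : weight_limit r * gen_limit r = weight_limit r * Vt r (x r) * 1 + \sum_i weight_limit r * Vx i r (x r) * b i r +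
    2^-1 * \sum_i \sum_j \sum_p weight_limit r * Vxx i j r (x r) * (sg j p r * sg i p r).
  have := expand (weight_limit r) (Vt r (x r)) 1 (fun i => Vx i r (x r)) (fun i => b i r)
    (fun i j => Vxx i j r (x r)) (fun i j p => sg j p r * sg i p r).
  rewrite mulr1 => ->; congr (_ + _ + _); first by rewrite mulr1.
    by apply: eq_bigr => i _; rewrite mulr1.
  by congr (_ * _); apply: eq_bigr => i _; apply: eq_bigr => j _; apply: eq_bigr => p _; rewrite mulr1.
have I2 : itv_integrable t0 t (fun r => \sum_i weight_limit r * Vx i r (x r) * b i r).
  by apply: itv_integrable_sum => i; have [] := h2 i.
have I3' i j : itv_integrable t0 t (fun r => \sum_p weight_limit r * Vxx i j r (x r) * (sg j p r * sg i p r)).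
  by apply: itv_integrable_sum => p; have [] := h3 i j p.
have I3'' i : itv_integrable t0 t (fun r => \sum_j \sum_p weight_limit r * Vxx i j r (x r) * (sg j p r * sg i p r)).
  exact: itv_integrable_sum.
have I3 : itv_integrable t0 t (fun r => \sum_i \sum_j \sum_p weight_limit r * Vxx i j r (x r) * (sg j p r * sg i p r)).
  exact: itv_integrable_sum.
have I12 := itv_integrableD i1 I2.
under [X in itv_integrable _ _ X]eq_fun do rewrite limE.
split; first by apply: itv_integrableD => //; exact: itv_integrableZ.
under eq_Rintegral do rewrite limE.
rewrite itv_integralD//; last exact: itv_integrableZ.
rewrite itv_integralD// itv_integralZ//.
rewrite (@itv_integral_sum R t0 t _ (index_enum _) xpredT (fun i r => weight_limit r * Vx i r (x r) * b i r))//; last by move=> i; have [] := h2 i.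
rewrite (@itv_integral_sum R t0 t _ (index_enum _) xpredT (fun i r => \sum_j \sum_p weight_limit r * Vxx i j r (x r) * (sg j p r * sg i p r)))//.
rewrite (_ : (fun k => _) = fun k =>
   \sum_(l < L_ k | (j_ k <= l)%N) lweight k l * Vt (pi_ k l) (X_ k l) * 1 * De k l +
   \sum_i \sum_(l < L_ k | (j_ k <= l)%N) lweight k l * Vx i (pi_ k l) (X_ k l) * B_ k i l * De k l +
   2^-1 * \sum_i \sum_j \sum_p \sum_(l < L_ k | (j_ k <= l)%N)
     lweight k l * Vxx i j (pi_ k l) (X_ k l) * (C_ k j p l * C_ k i p l) * De k l); last first.
  apply/funext => k; under eq_bigr do rewrite /lgen expand.
  rewrite !big_split/= -mulr_sumr; congr (_ + _ + _ * _); first exact: exchange_big.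
  rewrite exchange_big; apply: eq_bigr => i _; rewrite exchange_big; apply: eq_bigr => j _.
  exact: exchange_big.
apply: cvgD; first apply: cvgD => //.
  by apply: cvg_rsum => i; have [] := h2 i.
apply: cvgM; first exact: cvg_cst.
apply: cvg_rsum => i.
rewrite (@itv_integral_sum R t0 t _ (index_enum _) xpredT (fun j r => \sum_p weight_limit r * Vxx i j r (x r) * (sg j p r * sg i p r)))//.
apply: cvg_rsum => j.
rewrite (@itv_integral_sum R t0 t _ (index_enum _) xpredT (fun p r => weight_limit r * Vxx i j r (x r) * (sg j p r * sg i p r)))//.
  by apply: cvg_rsum => p; have [] := h3 i j p.
by move=> p; have [] := h3 i j p.
Qed.

End pathwise_limit.

Lemma ae_null_cover d (T : measurableType d) (R : realType) (P : {measure set T -> \bar R}) (Q : T -> Prop) :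
  {ae P, forall om, Q om} -> exists N, [/\ measurable N, P N = 0%E & forall om, ~ N om -> Q om].
Proof.
move=> [N [mN PN hN]]; exists N; split => // om Nom.
by apply: contrapT => h; apply: Nom; exact: hN.
Qed.

(** * Choice of the approximating schemes *)

Section stages.
Context {R : realType} d {T : measurableType d} (P : probability T R).
Context (F : R -> set (set T)) (hF : usual_conditions P F).
Context (n m : nat) (w : R -> T -> 'cV[R]_m) (hw : brownian P F w).
Local Notation leb := (@lebesgue_measure R).
Local Notation TG g := (g_sigma_algebraType (F g)).
Variables (t0 s t : R) (x : R -> T -> 'cV[R]_n).
Variables (b : 'I_n -> R -> T -> R) (sg : 'I_n -> 'I_m -> R -> T -> R).
Hypotheses (t00 : 0 <= t0) (t0t : t0 < t) (st : t0 <= s <= t).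
Hypothesis jb : forall i g, t0 <= g -> measurable_fun (setT `*` `[t0, g]) (fun z : TG g * R => b i z.2 z.1).
Hypothesis jsg : forall i j g, t0 <= g -> measurable_fun (setT `*` `[t0, g]) (fun z : TG g * R => sg i j z.2 z.1).
Hypothesis ib : forall i, {ae P, forall om, itv_integrable t0 t (b i ^~ om)}.
Hypothesis eqn : forall r, t0 <= r <= t -> exists Z : 'I_n -> 'I_m -> T -> R,
  (forall i j, is_ito_integral P F (fun s om => w s om j 0) t0 r (sg i j) (Z i j)) /\
  {ae P, forall om, forall i, x r om i 0 = x t0 om i 0 +
    \int[leb]_(s in `[t0, r]) b i s om + \sum_j Z i j om}.

(* A stage is a partition through [s] with simple approximations [st_B], [st_C]
   of the coefficients; outside of the event [st_bad] of small probability they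
   are close to the coefficients, and the Euler scheme [st_X] is close to [x] at
   every node. *)
Record stage := Stage {
  st_pi : nat -> R ; st_L : nat ; st_j : nat ; st_K : R ; st_h : R ;
  st_B : 'I_n -> @simple_process R d T ; st_C : 'I_n -> 'I_m -> @simple_process R d T ;
  st_bad : set T }.

Definition st_Bv S k i om := simple_value (st_B S i) (st_pi S k.+1) om.
Definition st_Cv S k i j om := simple_value (st_C S i j) (st_pi S k.+1) om.
Definition st_X S := euler_state w (st_pi S) (x t0) (st_Bv S) (st_Cv S).

Record stage_ok (e eta : R) (S : stage) : Prop := {
  ok_0 : st_pi S 0%N = t0 ; ok_L : st_pi S (st_L S) = t ; ok_j : st_pi S (st_j S) = s ;
  ok_jL : (st_j S <= st_L S)%N ;
  ok_le : forall k, st_pi S k <= st_pi S k.+1 ;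
  ok_mesh : forall k, st_pi S k.+1 - st_pi S k <= st_h S ;
  ok_he : st_h S <= e ; ok_K : 1 <= st_K S ; ok_Kh : st_K S ^+ 4 * st_h S <= eta ;
  ok_aB : forall i, adapted_simple F t0 t (st_B S i) ;
  ok_aC : forall i j, adapted_simple F t0 t (st_C S i j) ;
  ok_rB : forall i, refines (st_pi S) (st_B S i) ;
  ok_rC : forall i j, refines (st_pi S) (st_C S i j) ;
  ok_bB : forall i r om, `|simple_value (st_B S i) r om| <= st_K S ;
  ok_bC : forall i j r om, `|simple_value (st_C S i j) r om| <= st_K S ;
  ok_bad : measurable (st_bad S) ; ok_Pbad : (P (st_bad S) <= e%:E)%E ;
  ok_dB : forall om i, ~ st_bad S om ->
    \int[leb]_(r in `[t0, t]) `|simple_value (st_B S i) r om - b i r om| <= e ;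
  ok_dC : forall om i j, ~ st_bad S om ->
    \int[leb]_(r in `[t0, t]) ((simple_value (st_C S i j) r om - sg i j r om) ^+ 2) <= e ;
  ok_dX : forall om l i, ~ st_bad S om -> (l <= st_L S)%N ->
    `|st_X S l om i 0 - x (st_pi S l) om i 0| <= e }.

Let sT : sigma_algebra setT (F t). Proof. by apply: (filtration_sigma hF); rewrite (le_trans t00)// ltW. Qed.
Let FT : F t `<=` measurable. Proof. by apply: (filtration_sub hF); rewrite (le_trans t00)// ltW. Qed.

Let jsgT i j r : t0 <= r <= t -> measurable_fun (setT `*` `[t0, r]) (fun z : T * R => sg i j z.2 z.1).
Proof.
move=> /andP[t0r rt].
have : measurable_fun (setT `*` `[t0, t]) (fun z : T * R => sg i j z.2 z.1).
  apply: (@measurable_joint_sub _ _ _ (F t) _ (fun om r => sg i j r om)) => //.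
  by apply: jsg; exact: ltW.
apply: measurable_funS => //; first exact: measurableX.
move=> [om y] /= [_ yr]; split => //; move: yr; rewrite !in_itv/= => /andP[-> h].
exact: le_trans rt.
Qed.

Let simpleT t' S : adapted_simple F t0 t' S -> measurable_fun setT (fun z : T * R => simple_value S z.2 z.1).
Proof.
move=> aS; apply: simple_value_joint => k kS.
have /andP[n1 _] := node_itv aS (ltnW kS); have [_ _ /(_ k kS)[_ r _]] := aS.
exact: (filtration_rv_measurable hF (le_trans t00 n1) r).
Qed.

Lemma sqdist_measurable i j S t' r : t0 <= r <= t -> adapted_simple F t0 t' S ->
  measurable_fun setT (fun om => (\int[leb]_(y in `[t0, r]) ((simple_value S y om - sg i j y om) ^+ 2)%:E)%E).
Proof.
move=> rt aS.
apply: (@measurable_integral_param R _ T _ _ (fun om y => (simple_value S y om - sg i j y om) ^+ 2)).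
  apply: measurable_funX; apply: measurable_funB; last exact: jsgT.
  by apply: measurable_funTS; exact: simpleT aS.
by move=> om y; exact: sqr_ge0.
Qed.

Lemma sg_section i j om : measurable_fun `[t0, t] (sg i j ^~ om).
Proof.
apply: (@measurable_section R _ T t0 t (fun om r => sg i j r om)).
by apply: jsgT; rewrite lexx ltW.
Qed.

(** Simple processes are fixed first, then [K], then the mesh, then a partition through all their
    nodes and [s]; only then are the grid and the null sets of the integral equation at its points
    known. This works because the threshold of [ito_grid_close] is independent of the grid. *)
Lemma stage_exists (e eta : R) : 0 < e -> 0 < eta -> exists S, stage_ok e eta S.
Proof.
move=> e0 eta0.
have t0r : t0 <= t by exact: ltW.
have tt : t0 <= t <= t by rewrite t0r lexx.
(* [e] is divided into [c] shares: the drift events cost [n], the two kinds of diffusion events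
   [n * m] and [7 * (n * m)], and the error of the state at a node is [1 + m] shares. *)
pose c : R := n%:R + n%:R * m%:R * 8 + m%:R + 1.
have nm0 : 0 <= n%:R * m%:R :> R by rewrite mulr_ge0.
have n0 : 0 <= n%:R :> R by []. have m0 : 0 <= m%:R :> R by [].
have c1 : 1 <= c by rewrite /c lerDr !addr_ge0// mulr_ge0.
have c0 : 0 < c by exact: lt_le_trans c1.
pose e1 := e / c; have e10 : 0 < e1 by rewrite divr_gt0.
have e1c : c * e1 = e by rewrite /e1 mulrC divfK// gt_eqF.
clearbody e1.
have e1e : e1 <= e by rewrite -e1c ler_peMl// ltW.
(* A single choice of the stochastic integrals for all times, 0 outside of [[t0, t]], so that the
   grid estimates and the equation speak of the same [Z]. *)
pose Zr r (h : t0 <= r <= t) := sval (cid (eqn h)).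
pose Z i j r om := if pselect (t0 <= r <= t) is left h then Zr r h i j om else 0.
have ZP r (rt : t0 <= r <= t) : (forall i j, is_ito_integral P F (fun s om => w s om j 0) t0 r (sg i j) (Z i j r)) /\
  {ae P, forall om, forall i, x r om i 0 = x t0 om i 0 +
    \int[leb]_(s in `[t0, r]) b i s om + \sum_j Z i j r om}.
  have h := svalP (cid (eqn rt)).
  have e_ i j : Z i j r = Zr r rt i j.
    by apply/funext => om; rewrite /Z; case: pselect => // rt'; rewrite (Prop_irrelevance rt' rt).
  split; first by move=> i j; rewrite e_; exact: h.1.
  by apply: filterS h.2 => om + i => /(_ i) ->; congr (_ + _); apply: eq_bigr => j _; rewrite e_.
have exB i := drift_approximation hF t00 t0t (jb i) (ib i) e10 e10.
pose SB i := s2val (cid2 (exB i)).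
have SBP i : adapted_simple F t0 t (SB i) /\
  measurable [set om | e1 <= l1dist t0 t ((simple_value (SB i))^~ om) (b i ^~ om)] /\
    (P [set om | (e1 <= l1dist t0 t ((simple_value (SB i))^~ om) (b i ^~ om))%R] <= e1%:E)%E.
  by rewrite /SB; case: cid2.
have exC (i : 'I_n) (j : 'I_m) : exists S, [/\ adapted_simple F t0 t S,
    measurable [set om | (e1%:E <= edist t0 (sg i j) S t om)%E] /\
    (P [set om | (e1%:E <= edist t0 (sg i j) S t om)%E] <= e1%:E)%E &
    forall q : seq R, (forall r, r \in q -> t0 <= r <= t) ->
      measurable [set om | exists2 r, r \in q & (e1 <= `|simple_int_at (fun s om => w s om j 0) S r om - Z i j r om|)%R] /\
      (P [set om | exists2 r, r \in q & (e1 <= `|simple_int_at (fun s om => w s om j 0) S r om - Z i j r om|)%R] <= (7 * e1)%:E)%E].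
  have [del del0 hdel] := ito_grid_close hF hw (j := j) t00 t0r (fun r rt => (ZP r rt).1 i j)
    (fun S t' r rt aS => @sqdist_measurable i j S t' r rt aS) (sg_section i j) e10 e10.
  have [_ [Sk [aSk cSk _]]] := (ZP t tt).1 i j.
  have [S aS [h1 h2]] : exists2 S, adapted_simple F t0 t S &
      (P [set om | (e1%:E <= edist t0 (sg i j) S t om)%E] <= e1%:E)%E /\
      (P [set om | (del%:E <= edist t0 (sg i j) S t om)%E] <= e1%:E)%E.
    have g1 := cvg0_probP cSk e10 e10; have g2 := cvg0_probP cSk del0 e10.
    have [k [k1 k2]] : exists k,
      (P [set om | (e1%:E <= edist t0 (sg i j) (Sk k) t om)%E] <= e1%:E)%E /\
      (P [set om | (del%:E <= edist t0 (sg i j) (Sk k) t om)%E] <= e1%:E)%E.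
      by near \oo => k; exists k; split; near: k.
    by exists (Sk k).
  exists S; split => //; last by move=> q hq; exact: hdel aS hq h2.
  split => //.
  have mE := sqdist_measurable i j tt aS.
  have := emeasurable_fun_c_infty measurableT mE e1%:E; rewrite setTI.
  by congr (measurable _); apply/seteqP; split => om /=; rewrite in_itv/= andbT.
pose SC i j := sval (cid (exC i j)).
have SCP i j := svalP (cid (exC i j)); rewrite -/(SC _ _) in SCP.
have aB i : adapted_simple F t0 t (SB i) by have [] := SBP i.
have aC i j : adapted_simple F t0 t (SC i j) by have [] := SCP i j.
pose KB i := sval (cid (simple_bounded (aB i))).
have KBP i : forall r om, `|simple_value (SB i) r om| <= KB i by rewrite /KB; case: cid.
pose KC i j := sval (cid (simple_bounded (aC i j))).
have KCP i j : forall r om, `|simple_value (SC i j) r om| <= KC i j by rewrite /KC; case: cid.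
pose K := 1 + \sum_i `|KB i| + \sum_i \sum_j `|KC i j|.
have sB0 : 0 <= \sum_i `|KB i| by exact: sumr_ge0.
have sC0 : 0 <= \sum_i \sum_j `|KC i j| by apply: sumr_ge0 => i _; exact: sumr_ge0.
have K1 : 1 <= K by rewrite /K -addrA lerDl addr_ge0.
have KB_K i : KB i <= K.
  apply: (le_trans (ler_norm _)); apply: (@le_trans _ _ (\sum_i `|KB i|)).
    by rewrite (bigD1 i)//= lerDl sumr_ge0.
  by rewrite /K addrAC lerDr addr_ge0.
have KC_K i j : KC i j <= K.
  apply: (le_trans (ler_norm _)); apply: (@le_trans _ _ (\sum_j `|KC i j|)).
    by rewrite (bigD1 j)//= lerDl sumr_ge0.
  apply: (@le_trans _ _ (\sum_i \sum_j `|KC i j|)); last by rewrite /K lerDr addr_ge0.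
  by rewrite (bigD1 i)//= lerDl sumr_ge0// => i' _; exact: sumr_ge0.
have K40 : 0 < K ^+ 4 by rewrite exprn_gt0// (lt_le_trans ltr01).
(* Small enough for the mesh condition and for [K ^+ 4 * h <= eta]; [K] no longer changes. *)
pose h := Num.min e1 (eta / K ^+ 4).
have h0 : 0 < h by rewrite lt_min e10 divr_gt0.
pose nodes (S : @simple_process R d T) := [seq node S k | k <- iota 0 (pieces S).+1].
pose q : seq R := s :: flatten [seq nodes (SB i) | i <- enum 'I_n] ++
  flatten [seq nodes (SC ij.1 ij.2) | ij <- enum {: 'I_n * 'I_m}].
have nodesP S : adapted_simple F t0 t S -> forall r, r \in nodes S -> t0 <= r <= t.
  move=> aS r /mapP[k]; rewrite mem_iota add0n ltnS => /andP[_ kS] ->; exact: (node_itv aS kS).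
have qP r : r \in q -> t0 <= r <= t.
  rewrite inE mem_cat => /predU1P[->//|/orP[]/flatten_mapP[i _]]; exact: nodesP.
have [pi [L [[pi0 piL pi_le piq] mesh]]] := exists_partition t0r h0 qP.
have [j0 j0L sj0] : exists2 l, (l <= L)%N & s = pi l by apply: piq; rewrite mem_head.
have rB i : refines pi (SB i).
  move=> k kS; have [|l _ ->] := piq (node (SB i) k); last by exists l.
  rewrite inE mem_cat; apply/orP; right; apply/orP; left; apply/flatten_mapP; exists i.
    by rewrite mem_enum.
  by apply/mapP; exists k => //; rewrite mem_iota add0n ltnS.
have rC i j : refines pi (SC i j).
  move=> k kS; have [|l _ ->] := piq (node (SC i j) k); last by exists l.
  rewrite inE mem_cat; apply/orP; right; apply/orP; right; apply/flatten_mapP; exists (i, j).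
    by rewrite mem_enum.
  by apply/mapP; exists k => //; rewrite mem_iota add0n ltnS.
have pi_itv l : (l <= L)%N -> t0 <= pi l <= t.
  by move=> lL; rewrite -{1}pi0 -piL !(partition_mono pi_le).
pose grid := [seq pi l | l <- iota 0 L.+1].
have gridP r : r \in grid -> t0 <= r <= t.
  by move=> /mapP[l]; rewrite mem_iota add0n ltnS => /andP[_ lL] ->; exact: pi_itv.
have exN l : exists N, [/\ measurable N, P N = 0%E & forall om, ~ N om -> (l <= L)%N ->
    forall i, x (pi l) om i 0 = x t0 om i 0 +
    \int[leb]_(s in `[t0, pi l]) b i s om + \sum_j Z i j (pi l) om].
  have [lL|Ll] := leqP l L; last first.
    by exists set0; split => // om _ h'; exfalso; move: Ll; rewrite ltnNge h'.
  have [N [h1 h2 h3]] := ae_null_cover (ZP _ (pi_itv l lL)).2.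
  by exists N; split => // om /h3.
pose N1 l := sval (cid (exN l)); have N1P l := svalP (cid (exN l)); rewrite -/(N1 _) in N1P.
have exN2 i := ae_null_cover (ib i).
pose N2 i := sval (cid (exN2 i)); have N2P i := svalP (cid (exN2 i)); rewrite -/(N2 _) in N2P.
pose A1 i := [set om | e1 <= l1dist t0 t ((simple_value (SB i))^~ om) (b i ^~ om)].
pose A2 (ij : 'I_n * 'I_m) := [set om | (e1%:E <= edist t0 (sg ij.1 ij.2) (SC ij.1 ij.2) t om)%E].
pose A3 (ij : 'I_n * 'I_m) := [set om | exists2 r, r \in grid &
  (e1 <= `|simple_int_at (fun s om => w s om ij.2 0) (SC ij.1 ij.2) r om - Z ij.1 ij.2 r om|)%R].
pose bad1 := [set om | exists2 i, i \in enum 'I_n & A1 i om].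
pose bad2 := [set om | exists2 ij, ij \in enum {: 'I_n * 'I_m} & A2 ij om].
pose bad3 := [set om | exists2 ij, ij \in enum {: 'I_n * 'I_m} & A3 ij om].
pose bad4 := [set om | exists2 l, l \in iota 0 L.+1 & N1 l om].
pose bad5 := [set om | exists2 i, i \in enum 'I_n & N2 i om].
have mA1 i : measurable (A1 i) by have [_ []] := SBP i.
have mA2 ij : measurable (A2 ij) by have [_ []] := SCP ij.1 ij.2.
have mA3 ij : measurable (A3 ij) by have [_ _ /(_ grid gridP)[]] := SCP ij.1 ij.2.
have mN1 l : measurable (N1 l) by have [] := N1P l.
have mN2 i : measurable (N2 i) by have [] := N2P i.
have m1 : measurable bad1 by exact: measurable_exists_list.
have m2 : measurable bad2 by exact: measurable_exists_list.
have m3 : measurable bad3 by exact: measurable_exists_list.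
have m4 : measurable bad4 by exact: measurable_exists_list.
have m5 : measurable bad5 by exact: measurable_exists_list.
have p1 : (P bad1 <= (n%:R * e1)%:E)%E.
  have := @probability_list_le _ _ _ P _ (enum 'I_n) A1 e1 (fun i _ => mA1 i).
  by rewrite size_enum_ord; apply => i _; have [_ []] := SBP i.
have p2 : (P bad2 <= (n%:R * m%:R * e1)%:E)%E.
  have := @probability_list_le _ _ _ P _ (enum {: 'I_n * 'I_m}) A2 e1 (fun i _ => mA2 i).
  rewrite -cardE card_prod !card_ord natrM; apply => ij _; by have [_ []] := SCP ij.1 ij.2.
have p3 : (P bad3 <= (n%:R * m%:R * (7 * e1))%:E)%E.
  have := @probability_list_le _ _ _ P _ (enum {: 'I_n * 'I_m}) A3 (7 * e1) (fun i _ => mA3 i).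
  rewrite -cardE card_prod !card_ord natrM; apply => ij _; by have [_ _ /(_ grid gridP)[]] := SCP ij.1 ij.2.
have p4 : (P bad4 <= 0%:E)%E.
  have := @probability_list_le _ _ _ P _ (iota 0 L.+1) N1 0 (fun i _ => mN1 i).
  by rewrite mulr0; apply => l _; have [_ ->] := N1P l.
have p5 : (P bad5 <= 0%:E)%E.
  have := @probability_list_le _ _ _ P _ (enum 'I_n) N2 0 (fun i _ => mN2 i).
  by rewrite mulr0; apply => l _; have [_ ->] := N2P l.
pose bad := bad1 `|` bad2 `|` bad3 `|` bad4 `|` bad5.
exists (Stage pi L j0 K h SB SC bad); split => //=.
- by rewrite /h ge_min e1e.
- by rewrite mulrC -ler_pdivlMr// ge_min lexx orbT.
- by move=> i r om; exact: le_trans (KB_K i).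
- by move=> i j r om; exact: le_trans (KC_K i j).
- by do ! apply: measurableU.
- apply: (le_trans (measureU2 _ _ _)); rewrite //; first by do ! apply: measurableU.
  apply: (@le_trans _ _ (((n%:R * e1)%:E + (n%:R * m%:R * e1)%:E + (n%:R * m%:R * (7 * e1))%:E + 0%:E) + 0%:E)%E).
    apply: leeD => //; apply: (le_trans (measureU2 _ _ _)); rewrite //; first by do ! apply: measurableU.
    apply: leeD => //; apply: (le_trans (measureU2 _ _ _)); rewrite //; first by do ! apply: measurableU.
    apply: leeD => //; apply: (le_trans (measureU2 _ _ _)); rewrite //.
    exact: leeD.
  rewrite !adde0 -!EFinD lee_fin -e1c /c.
  rewrite -subr_ge0 (_ : _ - _ = (m%:R + 1) * e1); last by ring.
  by rewrite mulr_ge0 ?(ltW e10)// addr_ge0.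
- move=> om i nb; have : ~ A1 i om.
    by move=> h1; apply: nb; do 4 left; exists i => //; rewrite mem_enum.
  rewrite /A1/= => /negP; rewrite -ltNge => /ltW/le_trans; apply.
  exact: e1e.
- move=> om i j nb; have : ~ A2 (i, j) om.
    by move=> h1; apply: nb; do 3 left; right; exists (i, j) => //; rewrite mem_enum.
  rewrite /A2/= => /negP; rewrite -ltNge => h1.
  have h2 : (0 <= edist t0 (sg i j) (SC i j) t om)%E.
    by apply: integral_ge0 => y _; rewrite lee_fin sqr_ge0.
  apply: le_trans e1e.
  have fe : edist t0 (sg i j) (SC i j) t om \is a fin_num.
    by rewrite ge0_fin_numE// (lt_trans h1)// ltry.
  by rewrite -lee_fin; apply: le_trans (ltW h1); rewrite -(fineK fe).
- move=> om l i nb lL.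
  have nN1 : ~ N1 l om.
    by move=> h1; apply: nb; left; right; exists l => //; rewrite mem_iota add0n ltnS.
  have nN2 : ~ N2 i om by move=> h1; apply: nb; right; exists i => //; rewrite mem_enum.
  have nA1 : l1dist t0 t ((simple_value (SB i))^~ om) (b i ^~ om) < e1.
    rewrite ltNge; apply/negP => h1; apply: nb; do 4 left; exists i => //; by rewrite mem_enum.
  have nA3 j : `|simple_int_at (fun s om => w s om j 0) (SC i j) (pi l) om - Z i j (pi l) om| < e1.
    rewrite ltNge; apply/negP => h1; apply: nb; do 2 left; right; exists (i, j); rewrite ?mem_enum//.
    by exists (pi l) => //; apply/mapP; exists l => //; rewrite mem_iota add0n ltnS.
  have [_ _ /(_ om nN1 lL i) xE] := N1P l.
  have [_ _ /(_ om nN2) ibo] := N2P i.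
  have [_ e_] : itv_integrable t0 (pi l) ((simple_value (SB i))^~ om) /\
      \int[leb]_(r in `[t0, pi l]) simple_value (SB i) r om =
      \sum_(k < l) simple_value (SB i) (pi k.+1) om * (pi k.+1 - pi k).
    rewrite -pi0; apply: (step_integral pi_le (f := fun r => simple_value (SB i) r om)) => k r kl hr.
    exact: (simple_value_step pi_le (rB i)).
  (* The partition refines every simple process, so the Euler state at a node is exactly the initial
     value plus elementary integrals; no discretization error arises here. *)
  have XE : st_X (Stage pi L j0 K h SB SC bad) l om i 0 = x t0 om i 0 +
      \int[leb]_(r in `[t0, pi l]) simple_value (SB i) r om +
      \sum_j simple_int_at (fun s om => w s om j 0) (SC i j) (pi l) om.
    have ie j := simple_int_refine pi_le (aC i j) (rC i j) (fun s om => w s om j 0) l om pi0.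
    rewrite e_ -(eq_bigr _ (fun j _ => ie j)).
    rewrite /st_X /=; elim: l {lL nN1 nA3 xE e_ ie} => [|k ih] /=.
      by rewrite big_ord0 addr0 big1 ?addr0// => j _; rewrite big_ord0.
    rewrite !mxE ih /st_Bv /st_Cv /= big_ord_recr/=.
    rewrite [X in _ = _ + X](_ : _ = \sum_j \sum_(i0 < k) simple_value (SC i j) (pi i0.+1) om *
        (w (pi i0.+1) om j 0 - w (pi i0) om j 0) +
      \sum_j simple_value (SC i j) (pi k.+1) om * (w (pi k.+1) om j 0 - w (pi k) om j 0)).
      by rewrite /incr; ring.
    by rewrite -big_split/=; apply: eq_bigr => j _; rewrite big_ord_recr.
  rewrite XE xE.
  have /andP[p1' p2'] := pi_itv l lL.
  have iS : itv_integrable t0 t ((simple_value (SB i))^~ om).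
    apply: (@itv_integrable_le _ t0 t _ (fun=> KB i)) => //.
    - by apply: measurable_funTS; exact: simple_value_measurable_time.
    - exact: itv_integrable_cst.
  have d1 : `|\int[leb]_(r in `[t0, pi l]) simple_value (SB i) r om - \int[leb]_(r in `[t0, pi l]) b i r om| <= e1.
    have sub f : itv_integrable t0 t f -> itv_integrable t0 (pi l) f by exact: itv_integrableS.
    rewrite -itv_integralB; [|exact: sub|exact: sub].
    apply: (le_trans (itv_norm_integral_le (itv_integrableB (sub _ iS) (sub _ ibo)))).
    apply: le_trans (ltW nA1); apply: itv_integral_mono => //.
    by apply: itv_integrable_norm; exact: itv_integrableB.
  have d2 : `|\sum_j simple_int_at (fun s om => w s om j 0) (SC i j) (pi l) om - \sum_j Z i j (pi l) om| <= m%:R * e1.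
    rewrite -sumrB; apply: (le_trans (ler_norm_sum _ _ _)); apply: ler_sum_ord => j; exact: ltW.
  rewrite (_ : _ - _ = (\int[leb]_(r in `[t0, pi l]) simple_value (SB i) r om - \int[leb]_(r in `[t0, pi l]) b i r om) +
    (\sum_j simple_int_at (fun s om => w s om j 0) (SC i j) (pi l) om - \sum_j Z i j (pi l) om)); last by ring.
  apply: (le_trans (ler_normD _ _)); apply: (le_trans (lerD d1 d2)).
  rewrite -e1c /c.
  rewrite -subr_ge0 (_ : _ - _ = (n%:R + n%:R * m%:R * 8) * e1); last by ring.
  by rewrite mulr_ge0 ?(ltW e10)// addr_ge0// mulr_ge0.
Unshelve. all: by end_near. Qed.

End stages.

Section scheme_bound.
Context {R : realType} d {T : measurableType d}.
Context (n m : nat) (w : R -> T -> 'cV[R]_m) (tau : R) (V : R -> 'cV[R]_n -> R).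
Hypotheses (tau0 : 0 <= tau) (hV : classC21 tau V).
Variables (pi : nat -> R) (K h N M Tm Rd C1 : R) (X0 : T -> 'cV[R]_n).
Variables (B : nat -> 'I_n -> T -> R) (C : nat -> 'I_n -> 'I_m -> T -> R).
Hypotheses (pi0 : 0 <= pi 0%N) (pi_le : forall k, pi k <= pi k.+1) (hh : forall k, pi k.+1 - pi k <= h).
Hypotheses (bB : forall k i om, `|B k i om| <= K) (bC : forall k i j om, `|C k i j om| <= K).
Hypotheses (N0 : 0 < N) (M0 : 0 < M) (K1 : 1 <= K) (Kh : K ^+ 4 * h <= 1) (C10 : 0 <= C1).
Hypothesis coer : forall r x, 0 <= r <= Tm -> V r x < N -> `|x| <= Rd.
Hypothesis bVt : forall r x, 0 <= r <= Tm -> `|x| <= Rd -> `|V_t tau V r x| <= C1.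
Hypothesis bVx : forall i r x, 0 <= r <= Tm -> `|x| <= Rd -> `|V_x V r x 0 i| <= C1.
Hypothesis bVxx : forall i j r x, 0 <= r <= Tm -> `|x| <= Rd -> `|V_xx V r x i j| <= C1.

(** Uniform in the path, the partition and [K], as domination requires. The derivatives of [V] are
    bounded where the weight is nonzero, and the coefficients are paid for by the weighted control;
    [1 + n] comes from bounding the second-order term by the squared diffusion coefficients. *)
Lemma scheme_bound j0 l om : pi l <= Tm ->
  `|\sum_(k < l | (j0 <= k)%N) weight' w V pi X0 B C N M k om *
     generator w tau V pi X0 B C k om * (pi k.+1 - pi k)| <=
  C1 * (Tm + (1 + n%:R) * (M + (n%:R + n%:R * m%:R))).
Proof.
move=> lT; have K0 : 0 <= K by exact: le_trans K1.
have h0 : 0 <= h by apply: le_trans (hh 0%N); rewrite subr_ge0.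
have p0 k : 0 <= pi k by exact: partition_ge0.
have step (k : 'I_l) : `|weight' w V pi X0 B C N M k om *
     generator w tau V pi X0 B C k om * (pi k.+1 - pi k)| <=
    C1 * ((pi k.+1 - pi k) + (1 + n%:R) * (weight pi B C M k om * control_incr pi B C k om)).
  have kT : 0 <= pi k <= Tm.
    by rewrite p0 (le_trans _ lT)//; apply: partition_mono => //; exact: ltnW.
  have D0 : 0 <= pi k.+1 - pi k by rewrite subr_ge0.
  have w0 := weight_ge0 pi B C M k om; have w1 : weight pi B C M k om <= 1 by exact: weight_le1.
  set X := euler_state w pi X0 B C k om.
  have V0 : 0 <= V (pi k) X by apply: (C21_ge0 hV); rewrite (le_trans _ (p0 k))// oppr_le0.
  have hdG (G : R) : (V (pi k) X < N -> `|G| <= C1) -> `|hcap_d N (V (pi k) X) * G| <= C1.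
    move=> hG; have [NV|VN] := leP N (V (pi k) X); first by rewrite hcap_d_eq0// mul0r normr0.
    rewrite normrM; apply: (@le_trans _ _ (1 * C1)); last by rewrite mul1r.
    apply: ler_pM => //; last exact: hG.
    by rewrite ger0_norm ?hcap_d_ge0// hcap_d_le1.
  have gT : `|hcap_d N (V (pi k) X) * V_t tau V (pi k) X| <= C1.
    by apply: hdG => VN; apply: bVt => //; exact: coer VN.
  have gX i : `|hcap_d N (V (pi k) X) * V_x V (pi k) X 0 i| <= C1.
    by apply: hdG => VN; apply: bVx => //; exact: coer VN.
  have gXX i j : `|hcap_d N (V (pi k) X) * V_xx V (pi k) X i j| <= C1.
    by apply: hdG => VN; apply: bVxx => //; exact: coer VN.
  pose SB := \sum_i `|B k i om|; pose SC := \sum_i \sum_j C k i j om ^+ 2.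
  have SB0 : 0 <= SB by exact: sumr_ge0.
  have SC0 : 0 <= SC by apply: sumr_ge0 => i _; apply: sumr_ge0 => j _; exact: sqr_ge0.
  have gen : `|hcap_d N (V (pi k) X) * generator w tau V pi X0 B C k om| <=
      C1 * (1 + SB + n%:R * SC).
    rewrite /generator -/X !mulrDr mulr1.
    apply: (le_trans (ler_normD _ _)); apply: lerD.
      apply: (le_trans (ler_normD _ _)); apply: lerD; first exact: gT.
      rewrite mulr_sumr (le_trans (ler_norm_sum _ _ _))// mulr_sumr; apply: ler_sum => i _.
      by rewrite mulrA normrM ler_wpM2r.
    have q : \sum_i \sum_j `|hcap_d N (V (pi k) X) * V_xx V (pi k) X i j * \sum_p C k j p om * C k i p om| <=
        C1 * (2 * (n%:R * SC)).
      apply: (@le_trans _ _ (\sum_i \sum_j C1 * (\sum_p C k j p om ^+ 2 + \sum_p C k i p om ^+ 2))).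
        apply: ler_sum => i _; apply: ler_sum => j _; rewrite normrM; apply: ler_pM => //.
        rewrite (le_trans (ler_norm_sum _ _ _))// -big_split/=; apply: ler_sum => p _.
        exact: norm_mul_le.
      rewrite le_eqVlt; apply/orP; left; apply/eqP.
      under eq_bigr do rewrite -mulr_sumr big_split/= sumr_const card_ord -mulr_natl.
      rewrite -mulr_sumr big_split/= sumr_const card_ord -mulr_natl -mulr_sumr -/SC; ring.
    rewrite mulrCA normrM (ger0_norm (_ : 0 <= 2^-1 :> R)) ?invr_ge0//.
    rewrite ler_pdivrMl// [leRHS]mulrCA.
    apply: le_trans q; rewrite mulr_sumr (le_trans (ler_norm_sum _ _ _))//; apply: ler_sum => i _.
    rewrite mulr_sumr (le_trans (ler_norm_sum _ _ _))//; apply: ler_sum => j _.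
    by rewrite mulrA.
  rewrite normrM (ger0_norm D0) /weight' -/X -mulrA normrM (ger0_norm w0).
  apply: (@le_trans _ _ (weight pi B C M k om * (C1 * (1 + SB + n%:R * SC)) * (pi k.+1 - pi k))).
    by rewrite ler_wpM2r// ler_wpM2l.
  rewrite /control_incr -/SB -/SC.
  set W := weight pi B C M k om; set De := pi k.+1 - pi k.
  rewrite (_ : W * (C1 * (1 + SB + n%:R * SC)) * De = C1 * (W * De + (W * De) * (SB + n%:R * SC))); last by ring.
  apply: ler_wpM2l => //; apply: lerD; first by rewrite ler_piMl.
  rewrite (_ : (1 + n%:R) * (W * ((SB + SC) * De)) = (W * De) * ((1 + n%:R) * (SB + SC))); last by ring.
  apply: ler_wpM2l; first exact: mulr_ge0.
  rewrite mulrDl mul1r mulrDr.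
  have : 0 <= n%:R * SB by rewrite mulr_ge0.
  lra.
apply: (le_trans (ler_norm_sum _ _ _)).
apply: (@le_trans _ _ (\sum_(k < l) C1 * ((pi k.+1 - pi k) + (1 + n%:R) * (weight pi B C M k om * control_incr pi B C k om)))).
  rewrite [leRHS](bigID (fun k : 'I_l => (j0 <= k)%N))/=.
  apply: (le_trans (ler_sum _ (fun k _ => step k))); rewrite lerDl; apply: sumr_ge0 => k _.
  exact: le_trans (step k).
rewrite -mulr_sumr ler_wpM2l// big_split/=; apply: lerD.
  apply: le_trans lT; rewrite -(big_mkord xpredT (fun k => pi k.+1 - pi k)) telescope_sumr//.
  by rewrite lerBlDr lerDl.
rewrite -mulr_sumr ler_wpM2l ?addr_ge0//.
apply: weighted_control_le => // k; apply: (le_trans (control_incr_le pi_le bB bC K0 k om)).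
have hb := hh k; have D0 : 0 <= pi k.+1 - pi k by rewrite subr_ge0.
have k1 : K * (pi k.+1 - pi k) <= 1.
  apply: le_trans Kh; apply: ler_pM => //; by rewrite -[X in X <= _]expr1 ler_weXn2l.
have k2 : K ^+ 2 * (pi k.+1 - pi k) <= 1.
  by apply: le_trans Kh; apply: ler_pM => //; rewrite ?sqr_ge0// ler_weXn2l.
rewrite mulrDl; apply: lerD; first by rewrite -mulrA ler_piMr.
by rewrite -mulrA ler_piMr// mulr_ge0.
Qed.

End scheme_bound.

Lemma ae_forall_fin d (T : measurableType d) (R : realType) (P : {measure set T -> \bar R}) (I : finType)
    (Q : I -> T -> Prop) :
  (forall i, {ae P, forall om, Q i om}) -> {ae P, forall om, forall i, Q i om}.
Proof.
move=> h; have : {ae P, forall om, forall i, i \in enum I -> Q i om}.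
  elim: (enum I) => [|i q ih]; first by apply: aeW => om i; rewrite in_nil.
  apply: filterS2 (h i) ih => om h1 h2 i'; rewrite inE => /predU1P[->//|]; exact: h2.
by apply: filterS => om h' i; apply: h'; rewrite mem_enum.
Qed.

Section truncated_ito.
Context {R : realType} d {T : measurableType d} (P : probability T R).
Context (F : R -> set (set T)) (hF : usual_conditions P F).
Context (n m : nat) (w : R -> T -> 'cV[R]_m) (hw : brownian P F w).
Context (tau : R) (V : R -> 'cV[R]_n -> R).
Hypotheses (tau0 : 0 <= tau) (hV : classC21 tau V).
Local Notation leb := (@lebesgue_measure R).
Local Notation TG g := (g_sigma_algebraType (F g)).
Variables (N M Rd t0 s t : R) (x : R -> T -> 'cV[R]_n).
Variables (b : 'I_n -> R -> T -> R) (sg : 'I_n -> 'I_m -> R -> T -> R).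
Hypotheses (N0 : 0 < N) (M0 : 0 < M) (t00 : 0 <= t0) (t0t : t0 < t) (st : t0 <= s <= t).
Hypothesis coer : forall r x, 0 <= r <= t -> V r x < N -> `|x| <= Rd.
Hypothesis mx0 : forall i, rv_measurable (F t0) (fun om => x t0 om i 0).
Hypothesis cx : forall om (r_ : nat -> R) r, (forall k, t0 <= r_ k <= t) -> t0 <= r <= t ->
  r_ k @[k --> \oo] --> r -> forall i, x (r_ k) om i 0 @[k --> \oo] --> x r om i 0.
Hypothesis jb : forall i g, t0 <= g -> measurable_fun (setT `*` `[t0, g]) (fun z : TG g * R => b i z.2 z.1).
Hypothesis jsg : forall i j g, t0 <= g -> measurable_fun (setT `*` `[t0, g]) (fun z : TG g * R => sg i j z.2 z.1).
Hypothesis ib : forall i, {ae P, forall om, itv_integrable t0 t (b i ^~ om)}.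
Hypothesis isg : forall i j, {ae P, forall om, itv_integrable t0 t (fun r => sg i j r om ^+ 2)}.
Hypothesis eqn : forall r, t0 <= r <= t -> exists Z : 'I_n -> 'I_m -> T -> R,
  (forall i j, is_ito_integral P F (fun s om => w s om j 0) t0 r (sg i j) (Z i j)) /\
  {ae P, forall om, forall i, x r om i 0 = x t0 om i 0 +
    \int[leb]_(s in `[t0, r]) b i s om + \sum_j Z i j om}.

Definition path_control r om : R := control_limit t0 (fun i => b i ^~ om) (fun i j => sg i j ^~ om) r.
Definition path_boundary r om : R := hcap_d M (path_control r om) * hcap N (V r (x r om)).
Definition path_rate r om : R :=
  weight_limit V N M t0 s t (x ^~ om) (fun i => b i ^~ om) (fun i j => sg i j ^~ om) r *
  gen_limit tau V (x ^~ om) (fun i => b i ^~ om) (fun i j => sg i j ^~ om) r.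

(** A sequence of stages with summable bad events converges along almost every path, and all terms
    are bounded independently of the stage, so [scheme_inequality] passes to the limit by dominated
    convergence. *)
Lemma truncated_ito :
  [/\ measurable_fun setT (path_boundary s), measurable_fun setT (path_boundary t),
      P.-integrable setT (EFin \o (fun om => \int[leb]_(r in `[t0, t]) path_rate r om)) &
      \int[P]_om path_boundary t om <= \int[P]_om path_boundary s om +
        \int[P]_om \int[leb]_(r in `[t0, t]) path_rate r om].
Proof.
have /andP[t0s st'] := st.
have t0' : 0 <= t by rewrite (le_trans t00)// ltW.
(* Accuracy and probability of the bad event of stage [k]; summable, for the Borel-Cantelli
   lemma. *)
pose e_ k : R := 1 / (2 ^ k.+1)%:R.
have e_0 k : 0 < e_ k by rewrite divr_gt0// ltr0n expn_gt0.
have ce : e_ k @[k --> \oo] --> 0.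
  have := @cvg_geometric R 2^-1 2^-1; rewrite ger0_norm ?invr_ge0// invf_lt1// ltr1n => /(_ isT).
  apply: cvg_trans; apply: near_eq_cvg; apply: nearW => k /=.
  by rewrite /e_ div1r natrX exprS invfM exprVn.
have exeta k := scheme_inequality hF hw tau0 hV N0 M0 t0' coer (e_0 k).
pose eta k := sval (cid2 (exeta k)).
have etaP k := svalP (cid2 (exeta k)).
have eta0 k : 0 < eta k by rewrite /eta; case: cid2.
(* The minimum with 1 secures [K ^+ 4 * h <= 1], required by [scheme_bound]. *)
have eta'0 k : 0 < Num.min (eta k) 1 by rewrite lt_min eta0 ltr01.
have exS k := stage_exists hF hw t00 t0t st jb jsg ib eqn (e_0 k) (eta'0 k).
pose S k := sval (cid (exS k)).
have SP k : stage_ok P F w t0 s t x b sg (e_ k) (Num.min (eta k) 1) (S k) by exact: svalP (cid (exS k)).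
pose Phi k om := \sum_(l < st_L (S k) | (st_j (S k) <= l)%N)
  weight' w V (st_pi (S k)) (x t0) (st_Bv (S k)) (st_Cv (S k)) N M l om *
  generator w tau V (st_pi (S k)) (x t0) (st_Bv (S k)) (st_Cv (S k)) l om *
  (st_pi (S k) l.+1 - st_pi (S k) l).
pose bd k l om := weight (st_pi (S k)) (st_Bv (S k)) (st_Cv (S k)) M l om *
  capped w V (st_pi (S k)) (x t0) (st_Bv (S k)) (st_Cv (S k)) N l om.
have pi0 k : 0 <= st_pi (S k) 0%N by rewrite (ok_0 (SP k)).
have mX0 k i : rv_measurable (F (st_pi (S k) 0%N)) (fun om => x t0 om i 0) by rewrite (ok_0 (SP k)).
have Fs r : 0 <= r -> sigma_algebra setT (F r) by exact: (filtration_sigma hF).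
have Fi r r' : 0 <= r -> r <= r' -> F r `<=` F r' by exact: (filtration_incr hF).
have rB k i : refines (st_pi (S k)) (st_B (S k) i) by case: (SP k).
have rC k i j : refines (st_pi (S k)) (st_C (S k) i j) by case: (SP k).
have mB k l i : rv_measurable (F (st_pi (S k) l)) (st_Bv (S k) l i).
  have p0 := partition_ge0 (pi0 k) (ok_le (SP k)) l.
  exact: (@simple_value_rv_measurable R d T F Fs Fi (st_pi (S k)) t0 t (st_B (S k) i) (pi0 k) (ok_le (SP k)) (ok_aB (SP k) i) (rB k i) l).
have mC k l i j : rv_measurable (F (st_pi (S k) l)) (st_Cv (S k) l i j).
  exact: (@simple_value_rv_measurable R d T F Fs Fi (st_pi (S k)) t0 t (st_C (S k) i j) (pi0 k) (ok_le (SP k)) (ok_aC (SP k) i j) (rC k i j) l).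
have bB k l i om : `|st_Bv (S k) l i om| <= st_K (S k) by exact: (ok_bB (SP k) _ _ _).
have bC k l i j om : `|st_Cv (S k) l i j om| <= st_K (S k) by exact: (ok_bC (SP k) _ _ _ _).
have Kh k : st_K (S k) ^+ 4 * st_h (S k) <= eta k.
  by apply: (le_trans (ok_Kh (SP k))); rewrite ge_min lexx.
have Kh1 k : st_K (S k) ^+ 4 * st_h (S k) <= 1.
  by apply: (le_trans (ok_Kh (SP k))); rewrite ge_min lexx orbT.
have LT k : st_pi (S k) (st_L (S k)) <= t by rewrite (ok_L (SP k)).
have scheme k : P.-integrable setT (EFin \o Phi k) /\
    \int[P]_om bd k (st_L (S k)) om <= \int[P]_om bd k (st_j (S k)) om + \int[P]_om Phi k om + e_ k.
  have [_ h] := etaP k.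
  exact: (h _ _ _ _ _ _ _ _ (pi0 k) (ok_le (SP k)) (ok_mesh (SP k)) (mX0 k) (mB k) (mC k) (bB k) (bC k)
    (ok_K (SP k)) (Kh k) (ok_jL (SP k)) (LT k)).
have [C1 C10 [bVt bVx bVxx]] := @derivative_bound R n tau V tau0 hV t Rd.
pose CB := C1 * (t + (1 + n%:R) * (M + (n%:R + n%:R * m%:R))).
have bPhi k om : `|Phi k om| <= CB.
  apply: (@scheme_bound R d T n m w tau V tau0 hV (st_pi (S k)) (st_K (S k)) (st_h (S k)) N M t Rd C1) => //.
  - exact: (ok_le (SP k)).
  - exact: (ok_mesh (SP k)).
  - exact: (ok_K (SP k)).
have bbd k l om : `|bd k l om| <= N / 2.
  have V0 : 0 <= V (st_pi (S k) l) (euler_state w (st_pi (S k)) (x t0) (st_Bv (S k)) (st_Cv (S k)) l om).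
    apply: (C21_ge0 hV); rewrite (le_trans _ (partition_ge0 (pi0 k) (ok_le (SP k)) l))// oppr_le0//.
  have c0 : 0 <= capped w V (st_pi (S k)) (x t0) (st_Bv (S k)) (st_Cv (S k)) N l om by exact: hcap_ge0.
  rewrite ger0_norm; last by apply: mulr_ge0; [exact: weight_ge0|exact: c0].
  apply: (@le_trans _ _ (capped w V (st_pi (S k)) (x t0) (st_Bv (S k)) (st_Cv (S k)) N l om)).
    by apply: ler_piMl => //; apply: weight_le1 => //; exact: (ok_le (SP k)).
  exact: hcap_le.
have mbd k l : measurable_fun setT (bd k l).
  have [i _] := mean_weighted_capped hF hw tau0 hV (pi0 k) (ok_le (SP k)) (mX0 k) (mB k) (mC k) N0 M0 l.
  by apply/measurable_EFinP; exact: measurable_int i.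
have mPhi k : measurable_fun setT (Phi k).
  by apply/measurable_EFinP; have [i _] := scheme k; exact: measurable_int i.
have nbad : {ae P, forall om, exists k0, forall k, (k0 <= k)%N -> ~ st_bad (S k) om}.
  have mbad k : measurable (st_bad (S k)) by exact: (ok_bad (SP k)).
  exists (lim_sup_set (fun k => st_bad (S k))); split.
  - by apply: bigcapT_measurable => k; apply: bigcup_measurable.
  - apply: lim_sup_set_cvg0 => //; apply: (@le_lt_trans _ _ 1%:E); last exact: ltry.
    apply: le_trans (@epsilon_trick0 R 1 xpredT ler01); apply: lee_nneseries => // k _.
    exact: (ok_Pbad (SP k)).
  - move=> om; apply: contraPP => h1 h2; apply: h1 => k0 _.
    apply: contrapT => h3; apply: h2; exists k0 => k kk; apply: contra_not h3 => h4.
    by exists k.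
pose good om := (exists k0, forall k, (k0 <= k)%N -> ~ st_bad (S k) om) /\
  ((forall i, itv_integrable t0 t (b i ^~ om)) /\
   (forall ij : 'I_n * 'I_m, itv_integrable t0 t (fun r => sg ij.1 ij.2 r om ^+ 2))).
have aegood : {ae P, forall om, good om}.
  have h1 := ae_forall_fin ib.
  have h2 := ae_forall_fin (fun ij : 'I_n * 'I_m => isg ij.1 ij.2).
  by apply: filterS3 nbad h1 h2 => om ? ? ?; split.
have limits om : good om -> [/\
    Phi k om @[k --> \oo] --> \int[leb]_(r in `[t0, t]) path_rate r om,
    bd k (st_L (S k)) om @[k --> \oo] --> path_boundary t om &
    bd k (st_j (S k)) om @[k --> \oo] --> path_boundary s om].
  move=> [[k0 hk0] [ibo isgo]].
  have isgo' i j := isgo (i, j).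
  (* The sequence is restarted after the last bad event of this path; shifting does not change the
     limits. *)
  pose S' k := S (k + k0)%N.
  have nb k : ~ st_bad (S' k) om by apply: hk0; rewrite leq_addl.
  have ce' : e_ (k + k0)%N @[k --> \oo] --> 0 by rewrite (cvg_shiftn k0 e_).
  have msg i j := sg_section hF t00 t0t jsg i j om.
  have fB_val k i l r : (l < st_L (S' k))%N -> st_pi (S' k) l < r <= st_pi (S' k) l.+1 ->
      simple_value (st_B (S' k) i) r om = st_Bv (S' k) l i om.
    by move=> _ hr; exact: (simple_value_step (ok_le (SP _)) (rB _ i)).
  have fC_val k i j l r : (l < st_L (S' k))%N -> st_pi (S' k) l < r <= st_pi (S' k) l.+1 ->
      simple_value (st_C (S' k) i j) r om = st_Cv (S' k) l i j om.
    by move=> _ hr; exact: (simple_value_step (ok_le (SP _)) (rC _ i j)).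
  have fB_int k i : itv_integrable t0 t (fun r => simple_value (st_B (S' k) i) r om).
    apply: (@itv_integrable_le _ t0 t _ (fun=> st_K (S' k))).
    - by apply: measurable_funTS; exact: simple_value_measurable_time.
    - exact: itv_integrable_cst.
    - by move=> r _; exact: (ok_bB (SP _) _ _ _).
  have fC_meas k i j : measurable_fun `[t0, t] (fun r => simple_value (st_C (S' k) i j) r om).
    by apply: measurable_funTS; exact: simple_value_measurable_time.
  have fC_int k i j : itv_integrable t0 t (fun r => simple_value (st_C (S' k) i j) r om ^+ 2).
    apply: (@itv_integrable_le _ t0 t _ (fun=> st_K (S' k) ^+ 2)).
    - exact: measurable_funX.
    - exact: itv_integrable_cst.
    - move=> r _; rewrite normrX; apply: lerXn2r; rewrite ?nnegrE//.
        exact: le_trans ler01 (ok_K (SP _)).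
      exact: (ok_bC (SP _) _ _ _ _).
  have hX k l i : (l <= st_L (S' k))%N ->
      `|st_X w t0 x (S' k) l om i 0 - x (st_pi (S' k) l) om i 0| <= e_ (k + k0)%N.
    by have [_ _ _ _ _ _ _ _ _ _ _ _ _ _ _ _ _ _ _ dX] := SP (k + k0)%N; exact: dX (nb k).
  have hB k i : \int[leb]_(r in `[t0, t]) `|simple_value (st_B (S' k) i) r om - b i r om| <= e_ (k + k0)%N.
    by have [_ _ _ _ _ _ _ _ _ _ _ _ _ _ _ _ _ dB _ _] := SP (k + k0)%N; exact: dB (nb k).
  have hC k i j : \int[leb]_(r in `[t0, t]) ((simple_value (st_C (S' k) i j) r om - sg i j r om) ^+ 2) <= e_ (k + k0)%N.
    by have [_ _ _ _ _ _ _ _ _ _ _ _ _ _ _ _ _ _ dC _] := SP (k + k0)%N; exact: dC (nb k).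
  have pi_le k l := ok_le (SP (k + k0)%N) l.
  have mesh k l : st_pi (S' k) l.+1 - st_pi (S' k) l <= e_ (k + k0)%N.
    exact: le_trans (ok_mesh (SP _) l) (ok_he (SP _)).
  have pi_0 k := ok_0 (SP (k + k0)%N); have pi_L k := ok_L (SP (k + k0)%N).
  have pi_j k := ok_j (SP (k + k0)%N); have jL k := ok_jL (SP (k + k0)%N).
  pose X' k l := st_X w t0 x (S' k) l om.
  pose B' k i l := st_Bv (S' k) l i om.
  pose C' k i j l := st_Cv (S' k) l i j om.
  pose fB k i r := simple_value (st_B (S' k) i) r om.
  pose fC k i j r := simple_value (st_C (S' k) i j) r om.
  have [_ c1] := sum_cvg (x := x ^~ om) (b := fun i => b i ^~ om) (sg := fun i j => sg i j ^~ om)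
    (X_ := X') (B_ := B') (C_ := C') (fB_ := fB) (fC_ := fC) tau0 hV N0 M0 t00 t0s st' coer (@cx om) ibo msg isgo' ce' pi_le pi_0 pi_L pi_j mesh
    fB_val fC_val hX fB_int fC_meas fC_int hB hC.
  have c2 := boundary_cvg (x := x ^~ om) (b := fun i => b i ^~ om) (sg := fun i j => sg i j ^~ om)
    (X_ := X') (B_ := B') (C_ := C') (fB_ := fB) (fC_ := fC) tau0 hV N0 M0 t00 t0s st' (@cx om) ibo msg isgo' ce' pi_le pi_0 pi_L
    fB_val fC_val hX fB_int fC_meas fC_int hB hC.
  split.
  - by rewrite -(cvg_shiftn k0); exact: c1.
  - rewrite -(cvg_shiftn k0).
    apply: (c2 (fun k => st_L (S' k)) t) => //; first by rewrite (ltW t0t) lexx.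
    by under eq_fun do rewrite pi_L; exact: cvg_cst.
  - rewrite -(cvg_shiftn k0).
    apply: (c2 (fun k => st_j (S' k)) s) => //.
    by under eq_fun do rewrite pi_j; exact: cvg_cst.
have cP := filtration_complete hF.
have ae1 : {ae P, forall om, Phi k om @[k --> \oo] --> \int[leb]_(r in `[t0, t]) path_rate r om}.
  by apply: filterS aegood => om /limits[].
have ae2 : {ae P, forall om, bd k (st_L (S k)) om @[k --> \oo] --> path_boundary t om}.
  by apply: filterS aegood => om /limits[].
have ae3 : {ae P, forall om, bd k (st_j (S k)) om @[k --> \oo] --> path_boundary s om}.
  by apply: filterS aegood => om /limits[].
have mr := measurable_ae_cvg cP mPhi ae1.
have mt := measurable_ae_cvg cP (fun k => mbd k _) ae2.
have ms := measurable_ae_cvg cP (fun k => mbd k _) ae3.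
have icst (c : R) : P.-integrable setT (EFin \o (fun=> c)) by exact: finite_measure_integrable_cst.
have toD (f_ : nat -> T -> R) (f : T -> R) : {ae P, forall om, f_ k om @[k --> \oo] --> f om} ->
    {ae P, forall om, setT om -> f_ k om @[k --> \oo] --> f om}.
  by apply: filterS => om h _.
have [i1 c1] := Rintegral_dominated measurableT mPhi mr (toD _ _ ae1) (icst CB) (fun k om _ => bPhi k om).
have [_ c2] := Rintegral_dominated measurableT (fun k => mbd k _) mt (toD _ _ ae2) (icst (N / 2)) (fun k om _ => bbd k _ om).
have [_ c3] := Rintegral_dominated measurableT (fun k => mbd k _) ms (toD _ _ ae3) (icst (N / 2)) (fun k om _ => bbd k _ om).
split => //.
have c4 : \int[P]_om bd k (st_j (S k)) om + \int[P]_om Phi k om + e_ k @[k --> \oo] -->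
    \int[P]_om path_boundary s om + \int[P]_om \int[leb]_(r in `[t0, t]) path_rate r om.
  by rewrite -[X in _ --> X]addr0; apply: cvgD => //; exact: cvgD.
apply: (ler_cvg_to c2 c4); apply: nearW => k; exact: (scheme k).2.
Qed.

End truncated_ito.

(** * The Ito inequality for solutions *)

Lemma integrable_fine d (T : measurableType d) (R : realType) (mu : {measure set T -> \bar R})
    (D : set T) (f : T -> \bar R) : measurable D -> mu.-integrable D f ->
  mu.-integrable D (EFin \o (fine \o f)) /\
  \int[mu]_(x in D) fine (f x) = fine (\int[mu]_(x in D) f x)%E.
Proof.
move=> mD fi; have mf : measurable_fun D f := measurable_int mu fi.
have mff : measurable_fun D (EFin \o (fine \o f)).
  by apply/measurable_EFinP; exact: measurableT_comp.
split.
  apply: (le_integrable mD mff _ fi) => x Dx /=.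
  by case: (f x) => [r| |] //=; rewrite ?normr0 leey.
rewrite /Rintegral; congr fine; apply: ae_eq_integral => //.
apply: filterS (integrable_ae mD fi) => x h Dx /=; rewrite fineK//; exact: h.
Qed.

Lemma itv_integral_indic {R : realType} (t0 s t : R) (e : R -> R) : t0 <= s -> s <= t ->
  itv_integrable t0 t e ->
  \int[@lebesgue_measure R]_(r in `[t0, t]) (\1_(`]s, t]%classic) r * e r) =
  \int[@lebesgue_measure R]_(r in `[s, t]) e r.
Proof.
move=> t0s st ie.
have i1 : itv_integrable t0 t (fun r => \1_(`]s, t]%classic) r * e r).
  apply: (@itv_integrable_le _ t0 t _ (fun r => `|e r|)).
  - apply: measurable_funM; last exact: itv_integrable_measurable ie.
    by apply: measurable_funTS; exact: measurable_indic.
  - exact: itv_integrable_norm.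
  - by move=> r _; rewrite normrM indicE ler_piMl// ger0_norm ?lern1 ?leq_b1.
rewrite (itv_integral_cat t0s st i1).
have -> : \int[@lebesgue_measure R]_(r in `[t0, s]) (\1_(`]s, t]%classic) r * e r) = 0.
  rewrite (@eq_Rintegral _ _ _ _ _ (fun=> 0)); first by rewrite itv_integral_cst// mul0r.
  move=> r /set_mem; rewrite /= in_itv/= => /andP[_ rs].
  by rewrite indicE memNset ?mul0r//= in_itv/= ltNge rs.
rewrite add0r.
have i2 : itv_integrable s t (fun r => \1_(`]s, t]%classic) r * e r) by exact: itv_integrableS i1.
have sub f : itv_integrable s t f -> (@lebesgue_measure R).-integrable `]s, t] (EFin \o f).
  move=> h; apply: integrableS h => //; exact: subset_itv_oc_cc.
rewrite -(Rintegral_itv_obnd_cbnd (sub _ i2)) -[RHS](Rintegral_itv_obnd_cbnd (sub _ (itv_integrableS t0s (lexx t) ie))).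
by apply: eq_Rintegral => r rst; rewrite indicE (_ : (r \in _) = true) ?mul1r.
Qed.

Section fubini_interval.
Context {R : realType} d {T : measurableType d} (P : probability T R) (a b : R) (f : T -> R -> R).
Local Notation leb := (@lebesgue_measure R).
Hypothesis mf : measurable_fun (setT `*` `[a, b]) (fun z : T * R => f z.1 z.2).

Lemma measurable_mean_norm : measurable_fun `[a, b] (fun r => 'E_P[fun om => `|f om r|%R])%E.
Proof.
pose D : set (T * R) := setT `*` `[a, b].
have mD : measurable D by exact: measurableX.
pose g (z : T * R) : \bar R := ((fun z => (`|f z.1 z.2|)%:E) \_ D) z.
have mg : measurable_fun setT g.
  by apply/(measurable_restrictT _ mD); apply/measurable_EFinP; exact: measurableT_comp.
have h : measurable_fun setT (fubini_G P g).
  apply: (@measurable_fun_fubini_tonelli_G _ _ _ _ _ P g) => // z.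
  by rewrite /g patchE; case: ifP.
apply: eq_measurable_fun (measurable_funTS h) => r rab.
rewrite /fubini_G unlock; apply: eq_integral => om _; rewrite /g patchE.
by rewrite mem_set//; split => //; exact: set_mem.
Qed.

Hypothesis fi : (\int[leb]_(r in `[a, b]) 'E_P[fun om => `|f om r|%R] < +oo)%E.

(** The integrand is extended by zero outside of the strip, which turns the claim into Fubini's
    theorem on the whole product; values of the inner integrals are real almost everywhere and
    [integrable_fine] removes the exceptional ones. *)
Lemma itv_fubini : [/\ {ae P, forall om, itv_integrable a b (f om)},
  P.-integrable setT (EFin \o (fun om => \int[leb]_(r in `[a, b]) f om r)),
  itv_integrable a b (fun r => fine ('E_P[f ^~ r])%E) &
  \int[P]_om \int[leb]_(r in `[a, b]) f om r = \int[leb]_(r in `[a, b]) fine ('E_P[f ^~ r])%E].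
Proof.
pose D : set (T * R) := setT `*` `[a, b].
have mD : measurable D by exact: measurableX.
pose g (z : T * R) : \bar R := ((fun z => (f z.1 z.2)%:E) \_ D) z.
have mg : measurable_fun setT g.
  by apply/(measurable_restrictT _ mD); exact/measurable_EFinP.
have gE om r : g (om, r) = ((fun r => (f om r)%:E) \_ `[a, b]) r.
  rewrite /g !patchE; congr (if _ then _ else _).
  by apply/idP/idP => /set_mem h; apply/mem_set; [case: h|split].
have ig : (P \x leb)%E.-integrable setT g.
  apply/(integrable21ltyP P leb mg); move: fi; rewrite integral_mkcond; congr (_ < _)%E.
  apply: eq_integral => r _; rewrite patchE; case: ifPn => rab.
    by rewrite unlock; apply: eq_integral => om _; rewrite gE patchE rab.
  by rewrite integral0_eq// => om _; rewrite gE patchE (negbTE rab) abse0.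
have eF om : fubini_F leb g om = (\int[leb]_(r in `[a, b]) (f om r)%:E)%E.
  by rewrite /fubini_F [RHS]integral_mkcond; apply: eq_integral => r _; rewrite gE.
have eG r : r \in `[a, b]%classic -> fubini_G P g r = ('E_P[f ^~ r])%E.
  by move=> rab; rewrite /fubini_G unlock; apply: eq_integral => om _; rewrite gE patchE rab.
have eG0 r : r \notin `[a, b]%classic -> fubini_G P g r = 0%E.
  by move=> rab; rewrite /fubini_G integral0_eq// => om _; rewrite gE patchE (negbTE rab).
have [i1 e1] := integrable_fine measurableT (integrable_fubini_F ig).
have iG : leb.-integrable `[a, b] (fubini_G P g).
  apply: (@integrableS _ _ _ leb setT) => //; apply/integrableP; split.
    exact: (measurable_fubini_G ig).
  apply: le_lt_trans ((integrable21ltyP P leb mg).1 ig); apply: ge0_le_integral => //.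
  - by apply: measurableT_comp => //; exact: (measurable_fubini_G ig).
  - by apply: (@measurable_fun_fubini_tonelli_G _ _ _ _ _ P (abse \o g)) => //=; exact: measurableT_comp.
  - move=> r _; apply: le_abse_integral => //.
    by apply: (measurableT_comp mg); exact: measurable_pair2.
have [i2 e2] := @integrable_fine _ _ R leb `[a, b]%classic (fubini_G P g) (measurable_itv _) iG.
have eF' : fine \o fubini_F leb g = fun om => \int[leb]_(r in `[a, b]) f om r.
  by apply/funext => om /=; rewrite eF.
split.
- apply: filterS (ae_integrable1 ig) => om h.
  apply/(@integrable_mkcond _ _ _ leb `[a, b]%classic (EFin \o f om) (measurable_itv _)).
  by apply: eq_integrable h => // r _; exact: gE.
- by rewrite -eF'.
- by apply: eq_integrable i2 => // r rab /=; rewrite eG.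
- rewrite -(eq_Rintegral _ (fun om _ => congr1 (@^~ om) eF')) e1.
  rewrite (integral12_prod_meas1 ig) -(integral21_prod_meas1 ig).
  rewrite (@eq_Rintegral _ _ _ leb _ (fine \o fubini_G P g)); last by move=> r rab /=; rewrite eG.
  rewrite e2; congr fine; rewrite [RHS]integral_mkcond; apply: eq_integral => r _.
  by rewrite [RHS]patchE; case: ifPn => // rab; exact: eG0.
Qed.

End fubini_interval.

Section hcap_limits.
Context {R : realType}.
Local Notation leb := (@lebesgue_measure R).
Implicit Types v : R.

Lemma hcap_d_cvg1 v : hcap_d k.+1%:R v @[k --> \oo] --> (1 : R).
Proof.
have h0 k : hcap_d k.+1%:R 0 = 1 :> R by rewrite /hcap_d mul0r subr0 max_r.
have c : `|v| * harmonic k @[k --> \oo] --> 0.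
  by rewrite -[X in _ --> X](mulr0 `|v|); apply: cvgM; [exact: cvg_cst|exact: cvg_harmonic].
apply/cvgrPdist_le => e e0; move/cvgrPdist_le : c => /(_ _ e0); apply: filterS => k.
rewrite sub0r normrN ger0_norm ?mulr_ge0 ?harmonic_ge0// => h.
by have := hcap_d_lip (ltr0Sn R k) v 0; rewrite h0 subr0 distrC => /le_trans; exact.
Qed.

Lemma hcap_cvg v : 0 <= v -> hcap k.+1%:R v @[k --> \oo] --> v.
Proof.
move=> v0; apply: (@squeeze_cvgr _ _ _ _ (fun k => hcap_d k.+1%:R v * v) (fun=> v)).
- apply: nearW => k; rewrite hcap_le_id// andbT.
  have := @hcap_concave R k.+1%:R (ltr0Sn _ _) v 0.
  rewrite sub0r mulrN {1}/hcap /hcap_d mul0r subr0 max_r// expr1n subrr mulr0 sub0r lerN2.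
  exact.
- by rewrite -[X in _ --> X]mul1r; apply: cvgM; [exact: hcap_d_cvg1|exact: cvg_cst].
- exact: cvg_cst.
Qed.

Lemma capped_rate_cvg (t0 s t : R) (a v L : R -> R) : t0 <= s -> s <= t ->
  measurable_fun `[t0, t] a -> measurable_fun `[t0, t] v -> itv_integrable t0 t L ->
  (forall r, t0 <= r <= t -> 0 <= a r) -> (forall r, t0 <= r <= t -> 0 <= v r) ->
  let w k r := \1_(`]s, t]%classic) r * (hcap_d k.+1%:R (a r) * hcap_d k.+1%:R (v r)) in
  (forall k, `|\int[leb]_(r in `[t0, t]) (w k r * L r)| <= \int[leb]_(r in `[t0, t]) `|L r|) /\
  \int[leb]_(r in `[t0, t]) (w k r * L r) @[k --> \oo] --> \int[leb]_(r in `[s, t]) L r.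
Proof.
move=> t0s st ma mv iL a0 v0 w.
have mL := itv_integrable_measurable iL.
have ind1 r : `|\1_(`]s, t]%classic) r : R| <= 1 by rewrite indicE normr_nat lern1 leq_b1.
have mw k : measurable_fun `[t0, t] (w k).
  apply: measurable_funM; first by apply: measurable_funTS; exact: measurable_indic.
  by apply: measurable_funM; apply: measurableT_comp => //; exact: hcap_d_measurable.
have bw k r : t0 <= r <= t -> `|w k r * L r| <= `|L r|.
  move=> rt; rewrite normrM ler_piMl// !normrM.
  have ha := hcap_d_le1 (ltr0Sn R k) (a0 _ rt); have hv := hcap_d_le1 (ltr0Sn R k) (v0 _ rt).
  apply: mulr_ile1; rewrite ?mulr_ge0//.
  by rewrite !ger0_norm ?hcap_d_ge0//; apply: mulr_ile1; rewrite ?hcap_d_ge0.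
have iw k : itv_integrable t0 t (fun r => w k r * L r).
  by apply: (itv_integrable_le _ (itv_integrable_norm iL)); [exact: measurable_funM|exact: bw].
split=> [k|].
  apply: (le_trans (itv_norm_integral_le (iw k))).
  by apply: itv_le_integral; [exact: itv_integrable_norm|exact: itv_integrable_norm|exact: bw].
rewrite -(itv_integral_indic t0s st iL).
have [|||||_ h] := @Rintegral_dominated _ _ R leb `[t0, t]%classic (measurable_itv _)
   (fun k r => w k r * L r) (fun r => \1_(`]s, t]%classic) r * L r) (fun r => `|L r|).
- by move=> k; apply: measurable_funM => //; exact: mw.
- by apply: measurable_funM => //; apply: measurable_funTS; exact: measurable_indic.
- apply: aeW => r rt; apply: cvgM; last exact: cvg_cst.
  rewrite -[X in _ --> X]mulr1; apply: cvgM; first exact: cvg_cst.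
  by rewrite -[X in _ --> X](mulr1 1); apply: cvgM; exact: hcap_d_cvg1.
- exact: itv_integrable_norm.
- by move=> k r /=; rewrite in_itv/= => /bw.
- exact: h.
Qed.

End hcap_limits.

Lemma norm_le_enorm {R : realType} n (y : 'cV[R]_n) : `|y| <= enorm y.
Proof.
apply: norm_le_coord; first exact: sqrtr_ge0.
move=> i; rewrite -sqrtr_sqr; apply: ler_wsqrtr.
by rewrite (bigD1 i)//= lerDl; apply: sumr_ge0 => j _; exact: sqr_ge0.
Qed.

Lemma enorm_ge0 {R : realType} n (y : 'cV[R]_n) : 0 <= enorm y.
Proof. exact: sqrtr_ge0. Qed.

Lemma coercive_bound {R : realType} (alpha : R -> R) (p N : R) : classKoo alpha -> 0 < p ->
  exists Rd, forall s, 0 <= s -> alpha (s `^ p) < N -> s <= Rd.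
Proof.
move=> [[_ _ incr] /cvgryPge /(_ N)[B [_ hB]]] p0.
pose S := `|B| + 1; have S0 : 0 < S by rewrite ltr_wpDl.
have NS : N <= alpha S by apply: hB; rewrite (le_lt_trans (ler_norm _))// ltrDl.
exists (S `^ p^-1) => s s0 h; rewrite leNgt; apply/negP => hs.
move: h; apply/negP; rewrite -leNgt (le_trans NS)// ltW//; apply: incr; first exact: ltW.
have -> : S = (S `^ p^-1) `^ p by rewrite -powRrM mulVf ?gt_eqF// powRr1// ltW.
by apply: gt0_ltr_powR => //; rewrite nnegrE ?powR_ge0.
Qed.

Section solution_ito.
Context {R : realType} d {T : measurableType d} (P : probability T R).
Context (F : R -> set (set T)) (hF : usual_conditions P F).
Context (tau : R) (n m l : nat) (w : R -> T -> 'cV[R]_m) (hw : brownian P F w).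
Context (f0 : R -> history tau n -> 'cV[R]_l -> 'cV[R]_n).
Context (g0 : R -> history tau n -> 'cV[R]_l -> 'M[R]_(n, m)).
Context (hfg : sfde_assumptions P F w f0 g0).
Context (V : R -> 'cV[R]_n -> R) (p : R) (alpha1 alpha2 : R -> R).
Hypotheses (tau0 : 0 <= tau) (hV : classC21 tau V).
Hypotheses (hp : 0 < p) (ha1 : classKoo alpha1) (hA : cond_A tau V p alpha1 alpha2).
Variables (t0 : R) (xi : T -> history tau n) (u : @input R l) (x : R -> T -> 'cV[R]_n).
Hypotheses (t00 : 0 <= t0) (hxi : initial_condition F t0 xi) (hu : admissible_input u).
Hypothesis hx : is_solution P F w f0 g0 t0 xi u x.
Hypothesis hE : expectations_defined P f0 g0 V t0 u x.
Local Notation leb := (@lebesgue_measure R).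
Local Notation a0 := (t0 - tau).
Local Notation TG g := (g_sigma_algebraType (F g)).
Local Notation b i := (drift_along f0 u x i).
Local Notation sg i j := (diffusion_along g0 u x i j).
Local Notation LVx r om := (LV_along f0 g0 V u x r om).

Lemma LV_alongE r om : LVx r om =
  gen_limit tau V (x ^~ om) (fun i => b i ^~ om) (fun i j => sg i j ^~ om) r.
Proof.
rewrite /LV_along /LV /gen_limit mxE; congr (_ + _ + _ * _).
rewrite /mxtrace.
transitivity (\sum_q \sum_j \sum_i V_xx V r (x r om) i j * (sg j q r om * sg i q r om)).
  apply: eq_bigr => q _; rewrite mxE; apply: eq_bigr => j _; rewrite mxE mulr_suml.
  by apply: eq_bigr => i _; rewrite mxE [in LHS]mulrAC [in LHS]mulrC [in LHS](mulrC (g0 _ _ _ i q)).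
rewrite exchange_big/=; under eq_bigr do rewrite exchange_big/=.
rewrite exchange_big/=; apply: eq_bigr => i _; apply: eq_bigr => j _.
by rewrite mulr_sumr.
Qed.

Lemma path_clamp_continuous (G : R -> 'cV[R]_n -> R) t om : Jtau_continuous tau G ->
  continuous (fun r => G (Num.max a0 (Num.min r t)) (x (Num.max a0 (Num.min r t)) om)).
Proof.
move=> /subspace_continuousP cG r; pose c (r : R) := Num.max a0 (Num.min r t).
have cmin : continuous (fun r : R => Num.min r t).
  by move=> z; apply: continuous_min; [exact: cvg_id|exact: cst_continuous].
have cc : continuous c.
  move=> z; apply: (continuous_comp (cmin z)).
  by apply: continuous_max; [exact: cst_continuous|exact: cvg_id].
have cxc : continuous (fun r => x (c r) om).
  have pc : continuous (fun r => x (Num.max a0 r) om) by exact: (path_continuous hx).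
  by move=> z; exact: (@continuous_comp _ _ _ (fun r => Num.min r t) (fun r => x (Num.max a0 r) om) z (cmin z) (pc _)).
have Ac z : - tau <= c z by rewrite /c le_max lerDr t00.
apply: (@cvg_comp _ _ _ (fun r => (c r, x (c r) om)) (fun z : R * 'cV[R]_n => G z.1 z.2) _ _ _ _ (cG (c r, x (c r) om) (Ac r))) => B nB.
have h : \forall z \near r, - tau <= c z -> B (c z, x (c z) om).
  exact: (cvg_pair (cc r) (cxc r) nB).
by apply: filterS h => z; apply; exact: Ac.
Qed.

Lemma path_joint_measurable (G : R -> 'cV[R]_n -> R) t : t0 <= t -> Jtau_continuous tau G ->
  measurable_fun (setT `*` `[t0, t]) (fun z : T * R => G z.2 (x z.2 z.1)).
Proof.
move=> t0t cG; pose c (r : R) := Num.max a0 (Num.min r t).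
have at_ : a0 <= t by rewrite (le_trans _ t0t)// gerBl.
have t0' : 0 <= t by exact: le_trans t0t.
have mf : measurable_fun setT (fun z : T * R => G (c z.2) (x (c z.2) z.1)).
  apply: (@measurable_caratheodory R _ T (fun om r => G (c r) (x (c r) om))).
    by move=> om; exact: path_clamp_continuous.
  move=> r; apply: measurable_continuous_vec.
    by apply: Jtau_slice_continuous cG _; rewrite le_max lerDr t00.
  move=> i; apply: (filtration_rv_measurable hF t0'); apply: (solution_rv_measurable hF t00 hxi hx) => //.
    by rewrite le_max lexx.
  by rewrite ge_max at_ ge_min lexx orbT.
apply: eq_measurable_fun (measurable_funTS mf) => -[om r] /set_mem[_ /=]; rewrite in_itv/= => /andP[t0r rt].
by rewrite /c min_l// max_r// (le_trans _ t0r)// gerBl.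
Qed.

Lemma LV_joint_measurable t : t0 <= t ->
  measurable_fun (setT `*` `[t0, t]) (fun z : T * R => LVx z.2 z.1).
Proof.
move=> t0t; have t0' : 0 <= t by exact: le_trans t0t.
have sub (h : R -> history tau n -> 'cV[R]_l -> R) : coef_measurable h ->
    measurable_fun (setT `*` `[t0, t]) (fun z : T * R => h z.2 (history_at tau (x ^~ z.1) z.2) (u z.2)).
  move=> mh; apply: (@measurable_joint_sub _ _ _ (F t) _ (fun om r => h r (history_at tau (x ^~ om) r) (u r))) => //.
  - exact: (filtration_sigma hF t0').
  - exact: (filtration_sub hF t0').
  - exact: (along_joint_measurable hF tau0 t00 hxi hu hx t0t mh).
have mb i : measurable_fun (setT `*` `[t0, t]) (fun z : T * R => b i z.2 z.1).
  exact: (sub _ (drift_measurable hfg i)).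
have ms i j : measurable_fun (setT `*` `[t0, t]) (fun z : T * R => sg i j z.2 z.1).
  exact: (sub _ (diffusion_measurable hfg i j)).
rewrite (_ : (fun z : T * R => _) = fun z : T * R =>
  gen_limit tau V (x ^~ z.1) (fun i => b i ^~ z.1) (fun i j => sg i j ^~ z.1) z.2); last first.
  by apply/funext => z; exact: LV_alongE.
rewrite /gen_limit.
apply: measurable_funD; first apply: measurable_funD.
- exact: (path_joint_measurable t0t (@C21_continuous_t _ _ _ _ hV)).
- apply: measurable_sum => i; apply: measurable_funM; last exact: mb.
  exact: (path_joint_measurable t0t (@C21_continuous_x _ _ _ _ hV i)).
- apply: measurable_funM => //; apply: measurable_sum => i; apply: measurable_sum => j.
  apply: measurable_funM; first exact: (path_joint_measurable t0t (@C21_continuous_xx _ _ _ _ hV i j)).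
  by apply: measurable_sum => q; apply: measurable_funM; exact: ms.
Qed.

Lemma EV_integral r : EV P V x r = \int[P]_om V r (x r om).
Proof. by rewrite /EV unlock. Qed.

Lemma path_seq_cvg t om (r_ : nat -> R) r : (forall k, t0 <= r_ k <= t) -> t0 <= r <= t ->
  r_ k @[k --> \oo] --> r -> forall i, x (r_ k) om i 0 @[k --> \oo] --> x r om i 0.
Proof.
move=> hr_ hr cr i.
have mx z : t0 <= z <= t -> Num.max a0 z = z.
  by move=> /andP[h _]; rewrite max_r// (le_trans _ h)// gerBl.
have pc : continuous (fun r => x (Num.max a0 r) om) by exact: (path_continuous hx).
have c : x (Num.max a0 (r_ k)) om @[k --> \oo] --> x (Num.max a0 r) om.
  exact: cvg_comp cr (pc r).
rewrite -(mx _ hr); under eq_fun do rewrite -(mx _ (hr_ _)).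
by apply: (@cvg_comp _ _ _ (fun k => x (Num.max a0 (r_ k)) om) (fun M : 'cV[R]_n => M i 0) _ _ _ c); exact: coord_continuous.
Qed.

Lemma truncated_solution_ito s t k : t0 <= s <= t -> t0 < t ->
  let pb := path_boundary V k.+1%:R k.+1%:R t0 x (drift_along f0 u x) (diffusion_along g0 u x) in
  let pr := path_rate tau V k.+1%:R k.+1%:R t0 s t x (drift_along f0 u x) (diffusion_along g0 u x) in
  [/\ measurable_fun setT (pb s), measurable_fun setT (pb t),
      P.-integrable setT (EFin \o (fun om => \int[leb]_(r in `[t0, t]) pr r om)) &
      \int[P]_om pb t om <= \int[P]_om pb s om +
        \int[P]_om \int[leb]_(r in `[t0, t]) pr r om].
Proof.
move=> st t0t pb pr; have t0t' := ltW t0t.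
have [Rd hRd] := coercive_bound k.+1%:R ha1 hp.
apply: (truncated_ito hF hw tau0 hV (Rd := Rd) (ltr0Sn _ _) (ltr0Sn _ _) t00 t0t st).
- move=> r y /andP[r0 _] Vy; apply: (le_trans (norm_le_enorm y)); apply: hRd; first exact: enorm_ge0.
  have tr : - tau <= r by rewrite (le_trans _ r0)// oppr_le0.
  by apply: le_lt_trans Vy; have /andP[] := @hA r y tr.
- by move=> i; exact: (solution_adapted hx i (lexx t0)).
- by move=> om r_ r; exact: path_seq_cvg.
- by move=> i g t0g; exact: (along_joint_measurable hF tau0 t00 hxi hu hx t0g (drift_measurable hfg i)).
- by move=> i j g t0g; exact: (along_joint_measurable hF tau0 t00 hxi hu hx t0g (diffusion_measurable hfg i j)).
- by move=> i; exact: (solution_drift hx i t0t').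
- by move=> i j; exact: (solution_diffusion hx i j t0t').
- by move=> r /andP[t0r _]; exact: (solution_equation hx t0r).
Qed.

Lemma mean_LV_integrable s t : t0 <= s -> s <= t ->
  (\int[leb]_(r in `[s, t]) 'E_P[fun om => `|LVx r om|%R] < +oo)%E.
Proof.
move=> t0s st; have t0t : t0 <= t by exact: le_trans st.
apply: le_lt_trans (hE.2 _ t0t); apply: ge0_subset_integral => //.
- exact: (measurable_mean_norm P (f := fun om r => LVx r om) (LV_joint_measurable t0t)).
- by move=> r _; rewrite unlock; exact: integral_ge0.
- by apply: subset_itvr; rewrite bnd_simp.
Qed.

(** Both truncation levels equal [k.+1] and tend to infinity. The boundary terms are dominated by
    [V] along the solution; the rates by the integral of the modulus of the generator, which
    [expectations_defined] makes integrable. *)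
Lemma solution_ito s t : t0 <= s <= t ->
  itv_integrable s t (fun r => fine ('E_P[LV_along f0 g0 V u x r])%E) /\
  EV P V x t <= EV P V x s +
    \int[leb]_(r in `[s, t]) fine ('E_P[LV_along f0 g0 V u x r])%E.
Proof.
move=> /andP[t0s]; rewrite le_eqVlt => /predU1P[<-|st'].
  by split; [exact: itv_integrable_point|rewrite itv_integral_point addr0].
have st := ltW st'; have t0t' : t0 < t by exact: le_lt_trans st'.
have t0t := ltW t0t'; have stt : t0 <= s <= t by rewrite t0s.
have mL := LV_joint_measurable t0t.
have mLs : measurable_fun (setT `*` `[s, t]) (fun z : T * R => LVx z.2 z.1).
  apply: measurable_funS mL; first exact: measurableX.
  move=> [om r] /= [_]; rewrite !in_itv/= => /andP[sr ->]; split => //.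
  by rewrite (le_trans t0s sr).
have [aeL _ _ _] := itv_fubini (P := P) (f := fun om r => LVx r om) mL (mean_LV_integrable (lexx _) t0t).
have [_ iLs im <-] := itv_fubini (P := P) (f := fun om r => LVx r om) mLs (mean_LV_integrable t0s st).
split; first exact: im.
have mN : measurable_fun (setT `*` `[t0, t]) (fun z : T * R => `|LVx z.2 z.1|).
  exact: measurableT_comp mL.
(* Fubini for the absolute value produces the dominating random variable of the rates. *)
have [|_ iN _ _] := itv_fubini (P := P) (f := fun om r => `|LVx r om|) mN.
  apply: le_lt_trans (mean_LV_integrable (lexx _) t0t); rewrite le_eqVlt; apply/orP; left; apply/eqP.
  by apply: eq_integral => r _; congr ('E_P[_])%E; apply/funext => om; rewrite normr_id.
pose pb k := path_boundary V k.+1%:R k.+1%:R t0 x (drift_along f0 u x) (diffusion_along g0 u x).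
pose pr k := path_rate tau V k.+1%:R k.+1%:R t0 s t x (drift_along f0 u x) (diffusion_along g0 u x).
pose pc := path_control t0 (drift_along f0 u x) (diffusion_along g0 u x).
have ito k := truncated_solution_ito k stt t0t'.
have pc0 r om : 0 <= pc r om.
  by apply: itv_integral_ge0 => y _; rewrite /control_density addr_ge0// sumr_ge0// => i _; rewrite sumr_ge0// => j _; exact: sqr_ge0.
have V0 r om : t0 <= r -> 0 <= V r (x r om).
  by move=> t0r; apply: (C21_ge0 hV); rewrite (le_trans _ (le_trans t00 t0r))// oppr_le0.
have boundary r : t0 <= r -> (forall k, measurable_fun setT (pb k r)) ->
    \int[P]_om pb k r om @[k --> \oo] --> EV P V x r.
  move=> t0r mpb; rewrite EV_integral; have iV : P.-integrable setT (EFin \o (fun om => V r (x r om))).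
    by apply: hE.1; rewrite (le_trans _ t0r)// gerBl.
  have [|||||_ h] := @Rintegral_dominated _ _ R P setT measurableT (fun k => pb k r) (fun om => V r (x r om)) (fun om => V r (x r om)).
  - exact: mpb.
  - by apply/measurable_EFinP; exact: measurable_int iV.
  - apply: aeW => om _; rewrite -[X in _ --> X]mul1r; apply: cvgM; first exact: hcap_d_cvg1.
    by apply: hcap_cvg; exact: V0.
  - exact: iV.
  - move=> k om _; have v0 := V0 r om t0r; have c0 := pc0 r om.
    rewrite /pb /path_boundary normrM ger0_norm ?hcap_d_ge0// ger0_norm ?hcap_ge0//.
    apply: (@le_trans _ _ (hcap k.+1%:R (V r (x r om)))); last exact: hcap_le_id.
    by apply: ler_piMl; [exact: hcap_ge0|exact: hcap_d_le1].
  - exact: h.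
have rate : \int[P]_om \int[leb]_(r in `[t0, t]) pr k r om @[k --> \oo] -->
    \int[P]_om \int[leb]_(r in `[s, t]) LVx r om.
  have aeb := ae_forall_fin (fun i => solution_drift hx i t0t).
  have aes := ae_forall_fin (fun ij : 'I_n * 'I_m => solution_diffusion hx ij.1 ij.2 t0t).
  have key : {ae P, forall om, (forall k, `|\int[leb]_(r in `[t0, t]) pr k r om| <= \int[leb]_(r in `[t0, t]) `|LVx r om|) /\
      \int[leb]_(r in `[t0, t]) pr k r om @[k --> \oo] --> \int[leb]_(r in `[s, t]) LVx r om}.
    apply: filterS3 aeL aeb aes => om iL ib isg.
    have mpc : measurable_fun `[t0, t] (fun r => pc r om).
      apply: subspace_continuous_measurable_fun => //.
      apply: parameterized_integral_continuous => //.
      exact: (control_density_integrable (b := fun i => b i ^~ om) (sg := fun i j => sg i j ^~ om) ib (fun i j => isg (i, j))).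
    have mV : measurable_fun `[t0, t] (fun r => V r (x r om)).
      exact: (measurable_section om (f := fun om r => V r (x r om)) (path_joint_measurable t0t (@C21_continuous _ _ _ _ hV))).
    have [||h1 h2] := capped_rate_cvg t0s st mpc mV iL.
    - by move=> r _; exact: pc0.
    - by move=> r /andP[t0r _]; exact: V0.
    have e k : \int[leb]_(r in `[t0, t]) pr k r om =
      \int[leb]_(r in `[t0, t]) (\1_(`]s, t]%classic) r * (hcap_d k.+1%:R (pc r om) * hcap_d k.+1%:R (V r (x r om))) * LVx r om).
      by apply: eq_Rintegral => r _; rewrite /pr /path_rate -LV_alongE.
    by split=> [k|]; [rewrite e; exact: h1|under eq_fun do rewrite e; exact: h2].
  have [|||||_ h] := @Rintegral_dominated_ae _ _ R P setT measurableT
    (fun k om => \int[leb]_(r in `[t0, t]) pr k r om) (fun om => \int[leb]_(r in `[s, t]) LVx r om)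
    (fun om => \int[leb]_(r in `[t0, t]) `|LVx r om|).
  - by move=> k; have [_ _ i _] := ito k; apply/measurable_EFinP; exact: measurable_int i.
  - by apply/measurable_EFinP; exact: measurable_int iLs.
  - by apply: filterS key => om [_ h] _.
  - exact: iN.
  - by apply: filterS key => om [h _] k _.
  - exact: h.
have c2 : \int[P]_om pb k s om + \int[P]_om \int[leb]_(r in `[t0, t]) pr k r om @[k --> \oo] -->
    EV P V x s + \int[P]_om \int[leb]_(r in `[s, t]) LVx r om.
  by apply: cvgD rate; apply: boundary => // k; case: (ito k).
apply: (ler_cvg_to (boundary t t0t _) c2); first by move=> k; case: (ito k).
by apply: nearW => k; case: (ito k).
Qed.

End solution_ito.

(** * The scalar Razumikhin comparison *)

(* Halving [[s, t]] repeatedly gains a factor 2 each time. *)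
Lemma dyadic_increment_le {R : realType} (Gam M : R -> R) (C a b : R) : a <= b ->
  (forall s t, a <= s -> s <= t -> t <= b -> Gam t - Gam s <= C * (t - s) * (M t - M s)) ->
  Gam b <= Gam a.
Proof.
move=> ab h; pose c := C * (b - a) * (M b - M a).
have key k s t : a <= s -> s <= t -> t <= b ->
    Gam t - Gam s <= C * (t - s) * (M t - M s) * 2^-1 ^+ k.
  elim: k s t => [|k ih] s t as_ st tb; first by rewrite expr0 mulr1; exact: h.
  pose r := (s + t) / 2.
  have sr : s <= r by rewrite ler_pdivlMr// mulr_natr mulr2n lerD2l.
  have rt : r <= t by rewrite ler_pdivrMr// mulr_natr mulr2n lerD2r.
  have h1 := ih s r as_ sr (le_trans rt tb); have h2 := ih r t (le_trans as_ sr) rt tb.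
  rewrite (_ : Gam t - Gam s = (Gam r - Gam s) + (Gam t - Gam r)); last by ring.
  apply: (le_trans (lerD h1 h2)); rewrite exprS.
  rewrite (_ : r - s = (t - s) / 2); last by rewrite /r; field.
  rewrite (_ : t - r = (t - s) / 2); last by rewrite /r; field.
  by rewrite le_eqVlt; apply/orP; left; apply/eqP; field.
have lim : c * 2^-1 ^+ k @[k --> \oo] --> (0 : R).
  by apply: cvg_geometric; rewrite ger0_norm ?invr_ge0// invf_lt1// ltr1n.
rewrite -subr_le0; apply: (ler_cvg_to (@cvg_cst _ (Gam b - Gam a) _ _ _) lim).
by apply: nearW => k; exact: key.
Qed.

Section stable_function.
Context {R : realType} (mu : R -> R) (T0 : R).
Local Notation leb := (@lebesgue_measure R).
Hypotheses (hmu : uniformly_stable mu) (hT0 : Omega mu T0).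
Local Notation I := (integral_between mu).

Lemma mu_integrable s t : 0 <= s -> itv_integrable s t mu.
Proof.
move=> s0; apply: continuous_compact_integrable; first exact: segment_compact.
by apply: continuous_subspaceW hmu.1 => r /=; rewrite in_itv/= => /andP[sr _]; rewrite /J/= (le_trans s0 sr).
Qed.

Lemma integral_between_cat r s t : 0 <= r -> r <= s -> s <= t -> I r t = I r s + I s t.
Proof. by move=> r0 rs st; apply: itv_integral_cat => //; exact: mu_integrable. Qed.

Lemma integral_between_point r : I r r = 0. Proof. exact: itv_integral_point. Qed.

Lemma mu_bounded t : 0 <= t -> exists2 B, 0 <= B & forall r, 0 <= r <= t -> `|mu r| <= B.
Proof.
move=> t0; have cm : {within `[0, t], continuous (fun r => `|mu r|)}.
  have c1 : {within `[0, t], continuous mu}.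
    by apply: continuous_subspaceW hmu.1 => r /=; rewrite in_itv/= => /andP[].
  by move=> r; apply: continuous_comp; [exact: c1|exact: norm_continuous].
have [c _ hc] := EVT_max t0 cm.
by exists `|mu c| => // r hr; apply: hc; rewrite in_itv.
Qed.

(** Uniform stability bounds both nested suprema in [phi] by its constant; without boundedness [sup]
    would not be an upper bound. *)
Lemma integral_between_le_phi t theta : 0 <= t -> 0 <= theta <= T0 -> I t (t + theta) <= phi mu T0.
Proof.
have [_ [e [dl [e0 dl0 hI]]]] := hmu.
have bI s th : 0 <= s -> 0 <= th -> I s (s + th) <= dl.
  move=> s0 th0; apply: (le_trans (hI s (s + th) s0 _)); first by rewrite lerDl.
  by rewrite addrAC subrr add0r mulNr gerDr oppr_le0 mulr_ge0// ltW.
have T00 : 0 < T0 := hT0.1.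
have bsup s : 0 <= s -> sup [set I s (s + th) | th in `[0, T0]] <= dl.
  move=> s0; apply: ge_sup; first by exists (I s (s + 0)), 0 => //=; rewrite in_itv/= lexx ltW.
  by move=> _ [th /= hth <-]; move: hth; rewrite in_itv/= => /andP[th0 _]; exact: bI.
move=> t0 hth; apply: (@le_trans _ _ (sup [set I t (t + th) | th in `[0, T0]])).
  apply: ub_le_sup; last by exists theta => //=; rewrite in_itv.
  by exists dl => _ [th /= hth' <-]; move: hth'; rewrite in_itv/= => /andP[th0 _]; exact: bI.
apply: ub_le_sup; last by exists t.
by exists dl => _ [s /= s0 <-]; exact: bsup.
Qed.

(** Guaranteed decay of the integral of [mu] over one period; membership of [T0] in [Omega mu] makes
    it positive. *)
Definition kappa : R := - sup [set I t (t + T0) | t in J].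

Lemma kappa_gt0 : 0 < kappa. Proof. by rewrite oppr_gt0; exact: hT0.2. Qed.

Lemma integral_between_le_kappa t : 0 <= t -> I t (t + T0) <= - kappa.
Proof.
move=> t0; rewrite opprK; apply: ub_le_sup; last by exists t.
have [_ [e [dl [e0 dl0 hI]]]] := hmu; exists dl => _ [s /= s0 <-].
apply: (le_trans (hI s (s + T0) s0 _)); first by rewrite lerDl ltW// hT0.1.
by rewrite addrAC subrr add0r mulNr gerDr oppr_le0 mulr_ge0// ltW// hT0.1.
Qed.

Variable eps : R.
Hypotheses (eps0 : 0 < eps) (epsT : eps * T0 <= kappa).

(** Whole periods are removed one by one: each contributes at most [- kappa + eps * T0], which is
    not positive. What remains is shorter than [T0] and contributes at most
    [phi mu T0 + eps * T0]. *)
Lemma shifted_integral_le s t : 0 <= s -> s <= t -> I s t + eps * (t - s) <= phi mu T0 + eps * T0.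
Proof.
have T00 : 0 < T0 := hT0.1.
have key k r : 0 <= r -> forall th, 0 <= th <= k.+1%:R * T0 ->
    I r (r + th) + eps * th <= phi mu T0 + eps * T0.
  elim: k r => [|k ih] r r0 th /andP[th0].
    rewrite mul1r => thT; apply: lerD; first by apply: integral_between_le_phi => //; rewrite th0.
    by rewrite ler_wpM2l// ltW.
  move=> hth; have [thT|Tth] := leP th T0.
    by apply: lerD; [apply: integral_between_le_phi => //; rewrite th0|rewrite ler_wpM2l// ltW].
  have rT : 0 <= r + T0 by rewrite addr_ge0// ltW.
  have h := ih (r + T0) rT (th - T0).
  rewrite (@integral_between_cat r (r + T0)) ?lerDl ?(ltW T00)//; last by rewrite lerD2l ltW.
  have {}h : I (r + T0) (r + th) + eps * (th - T0) <= phi mu T0 + eps * T0.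
    rewrite (_ : r + th = r + T0 + (th - T0)); last by ring.
    apply: h; rewrite subr_ge0 ltW//= lerBlDr; apply: (le_trans hth).
    by rewrite -[X in _ <= _ + X]mul1r -mulrDl [X in _ <= X * _]natr1.
  apply: le_trans h; have := integral_between_le_kappa r0; move: epsT; lra.
move=> s0 st; have := key (Num.truncn ((t - s) / T0)) s s0 (t - s).
rewrite (_ : s + (t - s) = t); last by ring.
apply; rewrite subr_ge0 st/= -ler_pdivrMr// ltW// truncnS_gt// divr_ge0 ?subr_ge0// ltW.
Qed.

End stable_function.

Lemma onem_expR_le {R : realType} (z : R) : 1 - expR z <= - z.
Proof. by rewrite lerBlDl -lerBlDr opprK expR_ge1Dx. Qed.

(** * A product rule for functions with controlled upward increments *)

Section gronwall.
Context {R : realType} (mu : R -> R) (T0 : R).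
Local Notation leb := (@lebesgue_measure R).
Hypothesis hmu : uniformly_stable mu.
Local Notation I := (integral_between mu).
Variables (t0 t1 : R).
Hypotheses (t00 : 0 <= t0) (t01 : t0 <= t1).

Definition discount r : R := expR (- I t0 r).

Lemma discount_gt0 r : 0 < discount r. Proof. exact: expR_gt0. Qed.

Lemma discountE s t : t0 <= s -> s <= t -> discount s = discount t * expR (I s t).
Proof.
by move=> t0s st; rewrite /discount (integral_between_cat hmu t00 t0s st) -expRD; congr expR; ring.
Qed.

Lemma discount_measurable : measurable_fun `[t0, t1] discount.
Proof.
apply: measurableT_comp => //; apply: measurableT_comp => //.
apply: subspace_continuous_measurable_fun => //.
apply: parameterized_integral_continuous => //; exact: (mu_integrable hmu).
Qed.

Lemma discount_bounds : exists H B : R, [/\ 0 <= H, 0 <= B,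
  forall r, t0 <= r <= t1 -> `|mu r| <= B,
  forall r, t0 <= r <= t1 -> discount r <= H &
  forall s t, t0 <= s -> s <= t -> t <= t1 -> `|discount t - discount s| <= H * B * (t - s)].
Proof.
have [B B0 hB] := mu_bounded hmu (le_trans t00 t01).
have hB' r : t0 <= r <= t1 -> `|mu r| <= B.
  by move=> /andP[h1 h2]; apply: hB; rewrite (le_trans t00 h1).
have hI s t : t0 <= s -> s <= t -> t <= t1 -> `|I s t| <= B * (t - s).
  move=> t0s st tt1; have im : itv_integrable s t mu by apply: (mu_integrable hmu); exact: le_trans t0s.
  apply: (le_trans (itv_norm_integral_le im)); rewrite -(itv_integral_cst B st).
  apply: itv_le_integral; [exact: itv_integrable_norm|exact: itv_integrable_cst|].
  by move=> r /andP[sr rt]; apply: hB'; rewrite (le_trans t0s sr) (le_trans rt tt1).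
pose H := expR (B * (t1 - t0)).
have hH r : t0 <= r <= t1 -> discount r <= H.
  move=> /andP[t0r rt]; rewrite ler_expR; apply: (le_trans (ler_norm _)); rewrite normrN.
  by apply: (le_trans (hI _ _ (lexx _) t0r rt)); rewrite ler_wpM2l// lerB.
exists H, B; split => //; first exact: expR_ge0.
move=> s t t0s st tt1; have hx := hI s t t0s st tt1; set x := I s t in hx.
have e := discountE t0s st; rewrite -/x in e.
have hs : discount s <= H by apply: hH; rewrite t0s (le_trans st).
have ht : discount t <= H by apply: hH; rewrite tt1 (le_trans t0s).
have h1 : discount t - discount s <= - (discount t * x).
  rewrite e -{1}[discount t]mulr1 -mulrBr -mulrN ler_wpM2l ?(ltW (discount_gt0 _))//.
  exact: onem_expR_le.
have h2 : discount s - discount t <= discount s * x.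
  have -> : discount t = discount s * expR (- x) by rewrite e -mulrA -expRD addrN expR0 mulr1.
  rewrite -{1}[discount s]mulr1 -mulrBr ler_wpM2l ?(ltW (discount_gt0 _))//.
  by rewrite -[leRHS]opprK; exact: onem_expR_le.
have bnd c : 0 <= c -> c <= H -> `|c * x| <= H * B * (t - s).
  by move=> c0 cH; rewrite normrM (ger0_norm c0) -mulrA; apply: ler_pM.
have b1 := bnd _ (ltW (discount_gt0 t)) ht; have b2 := bnd _ (ltW (discount_gt0 s)) hs.
rewrite ler_norml lerNl opprB; apply/andP; split.
  by apply: (le_trans h2); exact: le_trans (ler_norm _) b2.
by apply: (le_trans h1); apply: le_trans b1; rewrite -normrN; exact: ler_norm.
Qed.

Variables v a : R -> R.
Hypotheses (v0 : forall r, t0 <= r <= t1 -> 0 <= v r) (mv : measurable_fun `[t0, t1] v).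
Hypothesis ia : itv_integrable t0 t1 a.
Hypothesis va : forall s t, t0 <= s -> s <= t -> t <= t1 -> v t - v s <= \int[leb]_(r in `[s, t]) a r.

(* [v] need not be continuous: only its upward increments are controlled. *)
Definition discounted r : R := discount r * (a r - mu r * v r).

Let ia' s t : t0 <= s -> t <= t1 -> itv_integrable s t a.
Proof. by move=> h1 h2; exact: itv_integrableS ia. Qed.

Let Vm := v t0 + \int[leb]_(r in `[t0, t1]) `|a r|.

Lemma growth_bound r : t0 <= r <= t1 -> v r <= Vm.
Proof.
move=> /andP[t0r rt]; have := va (lexx t0) t0r rt; rewrite lerBlDl => /le_trans; apply.
rewrite lerD2l; apply: (le_trans (ler_norm _)).
apply: (le_trans (itv_norm_integral_le (ia' (lexx _) rt))).
by apply: itv_integral_mono => //; exact: itv_integrable_norm.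
Qed.

Lemma discounted_integrable : itv_integrable t0 t1 discounted.
Proof.
have [H [B [H0 B0 hB hH _]]] := discount_bounds.
have Vm0 : 0 <= Vm by apply: le_trans (growth_bound (_ : t0 <= t0 <= t1)); rewrite ?v0 ?lexx ?t01.
have mm : measurable_fun `[t0, t1] mu by apply: itv_integrable_measurable; exact: (mu_integrable hmu).
have ma := itv_integrable_measurable ia.
apply: (@itv_integrable_le _ t0 t1 _ (fun r => H * (`|a r| + B * Vm))).
- by apply: measurable_funM; [exact: discount_measurable|apply: measurable_funB => //; exact: measurable_funM].
- apply: itv_integrableZ; apply: itv_integrableD; first exact: itv_integrable_norm.
  exact: itv_integrable_cst.
- move=> r hr; rewrite normrM ger0_norm ?(ltW (discount_gt0 _))//; apply: ler_pM => //.
  + exact: ltW (discount_gt0 _).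
  + exact: hH.
  + apply: (le_trans (ler_normB _ _)); rewrite lerD2l normrM; apply: ler_pM => //; first exact: hB.
    by rewrite ger0_norm ?v0// growth_bound.
Qed.

Let if' s t : t0 <= s -> t <= t1 -> itv_integrable s t discounted.
Proof. by move=> h1 h2; exact: itv_integrableS discounted_integrable. Qed.

(** Subtracting the integral of [a] from [v] leaves a nonincreasing function [b], so [v] varies over
    a short interval by at most the drop of [b] plus an integral of the modulus of [a]. The defect
    of the product rule on [[s, t]] is then at most [C * (t - s)] times an increment of one function
    [M], and [dyadic_increment_le] removes it. *)
Lemma gronwall_incr s t : t0 <= s -> s <= t -> t <= t1 ->
  discount t * v t - discount s * v s <= \int[leb]_(r in `[s, t]) discounted r.
Proof.
move=> t0s st tt1.
have [H [B [H0 B0 hB hH hL]]] := discount_bounds.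
pose A r := \int[leb]_(y in `[t0, r]) a y; pose N r := \int[leb]_(y in `[t0, r]) `|a y|.
pose b r := v r - A r.
pose Gam r := discount r * v r - \int[leb]_(y in `[t0, r]) discounted y.
(* Collects all errors: one integral of the modulus of [a] from replacing [discount], another
   together with [- b] from freezing [v], and the linear term from bounding [v] by [Vm]. *)
pose M r := 2 * N r - b r + B * Vm * r.
have catA s' t' : t0 <= s' -> s' <= t' -> t' <= t1 -> A t' = A s' + \int[leb]_(y in `[s', t']) a y.
  by move=> h1 h2 h3; apply: itv_integral_cat => //; exact: ia'.
have catN s' t' : t0 <= s' -> s' <= t' -> t' <= t1 -> N t' = N s' + \int[leb]_(y in `[s', t']) `|a y|.
  by move=> h1 h2 h3; apply: itv_integral_cat => //; apply: itv_integrable_norm; exact: ia'.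
have catF s' t' : t0 <= s' -> s' <= t' -> t' <= t1 ->
    \int[leb]_(y in `[t0, t']) discounted y = \int[leb]_(y in `[t0, s']) discounted y + \int[leb]_(y in `[s', t']) discounted y.
  by move=> h1 h2 h3; apply: itv_integral_cat => //; exact: if'.
have bmono s' t' : t0 <= s' -> s' <= t' -> t' <= t1 -> b t' <= b s'.
  by move=> h1 h2 h3; rewrite /b (catA s' t')//; have := va h1 h2 h3; lra.
have alg (X Y F G : R) : X - (F + G) <= Y - F -> X - Y <= G by lra.
suff : Gam t <= Gam s by rewrite /Gam (catF s t)//; exact: alg.
apply: (@dyadic_increment_le _ Gam M (H * B) s t st) => s' t' ss' s't' tt'.
have t0s' := le_trans t0s ss'; have t't1 := le_trans tt' tt1.
have ms' : t0 <= s' <= t1 by rewrite t0s' (le_trans s't').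
have mt' : t0 <= t' <= t1 by rewrite t't1 (le_trans t0s').
pose D := H * B * (t' - s'); pose Na := \int[leb]_(y in `[s', t']) `|a y|.
have D0 : 0 <= D by rewrite !mulr_ge0// subr_ge0.
have imu : itv_integrable s' t' mu by apply: (mu_integrable hmu); exact: le_trans t0s'.
have iab : itv_integrable s' t' (fun r => `|a r|) by apply: itv_integrable_norm; exact: ia'.
have i1 : itv_integrable s' t' (fun r => discount t' * (a r - v s' * mu r)).
  by apply: itv_integrableZ; apply: itv_integrableB; [exact: ia'|exact: itv_integrableZ].
have step : discount t' * v t' - discount s' * v s' <= \int[leb]_(r in `[s', t']) (discount t' * (a r - v s' * mu r)).
  rewrite itv_integralZ ?itv_integralB ?itv_integralZ//; last 3 first.
  - exact: ia'.
  - exact: itv_integrableZ.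
  - by apply: itv_integrableB; [exact: ia'|exact: itv_integrableZ].
  have h1 : discount t' - discount s' <= - (discount t' * I s' t').
    rewrite (discountE t0s' s't') -{1}[discount t']mulr1 -mulrBr -mulrN ler_wpM2l ?(ltW (discount_gt0 _))//.
    exact: onem_expR_le.
  have h2 := ler_wpM2l (ltW (discount_gt0 t')) (va t0s' s't' t't1).
  have h3 := ler_wpM2r (v0 ms') h1.
  rewrite -/(integral_between mu s' t').
  have e4 (X Y Z W : R) : X * Y - Z * W = X * (Y - W) + (X - Z) * W by ring.
  have e5 (X Y Z W : R) : X * Y + - (X * Z) * W = X * (Y - W * Z) by ring.
  by rewrite e4; apply: (le_trans (lerD h2 h3)); rewrite e5.
have pt r : s' <= r <= t' -> discount t' * (a r - v s' * mu r) - discounted r <=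
    D * `|a r| + B * (D * Vm + H * ((b s' - b t') + Na)).
  move=> /andP[s'r rt']; have t0r := le_trans t0s' s'r; have rt1 := le_trans rt' t't1.
  have mr : t0 <= r <= t1 by rewrite t0r.
  have dr : `|discount t' - discount r| <= D.
    by apply: (le_trans (hL _ _ t0r rt' t't1)); rewrite ler_wpM2l ?mulr_ge0// lerB.
  have vr : `|v s' - v r| <= (b s' - b t') + Na.
    have b1 := bmono _ _ t0s' s'r rt1; have b2 := bmono _ _ t0r rt' t't1.
    have e : v s' - v r = (b s' - b r) - \int[leb]_(y in `[s', r]) a y.
      by rewrite /b (catA s' r)//; ring.
    rewrite e; apply: (le_trans (ler_normB _ _)); apply: lerD.
      by rewrite ger0_norm ?subr_ge0// lerD2l lerN2.
    apply: (le_trans (itv_norm_integral_le (ia' t0s' rt1))).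
    exact: itv_integral_mono.
  have e6 (X Y Z W A0 M0 : R) : X * (A0 - Y * M0) - Z * (A0 - M0 * W) = (X - Z) * A0 - M0 * (X * Y - Z * W) by ring.
  rewrite /discounted e6.
  apply: (le_trans (ler_norm _)); apply: (le_trans (ler_normB _ _)); rewrite !normrM; apply: lerD.
    by rewrite ler_wpM2r.
  apply: ler_pM => //; first exact: hB.
  have e7 (X Y Z W : R) : X * Y - Z * W = (X - Z) * Y + Z * (Y - W) by ring.
  rewrite e7.
  apply: (le_trans (ler_normD _ _)); rewrite !normrM; apply: lerD; apply: ler_pM => //.
    by rewrite ger0_norm ?v0// growth_bound.
  by rewrite ger0_norm ?hH// ltW// discount_gt0.
have ipt : \int[leb]_(r in `[s', t']) (discount t' * (a r - v s' * mu r) - discounted r) <=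
    D * Na + B * (D * Vm + H * ((b s' - b t') + Na)) * (t' - s').
  rewrite -(itv_integral_cst _ s't') -(itv_integralZ D iab) -itv_integralD; last 2 first.
  - exact: itv_integrableZ.
  - exact: itv_integrable_cst.
  apply: itv_le_integral => //.
  - by apply: itv_integrableB => //; exact: if'.
  - by apply: itv_integrableD; [exact: itv_integrableZ|exact: itv_integrable_cst].
rewrite itv_integralB// in ipt; last exact: if'.
rewrite /Gam (catF s' t')//.
rewrite (_ : H * B * (t' - s') * (M t' - M s') = D * Na + B * (D * Vm + H * ((b s' - b t') + Na)) * (t' - s')); last first.
  by rewrite /M /D (catN s' t')// -/Na; ring.
apply: le_trans ipt; rewrite lerBrDr; apply: le_trans step.
have e8 (X Y W F : R) : X - (W + F) - (Y - W) + F = X - Y by ring.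
by rewrite e8.
Qed.

End gronwall.

Lemma weighted_integrable {R : realType} (eps t0 s t : R) (g : R -> R) : 0 <= eps ->
  itv_integrable s t g -> itv_integrable s t (fun r => expR (eps * (r - t0)) * g r).
Proof.
move=> e0 ig; apply: (@itv_integrable_le _ s t _ (fun r => expR (eps * (t - t0)) * `|g r|)).
- apply: measurable_funM; last exact: itv_integrable_measurable ig.
  by apply: measurableT_comp => //; apply: measurable_funM => //; exact: measurable_funB.
- by apply: itv_integrableZ; exact: itv_integrable_norm.
- move=> r /andP[sr rt]; rewrite normrM ger0_norm ?expR_ge0// ler_wpM2r// ler_expR.
  by rewrite ler_wpM2l// lerB.
Qed.

Section razumikhin.
Context {R : realType} (mu : R -> R) (T0 eps : R).
Local Notation leb := (@lebesgue_measure R).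
Hypotheses (hmu : uniformly_stable mu) (hT0 : Omega mu T0).
Hypotheses (eps0 : 0 < eps) (epsT : eps * T0 <= kappa mu T0).
Local Notation I := (integral_between mu).
Local Notation phiT := (phi mu T0 + eps * T0).
Variable t0 : R.
Hypothesis t00 : 0 <= t0.

Let P r := I t0 r + eps * (r - t0).

(* [barrier Q] is [exp(\int mu)] times the nondecreasing function [exp(peak) Q];
   the exponent [P + peak] lies between 0 and [phi mu T0 + eps T0]. *)
Definition peak t : R := sup [set - P s | s in `[t0, t]].

Lemma shifted_increment_le s t : t0 <= s -> s <= t -> - P s <= phiT - P t.
Proof.
move=> t0s st; have := shifted_integral_le hmu hT0 eps0 epsT (le_trans t00 t0s) st.
by rewrite /P (integral_between_cat hmu t00 t0s st) => h; lra.
Qed.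

Lemma peak_ge s t : t0 <= s -> s <= t -> - P s <= peak t.
Proof.
move=> t0s st; apply: ub_le_sup; last by exists s => //=; rewrite in_itv/= t0s.
exists (phiT - P t) => _ [r /= hr <-]; move: hr; rewrite in_itv/= => /andP[t0r rt].
exact: shifted_increment_le.
Qed.

Lemma peak_le t c : t0 <= t -> (forall s, t0 <= s -> s <= t -> - P s <= c) -> peak t <= c.
Proof.
move=> t0t h; apply: ge_sup; first by exists (- P t0), t0 => //=; rewrite in_itv/= lexx.
by move=> _ [r /= hr <-]; move: hr; rewrite in_itv/= => /andP[t0r rt]; exact: h.
Qed.

Lemma peak_mono s t : t0 <= s -> s <= t -> peak s <= peak t.
Proof. by move=> t0s st; apply: peak_le => // r t0r rs; apply: peak_ge => //; exact: le_trans st. Qed.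

Definition barrier (Q : R -> R) r : R := expR (I t0 r) * (expR (peak r) * Q r).

Lemma barrierE Q r : barrier Q r = expR (P r + peak r) * (Q r * expR (- eps * (r - t0))).
Proof.
have e : I t0 r + peak r = P r + peak r + - eps * (r - t0) by rewrite /P; ring.
by rewrite /barrier mulrA -expRD e expRD -[LHS]mulrA [_ * Q r]mulrC.
Qed.

Lemma barrier_ge Q r : t0 <= r -> 0 <= Q r -> Q r * expR (- eps * (r - t0)) <= barrier Q r.
Proof.
move=> t0r Q0; rewrite barrierE ler_peMl ?mulr_ge0 ?expR_ge0// -expR0 ler_expR.
by have := peak_ge t0r (lexx r); lra.
Qed.

Lemma barrier_le Q r : t0 <= r -> 0 <= Q r ->
  barrier Q r <= expR phiT * (Q r * expR (- eps * (r - t0))).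
Proof.
move=> t0r Q0; rewrite barrierE ler_wpM2r ?mulr_ge0 ?expR_ge0// ler_expR.
suff : peak r <= phiT - P r by lra.
by apply: peak_le => // s; exact: shifted_increment_le.
Qed.

Variables (t1 tau lam eta c : R) (v a g Q : R -> R).
Hypotheses (t01 : t0 <= t1) (tau0 : 0 <= tau) (eta0 : 0 < eta) (c0 : 0 < c).
Hypothesis hlam : expR (phiT + eps * tau) * (1 + eta) <= lam.
Hypotheses (v0 : forall r, t0 <= r <= t1 -> 0 <= v r) (mv : measurable_fun `[t0, t1] v).
Hypothesis vc : forall r, t0 - tau <= r <= t0 -> v r <= c.
Hypothesis ia : itv_integrable t0 t1 a.
Hypothesis va : forall s t, t0 <= s -> s <= t -> t <= t1 -> v t - v s <= \int[leb]_(r in `[s, t]) a r.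
Hypotheses (ig : itv_integrable t0 t1 g) (g0 : forall r, t0 <= r <= t1 -> 0 <= g r).
Hypotheses (Qc : c <= Q t0)
  (Qmono : forall s t, t0 <= s -> s <= t -> t <= t1 -> Q s <= Q t)
  (Qg : forall s t, t0 <= s -> s <= t -> t <= t1 ->
     \int[leb]_(r in `[s, t]) (expR (eps * (r - t0)) * g r) <= Q t - Q s).
Hypothesis razu : forall r, t0 <= r <= t1 -> Q r * expR (- eps * (r - t0)) <= v r ->
  (forall theta, - tau <= theta <= 0 -> v (r + theta) <= lam * v r) -> a r <= mu r * v r + g r.

Let cQ r : t0 <= r -> r <= t1 -> c <= Q r.
Proof. by move=> h1 h2; apply: (le_trans Qc); exact: Qmono. Qed.

Let Q0 r : t0 <= r -> r <= t1 -> 0 <= Q r.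
Proof. by move=> h1 h2; apply: le_trans (cQ h1 h2); exact: ltW. Qed.

(** [barrier_le] at the delayed time costs [expR phiT], the exponential decay over at most [tau]
    costs [expR (eps * tau)], and [Q] is nondecreasing; [barrier_ge] closes the chain at [r]. *)
Lemma barrier_delay r theta : t0 <= r -> r <= t1 -> - tau <= theta <= 0 -> t0 <= r + theta ->
  barrier Q (r + theta) <= expR (phiT + eps * tau) * barrier Q r.
Proof.
move=> t0r rt1 /andP[th1 th2] t0rt; have rr : r + theta <= r by rewrite gerDl.
have rtt1 := le_trans rr rt1.
apply: (le_trans (barrier_le t0rt (Q0 t0rt rtt1))).
rewrite [in leRHS](expRD phiT) -[leRHS]mulrA ler_wpM2l ?expR_ge0//.
apply: (@le_trans _ _ (expR (eps * tau) * (Q r * expR (- eps * (r - t0))))); last first.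
  by rewrite ler_wpM2l ?expR_ge0//; apply: barrier_ge => //; exact: Q0.
rewrite mulrCA -expRD; apply: ler_pM; rewrite ?expR_ge0 ?Q0//; first exact: Qmono.
rewrite ler_expR -subr_ge0 (_ : _ - _ = eps * (tau + theta)); last by ring.
by rewrite mulr_ge0 ?(ltW eps0)// -lerBlDl sub0r.
Qed.

(** A delayed time before [t0] means [r - t0 <= tau], so the decay suffered by the barrier since
    [t0] is at most [expR (eps * tau)]. *)
Lemma barrier_initial r theta : t0 <= r -> r <= t1 -> - tau <= theta <= 0 -> r + theta <= t0 ->
  c <= expR (phiT + eps * tau) * barrier Q r.
Proof.
move=> t0r rt1 /andP[th1 th2] rt; have phi0 : 0 <= phiT.
  by have := shifted_integral_le hmu hT0 eps0 epsT t00 (lexx t0); rewrite integral_between_point subrr mulr0 addr0.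
apply: (@le_trans _ _ (expR (phiT + eps * tau) * (Q r * expR (- eps * (r - t0))))); last first.
  by rewrite ler_wpM2l ?expR_ge0//; apply: barrier_ge => //; exact: Q0.
rewrite mulrCA -expRD; apply: (le_trans (cQ t0r rt1)); rewrite ler_peMr ?Q0//.
rewrite -expR0 ler_expR.
rewrite (_ : _ + _ = phiT + eps * (tau - (r - t0))); last by ring.
by rewrite addr_ge0// mulr_ge0 ?(ltW eps0)//; move: th1 rt; lra.
Qed.

(** After discounting, the barrier is [expR (peak r) * Q r]. Since [- P r <= peak t] on the
    interval, the discount factor at [r] is at most [expR (peak t + eps * (r - t0))], and the growth
    of [Q] dominates the weighted gain. *)
Lemma barrier_growth s t : t0 <= s -> s <= t -> t <= t1 ->
  \int[leb]_(r in `[s, t]) (discount mu t0 r * g r) <= expR (peak t) * Q t - expR (peak s) * Q s.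
Proof.
move=> t0s st tt1; have t0t := le_trans t0s st; have st1 := le_trans st tt1.
have igs : itv_integrable s t g by exact: itv_integrableS ig.
have ieg := weighted_integrable t0 (ltW eps0) igs.
apply: (@le_trans _ _ (expR (peak t) * (Q t - Q s))); last first.
  rewrite mulrBr lerD2l lerN2 ler_wpM2r ?Q0// ler_expR; exact: peak_mono.
apply: (@le_trans _ _ (expR (peak t) * \int[leb]_(r in `[s, t]) (expR (eps * (r - t0)) * g r))); last first.
  by rewrite ler_wpM2l ?expR_ge0//; exact: Qg.
have pw r : s <= r <= t -> discount mu t0 r * g r <= expR (peak t) * (expR (eps * (r - t0)) * g r).
  move=> /andP[sr rt]; have t0r := le_trans t0s sr.
  rewrite mulrA -expRD ler_wpM2r ?g0 ?t0r ?(le_trans rt)// ler_expR.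
  by have := peak_ge t0r rt; rewrite /P; lra.
rewrite -(itv_integralZ _ ieg); apply: itv_le_integral => //; last exact: itv_integrableZ.
apply: (@itv_integrable_le _ s t _ (fun r => expR (peak t) * (expR (eps * (r - t0)) * g r))).
- apply: measurable_funM; last exact: itv_integrable_measurable igs.
  apply: measurable_funS (discount_measurable hmu t00 t01) => //.
  by move=> r /=; rewrite !in_itv/= => /andP[h1 h2]; rewrite (le_trans t0s h1) (le_trans h2 tt1).
- exact: itv_integrableZ.
- move=> r hr; rewrite ger0_norm; first exact: pw.
  by case/andP: hr => sr rt; rewrite mulr_ge0 ?expR_ge0// g0// (le_trans t0s sr) (le_trans rt tt1).
Qed.

(** By contradiction on the supremum [N] of [v / y]. If it exceeds 1, a level [N'] just below it is
    passed at some [t2]; after the last time [t3] with [v] below the level, the Razumikhin condition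
    holds, so the discounted [v] grows no faster than [N'] times the discounted barrier and cannot
    be above the level at [t2]. *)
Lemma razumikhin_comparison : v t1 <= expR phiT * (Q t1 * expR (- eps * (t1 - t0))).
Proof.
pose y := barrier Q; pose Kd := expR (phiT + eps * tau).
have t11 : t0 <= t1 <= t1 by rewrite t01 lexx.
have y_low r : t0 <= r <= t1 -> c * expR (- eps * (t1 - t0)) <= y r.
  move=> /andP[h1 h2]; apply: le_trans (barrier_ge h1 (Q0 h1 h2)).
  apply: ler_pM; rewrite ?expR_ge0 ?(ltW c0)//; first exact: cQ.
  by rewrite ler_expR !mulNr lerN2 ler_wpM2l ?(ltW eps0)// lerB.
have m0 : 0 < c * expR (- eps * (t1 - t0)) by rewrite mulr_gt0// expR_gt0.
have y0 r : t0 <= r <= t1 -> 0 < y r by move=> hr; apply: lt_le_trans (y_low r hr).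
suff : v t1 <= y t1 by move=> /le_trans; apply; apply: barrier_le => //; exact: Q0.
pose ratios := [set v r / y r | r in `[t0, t1]].
have vb := growth_bound ia va.
have ubR : has_ubound ratios.
  exists ((v t0 + \int[leb]_(r in `[t0, t1]) `|a r|) / (c * expR (- eps * (t1 - t0)))) => _ [r /= hr <-].
  rewrite in_itv/= in hr; apply: ler_pM; rewrite ?invr_ge0 ?v0 ?(ltW (y0 _ hr))//; first exact: vb.
  by rewrite lef_pV2 ?posrE ?y_low ?y0.
pose N := sup ratios.
have vN r : t0 <= r <= t1 -> v r <= N * y r.
  move=> hr; rewrite -ler_pdivrMr ?y0//; apply: ub_le_sup => //.
  by exists r => //=; rewrite in_itv.
have [N1|N1] := leP N 1.
  by apply: (le_trans (vN _ t11)); rewrite ler_piMl// ltW// y0.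
exfalso; have eta1 : 0 < 1 + eta by rewrite addr_gt0.
(* The slack [1 + eta] allows for a level [N'] strictly below the supremum [N] at
   which the Razumikhin condition holds, so that no first crossing is needed. *)
pose N' := Num.max 1 (N / (1 + eta)).
have N'1 : 1 <= N' by rewrite le_max lexx.
have N'0 : 0 <= N' by exact: le_trans N'1.
have N'N : N' < N.
  by rewrite gt_max N1/= ltr_pdivrMr// ltr_pMr ?(lt_trans ltr01)// ltrDl.
have NN' : N <= (1 + eta) * N' by rewrite mulrC -ler_pdivrMr// le_max lexx orbT.
have neR : ratios !=set0 by exists (v t1 / y t1), t1 => //=; rewrite in_itv.
have [_ [t2 /= ht2 <-]] := sup_gt neR N'N; rewrite in_itv/= in ht2.
rewrite ltr_pdivlMr ?y0// => h2; have /andP[t02 t21] := ht2.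
pose B := [set s | t0 <= s <= t2 /\ v s <= N' * y s].
have yN r : t0 <= r <= t1 -> y r <= N' * y r by move=> hr; rewrite ler_peMl// ltW// y0.
have Bt0 : B t0.
  split; first by rewrite lexx t02.
  apply: le_trans (yN _ _); last by rewrite lexx t01.
  apply: le_trans (barrier_ge (lexx _) (Q0 (lexx _) t01)).
  rewrite subrr mulr0 expR0 mulr1; apply: le_trans Qc; apply: vc.
  by rewrite lexx andbT gerBl.
have supB : has_sup B by split; [exists t0|exists t2 => s [/andP[]]].
(* The supremum may fail to be attained, as [v] need not be continuous; a sequence in [B] approaches
   it from the left. *)
pose t3 := sup B.
have t03 : t0 <= t3 by apply: ub_le_sup => //; exact: supB.2.
have t32 : t3 <= t2 by apply: ge_sup; [exists t0|move=> s [/andP[]]].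
have t31 := le_trans t32 t21.
have /choice[sg hsg] k : exists s, B s /\ t3 - harmonic k < s.
  by have [s Bs hs] := sup_adherent (@harmonic_gt0 R k) supB; exists s.
have sg3 k : sg k <= t3 by apply: ub_le_sup; [exact: supB.2|exact: (hsg k).1].
have csg : sg k @[k --> \oo] --> t3.
  apply: (@squeeze_cvgr _ _ _ _ (fun k => t3 - harmonic k) (fun=> t3)).
  - by apply: nearW => k; rewrite sg3 andbT ltW// (hsg k).2.
  - by rewrite -[X in _ --> X]subr0; apply: cvgB; [exact: cvg_cst|exact: cvg_harmonic].
  - exact: cvg_cst.
pose dc := discount mu t0; pose f := discounted mu t0 v a.
pose Y r := expR (peak r) * Q r.
have dy r : dc r * y r = Y r.
  by rewrite /y /barrier mulrA -expRD addNr expR0 mul1r.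
have dc0 r : 0 < dc r by exact: expR_gt0.
have iF : itv_integrable t0 t1 f := discounted_integrable hmu t00 t01 v0 mv ia va.
have iF' s t : t0 <= s -> t <= t1 -> itv_integrable s t f by move=> ? ?; exact: itv_integrableS iF.
have gw s t : t0 <= s -> s <= t -> t <= t1 -> dc t * v t - dc s * v s <= \int[leb]_(r in `[s, t]) f r.
  exact: (gronwall_incr hmu t00 t01 v0 mv ia va).
have idg : itv_integrable t3 t2 (fun r => dc r * g r).
  have [H [_ [H0 _ _ hH _]]] := discount_bounds hmu t00 t01.
  have igs : itv_integrable t3 t2 g by exact: itv_integrableS ig.
  apply: (@itv_integrable_le _ _ _ _ (fun r => H * `|g r|)).
  - apply: measurable_funM; last exact: itv_integrable_measurable igs.
    apply: measurable_funS (discount_measurable hmu t00 t01) => //.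
    by move=> r /=; rewrite !in_itv/= => /andP[k1 k2]; rewrite (le_trans t03 k1) (le_trans k2 t21).
  - by apply: itv_integrableZ; exact: itv_integrable_norm.
  - move=> r /andP[k1 k2]; rewrite normrM ler_wpM2r// ger0_norm ?(ltW (dc0 _))//.
    by apply: hH; rewrite (le_trans t03 k1) (le_trans k2 t21).
have Ymono s t : t0 <= s -> s <= t -> t <= t1 -> Y s <= Y t.
  move=> k1 k2 k3; apply: ler_pM; rewrite ?expR_ge0 ?Q0 ?(le_trans k2 k3)//; last exact: Qmono.
  by rewrite ler_expR; exact: peak_mono.
(* The product rule from points of [B] to [t2], then their limit: the integral is continuous in its
   lower end, and [Y] is nondecreasing, so no continuity of [v] at [t3] enters. *)
have step1 : dc t2 * v t2 <= N' * Y t3 + \int[leb]_(r in `[t3, t2]) f r.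
  have lim : N' * Y t3 + (\int[leb]_(r in `[t0, t2]) f r - \int[leb]_(r in `[t0, sg k]) f r) @[k --> \oo] -->
      N' * Y t3 + (\int[leb]_(r in `[t0, t2]) f r - \int[leb]_(r in `[t0, t3]) f r).
    apply: cvgD; first exact: cvg_cst.
    apply: cvgB; first exact: cvg_cst.
    apply: (itv_integral_cvg_end iF) => //; last by rewrite t03.
    by move=> k; have [/andP[-> _] _] := (hsg k).1; rewrite (le_trans (sg3 k)).
  rewrite (itv_integral_cat t03 t32 (iF' _ _ (lexx _) t21)) addrC addrK addrC in lim.
  apply: (ler_cvg_to (@cvg_cst _ (dc t2 * v t2) _ _ _) lim); apply: nearW => k.
  have [/andP[s0 s2] vs] := (hsg k).1.
  have hgw := gw _ _ s0 s2 t21.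
  rewrite -(itv_integral_cat t03 t32 (iF' _ _ (lexx _) t21)).
  rewrite (itv_integral_cat s0 s2 (iF' _ _ (lexx _) t21)) [X in _ + X]addrAC subrr add0r.
  rewrite -lerBlDr; apply: le_trans (_ : dc (sg k) * v (sg k) <= _); first by rewrite lerBlDr -lerBlDl.
  apply: (@le_trans _ _ (dc (sg k) * (N' * y (sg k)))); first by rewrite ler_wpM2l// ltW.
  by rewrite mulrCA dy ler_wpM2l//; apply: Ymono.
(* On the interval open at [t3], since only later points are known to lie above the level. *)
have step2 : \int[leb]_(r in `[t3, t2]) f r <= \int[leb]_(r in `[t3, t2]) (dc r * g r).
  have sub h : itv_integrable t3 t2 h -> leb.-integrable `]t3, t2] (EFin \o h).
    by move=> ih; apply: integrableS ih => //; exact: subset_itv_oc_cc.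
  have j1 := sub _ (iF' _ _ t03 t21); have j2 := sub _ idg.
  rewrite -(Rintegral_itv_obnd_cbnd j1) -(Rintegral_itv_obnd_cbnd j2).
  apply: le_Rintegral => // r /=; rewrite in_itv/= => /andP[k1 k2].
  have t0r : t0 <= r by rewrite (le_trans t03)// ltW.
  have rt1 := le_trans k2 t21; have hr : t0 <= r <= t1 by rewrite t0r.
  have vr : N' * y r < v r.
    rewrite ltNge; apply/negP => h; move: k1; apply/negP; rewrite -leNgt.
    by apply: ub_le_sup; [exact: supB.2|split=> //; rewrite t0r].
  rewrite /f /discounted ler_wpM2l ?(ltW (dc0 _))// lerBlDl; apply: razu => //.
    apply: (le_trans (barrier_ge t0r (Q0 t0r rt1))); exact: le_trans (yN _ hr) (ltW vr).
  move=> th hth; have lam0 : 0 <= lam.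
    by apply: le_trans hlam; rewrite mulr_ge0 ?expR_ge0// ltW.
  have Klam : Kd <= lam by apply: le_trans hlam; rewrite ler_peMr ?expR_ge0// lerDl ltW.
  have [t0rt|rtt0] := leP t0 (r + th).
    have rt : r + th <= r by case/andP: hth => _ h; rewrite gerDl.
    have N0 : 0 <= N by rewrite ltW// (lt_trans ltr01).
    (* A past value is only known to be at most [N] times the barrier; [N <= (1 + eta) * N'] and
       [N' * y r < v r] turn this into [lam * v r]. *)
    apply: (le_trans (vN _ _)); first by rewrite t0rt (le_trans rt).
    apply: (@le_trans _ _ (((1 + eta) * N') * (Kd * y r))).
      by apply: ler_pM => //; [rewrite ltW// y0// t0rt (le_trans rt)|exact: barrier_delay].
    rewrite (_ : _ * _ = (Kd * (1 + eta)) * (N' * y r)); last by ring.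
    apply: ler_pM; [|exact: mulr_ge0 N'0 (ltW (y0 _ hr))|exact: hlam|exact: ltW vr].
    exact: mulr_ge0 (expR_ge0 _) (ltW eta1).
  apply: (@le_trans _ _ c).
    by apply: vc; rewrite (ltW rtt0) andbT; case/andP: hth => h _; apply: lerD.
  apply: (le_trans (barrier_initial t0r rt1 hth (ltW rtt0))).
  apply: ler_pM => //; rewrite ?expR_ge0 ?(ltW (y0 _ hr))//.
  by apply: le_trans (ltW vr); exact: yN.
have step3 := barrier_growth t03 t32 t21.
have D0 : 0 <= Y t2 - Y t3 by rewrite subr_ge0 Ymono.
have : dc t2 * v t2 <= N' * Y t2.
  apply: (le_trans step1); rewrite -lerBrDl -mulrBr.
  apply: (le_trans step2); apply: (le_trans step3); exact: ler_peMl.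
by rewrite -dy mulrCA leNgt ltr_pM2l ?dc0// h2.
Qed.

End razumikhin.

(** * Comparison functions and moments *)

(* No measurability: [history_norm (xi om)] is a supremum over a continuum. *)
Lemma le_integral_ge0 d (T : measurableType d) (R : realType) (mu : {measure set T -> \bar R})
    (f g : T -> \bar R) : (forall x, 0 <= f x)%E -> (forall x, f x <= g x)%E ->
  (\int[mu]_x f x <= \int[mu]_x g x)%E.
Proof.
move=> f0 fg; have g0 x : (0 <= g x)%E by exact: le_trans (fg x).
rewrite !ge0_integralTE//; apply: le_ereal_sup => _ [h hf <-]; exists h => //.
by move=> x; exact: le_trans (fg x).
Qed.

Section comparison_function_theory.
Context {R : realType}.
Implicit Types (f g alpha : R -> R).

(** [a] is the convex combination of [s] and 0 with coefficient [a / s]. Applied to [alpha1] and to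
    the opposite of [alpha2], this is the only form in which convexity enters. *)
Lemma convex_star f a s : @convex_function R R^o J f -> f 0 = 0 -> 0 < a -> a <= s ->
  f a <= a / s * f s.
Proof.
move=> cf f00 a0 as_; have s0 : 0 < s by exact: lt_le_trans as_.
have t0 : 0 <= a / s by rewrite divr_ge0 ?ltW.
have t1 : a / s <= 1 by rewrite ler_pdivrMr// mul1r.
have ms : s \in (J : set R) by apply/mem_set; exact: ltW.
have m0 : (0 : R) \in (J : set R) by apply/mem_set; exact: lexx.
have h : f (a / s * s + (1 - a / s) * 0) <= a / s * f s + (1 - a / s) * f 0 := cf (Itv01 t0 t1) s 0 ms m0.
by move: h; rewrite f00 !mulr0 !addr0 divfK ?gt_eqF.
Qed.

Lemma classK_ge0 alpha s : classK alpha -> 0 <= s -> 0 <= alpha s.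
Proof.
move=> [_ a0 incr]; rewrite le_eqVlt => /predU1P[<-|s0]; first by rewrite a0.
by rewrite -a0 ltW// incr.
Qed.

Lemma classK_gt0 alpha s : classK alpha -> 0 < s -> 0 < alpha s.
Proof. by move=> [_ a0 incr] s0; rewrite -a0; exact: incr. Qed.

Lemma classK_le alpha s t : classK alpha -> 0 <= s -> s <= t -> alpha s <= alpha t.
Proof.
by move=> [_ _ incr] s0; rewrite le_eqVlt => /predU1P[->//|st]; rewrite ltW// incr.
Qed.

Lemma classK_lt alpha s t : classK alpha -> 0 <= s -> 0 <= t -> (alpha s < alpha t) = (s < t).
Proof.
move=> ka s0 t0; have [ts|st] := leP t s; first by apply/negbTE; rewrite -leNgt classK_le.
by have [_ _ ->] := ka.
Qed.

Lemma withinJ_continuousP f : {within J, continuous f} <->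
  forall s e, 0 <= s -> 0 < e -> exists2 del, 0 < del &
    forall t, 0 <= t -> `|s - t| < del -> `|f s - f t| < e.
Proof.
split=> [/subspace_continuousP cf s e s0 e0|h].
  have /cvgrPdist_lt /(_ e e0) := cf s s0.
  rewrite near_withinE => /nbhs_ballP[del /= del0 hdel]; exists del => // t t0 st.
  exact: hdel.
apply/subspace_continuousP => s s0; apply/cvgrPdist_lt => e e0.
have [del del0 hdel] := h s e s0 e0.
rewrite near_withinE; apply/nbhs_ballP; exists del => //= t st t0; exact: hdel.
Qed.

Lemma classK_right alpha s e : classK alpha -> 0 <= s -> 0 < e ->
  exists2 del, 0 < del & alpha (s + del) <= alpha s + e.
Proof.
move=> [/withinJ_continuousP ca _ _] s0 e0; have [del del0 h] := ca s e s0 e0.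
exists (del / 2); first by rewrite divr_gt0.
have : `|alpha s - alpha (s + del / 2)| < e.
  apply: h; first by rewrite addr_ge0// divr_ge0// ltW.
  rewrite opprD addrA subrr add0r normrN ger0_norm ?divr_ge0 ?(ltW del0)//.
  by rewrite ltr_pdivrMr// ltr_pMr// ltr1n.
by rewrite distrC => /ltW /(le_trans (ler_norm _)); rewrite lerBlDl.
Qed.

Lemma classK_scale alpha c : 0 < c -> classK alpha -> classK (fun s => c * alpha s).
Proof.
move=> c0 [/withinJ_continuousP ca a0 incr]; split; last 2 first.
- by rewrite a0 mulr0.
- by move=> s s' s0 ss'; rewrite ltr_pM2l// incr.
apply/withinJ_continuousP => s e s0 e0; have [del del0 h] := ca s (e / c) s0 (divr_gt0 e0 c0).
exists del => // t t0 st; rewrite -mulrBr normrM gtr0_norm// mulrC -ltr_pdivlMr//.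
exact: h.
Qed.

Lemma classK_comp alpha g : classK alpha -> classK g -> classK (fun s => alpha (g s)).
Proof.
move=> ka kg; have [/withinJ_continuousP ca a0 aincr] := ka; have [/withinJ_continuousP cg g0 gincr] := kg.
split; last 2 first.
- by rewrite g0.
- by move=> s s' s0 ss'; apply: aincr; [exact: classK_ge0|exact: gincr].
apply/withinJ_continuousP => s e s0 e0; have gs := classK_ge0 kg s0.
have [d1 d10 h1] := ca (g s) e gs e0; have [d2 d20 h2] := cg s d1 s0 d10.
by exists d2 => // t t0 st; apply: h1; [exact: classK_ge0|exact: h2].
Qed.

Variable alpha : R -> R.
Hypothesis hal : classKoo alpha.
Let ka : classK alpha := hal.1.

Lemma classKoo_surj w : 0 <= w -> exists2 s, 0 <= s & alpha s = w.
Proof.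
move=> w0; have [[ca a0 incr] _] := hal; have /cvgryPge /(_ w)[B [_ hB]] := hal.2.
pose S := `|B| + 1; have S0 : 0 <= S by rewrite addr_ge0.
have wS : w <= alpha S by apply: hB; rewrite (le_lt_trans (ler_norm _))// ltrDl.
have cS : {within `[0, S], continuous alpha}.
  by apply: continuous_subspaceW ca => r /=; rewrite in_itv/= => /andP[].
have [|s hs <-] := @IVT R alpha 0 S w S0 cS.
  by rewrite a0 ge_min w0/= le_max wS orbT.
by exists s => //; move: hs; rewrite in_itv/= => /andP[].
Qed.

Let inj : {in J &, injective alpha}.
Proof.
move=> s t /set_mem s0 /set_mem t0 e; have [_ _ incr] := ka.
have [st|ts|//] := ltgtP s t; [have := incr s t s0 st|have := incr t s t0 ts]; by rewrite e ltxx.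
Qed.

Lemma KinvK s : 0 <= s -> Kinv alpha (alpha s) = s.
Proof. by move=> s0; apply: (pinvKV (fun=> 0) inj); apply/mem_set. Qed.

Lemma KinvKV w : 0 <= w -> alpha (Kinv alpha w) = w.
Proof. by move=> w0; have [s s0 <-] := classKoo_surj w0; rewrite KinvK. Qed.

Lemma Kinv_ge0 w : 0 <= w -> 0 <= Kinv alpha w.
Proof. by move=> w0; have [s s0 <-] := classKoo_surj w0; rewrite KinvK. Qed.

Lemma Kinv_lt w s : 0 <= w -> 0 <= s -> (Kinv alpha w < s) = (w < alpha s).
Proof. by move=> w0 s0; rewrite -{2}(KinvKV w0) (classK_lt ka)// Kinv_ge0. Qed.

Lemma Kinv_gt w s : 0 <= w -> 0 <= s -> (s < Kinv alpha w) = (alpha s < w).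
Proof. by move=> w0 s0; rewrite -{2}(KinvKV w0) (classK_lt ka)// Kinv_ge0. Qed.

(** Continuity follows from monotonicity: the values of [alpha] at [a - e] and [a + e] bracket [w],
    and when [a < e] the lower side holds because the inverse is nonnegative. *)
Lemma classK_Kinv : classK (Kinv alpha).
Proof.
split; last 2 first.
- by have [_ e0 _] := ka; rewrite -[in LHS]e0 KinvK.
- by move=> s t s0 st; rewrite Kinv_lt ?Kinv_ge0 ?KinvKV// (le_trans s0)// ltW.
apply/withinJ_continuousP => w e w0 e0; set a := Kinv alpha w.
have a0 : 0 <= a by exact: Kinv_ge0.
have wa : alpha a = w by exact: KinvKV.
have hup : 0 < alpha (a + e) - w by rewrite subr_gt0 -wa; have [_ _ ->] := ka; rewrite ?ltrDl.
have [del [del0 lo up]] : exists del, [/\ 0 < del,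
    forall t, 0 <= t -> w - t < del -> a - e < Kinv alpha t &
    forall t, 0 <= t -> t - w < del -> Kinv alpha t < a + e].
  have [ae|ea] := ltP a e.
    exists (alpha (a + e) - w); split => // [t t0 _|t t0 h].
      by rewrite (@lt_le_trans _ _ 0) ?subr_lt0// Kinv_ge0.
    by rewrite Kinv_lt ?addr_ge0 ?(ltW e0)//; move: h; rewrite ltrBlDr subrK.
  have ae0 : 0 <= a - e by rewrite subr_ge0.
  have hlo : 0 < w - alpha (a - e) by rewrite subr_gt0 -wa; have [_ _ ->] := ka; rewrite ?gtrBl.
  exists (Num.min (alpha (a + e) - w) (w - alpha (a - e))); split => [|t t0|t t0].
  - by rewrite lt_min hup.
  - by rewrite lt_min => /andP[_ h]; rewrite Kinv_gt//; move: h; rewrite ltrD2l ltrN2.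
  - by rewrite lt_min => /andP[h _]; rewrite Kinv_lt ?addr_ge0 ?(ltW e0)//; move: h; rewrite ltrBlDr subrK.
exists del => // t t0 wt; rewrite distrC ltr_distl lo ?up// ?(le_lt_trans (ler_norm _) wt)//.
by rewrite (le_lt_trans _ wt)// distrC ler_norm.
Qed.

(** A sum is at most twice the larger term. It separates the contribution of the initial value from
    that of the input. *)
Lemma Kinv_subadd w w' : 0 <= w -> 0 <= w' ->
  Kinv alpha (w + w') <= Kinv alpha (2 * w) + Kinv alpha (2 * w').
Proof.
move=> w0 w'0; have kk := classK_Kinv.
have k0 z : 0 <= z -> 0 <= Kinv alpha (2 * z) by move=> z0; apply: classK_ge0 => //; rewrite mulr_ge0.
have [h|h] := leP w w'.
  apply: (@le_trans _ _ (Kinv alpha (2 * w'))); last by rewrite lerDr k0.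
  by apply: classK_le => //; [exact: addr_ge0|rewrite mulr_natl mulr2n lerD2r].
apply: (@le_trans _ _ (Kinv alpha (2 * w))); last by rewrite lerDl k0.
by apply: classK_le => //; [exact: addr_ge0|rewrite mulr_natl mulr2n lerD2l ltW].
Qed.

Lemma decaying_classKL (beta : R -> R) (c eps : R) : classK beta -> 0 < c -> 0 < eps ->
  classKL (fun s t => 2 * Kinv alpha (c * beta s * expR (- eps * t))).
Proof.
move=> kb c0 e0; have kk := classK_Kinv; split=> [t t0|s s0].
  apply: classK_scale => //; apply: classK_comp => //.
  rewrite (_ : (fun s => _) = fun s => c * expR (- eps * t) * beta s).
    by apply: classK_scale => //; rewrite mulr_gt0// expR_gt0.
  by apply/funext => s; rewrite mulrAC.
have b0 : 0 <= c * beta s by rewrite mulr_ge0 ?(ltW c0)// classK_ge0.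
split=> [t t' t0 tt'|].
  rewrite ler_wpM2l//; apply: classK_le => //; first by rewrite mulr_ge0 ?expR_ge0.
  by rewrite ler_wpM2l// ler_expR !mulNr lerN2 ler_wpM2l// ltW.
apply/cvgrPdist_lt => e e'0.
have he : 0 < alpha (e / 2) by apply: classK_gt0 => //; rewrite divr_gt0.
have lim : c * beta s * expR (- (eps * t)) @[t --> +oo] --> 0.
  rewrite -[X in _ --> X](mulr0 (c * beta s)); apply: cvgM; first exact: cvg_cst.
  apply: (@cvg_comp _ _ _ (fun t => eps * t) (fun t => expR (- t))); last exact: cvgr_expR.
  by apply: gt0_cvgMry => //; exact: cvg_id.
move/cvgrPdist_lt : lim => /(_ _ he); apply: filterS => t.
rewrite !sub0r !normrN -mulNr => h.
rewrite ger0_norm; last by rewrite mulr_ge0// Kinv_ge0// mulr_ge0 ?expR_ge0.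
rewrite mulrC -ltr_pdivlMr// Kinv_lt ?divr_ge0 ?(ltW e'0) ?(mulr_ge0 b0) ?expR_ge0//.
exact: le_lt_trans (ler_norm _) h.
Qed.

End comparison_function_theory.

(** The supremum is over a bounded set: clamping extends [ph] to a continuous function on the line,
    which attains its maximum on [[- tau, 0]]. *)
Lemma history_norm_ge {R : realType} (tau : R) n (ph : history tau n) (theta : `[- tau, 0]%classic) :
  enorm (sval ph theta) <= history_norm ph.
Proof.
have tau0 : 0 <= tau.
  by have := set_valP theta; rewrite /= in_itv/= => /andP[h1 h2]; have := le_trans h1 h2; rewrite oppr_le0.
have clP (r : R) : Num.max (- tau) (Num.min r 0) \in `[- tau, 0]%classic.
  by apply/mem_set; rewrite /= in_itv/= le_max lexx/= ge_max oppr_le0 tau0/= ge_min lexx orbT.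
pose cl (r : R) : `[- tau, 0]%classic := SigSub (clP r).
have clE (th : `[- tau, 0]%classic) : cl (set_val th) = th.
  apply: val_inj => /=; have := set_valP th; rewrite /= in_itv/= set_valE => /andP[h1 h2].
  by rewrite min_l// max_r.
have cmm : continuous (fun r : R => Num.max (- tau) (Num.min r 0)).
  have cmin : continuous (fun r : R => Num.min r 0).
    by move=> y; apply: continuous_min; [exact: cvg_id|exact: cst_continuous].
  move=> y; apply: (continuous_comp (cmin y)).
  by apply: continuous_max; [exact: cst_continuous|exact: cvg_id].
have ccl : continuous cl.
  apply: continuous_comp_initial.
  rewrite (_ : set_val \o cl = fun r => Num.max (- tau) (Num.min r 0)); first exact: cmm.
  by apply/funext => r /=; rewrite set_valE.
pose f r := enorm (sval ph (cl r)).
have cf : continuous f.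
  move=> z; apply: (@continuous_comp _ _ _ (fun r => \sum_i sval ph (cl r) i 0 ^+ 2) Num.sqrt); last exact: sqrt_continuous.
  apply: cvg_rsum => i; rewrite expr2; under eq_fun do rewrite expr2.
  have c : sval ph (cl r) i 0 @[r --> z] --> sval ph (cl z) i 0.
    apply: (@cvg_comp _ _ _ (fun r => sval ph (cl r)) (fun M : 'cV[R]_n => M i 0)); last exact: coord_continuous.
    by apply: cvg_comp (ccl z) _; exact: (svalP ph).
  exact: cvgM.
have [||c _ hc] := @EVT_max R f (- tau) 0; first by rewrite oppr_le0.
  exact: continuous_subspaceT.
apply: ub_le_sup; last by exists theta.
exists (f c) => _ [th _ <-]; rewrite -(clE th); apply: hc.
by have := set_valP th.
Qed.

Lemma enorm_measurable {R : realType} d (T : measurableType d) (D : set T) n (Y : T -> 'cV[R]_n) :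
  (forall i, measurable_fun D (fun om => Y om i 0)) -> measurable_fun D (fun om => enorm (Y om)).
Proof.
move=> mY; apply: (@measurableT_comp _ _ _ _ _ _ (@Num.sqrt R)).
  by apply: continuous_measurable_fun; exact: sqrt_continuous.
by apply: measurable_sum => i; apply: measurable_funX.
Qed.

Lemma enorm_powR_measurable {R : realType} d (T : measurableType d) n (p : R) (Y : T -> 'cV[R]_n) :
  (forall i, measurable_fun setT (fun om => Y om i 0)) -> measurable_fun setT (fun om => enorm (Y om) `^ p).
Proof.
move=> mY; apply: (@measurableT_comp _ _ _ _ _ _ (fun r : R => r `^ p)); first exact: measurable_powR.
exact: enorm_measurable.
Qed.

(** * From moments to the mean of the Lyapunov function and back *)

Section solution_moments.
Context {R : realType} d {T : measurableType d} (P : probability T R).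
Context (F : R -> set (set T)) (hF : usual_conditions P F).
Context (tau : R) (n m l : nat) (w : R -> T -> 'cV[R]_m) (hw : brownian P F w).
Context (f0 : R -> history tau n -> 'cV[R]_l -> 'cV[R]_n).
Context (g0 : R -> history tau n -> 'cV[R]_l -> 'M[R]_(n, m)).
Context (hfg : sfde_assumptions P F w f0 g0).
Context (V : R -> 'cV[R]_n -> R) (p : R) (alpha1 alpha2 : R -> R).
Hypotheses (tau0 : 0 <= tau) (hV : classC21 tau V) (hp : 0 < p).
Hypotheses (ha1 : classVKoo alpha1) (ha2 : classCKoo alpha2) (hA : cond_A tau V p alpha1 alpha2).
Variables (t0 : R) (xi : T -> history tau n) (u : @input R l) (x : R -> T -> 'cV[R]_n).
Hypotheses (t00 : 0 <= t0) (hxi : initial_condition F t0 xi) (hu : admissible_input u).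
Hypothesis hx : is_solution P F w f0 g0 t0 xi u x.
Hypothesis hE : expectations_defined P f0 g0 V t0 u x.
Local Notation leb := (@lebesgue_measure R).
Local Notation v := (EV P V x).
Local Notation m0 := (initial_moment P p xi).

Let tauE r : t0 - tau <= r -> - tau <= r.
Proof. by apply: le_trans; rewrite lerDr. Qed.

Let hA' r y : - tau <= r -> alpha1 (enorm y `^ p) <= V r y <= alpha2 (enorm y `^ p).
Proof. by move=> h; exact: hA. Qed.

Lemma mean_V r : t0 - tau <= r -> mean P (fun om => V r (x r om)) (v r).
Proof. by move=> h; split; [exact: hE.1|rewrite EV_integral]. Qed.

Lemma EV_ge0 r : t0 - tau <= r -> 0 <= v r.
Proof.
move=> h; have := mean_le (mean_cst P 0) (mean_V h); apply => om.
by apply: (C21_ge0 hV); exact: tauE.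
Qed.

Lemma mean_EFin (X : T -> R) e : mean P X e -> (\int[P]_om (X om)%:E)%E = e%:E.
Proof. by move=> [iX <-]; rewrite /Rintegral fineK//; exact: integrable_fin_num. Qed.

(* Star-shapedness replaces Jensen's inequality, at the price of a factor 2. *)
Lemma moment_le r a : t0 - tau <= r -> 0 < a -> v r <= alpha1 a -> (moment P p x r <= (2 * a)%:E)%E.
Proof.
move=> hr a0 va; have ka := ha1.1.1; have aa0 := classK_gt0 ka a0.
have mb : mean P (fun om => a + a / alpha1 a * V r (x r om)) (a + a / alpha1 a * v r).
  by apply: meanD; [exact: mean_cst|apply: meanZ; exact: mean_V].
have k0 : 0 <= a / alpha1 a by rewrite divr_ge0 ?ltW.
rewrite /moment unlock; apply: (@le_trans _ _ (\int[P]_om (a + a / alpha1 a * V r (x r om))%:E)%E).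
  apply: le_integral_ge0 => om; first by rewrite lee_fin powR_ge0.
  have /andP[h1 _] := hA' (x r om) (tauE hr).
  rewrite lee_fin; set X := enorm (x r om) `^ p in h1 *.
  have V0 : 0 <= V r (x r om) by apply: (C21_ge0 hV); exact: tauE.
  have [Xa|aX] := leP X a; first by apply: (le_trans Xa); rewrite lerDl mulr_ge0.
  have X0 : 0 < X by exact: lt_trans aX.
  have h2 : alpha1 a <= a / X * alpha1 X.
    by apply: convex_star => //; [exact: ha1.2|have [_ ->] := ka|exact: ltW].
  rewrite (@le_trans _ _ (a / alpha1 a * alpha1 X))//; last first.
    by rewrite (le_trans (ler_wpM2l k0 h1))// lerDr ltW.
  rewrite mulrAC ler_pdivlMr// mulrC -ler_pdivlMr// (le_trans h2)// le_eqVlt; apply/orP; left; apply/eqP.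
  by rewrite mulrAC.
rewrite (mean_EFin mb) lee_fin mulr_natl mulr2n lerD2l -[leRHS]mulr1 -mulrA ler_wpM2l ?(ltW a0)//.
by rewrite mulrC ler_pdivrMr// mul1r.
Qed.

Lemma moment_le_Kinv r z : t0 - tau <= r -> 0 <= z -> v r <= z ->
  (moment P p x r <= (2 * Kinv alpha1 z)%:E)%E.
Proof.
move=> hr; rewrite le_eqVlt => /predU1P[<-|z0] vz.
  (* [moment_le] needs a positive level; at bound 0 it is applied with every small level [e / 2]. *)
  have k0 : Kinv alpha1 0 = 0 by have [_ ->] := classK_Kinv ha1.1.
  rewrite k0 mulr0; apply/lee_addgt0Pr => e e0; rewrite add0e.
  have e20 : 0 < e / 2 by rewrite divr_gt0.
  have -> : e = 2 * (e / 2) by field.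
  by apply: moment_le => //; apply: (le_trans vz); apply: ltW; apply: classK_gt0 e20; exact: ha1.1.1.
apply: moment_le => //; last by rewrite (KinvKV ha1.1 (ltW z0)).
by rewrite (Kinv_gt ha1.1 (ltW z0) (lexx 0)); have [_ -> _] := ha1.1.1.
Qed.

Lemma initial_moment_ge (theta : `[- tau, 0]%classic) :
  (\int[P]_om (enorm (x (t0 + set_val theta) om) `^ p)%:E <= m0%:E)%E.
Proof.
have /andP[th1 th2] : - tau <= set_val theta <= 0 by have := set_valP theta; rewrite /= in_itv.
have mx : measurable_fun setT (fun om => enorm (x (t0 + set_val theta) om) `^ p).
  apply: enorm_powR_measurable => i; apply: (filtration_rv_measurable hF t00).
  by apply: (solution_rv_measurable hF t00 hxi hx) => //; rewrite ?lerD2l// gerDl.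
have mxi : measurable_fun setT (fun om => enorm (sval (xi om) theta) `^ p).
  apply: enorm_powR_measurable => i; apply: (filtration_rv_measurable hF t00) => B mB.
  suff h : @history_sigma R tau n [set ph : history tau n | B (sval ph theta i 0)] by exact: (hxi.1 _ h).
  apply: sub_gen_smallest; exists (fun ph : history tau n => sval ph theta i 0); first by exists theta, i.
  by exists B => //; rewrite setTI.
have [c hc] := hxi.2.
have hn0 om : 0 <= history_norm (xi om) by exact: le_trans (enorm_ge0 _) (history_norm_ge _ theta).
have fin : (\int[P]_om (history_norm (xi om) `^ p)%:E <= (c `^ p)%:E)%E.
  rewrite -(mean_EFin (mean_cst P (c `^ p))); apply: le_integral_ge0 => om; rewrite lee_fin ?powR_ge0//.
  apply: ge0_ler_powR; rewrite ?nnegrE; [exact: ltW|exact: hn0| |exact: hc].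
  exact: le_trans (hn0 om) (hc om).
have e0 : (0 <= \int[P]_om (history_norm (xi om) `^ p)%:E)%E.
  by apply: integral_ge0 => om _; rewrite lee_fin powR_ge0.
rewrite /initial_moment unlock fineK; last first.
  by rewrite ge0_fin_numE// (le_lt_trans fin)// ltry.
have -> : (\int[P]_om (enorm (x (t0 + set_val theta) om) `^ p)%:E =
    \int[P]_om (enorm (sval (xi om) theta) `^ p)%:E)%E.
  apply: ae_eq_integral => //; [exact/measurable_EFinP|exact/measurable_EFinP|].
  by apply: filterS (solution_initial hx) => om h _; rewrite h.
apply: le_integral_ge0 => om; rewrite lee_fin ?powR_ge0//.
by apply: ge0_ler_powR; rewrite ?nnegrE ?hn0 ?enorm_ge0 ?(ltW hp)//; exact: history_norm_ge.
Qed.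

Lemma initial_moment_ge0 : 0 <= m0.
Proof. by apply: fine_ge0; rewrite unlock; apply: integral_ge0 => om _; rewrite lee_fin powR_ge0. Qed.

(** Concavity makes [alpha2 X] at most [(alpha2 m' / m') * X] for [m' <= X], while monotonicity
    covers smaller values; adding the two bounds gives the factor 2. The level [m'] decreases to the
    initial moment by right continuity, which includes the case of moment 0. *)
Lemma initial_EV_le r : t0 - tau <= r <= t0 -> v r <= 2 * alpha2 m0.
Proof.
move=> /andP[tr rt]; have ka := ha2.1.1; have m00 := initial_moment_ge0.
have mth : r - t0 \in `[- tau, 0]%classic.
  by apply/mem_set; rewrite /= in_itv/= subr_le0 rt andbT lerBrDl.
have := initial_moment_ge (SigSub mth); rewrite set_valE/= addrC subrK => hX.
pose X om := enorm (x r om) `^ p.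
have mX : measurable_fun setT X.
  apply: enorm_powR_measurable => i; apply: (filtration_rv_measurable hF t00).
  exact: (solution_rv_measurable hF t00 hxi hx).
have X0 om : 0 <= X om by exact: powR_ge0.
have iX : P.-integrable setT (EFin \o X).
  apply/integrableP; split; first exact/measurable_EFinP.
  apply: le_lt_trans (ltry m0); apply: le_trans hX; rewrite le_eqVlt; apply/orP; left; apply/eqP.
  by apply: eq_integral => om _ /=; rewrite ger0_norm.
have EX : \int[P]_om X om <= m0.
  by rewrite -lee_fin -(mean_EFin (conj iX erefl)).
have key m' : 0 < m' -> m0 <= m' -> v r <= 2 * alpha2 m'.
  move=> m'0 mm'; have a0 := classK_gt0 ka m'0.
  have mb : mean P (fun om => alpha2 m' + alpha2 m' / m' * X om) (alpha2 m' + alpha2 m' / m' * \int[P]_om X om).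
    by apply: meanD; [exact: mean_cst|exact: meanZ].
  apply: (le_trans (mean_le (mean_V tr) mb _)) => [om|].
    have /andP[_ h1] := hA' (x r om) (tauE tr); apply: (le_trans h1); rewrite -/(X om).
    have k0 : 0 <= alpha2 m' / m' by rewrite divr_ge0 ?ltW.
    have [Xm|mX'] := leP (X om) m'.
      by apply: (le_trans (classK_le ka (X0 om) Xm)); rewrite lerDl mulr_ge0.
    have X0' : 0 < X om by exact: lt_trans mX'.
    have h2 : - alpha2 m' <= m' / X om * (- alpha2 (X om)).
      by apply: (convex_star ha2.2) => //=; [have [_ ->] := ka; rewrite oppr0|exact: ltW].
    rewrite (@le_trans _ _ (alpha2 m' / m' * X om))//; last by rewrite lerDr ltW.
    rewrite mulrAC ler_pdivlMr// -ler_pdivrMr//.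
    rewrite (_ : _ * m' / X om = m' / X om * alpha2 (X om)); last by ring.
    by move: h2; rewrite mulrN lerN2.
  rewrite mulr_natl mulr2n lerD2l -mulrA ler_piMr ?(ltW a0)// mulrC ler_pdivrMr// mul1r.
  exact: le_trans EX mm'.
apply/ler_addgt0Pr => e e0.
have [del del0 hdel] := classK_right ka m00 (divr_gt0 e0 (ltr0Sn R 1)).
apply: (le_trans (key (m0 + del) (ltr_wpDl m00 del0) _)); first by rewrite lerDl ltW.
by move: hdel; lra.
Qed.

Lemma EV_measurable t : t0 <= t -> measurable_fun `[t0, t] v.
Proof.
move=> t0t; have := measurable_mean_norm P (f := fun om r => V r (x r om))
  (path_joint_measurable hF tau0 t00 hxi hx t0t (@C21_continuous _ _ _ _ hV)).
move=> /(measurableT_comp (fine_measurable measurableT)); apply: eq_measurable_fun => r.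
move=> /set_mem; rewrite /= in_itv/= => /andP[t0r _]; rewrite /EV; congr fine; congr ('E_P[_])%E.
apply/funext => om; rewrite ger0_norm//; apply: (C21_ge0 hV).
by rewrite (le_trans _ (le_trans t00 t0r))// oppr_le0.
Qed.

End solution_moments.

(** The margin [L = ln rho^-1] is halved: [eps * (T0 + tau)] takes at most one half and
    [1 + eta = expR (L / 2)] is the other. The first entry of the minimum keeps the decay over a
    period. *)
Lemma exists_rate {R : realType} (mu : R -> R) (T0 rho tau : R) :
  Omega mu T0 -> 0 < rho < 1 -> 0 <= tau ->
  exists eps eta : R, [/\ 0 < eps, 0 < eta, eps * T0 <= kappa mu T0 &
    expR (phi mu T0 + eps * T0 + eps * tau) * (1 + eta) <= expR (phi mu T0) / rho].
Proof.
move=> hT0 /andP[rho0 rho1] tau0; have T00 : 0 < T0 := hT0.1.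
have k0 := kappa_gt0 hT0; have Tt : 0 < T0 + tau by exact: ltr_wpDr.
pose L := ln rho^-1; have L0 : 0 < L by rewrite ln_gt0// invf_gt1.
have eL : expR L = rho^-1 by rewrite lnK// posrE invr_gt0.
pose eps := Num.min (kappa mu T0 / T0) (L / 2 / (T0 + tau)).
have e1 : eps <= kappa mu T0 / T0 by rewrite ge_min lexx.
have e2 : eps <= L / 2 / (T0 + tau) by rewrite ge_min lexx orbT.
exists eps, (expR (L / 2) - 1); split.
- by rewrite lt_min !divr_gt0.
- by rewrite subr_gt0 -expR0 ltr_expR divr_gt0.
- by rewrite -ler_pdivlMr.
- rewrite addrCA subrr addr0 -expRD -eL -expRD ler_expR -!addrA lerD2l.
  rewrite ler_pdivlMr// in e2; rewrite addrA -mulrDr.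
  by move: e2; lra.
Qed.

(** * Comparison along solutions and the four stability properties *)

Section solution_comparison.
Context {R : realType} d {T : measurableType d} (P : probability T R).
Context (F : R -> set (set T)) (hF : usual_conditions P F).
Context (tau : R) (n m l : nat) (w : R -> T -> 'cV[R]_m) (hw : brownian P F w).
Context (f0 : R -> history tau n -> 'cV[R]_l -> 'cV[R]_n).
Context (g0 : R -> history tau n -> 'cV[R]_l -> 'M[R]_(n, m)).
Context (hfg : sfde_assumptions P F w f0 g0).
Context (V : R -> 'cV[R]_n -> R) (p : R) (alpha1 alpha2 : R -> R).
Hypotheses (tau0 : 0 <= tau) (hV : classC21 tau V) (hp : 0 < p).
Hypotheses (ha1 : classVKoo alpha1) (ha2 : classCKoo alpha2) (hA : cond_A tau V p alpha1 alpha2).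
Context (mu : R -> R) (T0 eps eta lam : R).
Hypotheses (hmu : uniformly_stable mu) (hT0 : Omega mu T0).
Hypotheses (eps0 : 0 < eps) (eta0 : 0 < eta) (epsT : eps * T0 <= kappa mu T0).
Hypothesis hlam : expR (phi mu T0 + eps * T0 + eps * tau) * (1 + eta) <= lam.
Variables (t0 : R) (xi : T -> history tau n) (u : @input R l) (x : R -> T -> 'cV[R]_n).
Hypotheses (t00 : 0 <= t0) (hxi : initial_condition F t0 xi) (hu : admissible_input u).
Hypothesis hx : is_solution P F w f0 g0 t0 xi u x.
Hypothesis hE : expectations_defined P f0 g0 V t0 u x.
Local Notation leb := (@lebesgue_measure R).
Local Notation v := (EV P V x).
Local Notation m0 := (initial_moment P p xi).
Local Notation gain := (expR (phi mu T0 + eps * T0)).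

(* [g] is the gain added to the generator bound by the input; [W] bounds its
   accumulated effect. *)
Lemma EV_comparison (t1 : R) (g W : R -> R) : t0 <= t1 ->
  itv_integrable t0 t1 g -> (forall r, t0 <= r <= t1 -> 0 <= g r) -> 0 <= W t0 ->
  (forall s t, t0 <= s -> s <= t -> t <= t1 -> W s <= W t) ->
  (forall s t, t0 <= s -> s <= t -> t <= t1 ->
     \int[leb]_(r in `[s, t]) (expR (eps * (r - t0)) * g r) <= W t - W s) ->
  (forall r, t0 <= r <= t1 -> W r * expR (- eps * (r - t0)) <= v r ->
     (forall theta, - tau <= theta <= 0 -> v (r + theta) <= lam * v r) ->
     ELV_le P f0 g0 V u x r (mu r * v r + g r)) ->
  v t1 <= gain * ((2 * alpha2 m0 + W t1) * expR (- eps * (t1 - t0))).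
Proof.
move=> t01 ig gg0 W0 Wmono Wg hyp.
have ito s t (t0s : t0 <= s) (st : s <= t) :=
  solution_ito hF hw hfg tau0 hV hp ha1.1 hA t00 hxi hu hx hE (introT andP (conj t0s st)).
have m00 := initial_moment_ge0 P p xi.
have A0 : 0 <= 2 * alpha2 m0 by rewrite mulr_ge0// (classK_ge0 ha2.1.1).
have v0 r : t0 <= r -> 0 <= v r.
  by move=> t0r; apply: (EV_ge0 hV t00 hE); rewrite (le_trans _ t0r)// gerBl.
(* The initial level must be positive and the initial moment may vanish, so a strictly larger [c] is
   used and then lowered to the bound. *)
have key c : 2 * alpha2 m0 < c -> v t1 <= gain * ((c + W t1) * expR (- eps * (t1 - t0))).
  move=> hc; have c0 : 0 < c by exact: le_lt_trans hc.
  apply: (razumikhin_comparison hmu hT0 eps0 epsT t00 (c := c) (v := v)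
    (a := fun r => fine ('E_P[LV_along f0 g0 V u x r])%E) (g := g) (Q := fun r => c + W r)
    t01 tau0 eta0 c0 hlam) => //.
  - by move=> r /andP[t0r _]; exact: v0.
  - exact: (EV_measurable hF tau0 hV t00 hxi hx t01).
  - move=> r hr; apply: (le_trans _ (ltW hc)).
    exact: (initial_EV_le hF hp ha2 hA t00 hxi hx hE hr).
  - by case: (ito _ _ (lexx _) t01).
  - by move=> s t t0s st _; case: (ito _ _ t0s st) => _; rewrite lerBlDl.
  - by rewrite lerDl.
  - by move=> s t ? ? ?; rewrite lerD2l; exact: Wmono.
  - by move=> s t ? ? ?; rewrite opprD addrACA subrr add0r; exact: Wg.
  - move=> r hr hQ hth; have hQ' : W r * expR (- eps * (r - t0)) <= v r.
      by apply: le_trans hQ; rewrite ler_wpM2r ?expR_ge0// lerDr ltW.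
    have [iL hL] := hyp r hr hQ' hth.
    by rewrite -lee_fin fineK// unlock; exact: integrable_fin_num.
apply/ler_addgt0Pr => e e0.
pose z := gain * expR (- eps * (t1 - t0)); have z0 : 0 < z by rewrite mulr_gt0// expR_gt0.
apply: (le_trans (key (2 * alpha2 m0 + e / z) _)); first by rewrite ltrDl divr_gt0.
rewrite le_eqVlt; apply/orP; left; apply/eqP.
have e1 : e = z * (e / z) by field; rewrite gt_eqF.
by rewrite [in RHS]e1 /z; ring.
Qed.

Lemma moment_le_sum r z z' : t0 <= r -> 0 <= z -> 0 <= z' -> v r <= z + z' ->
  (moment P p x r <= (2 * Kinv alpha1 (2 * z) + 2 * Kinv alpha1 (2 * z'))%:E)%E.
Proof.
move=> t0r z0 z'0 vz; have hr : t0 - tau <= r by rewrite (le_trans _ t0r)// gerBl.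
apply: le_trans (moment_le_Kinv hV ha1 hA t00 hE hr (addr_ge0 z0 z'0) vz) _.
by rewrite lee_fin -mulrDr ler_wpM2l// (Kinv_subadd ha1.1).
Qed.

End solution_comparison.

Lemma enorm0 {R : realType} n : enorm (0 : 'cV[R]_n) = 0.
Proof. by rewrite /enorm big1 ?sqrtr0// => i _; rewrite mxE expr0n. Qed.

Lemma zero_input_admissible {R : realType} l : admissible_input (@zero_input R l).
Proof.
split=> [j|b b0].
  rewrite (_ : (fun t => _) = fun=> 0); first exact: measurable_cst.
  by apply/funext => t; rewrite mxE.
by exists 0; apply: aeW => t _; rewrite enorm0.
Qed.

Lemma input_gain_integrable {R : realType} l (varpi : R -> R) (u : @input R l) (t0 t : R) :
  classK varpi -> admissible_input u -> 0 <= t0 -> t0 <= t ->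
  itv_integrable t0 t (fun r => varpi (enorm (u r))).
Proof.
move=> kv [mu bu] t00 t0t; have [cv _ _] := kv; have [M hM] := bu t (le_trans t00 t0t).
have mg : measurable_fun `[t0, t] (fun r => varpi (enorm (u r))).
  rewrite (_ : (fun r => _) = (fun y => varpi (Num.max 0 y)) \o (fun r => enorm (u r))); last first.
    by apply/funext => r /=; rewrite max_r// enorm_ge0.
  apply: measurableT_comp; first by apply: continuous_measurable_fun; exact: continuous_clamp.
  apply: enorm_measurable => j; apply: measurable_funS (mu j).
    rewrite (_ : J = `[0, +oo[%classic); first exact: measurable_itv.
    by apply/seteqP; split => r /=; rewrite /J/= in_itv/= andbT.
  by move=> r /=; rewrite in_itv/= => /andP[t0r _]; exact: le_trans t0r.
apply/integrableP; split; first exact/measurable_EFinP.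
apply: (@le_lt_trans _ _ (\int[lebesgue_measure]_(r in `[t0, t]) (varpi `|M|)%:E)%E); last first.
  by rewrite integral_cst//= lebesgue_measure_itv/= lte_fin; case: ifP; rewrite ?mule0 ?ltry// -EFinB -EFinM ltry.
apply: ae_ge0_le_integral => //.
- by apply: measurableT_comp => //; exact/measurable_EFinP.
- by move=> r _; rewrite lee_fin classK_ge0.
- apply: (@filterS _ _ (ae_filter_ringOfSetsType (@lebesgue_measure R)) _ _ _ hM) => r h rt; rewrite /= lee_fin ger0_norm ?(classK_ge0 kv (enorm_ge0 _))//.
  apply: classK_le => //; first exact: enorm_ge0.
  apply: le_trans (ler_norm _); apply: h; move: rt; rewrite /= in_itv/= => /andP[h1 ->].
  by rewrite (le_trans t00 h1).
Qed.

Theorem corollary2 (R : realType) (d : measure_display) (T : measurableType d)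
    (P : probability T R) (F : R -> set (set T))
    (tau : R) (n m l : nat) (w : R -> T -> 'cV[R]_m)
    (f0 : R -> history tau n -> 'cV[R]_l -> 'cV[R]_n)
    (g0 : R -> history tau n -> 'cV[R]_l -> 'M[R]_(n, m))
    (p : R) (V : R -> 'cV[R]_n -> R)
    (mu alpha1 alpha2 varpi q : R -> R) (T0 rho : R)
    (htau : 0 <= tau)
    (hF : usual_conditions P F)
    (hw : brownian P F w)
    (hfg : sfde_assumptions P F w f0 g0)
    (hp : 0 < p)
    (hV : classC21 tau V)
    (hmu : uniformly_stable mu)
    (halpha1 : classVKoo alpha1)
    (halpha2 : classCKoo alpha2)
    (hvarpi : classKoo varpi)
    (hq : classKoo q)
    (hT0 : Omega mu T0)
    (hrho : 0 < rho < 1)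
    (hqrho : forall s : R, 0 <= s -> expR (phi mu T0) / rho * s <= q s) :
  [/\ cond_A tau V p alpha1 alpha2 ->
      cond_B_ISS P F w f0 g0 V mu varpi q ->
      moment_ISS P F w f0 g0 p,
      cond_A tau V p alpha1 alpha2 ->
      cond_B_iISS P F w f0 g0 V mu varpi q ->
      moment_iISS P F w f0 g0 p,
      cond_A tau V p alpha1 alpha2 ->
      cond_B_GUAS P F w f0 g0 V mu q ->
      moment_GUAS P F w f0 g0 p &
      cond_A tau V p alpha1 alpha2 ->
      cond_B_GUAS P F w f0 g0 V mu q ->
      cond_D alpha1 alpha2 ->
      moment_GUES P F w f0 g0 p].
Proof.
have [eps [eta [eps0 eta0 epsT hlam]]] := exists_rate hT0 hrho htau.
set lam := expR (phi mu T0) / rho in hlam.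
pose K := expR (phi mu T0 + eps * T0); have K0 : 0 < K by exact: expR_gt0.
have K20 : 0 < 2 * K by exact: mulr_gt0.
have K40 : 0 < 4 * K by exact: mulr_gt0.
have ka2 := halpha2.1.1; have kK := classK_Kinv halpha1.1; have kv := hvarpi.1.
(* The hypothesis on [q] only enters here: a delayed bound with factor [lam] implies the one with
   [q]. *)
have hq' a b : 0 <= a -> b <= lam * a -> b <= q a.
  by move=> a0 hb; apply: (le_trans hb); exact: hqrho.
have eK (A e : R) : K * (2 * A * e) = 2 * K * A * e by ring.
(* The outer 2 comes from [moment_le_Kinv], the inner one from [Kinv_subadd], and [K] from the
   comparison. *)
pose gam z := 2 * Kinv alpha1 (2 * K * z).
have kid : classK (@id R).
  by split => //; apply: continuous_subspaceT => z; exact: cvg_id.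
have kgam : classK gam.
  by apply: classK_scale => //; apply: classK_comp => //; exact: (classK_scale K20 kid).
have guas : cond_A tau V p alpha1 alpha2 -> cond_B_GUAS P F w f0 g0 V mu q ->
    forall t0 xi x t, 0 <= t0 -> t0 <= t -> initial_condition F t0 xi ->
      is_solution P F w f0 g0 t0 xi (@zero_input R l) x ->
      expectations_defined P f0 g0 V t0 (@zero_input R l) x /\
      EV P V x t <= 2 * K * alpha2 (initial_moment P p xi) * expR (- eps * (t - t0)).
  move=> hA hB t0 xi x t t00 t0t hxi hx; have [hE hC] := hB t0 xi _ x t00 hxi erefl hx.
  split => //; rewrite -eK -[2 * alpha2 _]addr0.
  apply: (EV_comparison hF hw hfg htau hV hp halpha1 halpha2 hA hmu hT0 eps0 eta0 epsT hlam t00 hxi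
    (zero_input_admissible l) hx hE (g := fun=> 0) (W := fun=> 0) t0t) => //.
  - exact: itv_integrable_cst.
  - move=> s r t0s sr rt; rewrite (@eq_Rintegral _ _ _ _ _ (fun=> 0)) => [|y _]; last by rewrite mulr0.
    by rewrite itv_integral_cst// mul0r subrr.
  - move=> r /andP[t0r rt] _ hth; rewrite addr0; apply: hC => // theta hth'; apply: hq'; last exact: hth.
    by apply: (EV_ge0 hV t00 hE); rewrite (le_trans _ t0r)// gerBl.
split.
- move=> hA hB; exists (fun s t => 2 * Kinv alpha1 (4 * K * alpha2 s * expR (- eps * t))), (fun s => gam (varpi s)).
  split; [exact: (decaying_classKL halpha1.1)|exact: (classK_comp kgam)|].
  move=> u hu [M hM] t0 xi x t t00 t0t hxi hx; have [hE hC] := hB t0 xi u x t00 hxi hu hx.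
  pose U := input_sup u t0 t.
  have huU r : t0 <= r <= t -> enorm (u r) <= U.
    move=> hr; apply: ub_le_sup; last by exists r => //=; rewrite in_itv.
    exists M => _ [y /= hy <-]; apply: hM; move: hy; rewrite in_itv/= => /andP[h _].
    exact: le_trans h.
  have U0 : 0 <= varpi U.
    by apply: (classK_ge0 kv); apply: le_trans (huU t0 _); rewrite ?enorm_ge0// lexx.
  have m00 : 0 <= alpha2 (initial_moment P p xi) by apply: (classK_ge0 ka2); exact: initial_moment_ge0.
  have e1 r : varpi U * expR (eps * (r - t0)) * expR (- eps * (r - t0)) = varpi U.
    by rewrite -mulrA -expRD mulNr addrN expR0 mulr1.
  have mono s r : t0 <= s -> s <= r -> varpi U * expR (eps * (s - t0)) <= varpi U * expR (eps * (r - t0)).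
    by move=> _ sr; rewrite ler_wpM2l// ler_expR ler_wpM2l ?(ltW eps0)// lerB.
  (* With this [W] the threshold [W r * expR (- eps * (r - t0))] is the constant [varpi U]. Hence
     wherever the comparison asks for the generator bound, the mean of [V] dominates the input, as
     (B-ISS) requires, and no additional gain [g] appears. *)
  have hv : EV P V x t <= K * ((2 * alpha2 (initial_moment P p xi) + varpi U * expR (eps * (t - t0))) * expR (- eps * (t - t0))).
    apply: (EV_comparison hF hw hfg htau hV hp halpha1 halpha2 hA hmu hT0 eps0 eta0 epsT hlam t00 hxi hu hx hE
      (g := fun=> 0) (W := fun r => varpi U * expR (eps * (r - t0))) t0t) => //.
    - exact: itv_integrable_cst.
    - by rewrite mulr_ge0// expR_ge0.
    - by move=> s r t0s sr _; exact: mono.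
    - move=> s r t0s sr rt; rewrite (@eq_Rintegral _ _ _ _ _ (fun=> 0)) => [|y _]; last by rewrite mulr0.
      by rewrite itv_integral_cst// mul0r subr_ge0 mono.
    - move=> r hr; rewrite e1 addr0 => hUv hth; have /andP[t0r rt] := hr.
      have vr0 : 0 <= EV P V x r by apply: le_trans hUv.
      apply: hC => // theta hth'; rewrite ge_max; apply/andP; split.
        by apply: le_trans hUv; apply: (classK_le kv) (huU r hr); exact: enorm_ge0.
      have vth0 : 0 <= EV P V x (r + theta).
        apply: (EV_ge0 hV t00 hE); case/andP: hth' => h _; move: t0r h; lra.
      (* The condition is stated with the inverse of [q]; monotonicity of the inverse turns it into
         the form without inverse. *)
      rewrite -(KinvK hq vr0); apply: (classK_le (classK_Kinv hq)) => //.
      by apply: hq' => //; exact: hth.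
  rewrite mulrDl e1 mulrDr eK in hv.
  have z1 : 0 <= 2 * K * alpha2 (initial_moment P p xi) * expR (- eps * (t - t0)).
    by rewrite !mulr_ge0 ?expR_ge0 ?(ltW K0).
  have := moment_le_sum htau hV halpha1 hA t00 hE t0t z1 (mulr_ge0 (ltW K0) U0) hv.
  move=> /le_trans; apply; rewrite lee_fin le_eqVlt; apply/orP; left; apply/eqP; rewrite /gam.
  by congr (2 * Kinv alpha1 _ + 2 * Kinv alpha1 _); ring.
- move=> hA hB; exists (fun s t => 2 * Kinv alpha1 (4 * K * alpha2 s * expR (- eps * t))), gam, varpi.
  split => //; first exact: (decaying_classKL halpha1.1).
  move=> u hu t0 xi x t t00 t0t hxi hx; have [hE hC] := hB t0 xi u x t00 hxi hu hx.
  have m00 : 0 <= alpha2 (initial_moment P p xi) by apply: (classK_ge0 ka2); exact: initial_moment_ge0.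
  pose g r := varpi (enorm (u r)); pose h r := expR (eps * (r - t0)) * g r.
  (* Accumulated input, weighted by the growth that the factor [expR (- eps * (t - t0))] removes in
     the end. *)
  pose W r := \int[lebesgue_measure]_(y in `[t0, r]) h y.
  have g_ge0 r : 0 <= g r by apply: (classK_ge0 kv); exact: enorm_ge0.
  have h_ge0 r : 0 <= h r by rewrite mulr_ge0 ?expR_ge0.
  have ig : itv_integrable t0 t g by exact: input_gain_integrable.
  have ih : itv_integrable t0 t h by exact: (weighted_integrable _ (ltW eps0)).
  have ihS r : r <= t -> itv_integrable t0 r h by move=> rt; exact: itv_integrableS ih.
  have hv : EV P V x t <= K * ((2 * alpha2 (initial_moment P p xi) + W t) * expR (- eps * (t - t0))).
    apply: (EV_comparison hF hw hfg htau hV hp halpha1 halpha2 hA hmu hT0 eps0 eta0 epsT hlam t00 hxi hu hx hE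
      (g := g) (W := W) t0t) => //.
    - exact: itv_integral_ge0.
    - by move=> s r t0s sr rt; apply: itv_integral_mono => //; exact: ihS.
    - by move=> s r t0s sr rt; rewrite /W (itv_integral_cat t0s sr (ihS _ rt)) addrAC subrr add0r.
    - move=> r /andP[t0r rt] _ hth; apply: hC => // theta hth'; apply: hq'; last exact: hth.
      by apply: (EV_ge0 hV t00 hE); rewrite (le_trans _ t0r)// gerBl.
  (* Discounting by the age [t - y] of the input gives factors at most 1, so the plain integral
     remains. *)
  have Wt : W t * expR (- eps * (t - t0)) <= \int[lebesgue_measure]_(y in `[t0, t]) g y.
    rewrite mulrC -(itv_integralZ _ ih); apply: itv_le_integral => //; first exact: itv_integrableZ.
    move=> y /andP[t0y yt]; rewrite mulrA -expRD ler_piMl// -expR0 ler_expR.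
    by rewrite mulNr addrC subr_le0 ler_wpM2l ?(ltW eps0)// lerB.
  have G0 : 0 <= \int[lebesgue_measure]_(y in `[t0, t]) g y by exact: itv_integral_ge0.
  rewrite mulrDl mulrDr eK in hv.
  have hv' := le_trans hv (lerD (lexx _) (ler_wpM2l (ltW K0) Wt)).
  have z1 : 0 <= 2 * K * alpha2 (initial_moment P p xi) * expR (- eps * (t - t0)).
    by rewrite !mulr_ge0 ?expR_ge0 ?(ltW K0).
  have := moment_le_sum htau hV halpha1 hA t00 hE t0t z1 (mulr_ge0 (ltW K0) G0) hv'.
  move=> /le_trans; apply; rewrite lee_fin le_eqVlt; apply/orP; left; apply/eqP; rewrite /gam.
  by congr (2 * Kinv alpha1 _ + 2 * Kinv alpha1 _); ring.
- move=> hA hB; exists (fun s t => 2 * Kinv alpha1 (2 * K * alpha2 s * expR (- eps * t))).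
  split; first exact: (decaying_classKL halpha1.1).
  move=> t0 xi x t t00 t0t hxi hx.
  have [hE hv] := guas hA hB _ _ _ _ t00 t0t hxi hx.
  have m00 : 0 <= alpha2 (initial_moment P p xi) by apply: (classK_ge0 ka2); exact: initial_moment_ge0.
  apply: (moment_le_Kinv hV halpha1 hA t00 hE) hv; first by rewrite (le_trans _ t0t)// gerBl.
  by rewrite !mulr_ge0 ?expR_ge0 ?(ltW K0).
- move=> hA hB [b0 [b1 [b2 [b00 b10 b20 hD]]]].
  have [C C0 hC] : exists2 C : R, 0 < C & b1 * C = 2 * K * b2.
    exists (2 * K * b2 / b1); first by rewrite divr_gt0// mulr_gt0.
    by rewrite mulrC divfK// gt_eqF.
  exists (eps / b0), (2 * C `^ b0^-1).
  split; [exact: divr_gt0|by rewrite mulr_gt0// powR_gt0|].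
  move=> t0 xi x t t00 t0t hxi hx.
  have [hE hv] := guas hA hB _ _ _ _ t00 t0t hxi hx.
  have m00 : 0 <= initial_moment P p xi by exact: initial_moment_ge0.
  set M0 := initial_moment P p xi in hv m00 *.
  (* Solves [alpha1 a] equal to the bound on the mean of [V], so that the inverse of [alpha1]
     returns [a]; the power [b0^-1] divides the rate by [b0]. *)
  pose a := C `^ b0^-1 * expR (- (eps / b0) * (t - t0)) * M0.
  have a0 : 0 <= a by rewrite !mulr_ge0 ?powR_ge0 ?expR_ge0.
  have hr : t0 - tau <= t by rewrite (le_trans _ t0t)// gerBl.
  have ea : alpha1 a = 2 * K * alpha2 M0 * expR (- eps * (t - t0)).
    rewrite (hD a a0).1 (hD M0 m00).2 /a !powRM ?mulr_ge0 ?powR_ge0 ?expR_ge0//.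
    rewrite -powRrM mulVf ?gt_eqF// powRr1 ?(ltW C0)//.
    rewrite -expRM (_ : - (eps / b0) * (t - t0) * b0 = - eps * (t - t0)); last by field; rewrite gt_eqF.
    by rewrite !mulrA hC; ring.
  have := moment_le_Kinv hV halpha1 hA t00 hE hr (classK_ge0 halpha1.1.1 a0).
  rewrite (KinvK halpha1.1 a0) ea => /(_ hv) /le_trans; apply.
  by rewrite lee_fin /a !mulrA.
Qed.
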